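(* Let $M^{2n}$ be a complete Kähler manifold of real dimension $2n$ satisfying, for some $\nu>2$ and some constant $C_S>0$, the Sobolev type inequality $$\left(\int_M |\phi|^{\frac{2\nu}{\nu-2}}\right)^{\frac{\nu-2}{\nu}}\leq C_S\int_M|\nabla\phi|^2$$ for every compactly supported smooth function $\phi$ on $M$. Let $p>1$, and suppose that $\|\lambda^-\|_{\nu/2}<\frac{4}{pC_S}$ if $p\geq2$ and $\|\lambda^-\|_{\nu/2}<\frac{4p}{(4-p)^2C_S}$ if $1<p<2$, where $$\|\lambda^-\|_{\nu/2}:=\left(\int_M|\lambda^-|^{\frac{\nu}{2}}\right)^{\frac{2}{\nu}}.$$ Then every (real-valued) pluriharmonic function $u$ on $M$ with $\int_M|\nabla u|^p<\infty$ is a constant function.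
   Context: Manifolds are connected. For $x\in M$, $\lambda(x)$ denotes the smallest eigenvalue of the Ricci curvature tensor of $M$ at $x$ (with respect to the metric), and $\lambda^-(x)=\min\{0,\lambda(x)\}$. Integrals are with respect to the Riemannian volume. A function $u$ is pluriharmonic if $\partial\bar\partial u=0$. *)

(* Defs.v *)
From HB Require Import structures.
From mathcomp Require Import all_boot all_order all_algebra.
From mathcomp Require Import all_classical all_reals all_analysis.
From mathcomp Require Import complex.

Set Implicit Arguments.
Unset Strict Implicit.
Unset Printing Implicit Defensive.

Import Order.TTheory GRing.Theory Num.Theory.
Import numFieldNormedType.Exports.

Local Open Scope classical_set_scope.
Local Open Scope ring_scope.

Section RealCalculus.
Context {R : realType} {m : nat}.
Implicit Types (f : 'rV[R]_m -> R) (y : 'rV[R]_m).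

Definition partial (a : 'I_m) f : 'rV[R]_m -> R :=
  fun y => 'D_(delta_mx 0 a) f y.

Definition partials (s : seq 'I_m) f : 'rV[R]_m -> R := foldr partial f s.

Definition smooth_on (U : set 'rV[R]_m) f : Prop :=
  forall (s : seq 'I_m) y, U y ->
    {for y, continuous (partials s f)} /\
    forall a, derivable (partials s f) y (delta_mx 0 a).

End RealCalculus.

(* Iterated one-dimensional Lebesgue integrals; by Tonelli's theorem, on
   nonnegative Borel functions this is integration against the Lebesgue measure
   of R^m. *)
Fixpoint lebesgue_int (R : realType) (m : nat) :
    ('rV[R]_m -> \bar R) -> \bar R :=
  match m return ('rV[R]_m -> \bar R) -> \bar R with
  | 0 => fun f => f 0
  | m'.+1 => fun f =>
      (\int[lebesgue_measure]_(t in [set: R])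
         lebesgue_int (fun y : 'rV[R]_m' =>
           f (row_mx (const_mx t : 'rV[R]_1) y)))%E
  end.

(* C^n is 'rV[R]_(n + n): the point z = x + i y is row_mx x y. *)
Section ComplexCalculus.
Context {R : realType} {n : nat}.
Implicit Types (f : 'rV[R]_(n + n) -> R[i]) (y : 'rV[R]_(n + n)).

Definition complex_coord (a : 'I_n) y : R[i] :=
  (y 0 (lshift n a) +i* y 0 (rshift n a))%C.

Definition cpartial (a : 'I_(n + n)) f : 'rV[R]_(n + n) -> R[i] :=
  fun y => (partial a (fun z => complex.Re (f z)) y +i*
            partial a (fun z => complex.Im (f z)) y)%C.

Definition d_z (a : 'I_n) f : 'rV[R]_(n + n) -> R[i] :=
  fun y =>
    (cpartial (lshift n a) f y - 'i%C * cpartial (rshift n a) f y) / 2.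

Definition d_zbar (a : 'I_n) f : 'rV[R]_(n + n) -> R[i] :=
  fun y =>
    (cpartial (lshift n a) f y + 'i%C * cpartial (rshift n a) f y) / 2.

(* Multiplication by i, acting on row vectors from the right:
   row_mx a b *m stdJ = row_mx (- b) a. *)
Definition stdJ : 'M[R]_(n + n) := block_mx 0 1%:M (- 1%:M) 0.

End ComplexCalculus.

(* Connected complex manifolds of complex dimension n.  The functions chart i
   and chart_inv i are total; their values are meaningful only on dom i and on
   chart i @` dom i. *)
Record complexManifold (R : realType) (n : nat) := ComplexManifold {
  carrier :> ptopologicalType;
  chart_index : Type;
  dom : chart_index -> set carrier;
  chart : chart_index -> carrier -> 'rV[R]_(n + n);
  chart_inv : chart_index -> 'rV[R]_(n + n) -> carrier;
  chart_at : carrier -> chart_index;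
  dom_chart_at : forall x, dom (chart_at x) x;
  open_dom : forall i, open (dom i);
  open_codom : forall i, open (chart i @` dom i);
  chartK : forall i x, dom i x -> chart_inv i (chart i x) = x;
  chart_continuous : forall i x, dom i x -> {for x, continuous (chart i)};
  chart_inv_continuous : forall i y, (chart i @` dom i) y ->
    {for y, continuous (chart_inv i)};
  transition_smooth : forall i j (a : 'I_(n + n)),
    smooth_on (chart i @` (dom i `&` dom j))
      (fun y => chart j (chart_inv i y) 0 a);
  transition_holomorphic : forall i j (a b : 'I_n) (y : 'rV[R]_(n + n)),
    (chart i @` (dom i `&` dom j)) y ->
    d_zbar b (fun z => complex_coord a (chart j (chart_inv i z))) y = 0;
  manifold_hausdorff : hausdorff_space carrier;
  manifold_second_countable : @second_countable carrier;
  manifold_connected : connected [set: carrier]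
}.

Section SmoothFunctions.
Context {R : realType} {n : nat} (M : complexManifold R n).

Definition chart_codom (i : chart_index M) : set 'rV[R]_(n + n) :=
  chart i @` dom i.

Definition smooth_fun (f : M -> R) : Prop :=
  forall i : chart_index M, smooth_on (chart_codom i) (f \o chart_inv i).

Definition compactly_supported (f : M -> R) : Prop :=
  compact (closure [set x | f x != 0]).

Definition pluriharmonic (u : M -> R) : Prop :=
  smooth_fun u /\
  forall (i : chart_index M) (a b : 'I_n) (y : 'rV[R]_(n + n)),
    chart_codom i y ->
    d_z a (d_zbar b (fun z => ((u (chart_inv i z))%:C)%C)) y = 0.

End SmoothFunctions.

(* gmx i y is the Gram matrix of the metric in the real coordinates of chart i.
   The Kaehler form omega (X, Y) = g (J X, Y) has matrix stdJ *m gmx i y, and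
   kahler_closed is d omega = 0. *)
Record kahlerMetric (R : realType) (n : nat) (M : complexManifold R n) :=
  KahlerMetric {
  gmx : chart_index M -> 'rV[R]_(n + n) -> 'M[R]_(n + n);
  gmx_smooth : forall i a b, smooth_on (chart_codom i) (fun y => gmx i y a b);
  gmx_sym : forall i y, chart_codom i y -> (gmx i y)^T = gmx i y;
  gmx_pos : forall i y (v : 'rV[R]_(n + n)), chart_codom i y -> v != 0 ->
    0 < (v *m gmx i y *m v^T) 0 0;
  gmx_transition : forall i j x, dom i x -> dom j x ->
    let D := 'J (chart j \o chart_inv i) (chart i x) in
    gmx i (chart i x) = D *m gmx j (chart j x) *m D^T;
  gmx_hermitian : forall i y, chart_codom i y ->
    stdJ *m gmx i y *m stdJ^T = gmx i y;
  kahler_closed : forall i (a b c : 'I_(n + n)) y, chart_codom i y ->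
    let omega (k l : 'I_(n + n)) := fun z => (stdJ *m gmx i z) k l in
    partial a (omega b c) y + partial b (omega c a) y +
      partial c (omega a b) y = 0
}.

Section RiemannianGeometry.
Context {R : realType} {n : nat} {M : complexManifold R n}.
Variable g : kahlerMetric M.

(* Tangent vectors at x are given by their components in the chart chart_at x. *)
Definition metric_at (x : M) : 'M[R]_(n + n) :=
  gmx g (chart_at x) (chart (chart_at x) x).

Definition tangent_norm (x : M) (v : 'rV[R]_(n + n)) : R :=
  Num.sqrt ((v *m metric_at x *m v^T) 0 0).

Definition gradient (f : M -> R) (x : M) : 'rV[R]_(n + n) :=
  (\row_a partial a (f \o chart_inv (chart_at x)) (chart (chart_at x) x))
    *m invmx (metric_at x).

Definition grad_norm (f : M -> R) (x : M) : R :=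
  tangent_norm x (gradient f x).

(* christoffel i k a b is Gamma^k_{ab} in chart i. *)
Definition christoffel (i : chart_index M) (k a b : 'I_(n + n))
    (y : 'rV[R]_(n + n)) : R :=
  2^-1 * \sum_l invmx (gmx g i y) k l *
    (partial a (fun z => gmx g i z b l) y +
     partial b (fun z => gmx g i z a l) y -
     partial l (fun z => gmx g i z a b) y).

Definition ricci (i : chart_index M) (y : 'rV[R]_(n + n)) : 'M[R]_(n + n) :=
  \matrix_(a, b) \sum_k
    (partial k (christoffel i k a b) y - partial b (christoffel i k a k) y +
     \sum_l (christoffel i k k l y * christoffel i l a b y -
             christoffel i k b l y * christoffel i l a k y)).

(* The Ricci tensor with its second index raised, as an endomorphism acting on
   row vectors from the right. *)
Definition ricci_operator (x : M) : 'M[R]_(n + n) :=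
  ricci (chart_at x) (chart (chart_at x) x) *m invmx (metric_at x).

(* The set of eigenvalues is finite, so the infimum is the minimum. *)
Definition lambda (x : M) : R :=
  inf [set a : R | eigenvalue (ricci_operator x) a].

Definition lambda_minus (x : M) : R := Num.min 0 (lambda x).

(* A C^1 curve is not required to be immersed, so a piecewise C^1 curve becomes
   C^1 by stopping at its corners, with the same length; hence rdist is the
   usual Riemannian distance. *)
Definition C1_curve (c : R -> M) : Prop :=
  continuous c /\
  forall (t : R) (i : chart_index M), dom i (c t) -> forall a : 'I_(n + n),
    let ca := fun s => chart i (c s) 0 a in
    derivable ca t 1 /\ {for t, continuous (derive1 ca)}.

Definition velocity (c : R -> M) (t : R) : 'rV[R]_(n + n) :=
  \row_a derive1 (fun s => chart (chart_at (c t)) (c s) 0 a) t.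

Definition curve_length (c : R -> M) : \bar R :=
  (\int[lebesgue_measure]_(t in `[0%R, 1%R])
     (tangent_norm (c t) (velocity c t))%:E)%E.

Definition rdist (x y : M) : \bar R :=
  ereal_inf [set curve_length c | c in
    [set c | [/\ C1_curve c, c 0 = x & c 1 = y]]].

Definition complete_metric : Prop :=
  forall s : nat -> M,
    (forall e : R, 0 < e -> exists N : nat, forall k l : nat,
       (N <= k)%N -> (N <= l)%N -> (rdist (s k) (s l) < e%:E)%E) ->
    exists x : M, rdist (s k) x @[k --> \oo] --> 0%E.

End RiemannianGeometry.

Definition borel (T : ptopologicalType) := g_sigma_algebraType (@open T).

(* In every chart the volume has density sqrt (det g) with respect to the
   Lebesgue measure; as countably many charts cover M, this determines mu. *)
Definition riemannian_volume (R : realType) (n : nat)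
    (M : complexManifold R n) (g : kahlerMetric M)
    (mu : {measure set (borel M) -> \bar R}) : Prop :=
  forall (i : chart_index M) (A : set (borel M)), measurable A -> A `<=` dom i ->
    mu A = lebesgue_int (fun y =>
      (\1_(chart i @` A) y * Num.sqrt (\det (gmx g i y)))%:E).

Definition sobolev_inequality (R : realType) (n : nat)
    (M : complexManifold R n) (g : kahlerMetric M)
    (mu : {measure set (borel M) -> \bar R}) (nu CS : R) : Prop :=
  forall phi : M -> R, smooth_fun phi -> compactly_supported phi ->
    ((\int[mu]_(x in [set: borel M])
        (`|phi x| `^ (2 * nu / (nu - 2)))%:E) `^ ((nu - 2) / nu)
     <= CS%:E * \int[mu]_(x in [set: borel M]) (grad_norm g phi x ^+ 2)%:E)%E.

Definition lambda_minus_norm (R : realType) (n : nat)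
    (M : complexManifold R n) (g : kahlerMetric M)
    (mu : {measure set (borel M) -> \bar R}) (nu : R) : \bar R :=
  ((\int[mu]_(x in [set: borel M])
      (`|lambda_minus g x| `^ (nu / 2))%:E) `^ (2 / nu))%E.

(* Main.v *)
Require Import Defs.
From HB Require Import structures.
From mathcomp Require Import all_boot all_order all_algebra.
From mathcomp Require Import all_classical all_reals all_analysis.
From mathcomp Require Import measurable_realfun complex perm ring lra.

(* Let w = |du|^2. For pluriharmonic u the complex structure reverses the sign
   of the Hessian of u, which gives the Kato inequality
   |dw|^2 <= 2 w |Hess u|^2 and, by the Bochner formula,
   Delta ln (w + e) >= 2 lambda^- for every e > 0.  Put f = (w + e)^(p/4) and
   eta = phi f with a cutoff phi, and integrate the inequality against eta^2:
     (4/p) (int |d eta|^2 - int f <d phi, d eta>) <= int |lambda^-| eta^2.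
   Hoelder and Sobolev bound the right-hand side by
   C_S ||lambda^-|| int |d eta|^2, and C_S ||lambda^-|| < 4/p in both ranges of p
   (4p/(4-p)^2 <= 4/p for p <= 2).  Hence a power of the L^q norm of eta is at most
   C int (w + e)^(p/2) |d phi|^2.  By completeness phi can be arbitrarily large
   at a given point with |d phi| <= 1, while the right-hand side stays bounded
   when e is small compared to phi; so w = 0.
   The cutoff is found without smoothing the distance: if all compactly supported
   functions with |d phi| <= 1 were bounded by r at x, then gluing local bumps
   would produce a point within distance r of x where they are bounded by
   (1 - kappa) r.  Iterating gives a Cauchy sequence whose limit is a point where
   all of them vanish, which is absurd. *)

Set Implicit Arguments.
Unset Strict Implicit.
Unset Printing Implicit Defensive.

Import Order.TTheory GRing.Theory Num.Theory.
Import numFieldNormedType.Exports.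

Local Open Scope classical_set_scope.
Local Open Scope ring_scope.

(** * Smooth functions on R^m *)

Section DirectionalCalculus.
Context {R : realType}.

(** All curvature computations take place in holomorphic charts. There the closedness of the Kähler
    form makes the Christoffel symbols with a fixed upper index anti-invariant under J, so their
    trace against the inverse metric vanishes. Coordinates are therefore harmonic, the Laplacian is
    the trace of the coordinate Hessian against the inverse metric, and the Bochner formula becomes
    an identity between matrices of partial derivatives. The factor 2 of the Kato inequality, half
    the constant of the general one, is exactly what makes the Hessian terms of Delta ln (w + e)
    nonnegative. The function lambda is an infimum of eigenvalues, and its measurability is never
    established. The estimate uses the negative part of Delta ln (w + e) / 2 instead: it is
    continuous, lies between 0 and |lambda^-|, and is compared with it only through monotonicity of
    integrals of nonnegative functions. The volume of M may be infinite, so (w + e)^(p/2) need not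
    be integrable; this is why e is chosen after phi. *)

Lemma near_eq_continuous (T U : topologicalType) (f g : T -> U) (y : T) :
  (\near y, f y = g y) -> {for y, continuous f} -> {for y, continuous g}.
Proof.
move=> fg cf; apply: (@cvg_trans _ (f @ y)); first exact: near_eq_cvg.
by rewrite -(nbhs_singleton fg); exact: cf.
Qed.

Lemma derive_shift_arg (V : normedModType R) (f : V -> R) (c x v : V) :
  (derivable f (x + c) v -> derivable (fun z => f (z + c)) x v) *
  ('D_v (fun z => f (z + c)) x = 'D_v f (x + c)).
Proof.
have E : (fun h : R => h^-1 *: (((fun z => f (z + c)) \o shift x) (h *: v)
   - f (x + c))) = (fun h : R => h^-1 *: ((f \o shift (x + c)) (h *: v) - f (x + c))).
  by apply/funext => h /=; rewrite addrA.
by split; rewrite /derivable /derive E.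
Qed.

Lemma is_derive_line (V : normedModType R) (f : V -> R) (p v : V) (s : R) :
  derivable f (p + s *: v) v ->
  is_derive s 1 (fun s => f (p + s *: v)) ('D_v f (p + s *: v)).
Proof.
have E : (fun h : R => h^-1 *: (((fun s => f (p + s *: v)) \o shift s) (h *: 1)
   - f (p + s *: v))) =
   (fun h : R => h^-1 *: ((f \o shift (p + s *: v)) (h *: v) - f (p + s *: v))).
  apply/funext => h /=; rewrite -[h%:A]/(h * 1) mulr1 scalerDl.
  by rewrite [p + (_ + _)]addrCA.
by move=> d; split; rewrite /derivable /derive E.
Qed.

(** Only derivability in the direction [v] is assumed, so the lemma is available before
    differentiability is known. The sign of [t] is free, and the intermediate parameter is located
    only through its absolute value. *)
Lemma MVT_line (V : normedModType R) (f : V -> R) (p v : V) (t : R) :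
  (forall s, `|s| <= `|t| -> derivable f (p + s *: v) v) ->
  exists2 s, `|s| <= `|t| & f (p + t *: v) - f p = t * 'D_v f (p + s *: v).
Proof.
move=> df; pose g s := f (p + s *: v).
have dg (s : R) : `|s| <= `|t| -> is_derive s 1 g ('D_v f (p + s *: v)).
  by move=> st; apply: is_derive_line; exact: df.
have cg (s : R) : `|s| <= `|t| -> {for s, continuous g}.
  move=> st; apply: differentiable_continuous; apply/derivable1_diffP.
  by have [] := dg _ st.
have [t0|t0|->] := ltgtP t 0; last first.
- by exists 0; rewrite ?normr0// !scale0r addr0 subrr mul0r.
- have dg' s : s \in `]0, t[ -> is_derive s 1 g ('D_v f (p + s *: v)).
    rewrite in_itv/= => /andP[s0 st]; apply: dg.
    by rewrite !gtr0_norm// ltW.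
  have cg' : {within `[0, t], continuous g}.
    apply: continuous_in_subspaceT => s; rewrite inE/= in_itv/= => /andP[s0 st].
    by apply: cg; rewrite !ger0_norm// ltW.
  have [c] := MVT t0 dg' cg'.
  rewrite in_itv/= => /andP[c0 ct]; rewrite /g scale0r addr0 subr0 => E.
    by exists c; rewrite ?E 1?mulrC// !gtr0_norm// ltW.
- have dg' s : s \in `]t, 0[ -> is_derive s 1 g ('D_v f (p + s *: v)).
    rewrite in_itv/= => /andP[s0 st]; apply: dg.
    by rewrite !ltr0_norm// lerN2 ltW.
  have cg' : {within `[t, 0], continuous g}.
    apply: continuous_in_subspaceT => s; rewrite inE/= in_itv/= => /andP[s0 st].
    by apply: cg; rewrite !ler0_norm ?lerN2// ltW.
  have [c] := MVT t0 dg' cg'.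
  rewrite in_itv/= => /andP[c0 ct]; rewrite /g scale0r addr0 sub0r => E.
    exists c; first by rewrite !ltr0_norm// lerN2 ltW.
    by apply: oppr_inj; rewrite opprB E mulrN mulrC.
Qed.

End DirectionalCalculus.

Section PartialCalculus.
Context {R : realType} {m : nat}.
Local Notation V := 'rV[R]_m.
Implicit Types (f g : V -> R) (y v : V) (U : set V).

Lemma rV_continuous (T : topologicalType) (F : T -> V) (t : T) :
  (forall a, {for t, continuous (fun s => F s 0 a)}) -> {for t, continuous F}.
Proof.
move=> cF; apply/cvgrPdist_le => e e0; near=> s.
rewrite [leLHS]/Num.Def.normr/= mx_normrE (bigmax_le _ (ltW e0))//= => -[i a] _.
rewrite !mxE/= (ord1 i); move: a; near: s; apply: filter_forall => a.
by have /cvgrPdist_le := cF a; apply.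
Unshelve. all: by end_near. Qed.

Lemma normrV_ge (v : V) a : `|v 0 a| <= `|v|.
Proof.
rewrite [leRHS]/Num.Def.normr/= mx_normrE.
exact: (le_bigmax _ (fun i : 'I_1 * 'I_m => `|v i.1 i.2|) (0, a)).
Qed.

Lemma normrV_le (v : V) (e : R) : 0 <= e ->
  (forall a, `|v 0 a| <= e) -> `|v| <= e.
Proof.
move=> e0 ve; rewrite [leLHS]/Num.Def.normr/= mx_normrE.
by apply: bigmax_le => // -[i a] _ /=; rewrite (ord1 i).
Qed.

Lemma partialE a f y : partial a f y = 'D_(delta_mx 0 a) f y.
Proof. by []. Qed.

Lemma partials_rcons (s : seq 'I_m) a f :
  partials (rcons s a) f = partials s (partial a f).
Proof. by rewrite /partials foldr_rcons. Qed.

Lemma partial_near a f g y :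
  (\near y, f y = g y) -> partial a f y = partial a g y.
Proof. exact: near_eq_derive. Qed.

Lemma partials_eq_on U (s : seq 'I_m) f g : open U ->
  (forall y, U y -> f y = g y) ->
  forall y, U y -> partials s f y = partials s g y.
Proof.
move=> oU fg; elim: s => //= a s IH y Uy; apply: partial_near.
by apply: filterS (open_nbhs_nbhs (conj oU Uy)) => z; exact: IH.
Qed.

Lemma partial_eq_on U a f g : open U ->
  (forall y, U y -> f y = g y) ->
  forall y, U y -> partial a f y = partial a g y.
Proof. by move=> oU fg; exact: (partials_eq_on [:: a] oU fg). Qed.

(* Sealed in a record to keep unification from unfolding [smooth_on]. *)
Record smooth U f : Prop := Smooth { smoothP : smooth_on U f }.

Lemma smooth_on_continuous U f y :
  smooth U f -> U y -> {for y, continuous f}.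
Proof. by move=> [sf] Uy; have [] := sf [::] y Uy. Qed.

Lemma smooth_on_derivable U f y a :
  smooth U f -> U y -> derivable f y (delta_mx 0 a).
Proof. by move=> [sf] Uy; have [_] := sf [::] y Uy; apply. Qed.

Lemma smooth_on_partial U f a : smooth U f -> smooth U (partial a f).
Proof. by move=> [sf]; split=> s y Uy; rewrite -partials_rcons; exact: sf. Qed.

Lemma smooth_on_sub U U' f : U' `<=` U -> smooth U f -> smooth U' f.
Proof. by move=> sU [sf]; split=> s y Uy; apply: sf; exact: sU. Qed.

(** Every iterated partial derivative of a member of [P] agrees on [U] with another member. The list
    of indices is unrolled from its right end because its last index is differentiated first. *)
Lemma smooth_on_coind U (P : (V -> R) -> Prop) : open U ->
  (forall f, P f -> forall y, U y -> {for y, continuous f}) ->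
  (forall f a, P f -> (forall y, U y -> derivable f y (delta_mx 0 a)) /\
     exists2 g, P g & forall y, U y -> partial a f y = g y) ->
  forall f, P f -> smooth U f.
Proof.
move=> oU cP dP.
have key (s : seq 'I_m) : forall f, P f ->
    exists2 g, P g & forall y, U y -> partials s f y = g y.
  elim/last_ind: s => [f Pf|s a IH f Pf]; first by exists f.
  have [_ [g Pg fg]] := dP f a Pf; have [h Ph gh] := IH g Pg.
  exists h => // y Uy; rewrite partials_rcons -gh//.
  exact: (partials_eq_on s oU fg).
move=> f Pf; split=> s y Uy; have [g Pg fg] := key s f Pf.
have nfg : \near y, g y = partials s f y.
  by apply: filterS (open_nbhs_nbhs (conj oU Uy)) => z /fg.
split; first by apply: near_eq_continuous nfg _; exact: cP.
move=> a; apply: near_eq_derivable nfg _.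
by have [/(_ _ Uy)] := dP g a Pg.
Qed.

Lemma smooth_on_eq U f g : open U -> (forall y, U y -> f y = g y) ->
  smooth U f -> smooth U g.
Proof.
move=> oU fg [sf]; split=> s y Uy; have [cf df] := sf s y Uy.
have nfg : \near y, partials s f y = partials s g y.
  by apply: filterS (open_nbhs_nbhs (conj oU Uy)) => z; exact: partials_eq_on.
split; first exact: near_eq_continuous cf.
by move=> a; apply: near_eq_derivable nfg _.
Qed.

Lemma smooth_on_local U f :
  (forall y, U y -> exists2 W, W y & smooth W f) -> smooth U f.
Proof. by move=> H; split=> s y /H [W Wy [sf]]; exact: sf. Qed.

Inductive smooth_alg U (Gen : (V -> R) -> Prop) : (V -> R) -> Prop :=
| alg_smooth f : smooth U f -> smooth_alg U Gen f
| alg_gen f : Gen f -> smooth_alg U Gen f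
| alg_add f g : smooth_alg U Gen f -> smooth_alg U Gen g ->
    smooth_alg U Gen (fun y => f y + g y)
| alg_mul f g : smooth_alg U Gen f -> smooth_alg U Gen g ->
    smooth_alg U Gen (fun y => f y * g y).

(* Smoothness is coinductive: an algebra of continuous functions that is stable
   under partial derivatives consists of smooth functions. *)
Lemma smooth_alg_smooth U (Gen : (V -> R) -> Prop) : open U ->
  (forall f, Gen f -> (forall y, U y -> {for y, continuous f}) /\
    forall a, (forall y, U y -> derivable f y (delta_mx 0 a)) /\
    exists2 g, smooth_alg U Gen g & forall y, U y -> partial a f y = g y) ->
  forall f, smooth_alg U Gen f -> smooth U f.
Proof.
move=> oU HG; apply: smooth_on_coind => //.
  move=> f; elim=> {f} [f sf|f Gf|f g _ cf _ cg|f g _ cf _ cg] y Uy.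
  - exact: smooth_on_continuous Uy.
  - by have [cf _] := HG f Gf; exact: cf.
  - by apply: (@continuousD R R V f g); [exact: cf|exact: cg].
  - by apply: (@continuousM R V f g); [exact: cf|exact: cg].
move=> f a; elim=> {f} [f sf|f Gf|f g Af [df [f' Af' ff']] Ag [dg [g' Ag' gg']]
    |f g Af [df [f' Af' ff']] Ag [dg [g' Ag' gg']]].
- split; first by move=> y; exact: smooth_on_derivable.
  by exists (partial a f) => //; apply: alg_smooth; exact: smooth_on_partial.
- by have [_ df] := HG f Gf; exact: df.
- split; first by move=> y Uy; apply: derivableD; [exact: df|exact: dg].
  exists (fun y => f' y + g' y); first exact: alg_add.
  by move=> y Uy; rewrite -ff'// -gg'// /partial deriveD//; [exact: df|exact: dg].
- split; first by move=> y Uy; apply: derivableM; [exact: df|exact: dg].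
  exists (fun y => f y * g' y + g y * f' y).
    by apply: alg_add; exact: alg_mul.
  move=> y Uy; rewrite -ff'// -gg'// /partial deriveM//; [exact: df|exact: dg].
Qed.

Lemma smooth_on_alg0 U f : open U -> smooth_alg U (fun=> False) f -> smooth U f.
Proof. by move=> oU; apply: smooth_alg_smooth. Qed.

Opaque partial.

Lemma smooth_on_cst U (c : R) : open U -> smooth U (fun=> c).
Proof.
move=> oU; apply: (@smooth_on_coind U (fun f => exists c, f = fun=> c)) => //.
- by move=> _ [k ->] y _; exact: cst_continuous.
- move=> _ a [k ->]; split; first by move=> y _; exact: derivable_cst.
  exists (fun=> 0); first by exists 0.
  by move=> y _; rewrite partialE derive_cst.
- by exists c.
Qed.

Lemma smooth_onD U f g : open U -> smooth U f -> smooth U g ->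
  smooth U (fun y => f y + g y).
Proof.
by move=> oU sf sg; apply: smooth_on_alg0 => //; apply: alg_add; exact: alg_smooth.
Qed.

Lemma smooth_onM U f g : open U -> smooth U f -> smooth U g ->
  smooth U (fun y => f y * g y).
Proof.
by move=> oU sf sg; apply: smooth_on_alg0 => //; apply: alg_mul; exact: alg_smooth.
Qed.

Lemma smooth_onN U f : open U -> smooth U f -> smooth U (fun y => - f y).
Proof.
move=> oU sf; apply: (@smooth_on_eq _ (fun y => -1 * f y)) => [//|y _|].
  by rewrite mulN1r.
by apply: smooth_onM => [//||//]; exact: smooth_on_cst.
Qed.

Lemma smooth_onB U f g : open U -> smooth U f -> smooth U g ->
  smooth U (fun y => f y - g y).
Proof. by move=> oU sf sg; apply: smooth_onD => [//|//|]; exact: smooth_onN. Qed.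

Lemma smooth_on_sum U (I : Type) (r : seq I) (P : pred I) (F : I -> V -> R) :
  open U -> (forall i, smooth U (F i)) ->
  smooth U (fun y => \sum_(i <- r | P i) F i y).
Proof.
move=> oU sF; elim: r => [|i r IH].
  by apply: (@smooth_on_eq _ (fun=> 0)) => [//|y _|]; rewrite ?big_nil//; exact: smooth_on_cst.
case Pi : (P i); last first.
  by apply: smooth_on_eq IH => // y _; rewrite big_cons Pi.
apply: (@smooth_on_eq _ (fun y => F i y + \sum_(i <- r | P i) F i y)) => [//|y _|].
  by rewrite big_cons Pi.
exact: smooth_onD oU (sF i) IH.
Qed.

Lemma smooth_on_prod U (I : Type) (r : seq I) (P : pred I) (F : I -> V -> R) :
  open U -> (forall i, smooth U (F i)) ->
  smooth U (fun y => \prod_(i <- r | P i) F i y).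
Proof.
move=> oU sF; elim: r => [|i r IH].
  by apply: (@smooth_on_eq _ (fun=> 1)) => [//|y _|]; rewrite ?big_nil//; exact: smooth_on_cst.
case Pi : (P i); last first.
  by apply: smooth_on_eq IH => // y _; rewrite big_cons Pi.
apply: (@smooth_on_eq _ (fun y => F i y * \prod_(i <- r | P i) F i y)) => [//|y _|].
  by rewrite big_cons Pi.
exact: smooth_onM oU (sF i) IH.
Qed.

Lemma coord_derive (a b : 'I_m) (y v : V) :
  is_derive y v (fun z : V => z 0 a) (v 0 a).
Proof.
have D : derivable (id : V -> V) y v by exact: derivable_id.
have := derive_mx D.
rewrite derive_id => /matrixP/(_ 0 a); rewrite mxE => E.
split; last by rewrite -E.
by move/derivable_mxP : D; apply.
Qed.

Lemma smooth_on_coord U a : open U -> smooth U (fun y : V => y 0 a).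
Proof.
move=> oU; apply: (@smooth_alg_smooth U (fun f => f = fun y : V => y 0 a)) => //;
  last exact: alg_gen.
move=> _ ->; split; first by move=> y _; exact: coord_continuous.
move=> b; split; first by move=> y _; have [] := coord_derive a b y (delta_mx 0 b).
exists (fun=> (delta_mx 0 b : V) 0 a); first by apply: alg_smooth; exact: smooth_on_cst.
by move=> y _; rewrite partialE; have [_] := coord_derive a b y (delta_mx 0 b).
Qed.

Definition C1_on U f := forall y a, U y ->
  derivable f y (delta_mx 0 a) /\ {for y, continuous (partial a f)}.

Lemma smooth_on_C1 U f : smooth U f -> C1_on U f.
Proof.
move=> sf y a Uy; split; first exact: smooth_on_derivable Uy.
by apply: smooth_on_continuous Uy; exact: smooth_on_partial.
Qed.

Definition lform (c : 'I_m -> R) (v : V) : R := \sum_a v 0 a * c a.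

Lemma lform_is_linear c : linear (lform c).
Proof.
move=> k u v; rewrite /lform/= scaler_sumr -big_split/=; apply: eq_bigr => a _.
by rewrite !mxE mulrDl /GRing.scale/= mulrA.
Qed.

HB.instance Definition _ c := GRing.isLinear.Build R V R *:%R (lform c)
  (lform_is_linear c).

Lemma lform_continuous c : continuous (lform c).
Proof.
move=> v; have : smooth setT (lform c).
  apply: smooth_on_sum; first exact: openT.
  move=> a; apply: smooth_onM; first exact: openT.
    exact: smooth_on_coord openT.
  exact: smooth_on_cst openT.
by move=> /smooth_on_continuous; exact.
Qed.

(** The increment is split into moves along one coordinate each; the mean value theorem turns each
    move into a partial derivative at a nearby point, and continuity brings that point back to
    [y]. *)
Lemma C1_differentiable U f y : open U -> C1_on U f -> U y ->
  differentiable f y /\ forall v, 'd f y v = \sum_a v 0 a * partial a f y.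
Proof.
move=> oU sf Uy; pose L := lform (fun a => partial a f y).
have LE (e : {posnum R}) :
    \forall h \near (0 : V), `|f (h + y) - (f y + L h)| <= e%:num * `|h|.
  (* There are [m] error terms; dividing by [m.+1] also covers [m = 0]. *)
  pose e' := e%:num / (m.+1)%:R.
  have e'0 : 0 < e' by rewrite divr_gt0.
  have : \forall z \near y, U z /\ forall a, `|partial a f y - partial a f z| <= e'.
    near=> z; split; first by near: z; exact: open_nbhs_nbhs.
    move=> a; move: a; near: z; apply: filter_forall => a.
    by have [_ /cvgrPdist_le] := sf y a Uy; apply.
  move=> /nbhs_ballP[d /= d0 Hd].
  near=> h.
  have hd : `|h| < d by near: h; apply: (@nbhs0_lt _ V).
  (* The polygonal path from [y] to [h + y]: after [k] moves the first [k] coordinates are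
     updated. *)
  pose p k : V := y + \row_a (if (a < k)%N then h 0 a else 0).
  have pS (k : 'I_m) : p k.+1 = p k + h 0 k *: delta_mx 0 k.
    rewrite /p -addrA; congr (_ + _); apply/rowP => a; rewrite !mxE eqxx/=.
    rewrite ltnS leq_eqVlt; have [->|ak] := eqVneq a k.
      by rewrite eqxx ltnn mulr1 add0r.
    by rewrite (negbTE (_ : nat_of_ord a != k))// mulr0 addr0.
  have p0 : p 0%N = y by apply/rowP => a; rewrite !mxE addr0.
  have pm : p m = h + y by apply/rowP => a; rewrite !mxE ltn_ord addrC.
  have key (k : 'I_m) :
      `|f (p k.+1) - f (p k) - h 0 k * partial k f y| <= e' * `|h|.
    have inb s : `|s| <= `|h 0 k| -> ball y d (p k + s *: delta_mx 0 k).
      move=> sh; rewrite -ball_normE /ball_/= (le_lt_trans _ hd)//.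
      apply: normrV_le => // a; rewrite !mxE eqxx/= -addrA opprD addNKr normrN.
      case: ifPn => ak.
        rewrite (_ : (a == k) = false) ?mulr0 ?addr0 ?normrV_ge//.
        by apply/negbTE/eqP => E; move: ak; rewrite E ltnn.
      rewrite add0r; case: eqP => _; last by rewrite mulr0 normr0.
      by rewrite mulr1 (le_trans sh)// normrV_ge.
    have [s sh] := @MVT_line R V f (p k) (delta_mx 0 k) (h 0 k)
      (fun s sh => (sf _ k (Hd _ (inb s sh)).1).1).
    rewrite pS -partialE => ->; rewrite -mulrBr normrM mulrC ler_pM//.
      by rewrite distrC; apply: (Hd _ (inb s sh)).2.
    exact: normrV_ge.
  rewrite opprD addrA -pm -p0.
  rewrite -(@telescope_sumr _ 0 m (f \o p))//= big_mkord /L /lform -sumrB.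
  rewrite (le_trans (ler_norm_sum _ _ _))//.
  rewrite (@le_trans _ _ (\sum_(k < m) e' * `|h|))//.
    by apply: ler_sum => k _; exact: key.
  rewrite sumr_const card_ord -mulr_natl mulrA ler_wpM2r//.
  by rewrite /e' mulrCA ger_pMr// ler_pdivrMr// mul1r ler_nat.
have dE : 'd f y = L :> (V -> R).
  apply: (@diff_unique R V R f (lform (fun a => partial a f y)) y).
    exact: lform_continuous.
  by apply/eqaddoP => _/posnumP[e]; exact: LE.
split; last by move=> v; rewrite dE.
apply/diff_locallyP; rewrite dE; split; first exact: lform_continuous.
by apply/eqaddoP => _/posnumP[e]; exact: LE.
Unshelve. all: by end_near. Qed.

Lemma C1_derive U f y v : open U -> C1_on U f -> U y ->
  is_derive y v f (\sum_a v 0 a * partial a f y).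
Proof.
move=> oU sf Uy; have [df dfE] := C1_differentiable oU sf Uy.
by split; [exact: diff_derivable|rewrite deriveE// dfE].
Qed.

Lemma C1_chain U f (c : R -> V) (t : R) (dc : 'I_m -> R) :
  open U -> C1_on U f -> U (c t) ->
  (forall a, is_derive t 1 (fun s => c s 0 a) (dc a)) ->
  is_derive t 1 (fun s => f (c s)) (\sum_a dc a * partial a f (c t)).
Proof.
move=> oU sf Uc hc; have [df dfE] := C1_differentiable oU sf Uc.
have Dc : derivable c t 1 by apply/derivable_mxP => i a; rewrite (ord1 i); have [] := hc a.
have dc' : differentiable c t by exact/derivable1_diffP.
have dfc : differentiable (f \o c) t by apply: differentiable_comp.
split; first exact/derivable1_diffP.
rewrite deriveE//.
rewrite diff_comp//= dfE; apply: eq_bigr => a _; congr (_ * _).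
by rewrite -deriveE// derive_mx// mxE; have [] := hc a.
Qed.

(** The second difference over a small square of side [t] is symmetric in the two directions. Two
    applications of the mean value theorem, in either order, write it as t^2 times a mixed
    derivative at a point of the ball; continuity at [y] concludes. *)
Lemma partialC U f a b y : open U -> smooth U f -> U y ->
  partial a (partial b f) y = partial b (partial a f) y.
Proof.
have aux1 (A B C D p q t : R) : t != 0 -> A - B - (C - D) = t * (t * p) ->
    A - C - (B - D) = t * (t * q) -> p = q.
  move=> t0 E1 E2; apply: (mulfI t0); apply: (mulfI t0); rewrite -E1 -E2; ring.
have aux2 (p q r s e : R) : r = s -> `|p - r| <= e / 2 -> `|q - s| <= e / 2 ->
    `|q - p| <= e.
  move=> -> pr qs; rewrite -(subrKA s) [leRHS]splitr.
  by rewrite (le_trans (ler_normD _ _))// lerD// distrC.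
move=> oU sf Uy; apply/eqP; rewrite -subr_eq0 -normr_eq0 eq_le normr_ge0 andbT.
apply/ler_addgt0Pl => e e0; rewrite addr0.
have cab : {for y, continuous (partial a (partial b f))}.
  by apply: smooth_on_continuous Uy; do 2 apply: smooth_on_partial.
have cba : {for y, continuous (partial b (partial a f))}.
  by apply: smooth_on_continuous Uy; do 2 apply: smooth_on_partial.
have e20 : 0 < e / 2 by rewrite divr_gt0.
have : \forall z \near y, [/\ U z,
    `|partial a (partial b f) y - partial a (partial b f) z| <= e / 2 &
    `|partial b (partial a f) y - partial b (partial a f) z| <= e / 2].
  have nU : \forall z \near y, U z by exact: open_nbhs_nbhs.
  move/cvgrPdist_le : cab => /(_ _ e20) nab.
  move/cvgrPdist_le : cba => /(_ _ e20) nba.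
  near=> z; split; [exact: (near nU)|exact: (near nab z)|exact: (near nba z)].
move=> /nbhs_ballP[d /= d0 Hd].
have HU z : ball y d z -> U z by move=> /Hd[].
(* Two displacements of size at most [t] stay within d / 2 of [y]. *)
pose t := d / 4; have t0 : 0 < t by rewrite divr_gt0.
have inb (i j : 'I_m) (r s : R) : `|r| <= `|t| -> `|s| <= `|t| ->
    ball y d (y + r *: delta_mx 0 i + s *: delta_mx 0 j).
  move=> rt st; rewrite -ball_normE /ball_/= -addrA opprD addNKr normrN.
  have n1 (u : R) k : `|u *: (delta_mx 0 k : V)| <= `|u|.
    apply: normrV_le => // l; rewrite !mxE normrM eqxx/=.
    by case: eqP => _; rewrite ?normr1 ?mulr1// normr0 mulr0.
  rewrite (le_lt_trans (ler_normD _ _))// (le_lt_trans (lerD (n1 _ _) (n1 _ _)))//.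
  rewrite (le_lt_trans (lerD rt st))// gtr0_norm// /t; lra.
have key (i j : 'I_m) : exists2 z, ball y d z &
   f (y + t *: delta_mx 0 i + t *: delta_mx 0 j) - f (y + t *: delta_mx 0 i)
   - (f (y + t *: delta_mx 0 j) - f y) = t * (t * partial j (partial i f) z).
  pose g z := f (z + t *: delta_mx 0 j) - f z.
  have [|s st] := @MVT_line R V g y (delta_mx 0 i) t.
    move=> s st; apply: derivableB.
      apply: (derive_shift_arg _ _ _ _).1.
      by apply: smooth_on_derivable sf (HU _ _); apply: inb.
    apply: smooth_on_derivable sf (HU _ _).
    by have := @inb i i s 0 st; rewrite scale0r addr0 normr0; apply.
  have dU1 : U (y + s *: delta_mx 0 i + t *: delta_mx 0 j).
    exact: HU (inb i j s t st (lexx _)).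
  have dU2 : U (y + s *: delta_mx 0 i).
    have := inb i i s 0 st; rewrite scale0r addr0 normr0 => /(_ (normr_ge0 _)).
    exact: HU.
  rewrite /g deriveB; last 2 first.
  - apply: (derive_shift_arg _ _ _ _).1; exact: smooth_on_derivable sf _.
  - exact: smooth_on_derivable sf _.
  rewrite (derive_shift_arg _ _ _ _).2 -!partialE => ->.
  have [|r rt] := @MVT_line R V (partial i f) (y + s *: delta_mx 0 i) (delta_mx 0 j) t.
    move=> r rt; apply: (@smooth_on_derivable U); first exact: smooth_on_partial.
    exact: HU (inb i j s r st rt).
  rewrite -partialE => ->.
  by exists (y + s *: delta_mx 0 i + r *: delta_mx 0 j) => //; exact: inb.
have [z1 bz1 E1] := key a b; have [z2 bz2 E2] := key b a.
have E : partial b (partial a f) z1 = partial a (partial b f) z2.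
  have tn0 : t != 0 by rewrite gt_eqF.
  have Eab : y + t *: delta_mx 0 b + t *: delta_mx 0 a =
    y + t *: delta_mx 0 a + t *: delta_mx 0 b by rewrite addrAC.
  rewrite Eab in E2; exact: aux1 tn0 E1 E2.
have [_ _ H1] := Hd _ bz1; have [_ H2 _] := Hd _ bz2.
exact: aux2 E H1 H2.
Unshelve. all: by end_near. Qed.

Lemma partial_out0 U f a y : open U -> (forall y, U y -> f y = 0) -> U y ->
  partial a f y = 0.
Proof.
move=> oU f0 Uy; rewrite (@partial_eq_on U a f (fun=> 0))//.
by rewrite partialE derive_cst.
Qed.

End PartialCalculus.

Global Opaque partial.

(** * Chain rule and composition with smooth functions *)

Section ChainRule.
Context {R : realType}.

Lemma is_derive_of_line (V : normedModType R) (f : V -> R) (x v : V) (d : R) :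
  is_derive (0 : R) 1 (fun s : R => f (x + s *: v)) d -> is_derive x v f d.
Proof.
move=> [df dE].
have fE : (fun s : R => f (x + s *: v)) = (fun h : R => f (h *: v + x)).
  by apply/funext => s; rewrite addrC.
have D : derivable f x v by apply/derivable1P; rewrite -fE.
split => //.
have D' : derivable f (x + 0 *: v) v by rewrite scale0r addr0.
by have [_] := is_derive_line D'; rewrite dE scale0r addr0.
Qed.

Lemma is_derive_to_line (V : normedModType R) (f : V -> R) (x v : V) (d : R) :
  is_derive x v f d -> is_derive (0 : R) 1 (fun s : R => f (x + s *: v)) d.
Proof.
move=> [df <-]; have D' : derivable f (x + 0 *: v) v by rewrite scale0r addr0.
by have := is_derive_line D'; rewrite scale0r addr0.
Qed.

Lemma is_derive_chain1 (V : normedModType R) (F : R -> R) (f : V -> R)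
    (x v : V) (a b : R) :
  is_derive (f x) 1 F a -> is_derive x v f b ->
  is_derive x v (fun z => F (f z)) (a * b).
Proof.
move=> dF df; apply: is_derive_of_line.
apply: (@is_derive1_comp R F (fun s => f (x + s *: v)) 0 a b).
  by rewrite scale0r addr0.
exact: is_derive_to_line.
Qed.

Lemma C1_chain_dir m (V : normedModType R) (W : set 'rV[R]_m) f
    (psi : V -> 'rV[R]_m) (y v : V) (d : 'I_m -> R) :
  open W -> C1_on W f -> W (psi y) ->
  (forall b, is_derive y v (fun z => psi z 0 b) (d b)) ->
  is_derive y v (fun z => f (psi z)) (\sum_b d b * partial b f (psi y)).
Proof.
move=> oW sf Wy dpsi; apply: is_derive_of_line.
have := @C1_chain R m W f (fun s : R => psi (y + s *: v)) 0 d oW sf.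
rewrite scale0r addr0; apply => // a.
exact: is_derive_to_line.
Qed.

Lemma partial_is_derive m (f : 'rV[R]_m -> R) y a d :
  is_derive y (delta_mx 0 a) f d -> partial a f y = d.
Proof. by move=> [_ <-]; rewrite partialE. Qed.

Lemma smooth_is_derive m (U : set 'rV[R]_m) f y a : smooth U f -> U y ->
  is_derive y (delta_mx 0 a) f (partial a f y).
Proof. by move=> sf Uy; rewrite partialE; split => //; exact: smooth_on_derivable Uy. Qed.

Lemma partial_comp k m (U : set 'rV[R]_k) (W : set 'rV[R]_m)
    (psi : 'rV[R]_k -> 'rV[R]_m) f a y :
  open W -> (forall b, smooth U (fun y => psi y 0 b)) ->
  smooth W f -> U y -> W (psi y) ->
  partial a (fun y => f (psi y)) y =
    \sum_b partial a (fun y => psi y 0 b) y * partial b f (psi y).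
Proof.
move=> oW spsi sf Uy Wy; apply: partial_is_derive.
apply: (C1_chain_dir oW _ Wy); first exact: smooth_on_C1.
move=> b; exact: smooth_is_derive Uy.
Qed.

Lemma alg_sum m (U : set 'rV[R]_m) Gen (I : Type) (r : seq I)
    (F : I -> 'rV[R]_m -> R) : open U ->
  (forall i, smooth_alg U Gen (F i)) ->
  smooth_alg U Gen (fun y => \sum_(i <- r) F i y).
Proof.
move=> oU sF; elim: r => [|i r IH].
  rewrite (_ : (fun y => _) = fun=> 0); last by apply/funext => y; rewrite big_nil.
  by apply: alg_smooth; exact: smooth_on_cst.
rewrite (_ : (fun y => _) = fun y => F i y + \sum_(i <- r) F i y); last first.
  by apply/funext => y; rewrite big_cons.
exact: alg_add (sF i) IH.
Qed.

(** By the chain rule, the algebra generated over the smooth functions by the pullbacks along [psi]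
    is stable under partial derivatives, so [smooth_alg_smooth] applies. *)
Lemma smooth_on_comp k m (U : set 'rV[R]_k) (W : set 'rV[R]_m)
    (psi : 'rV[R]_k -> 'rV[R]_m) f :
  open U -> open W -> (forall b, smooth U (fun y => psi y 0 b)) ->
  (forall y, U y -> W (psi y)) -> smooth W f ->
  smooth U (fun y => f (psi y)).
Proof.
move=> oU oW spsi UW sf.
pose Gen (h : 'rV[R]_k -> R) := exists2 f, smooth W f & h = (fun y => f (psi y)).
have HG : forall f, Gen f -> (forall y, U y -> {for y, continuous f}) /\
    forall a, (forall y, U y -> derivable f y (delta_mx 0 a)) /\
    exists2 g, smooth_alg U Gen g & forall y, U y -> partial a f y = g y.
  move=> _ [h sh ->]; split.
    move=> y Uy; apply: (@continuous_comp _ _ _ psi h).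
      by apply: rV_continuous => b; exact: smooth_on_continuous (spsi b) Uy.
    exact: smooth_on_continuous sh (UW _ Uy).
  move=> a; split.
    move=> y Uy; have [] // := @C1_chain_dir m _ W h psi y (delta_mx 0 a)
      (fun b => partial a (fun y => psi y 0 b) y) oW (smooth_on_C1 sh) (UW _ Uy) _.
    by move=> b; exact: smooth_is_derive (spsi b) Uy.
  exists (fun y => \sum_b partial a (fun y => psi y 0 b) y * partial b h (psi y)).
    apply: alg_sum => // b; apply: alg_mul.
      by apply: alg_smooth; apply: smooth_on_partial; exact: spsi.
    by apply: alg_gen; exists (partial b h); [exact: smooth_on_partial|by []].
  by move=> y Uy; exact: (partial_comp a oW spsi sh Uy (UW _ Uy)).
by apply: (smooth_alg_smooth oU HG); apply: alg_gen; exists f.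
Qed.

(** [C] is a class of outer functions, such as [expR] alone or all [flat b k], whose derivatives are
    polynomial in members of the class with smooth coefficients. *)
Lemma smooth_on_comp1 m (U : set 'rV[R]_m) (f : 'rV[R]_m -> R)
    (C : (R -> R) -> Prop) :
  open U -> smooth U f ->
  (forall F, C F -> exists2 F', smooth_alg U
       (fun h => exists2 F, C F & h = fun y => F (f y)) (fun y => F' (f y)) &
     forall y, U y -> is_derive (f y) 1 F (F' (f y))) ->
  forall F, C F -> smooth U (fun y => F (f y)).
Proof.
move=> oU sf HC F CF.
set Gen := (fun h => exists2 F, C F & h = fun y => F (f y)) in HC.
apply: (@smooth_alg_smooth _ _ U Gen) => //; last by apply: alg_gen; exists F.
move=> _ [{CF}F CF ->]; have [F' AF' dF] := HC F CF.
have dd y a : U y -> is_derive y (delta_mx 0 a) (fun y => F (f y)) (F' (f y) * partial a f y).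
  by move=> Uy; apply: is_derive_chain1; [exact: dF|exact: smooth_is_derive Uy].
split.
  move=> y Uy; apply: (@continuous_comp _ _ _ f F).
    exact: smooth_on_continuous sf Uy.
  apply: differentiable_continuous; apply/derivable1_diffP.
  by have [] := dF y Uy.
move=> a; split; first by move=> y Uy; have [] := dd y a Uy.
exists (fun y => F' (f y) * partial a f y).
  by apply: alg_mul => //; apply: alg_smooth; exact: smooth_on_partial.
by move=> y Uy; apply: partial_is_derive; exact: dd.
Qed.

Lemma smooth_on_exp m (U : set 'rV[R]_m) f : open U -> smooth U f ->
  smooth U (fun y => expR (f y)).
Proof.
move=> oU sf; apply: (@smooth_on_comp1 _ U f (fun F => F = expR)) => //.
move=> _ ->; exists expR; last by move=> y _; exact: is_derive_expR.
by apply: alg_gen; exists expR.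
Qed.

Lemma smooth_onV m (U : set 'rV[R]_m) f : open U -> smooth U f ->
  (forall y, U y -> f y != 0) -> smooth U (fun y => (f y)^-1).
Proof.
move=> oU sf f0.
apply: (@smooth_on_comp1 _ U f (fun F => F = fun x : R => x^-1)) => //.
move=> _ ->; exists (fun x => -1 * (x^-1 * x^-1)).
  apply: alg_mul; first by apply: alg_smooth; exact: smooth_on_cst.
  by apply: alg_mul; apply: alg_gen; exists (fun x : R => x^-1).
move=> y Uy; have := @is_deriveV R id (f y) 1 1 (f0 _ Uy) (is_derive_id _ _).
rewrite /GRing.scale/= mulr1 => H.
by rewrite mulN1r -invfM -expr2.
Qed.

Lemma smooth_on_ln m (U : set 'rV[R]_m) f : open U -> smooth U f ->
  (forall y, U y -> 0 < f y) -> smooth U (fun y => ln (f y)).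
Proof.
move=> oU sf f0; apply: (@smooth_on_comp1 _ U f (fun F => F = @ln R)) => //.
move=> _ ->; exists (fun x => x^-1).
  apply: alg_smooth; apply: smooth_onV => // y Uy; rewrite gt_eqF//; exact: f0.
by move=> y Uy; apply: is_derive1_ln; exact: f0.
Qed.

Lemma smooth_on_sqrt m (U : set 'rV[R]_m) f : open U -> smooth U f ->
  (forall y, U y -> 0 < f y) -> smooth U (fun y => Num.sqrt (f y)).
Proof.
move=> oU sf f0; apply: (@smooth_on_eq _ _ U (fun y => expR (2^-1 * ln (f y)))) => [//|y Uy|].
  have fy := f0 y Uy.
  by rewrite -powR12_sqrt ?ltW// /powR gt_eqF.
apply: smooth_on_exp => [//|]; apply: smooth_onM; first by [].
  exact: smooth_on_cst.
exact: smooth_on_ln.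
Qed.

Lemma jacobianE k m (U : set 'rV[R]_k) (psi : 'rV[R]_k -> 'rV[R]_m) y a b :
  open U -> (forall b, smooth U (fun y => psi y 0 b)) -> U y ->
  ('J psi y) a b = partial a (fun y => psi y 0 b) y.
Proof.
move=> oU spsi Uy.
have dpsi : differentiable psi y.
  rewrite (_ : psi = \sum_c (fun y => psi y 0 c *: delta_mx 0 c)); last first.
    apply/funext => z; rewrite fct_sumE [LHS]row_sum_delta.
    by apply: eq_bigr.
  apply: differentiable_sum => c; apply: differentiableZl.
  by have [] := C1_differentiable oU (smooth_on_C1 (spsi c)) Uy.
have := @deriveEjacobian R k m psi y (delta_mx 0 a) dpsi.
rewrite derive_mx; last exact: diff_derivable.
move=> /matrixP/(_ 0 b); rewrite mxE partialE => ->.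
by rewrite -rowE [RHS]mxE.
Qed.

Lemma partial0_ball m (U : set 'rV[R]_m) (f : 'rV[R]_m -> R) y d z :
  open U -> C1_on U f -> ball y d `<=` U ->
  (forall z a, ball y d z -> partial a f z = 0) -> ball y d z -> f z = f y.
Proof.
move=> oU sf bU f0 bz.
have inb s : `|s| <= `|1 : R| -> ball y d (y + s *: (z - y)).
  rewrite normr1 => s1; move: bz; rewrite -!ball_normE /ball_/= => bz.
  rewrite opprD addNKr normrN normrZ -normrN opprB.
  by rewrite (le_lt_trans _ bz)// ler_piMl.
have dz s : `|s| <= `|1 : R| -> is_derive (y + s *: (z - y)) (z - y) f 0.
  move=> s1; have := C1_derive (z - y) oU sf (bU _ (inb s s1)).
  by rewrite big1// => a _; rewrite f0 ?mulr0//; exact: inb.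
have [|s s1] := @MVT_line R _ f y (z - y) 1.
  by move=> s s1; have [] := dz s s1.
have [_ ->] := dz s s1; rewrite mulr0 scale1r addrCA subrr addr0 => /eqP.
by rewrite subr_eq0 => /eqP.
Qed.

End ChainRule.

(** * Flat functions and smooth ramps *)

Section FlatFunction.
Context {R : realType}.
Implicit Types (b t : R) (k : nat).

(** The exponent [k] is there to make the family closed under differentiation: t^-k exp(-b/t) has a
    derivative that combines two members with larger [k]. *)
Definition flat b k t : R := if 0 < t then t^-1 ^+ k * expR (- b / t) else 0.

(** One term of the exponential series bounds exp(b/t) from below by (b/t)^(k+2) / (k+2)!, which
    beats t^-k and leaves t^2. This is what is needed for the derivative at 0. *)
Lemma flat_quad b k : 0 < b -> exists2 C, 0 <= C &
  forall t, `|flat b k t| <= C * t ^+ 2.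
Proof.
move=> b0; pose C := (k.+2)`!%:R / b ^+ k.+2.
have C0 : 0 <= C by rewrite divr_ge0// exprn_ge0// ltW.
exists C => // t; rewrite /flat; case: ifPn => t0; last first.
  by rewrite normr0 mulr_ge0// sqr_ge0.
have tb0 : 0 < b / t by rewrite divr_gt0.
rewrite ger0_norm; last by rewrite mulr_ge0 ?expR_ge0// exprn_ge0// invr_ge0 ltW.
rewrite mulNr expRN; set E := expR _; have E0 : 0 < E := expR_gt0 _.
have : (b / t) ^+ k.+2 / (k.+2)`!%:R <= E.
  by rewrite (le_trans _ (expR_ge1Dxn k.+1 (ltW tb0)))// lerDr.
rewrite ler_pdivrMr ?ltr0n ?fact_gt0// => H.
rewrite ler_pdivrMr// /C exprVn -(ler_pM2l (exprn_gt0 k t0)) mulfV ?expf_neq0 ?gt_eqF//.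
rewrite -(ler_pM2l (exprn_gt0 k.+2 tb0)) mulr1 (le_trans H)// le_eqVlt; apply/orP; left.
apply/eqP; rewrite expr_div_n !exprSr; field.
by rewrite !gt_eqF ?exprn_gt0.
Qed.

Lemma is_derive_quad (F : R -> R) (C : R) : (forall t, `|F t| <= C * t ^+ 2) ->
  is_derive (0 : R) 1 F 0.
Proof.
move=> FC; have F0 : F 0 = 0.
  by apply/normr0_eq0/eqP; rewrite eq_le normr_ge0 (le_trans (FC 0))// expr0n mulr0.
have C0 : 0 <= C by have := FC 1; rewrite expr1n mulr1; exact: le_trans.
have H : (fun h : R => h^-1 *: ((F \o shift 0) (h *: (1:R)) - F 0)) @ 0^' --> (0 : R).
  apply/cvgrPdist_le => e e0; near=> h.
  have h0 : h != 0 by near: h; exact: nbhs_dnbhs_neq.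
  rewrite F0 /= subr0 addr0 sub0r normrN /GRing.scale/= mulr1 normrM normfV.
  rewrite ler_pdivrMl ?normr_gt0// (le_trans (FC h))// -real_normK ?num_real//.
  rewrite expr2 mulrA [leRHS]mulrC ler_wpM2r//.
  have : `|h| < e / (C + 1).
    by near: h; apply: dnbhs0_lt; rewrite divr_gt0// ltr_wpDl.
  rewrite ltr_pdivlMr ?ltr_wpDl// => /ltW; apply: le_trans.
  by rewrite mulrC ler_wpM2l// lerDl.
by split; [apply/cvg_ex; exists 0|apply/cvg_lim].
Unshelve. all: by end_near. Qed.

Lemma is_derive_flat b k t : 0 < b ->
  is_derive t 1 (flat b k) (b * flat b k.+2 t - k%:R * flat b k.+1 t).
Proof.
move=> b0; have [t0|t0|->] := ltgtP t 0; last first.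
- have [C C0 HC] := flat_quad k b0.
  rewrite /flat ltxx !mulr0 subrr; exact: is_derive_quad HC.
- have E : \forall s \near t, s^-1 ^+ k * expR (- b / s) = flat b k s.
    near=> s; rewrite /flat ifT//; near: s; exact: lt_nbhsr.
  apply: near_eq_is_derive E _.
  have dV : is_derive t 1 (fun s : R => s^-1) (- t ^- 2).
    have := @is_deriveV R id t 1 1 (lt0r_neq0 t0) (is_derive_id _ _).
    by rewrite /GRing.scale/= mulr1.
  have dX : is_derive t 1 (fun s : R => s^-1 ^+ k) (k%:R * t^-1 ^+ k.-1 * - t ^- 2).
    apply: (@is_derive_chain1 R R^o (fun s => s ^+ k)) => //.
    split; first exact: exprn_derivable.
    by rewrite exp_derive /GRing.scale/= mulr1.
  have dE : is_derive t 1 (fun s : R => expR (- b / s)) (expR (- b / t) * (- b * - t ^- 2)).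
    have dZ : is_derive t 1 (fun s : R => - b / s) (- b * - t ^- 2).
      exact: (@is_deriveZ R R^o R^o (fun s : R => s^-1) (- b) t 1 _ dV).
    exact: (@is_derive_chain1 R R^o expR _ _ _ _ _ (is_derive_expR _) dZ).
  have := @is_deriveM R R^o _ _ t 1 _ _ dX dE.
  rewrite /GRing.scale/= /flat t0 => H; apply: is_derive_eq H _.
  case: k {dX} => [|k] /=; rewrite ?mul0r ?mulr0 ?mulrNN ?subr0.
    by rewrite !expr0 exprVn; ring.
  by rewrite -!exprVn !exprS; ring.
- have E : \forall s \near t, cst 0 s = flat b k s.
    near=> s; rewrite /flat ifF//; apply/negbTE; rewrite -leNgt ltW//.
    near: s; exact: lt_nbhsl.
  apply: near_eq_is_derive E _; rewrite /flat !ifF ?mulr0 ?subrr; last 2 first.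
  + by apply/negbTE; rewrite -leNgt ltW.
  + by apply/negbTE; rewrite -leNgt ltW.
  exact: is_derive_cst.
Unshelve. all: by end_near. Qed.

Lemma smooth_on_flat m (U : set 'rV[R]_m) f b k : 0 < b -> open U ->
  smooth U f -> smooth U (fun y => flat b k (f y)).
Proof.
move=> b0 oU sf.
apply: (@smooth_on_comp1 _ _ U f (fun F => exists k, F = flat b k)) => //; last by exists k.
move=> _ [l ->]; exists (fun x => b * flat b l.+2 x + (- l%:R) * flat b l.+1 x).
  apply: alg_add; apply: alg_mul.
  - by apply: alg_smooth; exact: smooth_on_cst.
  - by apply: alg_gen; exists (flat b l.+2) => //; exists l.+2.
  - by apply: alg_smooth; exact: smooth_on_cst.
  - by apply: alg_gen; exists (flat b l.+1) => //; exists l.+1.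
by move=> y _; rewrite mulNr; exact: is_derive_flat.
Qed.

(** A smooth substitute for max(t, 0): it vanishes for t <= 0, is nondecreasing with slope at most
    1, and loses at most [b]. The slope bound is 1 + b/t <= exp(b/t). *)
Definition ramp b t : R := t * flat b 0 t.

Lemma ramp_le0 b t : t <= 0 -> ramp b t = 0.
Proof. by move=> t0; rewrite /ramp /flat ltNge t0 mulr0. Qed.

Lemma ramp_gt0E b t : 0 < t -> ramp b t = t * expR (- b / t).
Proof. by move=> t0; rewrite /ramp /flat t0 expr0 mul1r. Qed.

Lemma ramp_ge0 b t : 0 <= ramp b t.
Proof.
have [t0|t0] := leP t 0; first by rewrite ramp_le0.
by rewrite ramp_gt0E// mulr_ge0 ?expR_ge0// ltW.
Qed.

Lemma ramp_gt0 b t : (0 < ramp b t) = (0 < t).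
Proof.
have [t0|t0] := leP t 0; first by rewrite ramp_le0// ltxx.
by rewrite ramp_gt0E// mulr_gt0// expR_gt0.
Qed.

Lemma ramp_ge b t : 0 < b -> t - b <= ramp b t.
Proof.
move=> b0; have [t0|t0] := leP t 0.
  by rewrite ramp_le0// subr_le0 (le_trans t0)// ltW.
rewrite ramp_gt0E// -(ler_pM2l (_ : 0 < t^-1)) ?invr_gt0// mulKf ?gt_eqF//.
apply: le_trans (expR_ge1Dx _); rewrite mulrBr mulVf ?gt_eqF// lerD2l.
by rewrite mulNr mulrC.
Qed.

Lemma ramp_homo b : 0 < b -> {homo ramp b : x y / x <= y}.
Proof.
move=> b0 x y xy; have [x0|x0] := leP x 0; first by rewrite ramp_le0// ramp_ge0.
have y0 := lt_le_trans x0 xy; rewrite !ramp_gt0E// ler_pM ?expR_ge0 ?(ltW x0)//.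
rewrite ler_expR !mulNr lerN2 ler_pM2l// lef_pV2//.
Qed.

Definition dramp b t : R := flat b 0 t + b * flat b 1 t.

Lemma is_derive_ramp b t : 0 < b -> is_derive t 1 (ramp b) (dramp b t).
Proof.
move=> b0; have := @is_deriveM R R^o id (flat b 0) t 1 _ _ (is_derive_id _ _)
  (is_derive_flat 0 t b0).
rewrite /GRing.scale/= mulr1 mul0r subr0 => H; apply: is_derive_eq H _.
rewrite /dramp addrC; congr (_ + _); rewrite /flat; case: ifPn => t0; last by rewrite !mulr0.
by field; rewrite gt_eqF.
Qed.

Lemma dramp_le0 b t : t <= 0 -> dramp b t = 0.
Proof. by move=> t0; rewrite /dramp /flat ltNge t0 !mulr0 addr0. Qed.

Lemma dramp_ge0 b t : 0 < b -> 0 <= dramp b t.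
Proof.
move=> b0; have fp k : 0 <= flat b k t.
  rewrite /flat; case: ifPn => // t0.
  by rewrite mulr_ge0 ?expR_ge0// exprn_ge0// invr_ge0 ltW.
by rewrite addr_ge0// mulr_ge0// ltW.
Qed.

Lemma dramp_le1 b t : 0 < b -> dramp b t <= 1.
Proof.
move=> b0; have [t0|t0] := leP t 0; first by rewrite dramp_le0.
rewrite /dramp /flat t0 expr0 expr1 mul1r mulrA -[X in X + _]mul1r -mulrDl.
by rewrite mulNr expRN ler_pdivrMr ?expR_gt0// mul1r expR_ge1Dx.
Qed.

Lemma smooth_on_ramp m (U : set 'rV[R]_m) f b : 0 < b -> open U ->
  smooth U f -> smooth U (fun y => ramp b (f y)).
Proof.
move=> b0 oU sf; apply: smooth_onM; [exact: oU|exact: sf|].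
exact: smooth_on_flat.
Qed.

End FlatFunction.

(** * Matrix-valued functions *)

Section PositiveDefinite.
Context {R : realType}.

Definition qform m (A : 'M[R]_m) (v : 'rV[R]_m) : R := (v *m A *m v^T) 0 0.

Definition posdef m (A : 'M[R]_m) := forall v, v != 0 -> 0 < qform A v.

Lemma qformE m (A : 'M[R]_m) v : qform A v = \sum_i \sum_j v 0 i * A i j * v 0 j.
Proof.
rewrite /qform mxE exchange_big; apply: eq_bigr => j _; rewrite !mxE mulr_suml.
by apply: eq_bigr => i _.
Qed.

Lemma posdef_ge0 m (A : 'M[R]_m) v : posdef A -> 0 <= qform A v.
Proof.
move=> pA; have [->|v0] := eqVneq v 0; last by rewrite ltW// pA.
by rewrite /qform !mul0mx mxE.
Qed.

Lemma posdef_unit m (A : 'M[R]_m) : posdef A -> A \in unitmx.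
Proof.
move=> pA; rewrite -row_free_unit; apply/row_freeP.
have [//|] := EM (exists B, A *m B = 1%:M).
move=> nB; have : ~~ row_free A by apply/negP => /row_freeP.
rewrite -kermx_eq0 => /rowV0Pn[v vA v0].
by have := pA v v0; rewrite /qform (sub_kermxP vA) mul0mx mxE ltxx.
Qed.

(** Induction on the size: splitting off the first coordinate leaves the Schur complement D - a^-1
    b^T b, which is again symmetric and positive definite. *)
Lemma cholesky m (A : 'M[R]_m) : A^T = A -> posdef A ->
  exists2 E : 'M[R]_m, E \in unitmx & A = E *m E^T.
Proof.
move=> sA pA; suff [E AE] : exists E : 'M[R]_m, A = E *m E^T.
  exists E => //; have := posdef_unit pA.
  by rewrite {1}AE unitmx_mul => /andP[].
elim: m A sA pA => [|m IH] A sA pA; first by exists A; apply/matrixP => -[].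
rewrite -[m.+1]/(1 + m)%N in A sA pA *.
pose a := A 0 0; pose b : 'rV[R]_m := ursubmx A; pose D : 'M[R]_m := drsubmx A.
have a0 : 0 < a.
  have : (delta_mx 0 0 : 'rV[R]_(1 + m)) != 0.
    by apply/eqP => /matrixP/(_ 0 0)/eqP; rewrite !mxE/= oner_eq0.
  move=> /pA; rewrite /qform -rowE mxE (bigD1 0)//= big1 ?addr0.
    by rewrite !mxE eqxx mulr1.
  by move=> i /negbTE i0; rewrite !mxE i0 mulr0.
have ulA : ulsubmx A = a%:M.
  apply/matrixP => i j; rewrite !mxE !ord1/= mulr1n; congr (A _ _); exact/val_inj.
have dlA : dlsubmx A = b^T by rewrite /b trmx_ursub sA.
have AE : A = block_mx a%:M b b^T D by rewrite -ulA -dlA submxK.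
have sD : D^T = D by rewrite /D trmx_drsub sA.
pose S := D - a^-1 *: (b^T *m b).
have sS : S^T = S by rewrite /S linearB/= linearZ/= trmx_mul trmxK sD.
have pS : posdef S.
  (* The first coordinate is chosen to cancel the cross terms, so that the form of [A] at [v] is the
     form of [S] at [w]. *)
  move=> w w0; pose v : 'rV[R]_(1 + m) := row_mx (- a^-1 *: (w *m b^T)) w.
  have v0 : v != 0.
    by apply: contra w0 => /eqP vE; rewrite -(row_mxKr (- a^-1 *: (w *m b^T)) w) -/v vE linear0.
  have -> : qform S w = qform A v; last exact: pA.
  rewrite /qform AE /v mul_row_block tr_row_mx mul_row_col.
  rewrite mul_mx_scalar scalerA mulrN divff ?gt_eqF// scaleN1r addrC addNr.
  rewrite mul0mx addr0; congr ((_ *m _) 0 0).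
  by rewrite /S mulmxBr -scalemxAr mulmxA -scalemxAl scaleNr addrC.
have [F SF] := IH S sS pS.
pose r := Num.sqrt a; have r0 : r != 0 by rewrite gt_eqF// sqrtr_gt0.
have rr : r * r = a by rewrite -expr2 sqr_sqrtr// ltW.
exists (block_mx r%:M 0 (r^-1 *: b^T) F).
rewrite tr_block_mx mulmx_block AE !trmx0 tr_scalar_mx linearZ/= trmxK.
rewrite !mulmx0 !mul0mx !addr0 -scalar_mxM rr; congr (block_mx _ _ _ _).
- by rewrite mul_scalar_mx scalerA mulfV// scale1r.
- by rewrite mul_mx_scalar scalerA mulfV// scale1r.
- by rewrite -scalemxAl -scalemxAr scalerA -invfM rr -SF /S addrC subrK.
Qed.

Lemma posdef_det m (A : 'M[R]_m) : A^T = A -> posdef A -> 0 < \det A.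
Proof.
move=> sA pA; have [E uE ->] := cholesky sA pA.
rewrite det_mulmx det_tr -expr2 lt_neqAle sqr_ge0 andbT eq_sym sqrf_eq0.
by rewrite -unitfE -unitmxE.
Qed.

Lemma posdef_inv m (A : 'M[R]_m) : A^T = A -> posdef A ->
  (invmx A)^T = invmx A /\ posdef (invmx A).
Proof.
move=> sA pA; have uA := posdef_unit pA.
have sI : (invmx A)^T = invmx A by rewrite trmx_inv sA.
split => // v v0; have := pA (v *m invmx A); rewrite /qform trmx_mul sI.
rewrite mulmxKV// mulmxA; apply.
by apply: contra v0 => /eqP vA; rewrite -[v](mulmxKV uA) vA mul0mx.
Qed.

End PositiveDefinite.

(** * Derivatives of determinants and matrix-valued functions *)

Section DetDerive.
Context {R : realType}.

Lemma is_derive_bigprod (V : normedModType R) (I : eqType) (r : seq I)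
    (f : I -> V -> R) (f' : I -> R) (y v : V) : uniq r ->
  (forall i, is_derive y v (f i) (f' i)) ->
  is_derive y v (fun y => \prod_(i <- r) f i y)
    (\sum_(k <- r) f' k * \prod_(i <- r | i != k) f i y).
Proof.
move=> + df; elim: r => [_|i r IH /= /andP[ir ur]].
  rewrite big_nil (_ : (fun y => _) = cst 1); first exact: is_derive_cst.
  by apply/funext => z; rewrite big_nil.
rewrite (_ : (fun y => _) = (fun y => f i y * \prod_(i <- r) f i y)); last first.
  by apply/funext => z; rewrite big_cons.
have := @is_deriveM R V (f i) (fun y => \prod_(i <- r) f i y) y v _ _ (df i) (IH ur).
move=> H; apply: is_derive_eq H _; rewrite /GRing.scale/= big_cons addrC; congr (_ + _).
  rewrite big_cons eqxx/= mulrC; congr (_ * _); rewrite big_seq [RHS]big_seq_cond.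
  apply: eq_bigl => j; case jr : (j \in r) => //=.
  by apply/esym; apply: contraNneq ir => <-.
rewrite mulr_sumr [LHS]big_seq [RHS]big_seq; apply: eq_bigr => k kr.
have ik : i != k by apply: contraNneq ir => ->.
by rewrite big_cons ik mulrCA.
Qed.

Lemma is_derive_bigsum (V : normedModType R) (I : Type) (r : seq I)
    (f : I -> V -> R) (f' : I -> R) (y v : V) :
  (forall i, is_derive y v (f i) (f' i)) ->
  is_derive y v (fun y => \sum_(i <- r) f i y) (\sum_(i <- r) f' i).
Proof.
move=> df; elim: r => [|i r IH].
  rewrite big_nil (_ : (fun y => _) = cst 0); first exact: is_derive_cst.
  by apply/funext => z; rewrite big_nil.
rewrite (_ : (fun y => _) = (fun y => f i y + \sum_(i <- r) f i y)); last first.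
  by apply/funext => z; rewrite big_cons.
by rewrite big_cons; exact: is_deriveD.
Qed.

(** Jacobi's formula. In the Leibniz expansion the product rule replaces one row of [A y] at a time
    by the corresponding row of [B]; expanding along that row produces the adjugate. *)
Lemma is_derive_det m (V : normedModType R) (A : V -> 'M[R]_m) (B : 'M[R]_m) y v :
  (forall i j, is_derive y v (fun y => A y i j) (B i j)) ->
  is_derive y v (fun y => \det (A y)) (\tr (\adj (A y) *m B)).
Proof.
move=> dA.
have H : is_derive y v (fun y => \det (A y))
  (\sum_(s : 'S_m) (-1) ^+ s * \sum_k B k (s k) * \prod_(i | i != k) A y i (s i)).
  apply: is_derive_bigsum => s.
  have := @is_deriveZ R V R^o _ ((-1) ^+ s) y v _ (@is_derive_bigprod V _ (index_enum 'I_m)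
    (fun i y => A y i (s i)) (fun i => B i (s i)) y v (index_enum_uniq _) (fun i => dA i (s i))).
  exact.
apply: is_derive_eq H _.
rewrite (eq_bigr (fun s : 'S_m => \sum_k (-1) ^+ s * (B k (s k) *
  \prod_(i | i != k) A y i (s i)))); last by move=> s _; rewrite mulr_sumr.
rewrite exchange_big/= mxtrace_mulC /mxtrace; apply: eq_bigr => k _.
pose Ak := \matrix_(i, j) (if i == k then B i j else A y i j).
transitivity (\det Ak).
  apply: eq_bigr => s _; congr (_ * _); rewrite [RHS](bigD1 k)//= mxE eqxx; congr (_ * _).
  by apply: eq_bigr => i /negbTE ik; rewrite mxE ik.
rewrite (expand_det_row _ k) [RHS]mxE; apply: eq_bigr => j _; rewrite mxE eqxx.
congr (_ * _); rewrite mxE /cofactor; congr (_ * \det _).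
by apply/matrixP => i l; rewrite !mxE eq_sym (negbTE (neq_lift _ _)).
Qed.

Lemma smooth_det m k (U : set 'rV[R]_k) (A : 'rV[R]_k -> 'M[R]_m) : open U ->
  (forall i j, smooth U (fun y => A y i j)) -> smooth U (fun y => \det (A y)).
Proof.
move=> oU sA; apply: smooth_on_sum => // s; apply: smooth_onM => //.
  exact: smooth_on_cst.
by apply: smooth_on_prod => // i; exact: sA.
Qed.

Lemma smooth_invmx m k (U : set 'rV[R]_k) (A : 'rV[R]_k -> 'M[R]_m) i j : open U ->
  (forall i j, smooth U (fun y => A y i j)) -> (forall y, U y -> A y \in unitmx) ->
  smooth U (fun y => invmx (A y) i j).
Proof.
move=> oU sA uA.
apply: (@smooth_on_eq _ _ _ (fun y => (\det (A y))^-1 *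
   ((-1) ^+ (j + i) * \det (row' j (col' i (A y)))))) => //.
  by move=> y Uy; rewrite /invmx uA// !mxE.
apply: smooth_onM => //.
  apply: smooth_onV => //; first exact: smooth_det.
  by move=> y Uy; rewrite -unitfE -unitmxE; exact: uA.
apply: smooth_onM => //; first exact: smooth_on_cst.
apply: smooth_det => // a b.
apply: (@smooth_on_eq _ _ _ (fun y => A y (lift j a) (lift i b))) => //.
by move=> y _; rewrite !mxE.
Qed.

Fact pmx_key k m1 m2 :
  {f : 'I_k -> ('rV[R]_k -> 'M[R]_(m1, m2)) -> 'rV[R]_k -> 'M[R]_(m1, m2) |
     forall a A y, f a A y = \matrix_(i, j) partial a (fun z => A z i j) y}.
Proof. by eexists. Qed.

(* The body is sealed, for unification never to unfold it. *)
Definition pmx k m1 m2 (a : 'I_k) (A : 'rV[R]_k -> 'M[R]_(m1, m2)) y : 'M[R]_(m1, m2) :=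
  sval (pmx_key k m1 m2) a A y.

Lemma pmxE k m1 m2 (a : 'I_k) (A : 'rV[R]_k -> 'M[R]_(m1, m2)) y i j :
  pmx a A y i j = partial a (fun z => A z i j) y.
Proof. by rewrite /pmx (svalP (pmx_key k m1 m2)) mxE. Qed.

Definition msmooth k m1 m2 (U : set 'rV[R]_k) (A : 'rV[R]_k -> 'M[R]_(m1, m2)) :=
  forall i j, smooth U (fun y => A y i j).

Lemma msmooth_pmx k m1 m2 (U : set 'rV[R]_k) a (A : 'rV[R]_k -> 'M[R]_(m1, m2)) :
  open U -> msmooth U A -> msmooth U (pmx a A).
Proof.
move=> oU sA i j; apply: (@smooth_on_eq _ _ _ (partial a (fun y => A y i j))) => //.
  by move=> y _; rewrite pmxE.
exact: smooth_on_partial.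
Qed.

Lemma msmoothM k m1 m2 m3 (U : set 'rV[R]_k) (A : 'rV[R]_k -> 'M[R]_(m1, m2))
    (B : 'rV[R]_k -> 'M[R]_(m2, m3)) :
  open U -> msmooth U A -> msmooth U B -> msmooth U (fun y => A y *m B y).
Proof.
move=> oU sA sB i j.
apply: (@smooth_on_eq _ _ _ (fun y => \sum_l A y i l * B y l j)) => //.
  by move=> y _; rewrite mxE.
by apply: smooth_on_sum => // l; apply: smooth_onM.
Qed.

Lemma msmooth_tr k m1 m2 (U : set 'rV[R]_k) (A : 'rV[R]_k -> 'M[R]_(m1, m2)) :
  open U -> msmooth U A -> msmooth U (fun y => (A y)^T).
Proof.
move=> oU sA i j; apply: (@smooth_on_eq _ _ _ (fun y => A y j i)) => //.
by move=> y _; rewrite mxE.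
Qed.

Lemma msmooth_cst k m1 m2 (U : set 'rV[R]_k) (A : 'M[R]_(m1, m2)) :
  open U -> msmooth U (fun=> A).
Proof. by move=> oU i j; exact: smooth_on_cst. Qed.

Lemma pmxM k m1 m2 m3 (U : set 'rV[R]_k) a (A : 'rV[R]_k -> 'M[R]_(m1, m2))
    (B : 'rV[R]_k -> 'M[R]_(m2, m3)) y :
  msmooth U A -> msmooth U B -> U y ->
  pmx a (fun y => A y *m B y) y = pmx a A y *m B y + A y *m pmx a B y.
Proof.
move=> sA sB Uy; apply/matrixP => i j; rewrite !(pmxE, mxE) -big_split/=.
apply: partial_is_derive.
rewrite (_ : (fun z => _) = (fun z => \sum_l A z i l * B z l j)); last first.
  by apply/funext => z; rewrite mxE.
apply: is_derive_bigsum => l.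
have := @is_deriveM R _ _ _ y (delta_mx 0 a) _ _ (smooth_is_derive a (sA i l) Uy)
  (smooth_is_derive a (sB l j) Uy).
move=> H; apply: is_derive_eq H _; rewrite !(pmxE, mxE) /GRing.scale/= [RHS]addrC.
by congr (_ + _); rewrite mulrC.
Qed.

Lemma pmxD k m1 m2 (U : set 'rV[R]_k) a (A B : 'rV[R]_k -> 'M[R]_(m1, m2)) y :
  msmooth U A -> msmooth U B -> U y ->
  pmx a (fun y => A y + B y) y = pmx a A y + pmx a B y.
Proof.
move=> sA sB Uy; apply/matrixP => i j; rewrite !(pmxE, mxE); apply: partial_is_derive.
rewrite (_ : (fun z => _) = (fun z => A z i j + B z i j)); last first.
  by apply/funext => z; rewrite mxE.
exact: is_deriveD (smooth_is_derive a (sA i j) Uy) (smooth_is_derive a (sB i j) Uy).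
Qed.

Lemma pmx_tr k m1 m2 a (A : 'rV[R]_k -> 'M[R]_(m1, m2)) y :
  pmx a (fun y => (A y)^T) y = (pmx a A y)^T.
Proof.
apply/matrixP => i j; rewrite !(pmxE, mxE); congr (partial a _ _).
by apply/funext => z; rewrite mxE.
Qed.

Lemma pmx_eq k m1 m2 (U : set 'rV[R]_k) a (A B : 'rV[R]_k -> 'M[R]_(m1, m2)) y :
  open U -> (forall y, U y -> A y = B y) -> U y -> pmx a A y = pmx a B y.
Proof.
move=> oU AB Uy; apply/matrixP => i j; rewrite !(pmxE, mxE).
by apply: (partial_eq_on a oU _ Uy) => z Uz; rewrite AB.
Qed.

Lemma pmx_cst k m1 m2 a (A : 'M[R]_(m1, m2)) (y : 'rV[R]_k) : pmx a (fun=> A) y = 0.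
Proof. by apply/matrixP => i j; rewrite !(pmxE, mxE) partialE derive_cst. Qed.

Lemma pmx_inv k m (U : set 'rV[R]_k) a (A : 'rV[R]_k -> 'M[R]_m) y :
  open U -> msmooth U A -> (forall y, U y -> A y \in unitmx) -> U y ->
  pmx a (fun y => invmx (A y)) y = - (invmx (A y) *m pmx a A y *m invmx (A y)).
Proof.
move=> oU sA uA Uy.
have sI : msmooth U (fun y => invmx (A y)) by move=> i j; exact: smooth_invmx.
have := pmxM a sA sI Uy; rewrite (pmx_eq (B := fun=> 1%:M) a oU _ Uy); last first.
  by move=> z Uz; rewrite mulmxV// uA.
rewrite pmx_cst => /esym/eqP; rewrite addrC addr_eq0 => /eqP H.
have uAy := uA y Uy.
by rewrite -[LHS](mulKmx uAy) H mulmxN mulmxA.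
Qed.

End DetDerive.

(** * Smooth functions on a manifold *)

Lemma open_preimage_on (T S : topologicalType) (U : set T) (F : T -> S) (W : set S) :
  open U -> (forall y, U y -> {for y, continuous F}) -> open W ->
  open (U `&` F @^-1` W).
Proof.
move=> oU cF oW; rewrite openE => y [Uy Wy]; apply: filterI.
  exact: open_nbhs_nbhs.
by apply: (cF y Uy); exact: open_nbhs_nbhs.
Qed.

Section ManifoldTopology.
Context {R : realType} {n : nat} (M : complexManifold R n).
Local Notation V := 'rV[R]_(n + n).
Implicit Types (f h : M -> R) (i j : chart_index M).

Lemma codom_chart i x : dom i x -> chart_codom i (chart i x).
Proof. by move=> dx; exists x. Qed.

Lemma dom_chart_inv i y : chart_codom i y -> dom i (chart_inv i y).
Proof. by move=> [x dx <-]; rewrite chartK. Qed.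

Lemma chart_invK i y : chart_codom i y -> chart i (chart_inv i y) = y.
Proof. by move=> [x dx <-]; rewrite chartK. Qed.

Lemma open_chart_codom i : open (chart_codom i).
Proof. exact: open_codom. Qed.

Definition overlap i j : set V := chart i @` (dom i `&` dom j).

Lemma overlapE i j : overlap i j = chart_codom i `&` chart_inv i @^-1` dom j.
Proof.
apply/seteqP; split=> y.
  by move=> [x [dx dy] <-]; split; [exact: codom_chart|rewrite /= chartK].
move=> [cy dy]; exists (chart_inv i y); last exact: chart_invK.
by split => //; exact: dom_chart_inv.
Qed.

Lemma open_overlap i j : open (overlap i j).
Proof.
rewrite overlapE; apply: open_preimage_on; [exact: open_chart_codom| |exact: open_dom].
by move=> y cy; exact: chart_inv_continuous.
Qed.

Definition transition i j : V -> V := chart j \o chart_inv i.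

Lemma transition_smooth' i j a : smooth (overlap i j) (fun y => transition i j y 0 a).
Proof. by split; exact: transition_smooth. Qed.

Lemma transition_overlap i j y : overlap i j y -> overlap j i (transition i j y).
Proof.
by move=> [x [dx dy] <-]; exists x => //; rewrite /transition/= chartK.
Qed.

Lemma chart_inv_transition i j y : overlap i j y ->
  chart_inv j (transition i j y) = chart_inv i y.
Proof. by move=> [x [dx dy] <-]; rewrite /transition/= !chartK. Qed.

Record sfun f : Prop := Sfun {
  sfunP : forall i, smooth (chart_codom i) (fun y => f (chart_inv i y)) }.

Lemma sfun_smooth_fun f : sfun f <-> smooth_fun f.
Proof.
split=> [[sf] i|sf]; first by have [] := sf i.
by split=> i; split; exact: sf.
Qed.

(** One chart around each point is enough, since any other chart reads [f] through a smooth
    transition map. *)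
Lemma sfun_local f : (forall x, exists i, dom i x /\ exists W : set V,
    [/\ open W, W (chart i x) & smooth W (fun y => f (chart_inv i y))]) -> sfun f.
Proof.
move=> H; split=> j; apply: smooth_on_local => y cy.
have dy := dom_chart_inv cy.
have [i [di [W [oW Wx sW]]]] := H (chart_inv j y).
pose V' := overlap j i `&` transition j i @^-1` W.
have ctr z : overlap j i z -> {for z, continuous (transition j i)}.
  by move=> oz; apply: rV_continuous => a; exact: smooth_on_continuous (transition_smooth' j i a) oz.
have oV : open V' by apply: open_preimage_on => //; exact: open_overlap.
exists V'.
  by split; [rewrite overlapE|].
apply: (@smooth_on_eq _ _ _ (fun z => f (chart_inv i (transition j i z)))) => //.
  by move=> z [oz _]; rewrite chart_inv_transition.
apply: (smooth_on_comp oV oW _ _ sW); last by move=> z [].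
move=> b; apply: smooth_on_sub (transition_smooth' j i b); exact: subIsetl.
Qed.

Lemma sfun_continuous f : sfun f -> continuous f.
Proof.
move=> [sf] x; set i := chart_at x; have dx : dom i x := dom_chart_at x.
apply: (@near_eq_continuous _ _ ((fun y => f (chart_inv i y)) \o chart i)).
  near=> z; rewrite /= chartK//; near: z.
  by apply: open_nbhs_nbhs; split => //; exact: open_dom.
apply: continuous_comp; first exact: chart_continuous.
exact: smooth_on_continuous (sf i) (codom_chart dx).
Unshelve. all: by end_near. Qed.

Lemma sfun_cst (c : R) : sfun (fun=> c).
Proof. by split=> i; apply: smooth_on_cst; exact: open_chart_codom. Qed.

Lemma sfunD f h : sfun f -> sfun h -> sfun (fun x => f x + h x).
Proof. by move=> [sf] [sh]; split=> i; apply: smooth_onD; [exact: open_chart_codom|exact: sf|exact: sh]. Qed.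

Lemma sfunM f h : sfun f -> sfun h -> sfun (fun x => f x * h x).
Proof. by move=> [sf] [sh]; split=> i; apply: smooth_onM; [exact: open_chart_codom|exact: sf|exact: sh]. Qed.

Lemma sfunN f : sfun f -> sfun (fun x => - f x).
Proof. by move=> [sf]; split=> i; apply: smooth_onN; [exact: open_chart_codom|exact: sf]. Qed.

Lemma sfunB f h : sfun f -> sfun h -> sfun (fun x => f x - h x).
Proof. by move=> sf sh; apply: sfunD sf _; exact: sfunN. Qed.

Lemma sfun_exp f : sfun f -> sfun (fun x => expR (f x)).
Proof. by move=> [sf]; split=> i; apply: smooth_on_exp; [exact: open_chart_codom|exact: sf]. Qed.

Lemma sfun_ln f : sfun f -> (forall x, 0 < f x) -> sfun (fun x => ln (f x)).
Proof. by move=> [sf] f0; split=> i; apply: smooth_on_ln; [exact: open_chart_codom|exact: sf|]. Qed.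

Lemma sfun_sqrt f : sfun f -> (forall x, 0 < f x) -> sfun (fun x => Num.sqrt (f x)).
Proof. by move=> [sf] f0; split=> i; apply: smooth_on_sqrt; [exact: open_chart_codom|exact: sf|]. Qed.

Lemma sfun_ramp b f : 0 < b -> sfun f -> sfun (fun x => ramp b (f x)).
Proof. by move=> b0 [sf]; split=> i; apply: smooth_on_ramp => //; exact: open_chart_codom. Qed.

(** Containment in some compact set is stable under products and sums without computing closures; on
    a Hausdorff space it amounts to [compactly_supported]. *)
Definition csupp f := exists2 K : set M, compact K & forall x, f x != 0 -> K x.

Lemma csuppP f : csupp f <-> compactly_supported f.
Proof.
split=> [[K cK fK]|cf].
  apply: (subclosed_compact _ cK); first exact: closed_closure.
  rewrite closureE; apply: smallest_sub => [|x]; last exact: fK.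
  exact: compact_closed (@manifold_hausdorff _ _ M) cK.
by exists (closure [set x | f x != 0]) => // x fx; exact: subset_closure.
Qed.

Lemma csupp_sub f h : (forall x, h x != 0 -> f x != 0) -> csupp f -> csupp h.
Proof. by move=> hf [K cK fK]; exists K => // x /hf /fK. Qed.

Lemma csuppMl f h : csupp f -> csupp (fun x => f x * h x).
Proof. by apply: csupp_sub => x; rewrite mulf_eq0 negb_or => /andP[]. Qed.

Lemma csuppMr f h : csupp h -> csupp (fun x => f x * h x).
Proof. by apply: csupp_sub => x; rewrite mulf_eq0 negb_or => /andP[]. Qed.

Definition extend_chart i (F : V -> R) : M -> R :=
  fun x => if `[< dom i x >] then F (chart i x) else 0.

Lemma extend_chartE i F y : chart_codom i y -> extend_chart i F (chart_inv i y) = F y.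
Proof.
by move=> cy; rewrite /extend_chart asboolT ?chart_invK//; exact: dom_chart_inv.
Qed.

Lemma compact_chart_inv i (K : set V) : compact K -> K `<=` chart_codom i ->
  compact (chart_inv i @` K).
Proof.
move=> cK Ki; apply: continuous_compact => //.
apply: continuous_in_subspaceT => y; rewrite inE => /Ki cy.
exact: chart_inv_continuous.
Qed.

(** The image of [K] in the manifold is compact, hence closed by the Hausdorff property; a point
    outside the chart domain thus has a neighbourhood on which the extension is zero. *)
Lemma extend_chart_smooth i F (K : set V) :
  compact K -> K `<=` chart_codom i -> (forall y, chart_codom i y -> F y != 0 -> K y) ->
  smooth (chart_codom i) F ->
  sfun (extend_chart i F) /\ forall x, extend_chart i F x != 0 -> (chart_inv i @` K) x.
Proof.
move=> cK Ki FK sF.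
have supp x : extend_chart i F x != 0 -> (chart_inv i @` K) x.
  rewrite /extend_chart; case: asboolP => [dx Fx|]; last by rewrite eqxx.
  by exists (chart i x); [apply: FK => //; exact: codom_chart|rewrite chartK].
split => //; apply: sfun_local => x; have [dx|ndx] := EM (dom i x).
  exists i; split => //; exists (chart_codom i).
  split; [exact: open_chart_codom|exact: codom_chart|].
  apply: (@smooth_on_eq _ _ _ F) => //; first exact: open_chart_codom.
  by move=> y cy; rewrite extend_chartE.
have cl : closed (chart_inv i @` K).
  apply: compact_closed; first exact: manifold_hausdorff.
  exact: compact_chart_inv.
have nx : ~ (chart_inv i @` K) x.
  by move=> [y Ky yx]; apply: ndx; rewrite -yx; apply: dom_chart_inv; exact: Ki.
set j := chart_at x; exists j; split; first exact: dom_chart_at.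
have dx : dom j x by exact: dom_chart_at.
exists (chart_codom j `&` chart_inv j @^-1` (~` (chart_inv i @` K))).
have oW : open (chart_codom j `&` chart_inv j @^-1` (~` (chart_inv i @` K))).
  apply: open_preimage_on; [exact: open_chart_codom| |exact: closed_openC].
  by move=> y cy; exact: chart_inv_continuous.
split => //; first by split; [exact: codom_chart|rewrite /= chartK].
apply: (@smooth_on_eq _ _ _ (fun=> 0)) => //; last exact: smooth_on_cst.
move=> y [_ /= ny]; apply/esym/eqP; apply: contrapT => /negP H; apply: ny; exact: supp.
Qed.

End ManifoldTopology.

Arguments open_chart_codom {R n M} i.
Arguments open_overlap {R n M} i j.

(** * Iterated integrals *)

Lemma open_borel (T : ptopologicalType) (A : set T) : open A ->
  measurable (A : set (borel T)).
Proof. by move=> oA; exact: sub_sigma_algebra. Qed.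

(** Meant for functions continuous on the image of a chart and extended by zero, which may jump at
    its boundary. Preimages of rays are open, up to the complement of [U] when the ray contains
    0. *)
Lemma measurable_fun_on_open (R : realType) (T : ptopologicalType) (U : set T) (f : T -> R) :
  open U -> (forall x, U x -> {for x, continuous f}) -> (forall x, ~ U x -> f x = 0) ->
  measurable_fun [set: borel T] (f : borel T -> R).
Proof.
move=> oU cf f0; apply: (measurability _ (RGenOInfty.measurableE R)).
move=> _ [_ [x ->] <-]; rewrite setTI.
pose W := U `&` f @^-1` `]x, +oo[%classic.
have oW : open W by apply: open_preimage_on => //; exact: interval_open.
have [x0|x0] := leP 0 x.
  rewrite (_ : _ @^-1` _ = W); first exact: open_borel.
  apply/seteqP; split=> y; last by case.
  move=> fy; split => //; have [//|/f0 fy0] := EM (U y).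
  by move: fy; rewrite /= in_itv/= andbT fy0 ltNge x0.
rewrite (_ : _ @^-1` _ = W `|` ~` U).
  apply: measurableU; first exact: open_borel.
  by apply: measurableC; exact: open_borel.
apply/seteqP; split=> y; last first.
  by move=> [[]//|/f0 fy]; rewrite /= in_itv/= andbT fy.
by move=> fy; have [Uy|nU] := EM (U y); [left|right].
Qed.

Lemma continuous_borel (R : realType) (T : ptopologicalType) (f : T -> R) :
  continuous f -> measurable_fun [set: borel T] (f : borel T -> R).
Proof.
move=> cf; apply: (@measurable_fun_on_open R T setT) => [|x _|x]; [exact: openT|exact: cf|].
by move=> /(_ I).
Qed.

(* No measurability is needed: the integral of a nonnegative function is a
   supremum over the simple functions below it. *)
Lemma integral_mono d (T : measurableType d) (R : realType)
    (mu : {measure set T -> \bar R}) (f g : T -> \bar R) :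
  (forall x, (0 <= f x)%E) -> (forall x, (f x <= g x)%E) ->
  (\int[mu]_x f x <= \int[mu]_x g x)%E.
Proof.
move=> f0 fg; rewrite ge0_integralE//; rewrite ge0_integralE//; last first.
  by move=> x _; exact: le_trans (fg x).
apply: le_ereal_sup => _ [h /= hf <-]; exists h => //= x.
by have := hf x; rewrite !patch_setT => /le_trans; apply.
Qed.

Section TranslationInvariance.
Context {R : realType}.
Local Notation mu := (@lebesgue_measure R).

(** The image of Lebesgue measure under the translation has the same value on intervals, hence
    equals Lebesgue measure. *)
Lemma lebesgue_integral_shift (f : R -> \bar R) (c : R) :
  measurable_fun [set: measurableTypeR R] f -> (forall x, (0 <= f x)%E) ->
  (\int[mu]_x f (x + c)%R = \int[mu]_x f x)%E.
Proof.
move=> mf f0.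
have mc : measurable_fun [set: measurableTypeR R] (fun x : measurableTypeR R => x + c : measurableTypeR R).
  by apply: measurable_funD.
have := @ge0_integral_pushforward _ _ _ _ _ _ mc mu setT f measurableT mf (fun y _ => f0 y).
rewrite preimage_setT => <-.
apply: eq_measure_integral => A mA _; apply/esym.
apply: lebesgue_measure_unique => //= _ [[a b]] _ <-.
rewrite /pushforward (_ : _ @^-1` _ = `]a - c, b - c]%classic); last first.
  by apply/seteqP; split => x /=; rewrite !in_itv/= ltrBlDr lerBrDr.
rewrite !lebesgue_measure_itv/= !lte_fin ltrD2r -!EFinD.
by case: ifP => // _; congr EFin; ring.
Qed.

End TranslationInvariance.

Section IteratedIntegral.
Context {R : realType}.
Local Notation mu := (@lebesgue_measure R).
Local Notation LI := (@lebesgue_int R _).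

Definition bmeas m (f : 'rV[R]_m -> \bar R) :=
  measurable_fun [set: borel 'rV[R]_m] (f : borel 'rV[R]_m -> \bar R).

Lemma normrV_ltP m (v : 'rV[R]_m) (e : R) : 0 < e ->
  `|v| < e <-> forall a, `|v 0 a| < e.
Proof.
move=> e0; split=> [ve a|ve]; first exact: le_lt_trans (normrV_ge v a) ve.
rewrite [ltLHS]/Num.Def.normr/= mx_normrE; apply: bigmax_lt => // -[i a] _ /=.
by rewrite (ord1 i).
Qed.

Definition row_cons m (t : R) (y : 'rV[R]_m) : 'rV[R]_m.+1 :=
  row_mx (const_mx t : 'rV_1) y.

Lemma row_cons0 m (t : R) (y : 'rV[R]_m) : row_cons t y 0 ord0 = t.
Proof.
have := row_mxEl (const_mx t : 'rV_1) y 0 0; rewrite [RHS]mxE => E.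
by rewrite -[RHS]E; congr (row_mx _ _ _ _); exact/val_inj.
Qed.

Lemma row_consS m (t : R) (y : 'rV[R]_m) a : row_cons t y 0 (lift ord0 a) = y 0 a.
Proof.
have := row_mxEr (const_mx t : 'rV_1) y 0 a => E.
by rewrite -[RHS]E; congr (row_mx _ _ _ _); exact/val_inj.
Qed.

Lemma row_consE m (v : 'rV[R]_m.+1) :
  v = row_cons (v 0 ord0) (\row_a v 0 (lift ord0 a)).
Proof.
apply/rowP => a; case: (unliftP ord0 a) => [b ->|->]; last by rewrite row_cons0.
by rewrite row_consS mxE.
Qed.

Lemma row_consD m (t t' : R) (y y' : 'rV[R]_m) :
  row_cons t y + row_cons t' y' = row_cons (t + t') (y + y').
Proof.
apply/rowP => a; rewrite mxE; case: (unliftP ord0 a) => [b ->|->].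
  by rewrite !row_consS mxE.
by rewrite !row_cons0.
Qed.

Lemma row_consN m (t : R) (y : 'rV[R]_m) : - row_cons t y = row_cons (- t) (- y).
Proof.
apply/rowP => a; rewrite mxE; case: (unliftP ord0 a) => [b ->|->].
  by rewrite !row_consS mxE.
by rewrite !row_cons0.
Qed.

Lemma normr_row_cons_lt m (t e : R) (y : 'rV[R]_m) : 0 < e ->
  `|row_cons t y| < e <-> `|t| < e /\ `|y| < e.
Proof.
move=> e0; split=> [/(normrV_ltP _ e0) H|[te ye]].
  split; first by have := H ord0; rewrite row_cons0.
  by apply/(normrV_ltP _ e0) => a; have := H (lift ord0 a); rewrite row_consS.
apply/(normrV_ltP _ e0) => a; case: (unliftP ord0 a) => [b ->|->].
  by rewrite row_consS; exact: le_lt_trans (normrV_ge y b) ye.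
by rewrite row_cons0.
Qed.

Lemma rat_near (x e : R) : 0 < e -> exists q : rat, `|x - ratr q| < e.
Proof.
move=> e0; have [|q] := @rat_in_itvoo R (x - e) (x + e); first by lra.
rewrite in_itv/= => /andP[q1 q2]; exists q; rewrite ltr_norml; apply/andP; split; lra.
Qed.

Lemma rat_vec_near m (x : 'rV[R]_m) (e : R) : 0 < e ->
  exists q : 'rV[rat]_m, ball x e (map_mx ratr q).
Proof.
move=> e0; have [q hq] := choice (fun a => rat_near (x 0 a) e0).
exists (\row_a q a); rewrite -ball_normE /ball_/=.
by apply/(normrV_ltP _ e0) => a; rewrite !mxE.
Qed.

(** Compares two sigma-algebras: iterated integration needs the product one, while measurability of
    functions on R^(m+1) is Borel. An open set is a countable union of boxes with rational centres,
    which are measurable rectangles. *)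
Lemma measurable_row_mx m :
  measurable_fun [set: measurableTypeR R * borel 'rV[R]_m]
   (fun p => (row_cons p.1 p.2 : borel 'rV[R]_m.+1)).
Proof.
apply: (@measurability _ _ (measurableTypeR R * borel 'rV[R]_m)%type
  (borel 'rV[R]_m.+1) setT _ (@open 'rV[R]_m.+1) erefl) => _ [V oV <-]; rewrite setTI.
pose r k : R := k.+1%:R^-1.
pose B (i : rat * 'rV[rat]_m * nat) : set (measurableTypeR R * borel 'rV[R]_m) :=
  ball (ratr i.1.1 : R) (r i.2) `*` ball (map_mx ratr i.1.2 : 'rV[R]_m) (r i.2).
pose ok i := forall p, B i p -> V (row_cons p.1 p.2).
have mB i : measurable (B i).
  apply: measurableX; first by apply: open_measurable; exact: ball_open.
  by apply: open_borel; exact: ball_open.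
rewrite (_ : _ @^-1` V = \bigcup_i (if `[< ok i >] then B i else set0)); last first.
  apply/seteqP; split; last first.
    by move=> p [i _]; case: asboolP => // oki Bp; exact: oki.
  move=> [t y] /= Vp.
  have [e /= e0 He] : nbhs_ball (row_cons t y) V.
    by apply/nbhs_ballP; exact: open_nbhs_nbhs.
  have [k ke] : exists k, r k < e / 2.
    exists (Num.truncn (e / 2)^-1); rewrite /r invf_plt ?posrE ?divr_gt0// ?truncnS_gt//.
  have rk0 : 0 < r k by rewrite invr_gt0.
  have [q hq] := rat_near t rk0; have [b hb] := rat_vec_near y rk0.
  exists (q, b, k) => //; case: asboolP; first by move=> _; split => //=; exact: ball_sym.
  apply: contra_notP => _ [t' y'] [/= Bt By]; apply: He.
  have tt' : `|t - t'| < e.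
    rewrite -(subrKA (ratr q)) (le_lt_trans (ler_normD _ _))//.
    by move: Bt; rewrite /ball/= => Bt; lra.
  have yy' : `|y - y'| < e.
    move: hb By; rewrite -!ball_normE /ball_/= => hb By.
    by rewrite -(subrKA (map_mx ratr b)) (le_lt_trans (ler_normD _ _))//; lra.
  by rewrite -ball_normE /ball_/= row_consN row_consD; apply/normr_row_cons_lt.
apply: countable_bigcupT_measurable; first exact: countableP.
by move=> i; case: ifP => _; [exact: mB|exact: measurable0].
Qed.

Lemma LI_ge0 m (f : 'rV[R]_m -> \bar R) : (forall y, (0 <= f y)%E) -> (0 <= LI f)%E.
Proof.
elim: m f => [|m IH] f f0 /=; first exact: f0.
by apply: integral_ge0 => t _; exact: IH.
Qed.

Lemma LI_mono m (f g : 'rV[R]_m -> \bar R) : (forall y, (0 <= f y)%E) ->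
  (forall y, (f y <= g y)%E) -> (LI f <= LI g)%E.
Proof.
elim: m f g => [|m IH] f g f0 fg /=; first exact: fg.
apply: integral_mono => t; first by apply: LI_ge0.
by apply: IH.
Qed.

(** The parameter space [T] is general so that the induction can move the first coordinate into it,
    where Tonelli's theorem integrates it out. *)
Lemma LI_measurable m : forall d (T : measurableType d) (f : T -> 'rV[R]_m -> \bar R),
  (forall t y, (0 <= f t y)%E) ->
  measurable_fun [set: T * borel 'rV[R]_m] (fun p => f p.1 p.2) ->
  measurable_fun [set: T] (fun t => LI (f t)).
Proof.
elim: m => [|m IH] d T f f0 mf /=.
  have m1 : measurable_fun setT (fun t : T => (t, 0 : borel 'rV[R]_0)).
    exact: measurable_fun_pair.
  exact: (measurableT_comp mf m1).
pose F (p : T * measurableTypeR R) :=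
  LI (fun y : 'rV[R]_m => f p.1 (row_cons p.2 y)).
have mF : measurable_fun setT F.
  apply: IH => //.
  have m1 : measurable_fun setT
      (fun p : (T * measurableTypeR R) * borel 'rV[R]_m => (p.1.2, p.2)).
    apply: measurable_fun_pair; last exact: measurable_snd.
    exact: (measurableT_comp measurable_snd measurable_fst).
  have m2 : measurable_fun setT (fun p : (T * measurableTypeR R) * borel 'rV[R]_m =>
      (p.1.1, row_cons p.1.2 p.2 : borel 'rV[R]_m.+1)).
    apply: measurable_fun_pair.
      exact: (measurableT_comp measurable_fst measurable_fst).
    exact: (measurableT_comp (@measurable_row_mx m) m1).
  exact: (measurableT_comp mf m2).
have F0 p : (0 <= F p)%E by apply: LI_ge0.
exact: (@measurable_fun_fubini_tonelli_F _ _ _ _ R mu F mF F0).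
Qed.

Lemma bmeas_section m (f : 'rV[R]_m.+1 -> \bar R) (t : R) : bmeas f ->
  bmeas (fun y => f (row_cons t y)).
Proof.
move=> mf.
have m1 : measurable_fun setT (fun y : borel 'rV[R]_m => (t : measurableTypeR R, y)).
  exact: measurable_fun_pair.
exact: (measurableT_comp mf (measurableT_comp (@measurable_row_mx m) m1)).
Qed.

Lemma LI_section m (f : 'rV[R]_m.+1 -> \bar R) : (forall y, (0 <= f y)%E) -> bmeas f ->
  measurable_fun [set: measurableTypeR R]
    (fun t : measurableTypeR R => LI (fun y : 'rV[R]_m => f (row_cons t y))).
Proof.
move=> f0 mf; apply: (LI_measurable (T := measurableTypeR R)) => //.
exact: (measurableT_comp mf (@measurable_row_mx m)).
Qed.

Lemma LI_add m (f g : 'rV[R]_m -> \bar R) :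
  (forall y, (0 <= f y)%E) -> (forall y, (0 <= g y)%E) -> bmeas f -> bmeas g ->
  (LI (fun y => f y + g y) = LI f + LI g)%E.
Proof.
elim: m f g => [//|m IH] f g f0 g0 mf mg /=.
rewrite -ge0_integralD//; last 4 first.
- by move=> t _; exact: LI_ge0.
- exact: LI_section.
- by move=> t _; exact: LI_ge0.
- exact: LI_section.
by apply: eq_integral => t _; apply: IH => //; exact: bmeas_section.
Qed.

Lemma LI_scale m (f : 'rV[R]_m -> \bar R) (k : R) : 0 <= k ->
  (forall y, (0 <= f y)%E) -> bmeas f ->
  (LI (fun y => k%:E * f y) = k%:E * LI f)%E.
Proof.
move=> k0; elim: m f => [//|m IH] f f0 mf /=.
rewrite -ge0_integralZl ?lee_fin//; last 2 first.
- exact: LI_section.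
- by move=> t _; exact: LI_ge0.
by apply: eq_integral => t _; apply: IH => //; exact: bmeas_section.
Qed.

Lemma LI_eq m (f g : 'rV[R]_m -> \bar R) : (forall y, f y = g y) -> LI f = LI g.
Proof. by move=> fg; congr LI; apply/funext. Qed.

Lemma LI_0 m : lebesgue_int (fun _ : 'rV[R]_m => 0%E) = 0%E.
Proof.
elim: m => [//|m IH] /=.
by under eq_integral do rewrite IH; rewrite integral0.
Qed.

Lemma LI_sum m (I : Type) (s : seq I) (f : I -> 'rV[R]_m -> \bar R) :
  (forall i y, (0 <= f i y)%E) -> (forall i, bmeas (f i)) ->
  (LI (fun y => \sum_(i <- s) f i y) = \sum_(i <- s) LI (f i))%E.
Proof.
move=> f0 mf; elim: s => [|i s IH].
  by rewrite big_nil -[RHS](LI_0 m); apply: LI_eq => y; rewrite big_nil.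
rewrite big_cons -IH -LI_add//; first by apply: LI_eq => y; rewrite big_cons.
  by move=> y; apply: sume_ge0.
exact: emeasurable_sum.
Qed.

Lemma LI_shift m (f : 'rV[R]_m -> \bar R) (v : 'rV[R]_m) :
  (forall y, (0 <= f y)%E) -> bmeas f -> LI (fun y => f (y + v)) = LI f.
Proof.
elim: m f v => [|m IH] f v f0 mf /=; first by congr f; apply/rowP => -[].
pose v0 : R := v 0 ord0; pose v' : 'rV[R]_m := \row_a v 0 (lift ord0 a).
have vE t (y : 'rV[R]_m) : row_cons t y + v = row_cons (t + v0) (y + v').
  by rewrite {1}[v]row_consE row_consD.
rewrite -[RHS](@lebesgue_integral_shift R _ v0); last 2 first.
- exact: LI_section.
- by move=> t; exact: LI_ge0.
apply: eq_integral => t _; rewrite -[RHS](IH _ v')//; last exact: bmeas_section.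
by apply: LI_eq => y; rewrite vE.
Qed.

(** The norm of row vectors is the sup norm, so the ball is a cube of side 2 r. *)
Lemma LI_box m (c : 'rV[R]_m) (r k : R) : 0 < r -> 0 <= k ->
  LI (fun y => (if `|y - c| < r then k else 0)%:E) = (k * (2 * r) ^+ m)%:E.
Proof.
move=> r0; elim: m c k => [|m IH] c k k0 /=.
  by rewrite (_ : 0 - c = 0) ?normr0 ?r0 ?expr0 ?mulr1//; apply/rowP => -[].
pose c0 : R := c 0 ord0; pose c' : 'rV[R]_m := \row_a c 0 (lift ord0 a).
have nE t (y : 'rV[R]_m) : (`|row_cons t y - c| < r) = (`|t - c0| < r) && (`|y - c'| < r).
  rewrite {1}[c]row_consE row_consN row_consD.
  by apply/idP/andP => [/(normr_row_cons_lt _ _ r0)|/(normr_row_cons_lt _ _ r0)].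
transitivity (\int[mu]_(t in setT) ((k * (2 * r) ^+ m)%R%:E * (\1_(ball c0 r) t)%:E))%E.
  apply: eq_integral => t _; have [tc|tc] := boolP (`|t - c0| < r).
    rewrite indicE mem_set ?mule1; last by rewrite /ball/= distrC.
    by rewrite -(IH c')//; apply: LI_eq => y; rewrite nE tc.
  rewrite indicE memNset ?mule0; last by rewrite /ball/= distrC; exact/negP.
  by rewrite -[RHS](LI_0 m); apply: LI_eq => y; rewrite nE (negbTE tc).
have mb : measurable (ball c0 r : set (measurableTypeR R)).
  by apply: open_measurable; exact: ball_open.
rewrite ge0_integralZl//; last 2 first.
- by apply/measurable_EFinP; exact: measurable_indic.
- by rewrite lee_fin mulr_ge0// exprn_ge0// mulr_ge0// ltW.
rewrite integral_indic// setIT.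
rewrite (_ : ball c0 r = `]c0 - r, c0 + r[%classic); last first.
  apply/seteqP; split=> t; rewrite /ball/= in_itv/= ltr_norml => /andP[? ?]; apply/andP; split; lra.
rewrite [X in (_ * X)%E](lebesgue_measure_itv `]c0 - r, c0 + r[)/=.
rewrite ifT; last by rewrite lte_fin; lra.
rewrite -EFinD -EFinM.
by rewrite exprSr mulrA; congr (_ * _)%:E; ring.
Qed.

End IteratedIntegral.

(** Compactness as an induction principle: a property inherited by subsets and unions of two sets
    holds for [K] as soon as it holds near each of its points. It serves in place of finite
    subcovers and partitions of unity below. *)
Lemma compact_ind (T : ptopologicalType) (K : set T) (P : set T -> Prop) :
  compact K -> P set0 -> (forall A B, P A -> P B -> P (A `|` B)) ->
  (forall A B, A `<=` B -> P B -> P A) ->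
  (forall x, K x -> exists2 N, nbhs x N & P N) -> P K.
Proof.
move=> cK P0 PU PS PN.
have [f hf] : exists f : T -> set T, forall x, K x -> open_nbhs x (f x) /\ P (f x).
  have H (x : T) : exists N, K x -> open_nbhs x N /\ P N.
    have [Kx|nK] := EM (K x); last by exists setT.
    have [N nN PN'] := PN x Kx; exists (interior N) => _; split.
      by split; [exact: open_interior|exact: nN].
    by apply: PS PN'; exact: interior_subset.
  by have [f hf] := choice H; exists f.
have : cover_compact K by rewrite -compact_cover.
case/(_ T K f) => [x /hf[[]]//|x Kx|D' D'K KD'].
  by exists x => //; have [[]] := hf x Kx.
apply: (PS _ _ KD').
have {}D'K x : x \in finmap.enum_fset D' -> K x by move=> /D'K; rewrite inE.
rewrite -[cover _ _]/(\bigcup_(i in [set i | i \in finmap.enum_fset D']) f i).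
elim: (finmap.enum_fset D') D'K => [|x s IH] sK.
  by apply: (PS _ _ _ P0) => y [z].
apply: (PS _ (f x `|` \bigcup_(i in [set i | i \in s]) f i)).
  move=> y [z /= zs fz]; move: zs fz; rewrite inE => /orP[/eqP -> ?|? ?]; first by left.
  by right; exists z.
apply: PU; first by have [_] := hf x (sK x (mem_head _ _)).
by apply: IH => z zs; apply: sK; rewrite inE zs orbT.
Qed.

(** * Signed integrals on R^m *)

Section SignedIteratedIntegral.
Context {R : realType}.
Local Notation LI := (@lebesgue_int R _).

Definition pos_part (T : Type) (f : T -> R) x : R := Num.max (f x) 0.
Definition neg_part (T : Type) (f : T -> R) x : R := Num.max (- f x) 0.

Lemma pos_part_ge0 (T : Type) (f : T -> R) x : 0 <= pos_part f x.
Proof. by rewrite /pos_part le_max lexx orbT. Qed.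

Lemma neg_part_ge0 (T : Type) (f : T -> R) x : 0 <= neg_part f x.
Proof. by rewrite /neg_part le_max lexx orbT. Qed.

Lemma pos_neg_part (T : Type) (f : T -> R) x : f x = pos_part f x - neg_part f x.
Proof.
rewrite /pos_part /neg_part; have [f0|f0] := leP 0 (f x).
  by rewrite max_r ?oppr_le0// subr0.
by rewrite max_l ?oppr_ge0 ?ltW// sub0r opprK.
Qed.

Lemma pos_part_le (T : Type) (f : T -> R) x : pos_part f x <= `|f x|.
Proof. by rewrite /pos_part ge_max ler_norm normr_ge0. Qed.

Lemma neg_part_le (T : Type) (f : T -> R) x : neg_part f x <= `|f x|.
Proof. by rewrite /neg_part ge_max -normrN ler_norm normr_ge0. Qed.

Lemma continuous_pos_part (T : topologicalType) (f : T -> R) :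
  continuous f -> continuous (pos_part f).
Proof.
move=> cf x; apply: (@continuous_comp _ _ _ f (fun t => Num.max t 0)); first exact: cf.
by apply: continuous_max; [exact: cvg_id|exact: cvg_cst].
Qed.

Lemma continuous_neg_part (T : topologicalType) (f : T -> R) :
  continuous f -> continuous (neg_part f).
Proof.
move=> cf; rewrite (_ : neg_part f = pos_part (fun x => - f x))//.
by apply: continuous_pos_part => x; apply: continuousN; exact: cf.
Qed.

Context (m : nat).
Implicit Types (f g : 'rV[R]_m -> R).

Lemma bmeas_continuous f : continuous f -> bmeas (fun y => (f y)%:E).
Proof. by move=> cf; apply/measurable_EFinP; exact: continuous_borel. Qed.

Definition bsupp (r : R) f := continuous f /\ forall y, r <= `|y| -> f y = 0.

Lemma bsupp_le r r' f : r <= r' -> bsupp r f -> bsupp r' f.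
Proof. by move=> rr' [cf f0]; split => // y ry; apply: f0; exact: le_trans ry. Qed.

Lemma bsuppD r f g : bsupp r f -> bsupp r g -> bsupp r (fun y => f y + g y).
Proof.
move=> [cf f0] [cg g0]; split; last by move=> y ry; rewrite f0// g0// addr0.
by move=> y; apply: continuousD; [exact: cf|exact: cg].
Qed.

Lemma bsuppZ r (k : R) f : bsupp r f -> bsupp r (fun y => k * f y).
Proof.
move=> [cf f0]; split; last by move=> y ry; rewrite f0// mulr0.
by move=> y; apply: continuousM; [exact: cst_continuous|exact: cf].
Qed.

Lemma bsupp_bound r f : bsupp r f -> exists2 C, 0 <= C & forall y, `|f y| <= C.
Proof.
move=> [cf f0]; pose K : set 'rV[R]_m := [set y | `|y| <= Num.max r 0].
have cK : compact K.
  apply: bounded_closed_compact.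
    exists (Num.max r 0); split; first exact: num_real.
    by move=> x rx y /= H; apply: le_trans H _; exact: ltW.
  apply: (@closed_comp _ _ (fun y : 'rV[R]_m => `|y|) [set t | t <= Num.max r 0]) => //.
    by move=> y _; exact: norm_continuous.
have [||y Ky Hy] := @EVT_max_rV R m (fun y => `|f y|) K _ cK _.
- by exists 0; rewrite /K/= normr0 le_max lexx orbT.
- apply: continuous_subspaceT => y.
  by apply: (@continuous_comp _ _ _ f (fun t => `|t|)); [exact: cf|exact: norm_continuous].
exists `|f y| => // z; have [zr|zr] := leP (`|z|) r.
  by apply: Hy; rewrite inE /K/= le_max zr.
by rewrite f0 ?normr0// ltW.
Qed.

Lemma LI_bounded r f C : 0 < r -> 0 <= C -> (forall y, 0 <= f y) ->
  (forall y, f y <= C) -> (forall y, r <= `|y| -> f y = 0) ->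
  (LI (fun y => (f y)%:E) <= (C * (2 * r) ^+ m)%:E)%E.
Proof.
move=> r0 C0 f0 fC fr; rewrite -(@LI_box R m 0 r C)//.
apply: LI_mono => y; rewrite lee_fin// subr0; case: ifPn => // yr.
by rewrite fr// leNgt.
Qed.

(** The additivity lemmas for [lebesgue_int] are stated for nonnegative functions, so a signed
    function is integrated through its two parts, both finite under [bsupp]. *)
Definition sint f : R :=
  fine (LI (fun y => (pos_part f y)%:E)) - fine (LI (fun y => (neg_part f y)%:E)).

Lemma LI_part_fin r f : 0 < r -> bsupp r f ->
  (LI (fun y => (pos_part f y)%:E) \is a fin_num) /\
  (LI (fun y => (neg_part f y)%:E) \is a fin_num).
Proof.
move=> r0 bf; have [C C0 fC] := bsupp_bound bf; have [cf f0] := bf.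
split; rewrite ge0_fin_numE; try by apply: LI_ge0 => y; rewrite lee_fin ?pos_part_ge0 ?neg_part_ge0.
- apply: le_lt_trans (LI_bounded r0 C0 _ _ _) (ltry _) => y.
  + exact: pos_part_ge0.
  + by rewrite (le_trans (pos_part_le _ _)).
  + by move=> /f0; rewrite /pos_part => ->; rewrite maxxx.
- apply: le_lt_trans (LI_bounded r0 C0 _ _ _) (ltry _) => y.
  + exact: neg_part_ge0.
  + by rewrite (le_trans (neg_part_le _ _)).
  + by move=> /f0; rewrite /neg_part => ->; rewrite oppr0 maxxx.
Qed.

Lemma sintD r f g : 0 < r -> bsupp r f -> bsupp r g ->
  sint (fun y => f y + g y) = sint f + sint g.
Proof.
move=> r0 bf bg; have bfg := bsuppD bf bg.
have [pf nf] := LI_part_fin r0 bf; have [pg ng] := LI_part_fin r0 bg.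
have [ph nh] := LI_part_fin r0 bfg.
have [cf _] := bf; have [cg _] := bg; have [ch _] := bfg.
have cp (h : 'rV[R]_m -> R) : continuous h -> bmeas (fun y => (pos_part h y)%:E).
  by move=> ?; apply: bmeas_continuous; exact: continuous_pos_part.
have cn (h : 'rV[R]_m -> R) : continuous h -> bmeas (fun y => (neg_part h y)%:E).
  by move=> ?; apply: bmeas_continuous; exact: continuous_neg_part.
have p0 (h : 'rV[R]_m -> R) y : (0 <= (pos_part h y)%:E)%E by rewrite lee_fin pos_part_ge0.
have n0 (h : 'rV[R]_m -> R) y : (0 <= (neg_part h y)%:E)%E by rewrite lee_fin neg_part_ge0.
pose h y := f y + g y.
(* The parts of a sum are not the sums of the parts, but h^+ + f^- + g^- = h^- + f^+ + g^+ involves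
   only nonnegative functions. *)
have E : (LI (fun y => (pos_part h y)%:E) + (LI (fun y => (neg_part f y)%:E) +
     LI (fun y => (neg_part g y)%:E)) =
   LI (fun y => (neg_part h y)%:E) + (LI (fun y => (pos_part f y)%:E) +
     LI (fun y => (pos_part g y)%:E)))%E.
  rewrite -!LI_add; try by [| exact: cp | exact: cn | move=> y; exact: adde_ge0 |
    apply: emeasurable_funD; [exact: cn|exact: cn] |
    apply: emeasurable_funD; [exact: cp|exact: cp] ].
  apply: LI_eq => y; rewrite -!EFinD; congr EFin.
  have := pos_neg_part h y; rewrite {1}/h (pos_neg_part f y) (pos_neg_part g y); lra.
move/(congr1 fine) : E; rewrite !fineD ?fin_numD ?pf ?nf ?pg ?ng ?ph ?nh// /sint -/h.
lra.
Qed.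

Lemma sint0 : sint (fun=> 0) = 0.
Proof.
by rewrite /sint /pos_part /neg_part oppr0 maxxx subrr.
Qed.

Lemma sint_sum r (I : Type) (s : seq I) (F : I -> 'rV[R]_m -> R) : 0 < r ->
  (forall i, bsupp r (F i)) ->
  bsupp r (fun y => \sum_(i <- s) F i y) /\
  sint (fun y => \sum_(i <- s) F i y) = \sum_(i <- s) sint (F i).
Proof.
move=> r0 bF; elim: s => [|i s [bs IH]].
  have -> : (fun y => \sum_(i <- [::]) F i y) = (fun=> 0).
    by apply/funext => y; rewrite big_nil.
  rewrite big_nil sint0; split => //; split => // y; exact: cst_continuous.
have -> : (fun y => \sum_(j <- i :: s) F j y) = (fun y => F i y + \sum_(j <- s) F j y).
  by apply/funext => y; rewrite big_cons.
by split; [exact: bsuppD|rewrite (sintD r0)// IH big_cons].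
Qed.

Lemma sintZ r (k : R) f : 0 < r -> 0 <= k -> bsupp r f ->
  sint (fun y => k * f y) = k * sint f.
Proof.
move=> r0 k0 bf; have [cf _] := bf; have [pf nf] := LI_part_fin r0 bf.
rewrite /sint.
rewrite (@LI_eq _ _ _ (fun y => k%:E * (pos_part f y)%:E)%E); last first.
  by move=> y; rewrite -EFinM /pos_part maxr_pMr// mulr0.
rewrite [X in _ - fine X](@LI_eq _ _ _ (fun y => k%:E * (neg_part f y)%:E)%E); last first.
  by move=> y; rewrite -EFinM /neg_part maxr_pMr// mulr0 mulrN.
rewrite !LI_scale//.
- by rewrite !fineM//= mulrBr.
- by move=> y; rewrite lee_fin neg_part_ge0.
- by apply: bmeas_continuous; exact: continuous_neg_part.
- by move=> y; rewrite lee_fin pos_part_ge0.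
- by apply: bmeas_continuous; exact: continuous_pos_part.
Qed.

Lemma sint_shift f v : continuous f -> sint (fun y => f (y + v)) = sint f.
Proof.
move=> cf; rewrite /sint; congr (fine _ - fine _).
  apply: (@LI_shift R m (fun y => (pos_part f y)%:E) v).
    by move=> y; rewrite lee_fin pos_part_ge0.
  by apply: bmeas_continuous; exact: continuous_pos_part.
apply: (@LI_shift R m (fun y => (neg_part f y)%:E) v).
  by move=> y; rewrite lee_fin neg_part_ge0.
by apply: bmeas_continuous; exact: continuous_neg_part.
Qed.

Lemma sint_bound r f C : 0 < r -> bsupp r f -> (forall y, `|f y| <= C) ->
  `|sint f| <= C * (2 * r) ^+ m.
Proof.
move=> r0 bf fC; have [pf nf] := LI_part_fin r0 bf.
have C0 : 0 <= C by apply: le_trans (fC 0).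
have [cf f0] := bf.
have pC : fine (LI (fun y => (pos_part f y)%:E)) <= C * (2 * r) ^+ m.
  rewrite -lee_fin fineK//; apply: LI_bounded => // y; first exact: pos_part_ge0.
    by rewrite (le_trans (pos_part_le _ _)).
  by move=> /f0; rewrite /pos_part => ->; rewrite maxxx.
have nC : fine (LI (fun y => (neg_part f y)%:E)) <= C * (2 * r) ^+ m.
  rewrite -lee_fin fineK//; apply: LI_bounded => // y; first exact: neg_part_ge0.
    by rewrite (le_trans (neg_part_le _ _)).
  by move=> /f0; rewrite /neg_part => ->; rewrite oppr0 maxxx.
have p0 : 0 <= fine (LI (fun y => (pos_part f y)%:E)).
  by apply: fine_ge0; apply: LI_ge0 => y; rewrite lee_fin pos_part_ge0.
have n0 : 0 <= fine (LI (fun y => (neg_part f y)%:E)).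
  by apply: fine_ge0; apply: LI_ge0 => y; rewrite lee_fin neg_part_ge0.
rewrite /sint ler_norml; apply/andP; split; lra.
Qed.

Lemma bsupp_partial r f a : smooth setT f -> (forall y, r <= `|y| -> f y = 0) ->
  bsupp (r + 1) (partial a f).
Proof.
move=> sf f0; split.
  move=> y; apply: (@smooth_on_continuous _ _ setT) => //; exact: smooth_on_partial.
move=> y ry; have oU : open [set y : 'rV[R]_m | r < `|y|].
  apply: (@open_comp _ _ (fun y : 'rV[R]_m => `|y|) [set t | r < t]); last exact: open_gt.
  by move=> z _; exact: norm_continuous.
apply: (partial_out0 a oU).
  by move=> z /= rz; apply: f0; exact: ltW.
by apply: lt_le_trans ry; rewrite ltrDl.
Qed.

(* The integral of a difference quotient vanishes by translation invariance,
   and the difference quotients converge uniformly to the derivative. *)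
Lemma sint_partial r f a : 0 < r -> smooth setT f ->
  (forall y, r <= `|y| -> f y = 0) -> sint (partial a f) = 0.
Proof.
move=> r0 sf f0; pose F := partial a f.
have sF : smooth setT F by exact: smooth_on_partial.
have bF := bsupp_partial a sf f0.
have F0 y : r + 1 <= `|y| -> F y = 0 by have [_] := bF; apply.
have bG := bsupp_partial a sF F0.
have [C C0 GC] := bsupp_bound bG.
(* A common support radius for [f], its derivative and its translates by less than 1. *)
pose r' := r + 1 + 1 + 1; have r'0 : 0 < r' by rewrite /r'; lra.
pose e : 'rV[R]_m := delta_mx 0 a.
have cf : continuous f by move=> y; exact: (smooth_on_continuous sf).
have cF : continuous F by move=> y; exact: (smooth_on_continuous sF).
have df z : derivable f z e by apply: smooth_on_derivable sf _.
have dF z : derivable F z e by apply: smooth_on_derivable sF _.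
have ne (s : R) : `|s *: e| <= `|s|.
  apply: normrV_le => // l; rewrite !mxE normrM eqxx/=.
  by case: eqP => _; rewrite ?normr1 ?mulr1// normr0 mulr0.
have key h : 0 < h -> h < 1 -> `|sint F| <= C * h * (2 * r') ^+ m.
  (* The first-order Taylor remainder, of size C h^2 by two mean values. Since [f] and its translate
     have equal integrals, h times the integral of [F] is minus that of [E]. *)
  move=> h0 h1; pose E y := f (y + h *: e) - f y - h * F y.
  have bf : bsupp r' f by apply: (@bsupp_le r) => //; rewrite /r'; lra.
  have bF' : bsupp r' F by apply: (@bsupp_le (r + 1)) => //; rewrite /r'; lra.
  have bfh : bsupp r' (fun y => f (y + h *: e)).
    split.
      move=> y; apply: (@continuous_comp _ _ _ (fun y : 'rV[R]_m => y + h *: e) f); last exact: cf.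
      by apply: continuousD; [exact: cvg_id|exact: cst_continuous].
    move=> y ry; apply: f0; have := ler_normB (y + h *: e) (h *: e).
    rewrite addrK => H; have := ne h; rewrite (gtr0_norm h0) /r' in ry *; lra.
  have bE : bsupp r' E.
    rewrite (_ : E = fun y => (f (y + h *: e) + (-1) * f y) + (- h) * F y); last first.
      by apply/funext => y; rewrite /E mulN1r mulNr.
    by apply: bsuppD; [apply: bsuppD => //; exact: bsuppZ|exact: bsuppZ].
  have EC y : `|E y| <= C * h * h.
    rewrite /E; have [s sh ->] := @MVT_line R _ f y e h
      (fun s _ => df _).
    rewrite -partialE -/F -mulrBr.
    have [t ts ->] := @MVT_line R _ F y e s (fun s _ => dF _).
    rewrite -partialE !normrM (gtr0_norm h0) mulrC ler_wpM2r ?(ltW h0)//.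
    rewrite mulrC ler_pM//; rewrite (gtr0_norm h0) in sh; exact: sh.
  have fE : (fun y => f (y + h *: e)) = (fun y => (f y + h * F y) + E y).
    by apply/funext => y; rewrite /E; ring.
  have := sint_shift (h *: e) cf.
  rewrite fE (sintD r'0 _ bE); last by apply: bsuppD => //; exact: bsuppZ.
  rewrite (sintD r'0 bf (bsuppZ h bF')) (sintZ r'0 (ltW h0) bF').
  have := sint_bound r'0 bE EC; set J := sint F; set JE := sint E => JEC H.
  have {}H : h * J = - JE by lra.
  rewrite -(ler_pM2l h0) -{1}(gtr0_norm h0) -normrM H normrN.
  apply: le_trans JEC _; rewrite le_eqVlt; apply/orP; left; apply/eqP; ring.
apply/eqP; rewrite -normr_eq0 eq_le normr_ge0 andbT; apply/ler_addgt0Pl => x x0.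
rewrite addr0; pose B := C * (2 * r') ^+ m.
have B0 : 0 <= B by rewrite mulr_ge0// exprn_ge0// mulr_ge0// ltW.
pose h := Num.min (2^-1) (x / (B + 1)).
have h0 : 0 < h by rewrite lt_min invr_gt0 ltr0n/= divr_gt0// ltr_wpDl.
have h1 : h < 1 by rewrite gt_min invf_lt1 ?ltr1n.
apply: le_trans (key h h0 h1) _.
have : h <= x / (B + 1) by rewrite ge_min lexx orbT.
rewrite ler_pdivlMr ?ltr_wpDl// => hx; apply: le_trans hx.
rewrite mulrAC -/B mulrC ler_pM2l// lerDl//.
Qed.

End SignedIteratedIntegral.

(** * The metric on differentials *)

Lemma mxDE (R : realType) m1 m2 (A B : 'M[R]_(m1, m2)) i j : (A + B) i j = A i j + B i j.
Proof. by rewrite mxE. Qed.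

Lemma mxNE (R : realType) m1 m2 (A : 'M[R]_(m1, m2)) i j : (- A) i j = - A i j.
Proof. by rewrite mxE. Qed.

Lemma mxZE (R : realType) m1 m2 (k : R) (A : 'M[R]_(m1, m2)) i j : (k *: A) i j = k * A i j.
Proof. by rewrite mxE. Qed.

Lemma chart_at_codom (R : realType) n (M : complexManifold R n) (x : M) :
  chart_codom (chart_at x) (chart (chart_at x) x).
Proof. by apply: codom_chart; exact: dom_chart_at. Qed.

Section Gradient.
Context {R : realType} {n : nat} {M : complexManifold R n}.
Context (g : kahlerMetric M).
Local Notation V := 'rV[R]_(n + n).
Local Notation N := (n + n)%N.
Implicit Types (f h u : M -> R) (i j : chart_index M).

Lemma gmx_msmooth i : msmooth (chart_codom i) (gmx g i).
Proof. by move=> a b; split; exact: gmx_smooth. Qed.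

Lemma gmx_posdef i y : chart_codom i y -> posdef (gmx g i y).
Proof. by move=> cy v v0; exact: gmx_pos. Qed.

Lemma gmx_unit i y : chart_codom i y -> gmx g i y \in unitmx.
Proof. by move=> cy; apply: posdef_unit; exact: gmx_posdef. Qed.

Definition ginv i y : 'M[R]_N := invmx (gmx g i y).

Lemma ginv_msmooth i : msmooth (chart_codom i) (ginv i).
Proof.
move=> a b; apply: smooth_invmx; [exact: open_chart_codom|exact: gmx_msmooth|].
exact: gmx_unit.
Qed.

Lemma ginv_sym i y : chart_codom i y -> (ginv i y)^T = ginv i y.
Proof. by move=> cy; have [] := posdef_inv (gmx_sym g cy) (gmx_posdef cy). Qed.

Lemma ginv_posdef i y : chart_codom i y -> posdef (ginv i y).
Proof. by move=> cy; have [] := posdef_inv (gmx_sym g cy) (gmx_posdef cy). Qed.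

Definition lrep f i : V -> R := fun y => f (chart_inv i y).

Lemma sfun_lrep f i : sfun f -> smooth (chart_codom i) (lrep f i).
Proof. by move=> [sf]; exact: sf. Qed.

Definition dmx f i y : 'rV[R]_N := \row_a partial a (lrep f i) y.

Lemma dmx_msmooth f i : sfun f -> msmooth (chart_codom i) (dmx f i).
Proof.
move=> sf a b; apply: (@smooth_on_eq _ _ _ (partial b (lrep f i))).
- exact: open_chart_codom.
- by move=> y _; rewrite mxE.
- by apply: smooth_on_partial; exact: sfun_lrep.
Qed.

Definition cip f h i y : R := (dmx f i y *m ginv i y *m (dmx h i y)^T) 0 0.

(** The inner product of the differentials at [x]. The chart [chart_at x] can be replaced by any
    other one, because the transformation rules of the differential and of the inverse metric cancel
    ([cip_transition]). *)
Definition ip f h x : R := cip f h (chart_at x) (chart (chart_at x) x).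

Lemma cip_smooth f h i : sfun f -> sfun h -> smooth (chart_codom i) (cip f h i).
Proof.
move=> sf sh; have oU := open_chart_codom i.
have sfg := msmoothM oU (dmx_msmooth i sf) (ginv_msmooth i).
exact: (msmoothM oU sfg (msmooth_tr oU (dmx_msmooth i sh)) 0 0).
Qed.

Definition tjac i j y : 'M[R]_N := \matrix_(a, b) partial a (fun z => transition i j z 0 b) y.

Lemma tjac_jacobian i j y : overlap i j y -> 'J (transition i j) y = tjac i j y.
Proof.
move=> oy; apply/matrixP => a b; rewrite [RHS]mxE.
apply: (jacobianE a b (open_overlap i j) _ oy) => c; exact: transition_smooth'.
Qed.

Lemma gmx_tjac i j y : overlap i j y ->
  gmx g i y = tjac i j y *m gmx g j (transition i j y) *m (tjac i j y)^T.
Proof.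
move=> oy; rewrite -tjac_jacobian//; move: oy => [x [dx dy] <-].
by rewrite (gmx_transition g dx dy) /transition/= chartK.
Qed.

Lemma overlap_codom i j y : overlap i j y -> chart_codom i y.
Proof. by rewrite overlapE => -[]. Qed.

Lemma tjac_unit i j y : overlap i j y -> tjac i j y \in unitmx.
Proof.
move=> oy; have := gmx_unit (overlap_codom oy).
by rewrite (gmx_tjac oy) unitmx_mul => /andP[]; rewrite unitmx_mul => /andP[].
Qed.

Lemma ginv_tjac i j y : overlap i j y ->
  ginv j (transition i j y) = (tjac i j y)^T *m ginv i y *m tjac i j y.
Proof.
move=> oy; have uD := tjac_unit oy.
have uD' : (tjac i j y)^T \in unitmx by rewrite unitmx_tr.
have uj := gmx_unit (overlap_codom (transition_overlap oy)).
have H : gmx g j (transition i j y) *m ((tjac i j y)^T *m ginv i y *m tjac i j y) = 1%:M.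
  have E : tjac i j y *m (gmx g j (transition i j y) *m
      ((tjac i j y)^T *m ginv i y *m tjac i j y)) = tjac i j y.
    rewrite !mulmxA -gmx_tjac// mulmxV ?mul1mx//.
    exact: gmx_unit (overlap_codom oy).
  by rewrite -[LHS](mulKmx uD) E mulVmx.
by rewrite -[RHS](mulKmx uj) H mulmx1.
Qed.

Lemma lrep_transition f i j y : overlap i j y -> lrep f i y = lrep f j (transition i j y).
Proof. by move=> oy; rewrite /lrep chart_inv_transition. Qed.

Lemma partial_transition f i j a y : sfun f -> overlap i j y ->
  partial a (lrep f i) y =
  \sum_b tjac i j y a b * partial b (lrep f j) (transition i j y).
Proof.
move=> sf oy.
rewrite (partial_eq_on (g := fun z => lrep f j (transition i j z)) a (open_overlap i j)) //;
  last by move=> z oz; exact: lrep_transition.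
rewrite (partial_comp (U := overlap i j) (W := chart_codom j)) //.
- by apply: eq_bigr => b _; rewrite mxE.
- exact: open_chart_codom.
- by move=> b; exact: transition_smooth'.
- exact: sfun_lrep.
- exact: overlap_codom (transition_overlap oy).
Qed.

Lemma dmx_transition f i j y : sfun f -> overlap i j y ->
  dmx f i y = dmx f j (transition i j y) *m (tjac i j y)^T.
Proof.
move=> sf oy; apply/rowP => a; rewrite mxE (partial_transition a sf oy) mxE.
by apply: eq_bigr => b _; rewrite !mxE mulrC.
Qed.

Lemma cip_transition f h i j y : sfun f -> sfun h -> overlap i j y ->
  cip f h i y = cip f h j (transition i j y).
Proof.
move=> sf sh oy; rewrite /cip (ginv_tjac oy) (dmx_transition sf oy) (dmx_transition sh oy).
by rewrite trmx_mul trmxK !mulmxA.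
Qed.

Lemma overlap_chart i j x : dom i x -> dom j x -> overlap i j (chart i x).
Proof. by move=> di dj; exists x. Qed.

Lemma transition_chart i j x : dom i x -> transition i j (chart i x) = chart j x.
Proof. by move=> di; rewrite /transition/= chartK. Qed.

Lemma ip_chart f h i x : sfun f -> sfun h -> dom i x -> ip f h x = cip f h i (chart i x).
Proof.
move=> sf sh di; rewrite /ip (cip_transition (j := i) sf sh).
  by rewrite transition_chart//; exact: dom_chart_at.
by apply: overlap_chart => //; exact: dom_chart_at.
Qed.

Lemma ip_chart_inv f h i y : sfun f -> sfun h -> chart_codom i y ->
  ip f h (chart_inv i y) = cip f h i y.
Proof.
by move=> sf sh cy; rewrite (ip_chart sf sh (dom_chart_inv cy)) chart_invK.
Qed.

Lemma sfun_of_charts f (F : chart_index M -> V -> R) :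
  (forall i, smooth (chart_codom i) (F i)) ->
  (forall i y, chart_codom i y -> f (chart_inv i y) = F i y) -> sfun f.
Proof.
move=> sF fF; split=> i; apply: (@smooth_on_eq _ _ _ (F i)) => //.
  exact: open_chart_codom.
by move=> y cy; rewrite fF.
Qed.

Lemma sfun_ip f h : sfun f -> sfun h -> sfun (ip f h).
Proof.
move=> sf sh; apply: (@sfun_of_charts _ (cip f h)).
  by move=> i; exact: cip_smooth.
by move=> i y cy; exact: ip_chart_inv.
Qed.

Definition dform f x : 'rV[R]_N := dmx f (chart_at x) (chart (chart_at x) x).

Lemma gradientE f x : gradient g f x = dform f x *m invmx (metric_at g x).
Proof. by rewrite /gradient /dform /dmx; congr (_ *m _); apply/rowP => a; rewrite !mxE. Qed.

Lemma metric_at_ginv x : invmx (metric_at g x) = ginv (chart_at x) (chart (chart_at x) x).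
Proof. by []. Qed.

Lemma ip_ge0 f x : 0 <= ip f f x.
Proof. exact: posdef_ge0 (ginv_posdef (chart_at_codom x)). Qed.

Lemma grad_normE f x : grad_norm g f x = Num.sqrt (ip f f x).
Proof.
rewrite /grad_norm /tangent_norm gradientE; congr (Num.sqrt (fun_of_matrix _ 0 0)).
rewrite metric_at_ginv mulmxKV; last exact: gmx_unit (chart_at_codom x).
by rewrite trmx_mul ginv_sym ?mulmxA//; exact: chart_at_codom.
Qed.

Lemma grad_norm_sqr f x : grad_norm g f x ^+ 2 = ip f f x.
Proof. by rewrite grad_normE sqr_sqrtr// ip_ge0. Qed.

Lemma grad_norm_continuous f : sfun f -> continuous (grad_norm g f).
Proof.
move=> sf; rewrite (_ : grad_norm g f = fun x => Num.sqrt (ip f f x)); last first.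
  by apply/funext => x; rewrite grad_normE.
move=> x; apply: (@continuous_comp _ _ _ (ip f f) Num.sqrt).
  exact: sfun_continuous (sfun_ip sf sf) x.
exact: sqrt_continuous.
Qed.

Lemma dform_val f x (v : V) : (dform f x *m v^T) 0 0 =
  (gradient g f x *m metric_at g x *m v^T) 0 0.
Proof. by rewrite gradientE mulmxKV//; exact: gmx_unit (chart_at_codom x). Qed.

(** Cauchy-Schwarz, read off from the form at q u - b v, where q is the form at v and b the product
    of u and v. *)
Lemma qform_CS m (A : 'M[R]_m) (u v : 'rV[R]_m) : A^T = A -> posdef A ->
  ((u *m A *m v^T) 0 0) ^+ 2 <= qform A u * qform A v.
Proof.
move=> sA pA; have [->|v0] := eqVneq v 0.
  by rewrite trmx0 mulmx0 mxE expr0n/= mulr_ge0 ?posdef_ge0.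
set b := (u *m A *m v^T) 0 0; have q0 := pA v v0; set q := qform A v in q0 *.
have := posdef_ge0 (q *: u - b *: v) pA;
rewrite /qform [(_ - _)^T]linearB/= [(q *: _)^T]linearZ [(b *: _)^T]linearZ/=.
rewrite !mulmxBl !mulmxBr -!scalemxAl -!scalemxAr.
have -> : v *m A *m u^T = (u *m A *m v^T)^T by rewrite !trmx_mul trmxK sA mulmxA.
rewrite !(mxDE, mxNE, mxZE) [(_^T) 0 0]mxE -/b -/(qform A u) -/(qform A v) -/q => H.
have {}H : 0 <= q * (qform A u * q - b ^+ 2) by lra.
by move: H; rewrite pmulr_rge0// subr_ge0.
Qed.

Lemma qform_young m (A : 'M[R]_m) (u v : 'rV[R]_m) (a b : R) : A^T = A -> posdef A ->
  2 * (a * b) * (u *m A *m v^T) 0 0 <= a ^+ 2 * qform A u + b ^+ 2 * qform A v.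
Proof.
move=> sA pA; have := posdef_ge0 (a *: u - b *: v) pA.
rewrite /qform [(_ - _)^T]linearB/= [(a *: _)^T]linearZ [(b *: _)^T]linearZ/=.
rewrite !mulmxBl !mulmxBr -!scalemxAl -!scalemxAr.
have -> : v *m A *m u^T = (u *m A *m v^T)^T by rewrite !trmx_mul trmxK sA mulmxA.
rewrite !(mxDE, mxNE, mxZE) [(_^T) 0 0]mxE; lra.
Qed.

Lemma dform_le f x (v : V) :
  `|(dform f x *m v^T) 0 0| <= grad_norm g f x * tangent_norm g x v.
Proof.
have sA := gmx_sym g (chart_at_codom x); have pA := gmx_posdef (chart_at_codom x).
rewrite dform_val /grad_norm /tangent_norm -sqrtrM; last exact: posdef_ge0.
rewrite -sqrtr_sqr ler_wsqrtr//; exact: qform_CS.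
Qed.

Lemma lrep_is_derive f x a : sfun f ->
  is_derive (chart (chart_at x) x) (delta_mx 0 a) (lrep f (chart_at x)) (dform f x 0 a).
Proof.
by move=> sf; rewrite mxE; exact: smooth_is_derive (sfun_lrep _ sf) (chart_at_codom x).
Qed.

Lemma dform_is_derive f x (d : 'rV[R]_N) :
  (forall a, is_derive (chart (chart_at x) x) (delta_mx 0 a) (lrep f (chart_at x)) (d 0 a)) ->
  dform f x = d.
Proof. by move=> H; apply/rowP => a; rewrite mxE; apply: partial_is_derive. Qed.

Lemma dformD f h x : sfun f -> sfun h ->
  dform (fun x => f x + h x) x = dform f x + dform h x.
Proof.
move=> sf sh; apply: dform_is_derive => a; rewrite mxDE.
exact: is_deriveD (lrep_is_derive x a sf) (lrep_is_derive x a sh).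
Qed.

Lemma dform_comp (F : R -> R) (F' : R) f x : sfun f -> is_derive (f x) 1 F F' ->
  dform (fun x => F (f x)) x = F' *: dform f x.
Proof.
move=> sf dF; apply: dform_is_derive => a; rewrite mxZE.
apply: is_derive_chain1 (lrep_is_derive x a sf).
by rewrite /lrep chartK//; exact: dom_chart_at.
Qed.

Lemma dformM f h x : sfun f -> sfun h ->
  dform (fun x => f x * h x) x = f x *: dform h x + h x *: dform f x.
Proof.
move=> sf sh; apply: dform_is_derive => a; rewrite mxDE !mxZE.
have := is_deriveM (lrep_is_derive x a sf) (lrep_is_derive x a sh).
by rewrite /lrep !chartK//; exact: dom_chart_at.
Qed.

Lemma dform_cst (c : R) x : dform (fun=> c) x = 0.
Proof. by apply: dform_is_derive => a; rewrite mxE; exact: is_derive_cst. Qed.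

Lemma dform_near f h x : (\forall z \near x, f z = h z) -> dform f x = dform h x.
Proof.
move=> fh; apply/rowP => a; rewrite !mxE; apply: partial_near.
have dx : dom (chart_at x) x by exact: dom_chart_at.
have := chart_inv_continuous (chart_at_codom x).
by rewrite /prop_for /continuous_at (chartK dx) => /(_ _ fh).
Qed.

Lemma ipE f h x : ip f h x = (dform f x *m invmx (metric_at g x) *m (dform h x)^T) 0 0.
Proof. by []. Qed.

Lemma ipC f h x : ip f h x = ip h f x.
Proof.
rewrite !ipE metric_at_ginv; set A := ginv _ _.
have -> : dform h x *m A *m (dform f x)^T = (dform f x *m A *m (dform h x)^T)^T.
  by rewrite !trmx_mul trmxK ginv_sym ?mulmxA//; exact: chart_at_codom.
by rewrite [RHS]mxE.
Qed.

Lemma ip_young f h x (a b : R) : 2 * (a * b) * ip f h x <= a ^+ 2 * ip f f x + b ^+ 2 * ip h h x.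
Proof.
rewrite !ipE; apply: qform_young; [exact: ginv_sym (chart_at_codom x)|].
exact: ginv_posdef (chart_at_codom x).
Qed.

End Gradient.

(** * Local Kaehler geometry and the Bochner inequality *)

Section MatrixSums.
Context {R : realType}.

Lemma bilE m (x z : 'rV[R]_m) (A : 'M[R]_m) :
  (x *m A *m z^T) 0 0 = \sum_i \sum_j x 0 i * A i j * z 0 j.
Proof.
rewrite mxE exchange_big; apply: eq_bigr => j _; rewrite !mxE mulr_suml.
by apply: eq_bigr => i _.
Qed.

Lemma tr11 (A : 'M[R]_1) : A^T = A.
Proof. by apply/matrixP => i j; rewrite mxE !ord1. Qed.

Lemma bil_tr m (x z : 'rV[R]_m) (A : 'M[R]_m) : z *m A^T *m x^T = x *m A *m z^T.
Proof. by rewrite -[LHS]tr11 !trmx_mul !trmxK mulmxA. Qed.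

Lemma tr_mulE m (A B : 'M[R]_m) : \tr (A *m B) = \sum_i \sum_j A i j * B j i.
Proof. by apply: eq_bigr => i _; rewrite mxE. Qed.

Lemma tr_sym_anti m (A B : 'M[R]_m) : A^T = A -> B^T = - B -> \tr (A *m B) = 0.
Proof.
move=> sA aB; apply/eqP; rewrite -[_ == _](@mulrn_eq0 _ _ 2) mulr2n.
by rewrite -{1}mxtrace_tr trmx_mul sA aB mulNmx linearN/= mxtrace_mulC addNr.
Qed.

Lemma row_mul_sym m (x : 'rV[R]_m) (A : 'M[R]_m) b : A^T = A ->
  (x *m (row b A)^T) 0 0 = (x *m A) 0 b.
Proof. by move=> sA; rewrite tr_row sA colE mulmxA -colE mxE. Qed.

Lemma trmxD m1 m2 (A B : 'M[R]_(m1, m2)) : (A + B)^T = A^T + B^T.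
Proof. exact: linearD. Qed.

Lemma trmxB m1 m2 (A B : 'M[R]_(m1, m2)) : (A - B)^T = A^T - B^T.
Proof. exact: linearB. Qed.

Lemma trmxN m1 m2 (A : 'M[R]_(m1, m2)) : (- A)^T = - A^T.
Proof. exact: linearN. Qed.

Lemma mxtraceB m (A B : 'M[R]_m) : \tr (A - B) = \tr A - \tr B.
Proof. exact: linearB. Qed.

Lemma mxtraceN m (A : 'M[R]_m) : \tr (- A) = - \tr A.
Proof. exact: linearN. Qed.

Lemma pmxZ k m1 m2 (U : set 'rV[R]_k) a (c : R) (A : 'rV[R]_k -> 'M[R]_(m1, m2)) y :
  open U -> msmooth U A -> U y -> pmx a (fun y => c *: A y) y = c *: pmx a A y.
Proof.
move=> oU sA Uy; rewrite (_ : (fun y => _) = fun y => c%:M *m A y); last first.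
  by apply/funext => z; rewrite mul_scalar_mx.
by rewrite (pmxM a (msmooth_cst _ oU) sA Uy) pmx_cst mul0mx add0r mul_scalar_mx.
Qed.

Lemma pmxB k m1 m2 (U : set 'rV[R]_k) a (A B : 'rV[R]_k -> 'M[R]_(m1, m2)) y :
  open U -> msmooth U A -> msmooth U B -> U y ->
  pmx a (fun y => A y - B y) y = pmx a A y - pmx a B y.
Proof.
move=> oU sA sB Uy; have sNB : msmooth U (fun y => -1 *: B y).
  move=> i j; apply: (@smooth_on_eq _ _ _ (fun y => - B y i j)) => [//|z _|].
    by rewrite mxZE mulN1r.
  exact: smooth_onN.
rewrite (_ : (fun y => _) = fun y => A y + -1 *: B y); last first.
  by apply/funext => z; rewrite scaleN1r.
by rewrite (pmxD a sA sNB Uy) (pmxZ a (-1) oU sB Uy) scaleN1r.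
Qed.

End MatrixSums.

(** * Levi-Civita connection, curvature and the Bochner formula in coordinates *)

Section LocalGeometry.
Context {R : realType} {m : nat}.
Local Notation V := 'rV[R]_m.
Context (U : set V) (oU : open U) (G H : V -> 'M[R]_m).
Context (sG : msmooth U G) (sH : msmooth U H)
  (symG : forall y, U y -> (G y)^T = G y) (symH : forall y, U y -> (H y)^T = H y)
  (HG : forall y, U y -> H y *m G y = 1%:M) (GH : forall y, U y -> G y *m H y = 1%:M).

(** The inverse metric [H] is carried along with [G] as a function of its own. As with [pmx], an
    opaque witness prevents unfolding; the same device is used for most definitions of this
    section. *)
Fact chr_key : {f : 'I_m -> 'I_m -> 'I_m -> V -> R | forall k a b y, f k a b y =
  2^-1 * \sum_l H y k l *
    (partial a (fun z => G z b l) y + partial b (fun z => G z a l) y -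
     partial l (fun z => G z a b) y)}.
Proof. by eexists. Qed.

Definition chr := sval chr_key.

Lemma chr_def k a b y : chr k a b y = 2^-1 * \sum_l H y k l *
    (partial a (fun z => G z b l) y + partial b (fun z => G z a l) y -
     partial l (fun z => G z a b) y).
Proof. by rewrite /chr (svalP chr_key). Qed.

Lemma chrE k a b y : chr k a b y = 2^-1 * \sum_l H y k l *
  (pmx a G y b l + pmx b G y a l - pmx l G y a b).
Proof. by rewrite chr_def; congr (_ * _); apply: eq_bigr => l _; rewrite !pmxE. Qed.

Fact Gam_key : {f : 'I_m -> V -> 'M[R]_m | forall b y, f b y = \matrix_(c, k) chr k b c y}.
Proof. by eexists. Qed.

Fact Chr_key : {f : 'I_m -> V -> 'M[R]_m | forall k y, f k y = \matrix_(a, b) chr k a b y}.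
Proof. by eexists. Qed.

(* (Gam b) c k is the Christoffel symbol with upper index k and lower indices
   b, c; Chr k is the matrix with fixed upper index k. *)
Definition Gam := sval Gam_key.
Definition Chr := sval Chr_key.

Lemma GamE b c k y : Gam b y c k = chr k b c y.
Proof. by rewrite /Gam (svalP Gam_key) mxE. Qed.

Lemma ChrE k a b y : Chr k y a b = chr k a b y.
Proof. by rewrite /Chr (svalP Chr_key) mxE. Qed.

Lemma pmx_symG b y : U y -> (pmx b G y)^T = pmx b G y.
Proof. by move=> Uy; rewrite -pmx_tr; exact: (pmx_eq b oU symG Uy). Qed.

Lemma chr_sym k a b y : U y -> chr k a b y = chr k b a y.
Proof.
move=> Uy; rewrite !chrE; congr (_ * _); apply: eq_bigr => l _; congr (_ * _).
rewrite [X in X - _]addrC; congr (_ - _).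
by have /matrixP/(_ a b) := pmx_symG l Uy; rewrite mxE.
Qed.

Lemma chr_smooth k a b : smooth U (chr k a b).
Proof.
rewrite (_ : chr k a b = fun y => 2^-1 * \sum_l H y k l *
    (partial a (fun z => G z b l) y + partial b (fun z => G z a l) y -
     partial l (fun z => G z a b) y)); last by apply/funext => y; exact: chr_def.
apply: smooth_onM => [//||]; first exact: smooth_on_cst.
apply: smooth_on_sum => [//|l]; apply: smooth_onM => [//||]; first exact: sH.
apply: smooth_onB => [//||]; last by apply: smooth_on_partial; exact: sG.
by apply: smooth_onD => [//||]; apply: smooth_on_partial; exact: sG.
Qed.

Lemma Gam_msmooth b : msmooth U (Gam b).
Proof.
move=> c k; apply: (@smooth_on_eq _ _ _ (chr k b c)) => [//|y _|]; last exact: chr_smooth.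
by rewrite GamE.
Qed.

Lemma Chr_msmooth k : msmooth U (Chr k).
Proof.
move=> a b; apply: (@smooth_on_eq _ _ _ (chr k a b)) => [//|y _|]; last exact: chr_smooth.
by rewrite ChrE.
Qed.

Lemma Gam_sym b c k y : U y -> Gam b y c k = Gam c y b k.
Proof. by move=> Uy; rewrite !GamE chr_sym. Qed.

Lemma Chr_sym k y : U y -> (Chr k y)^T = Chr k y.
Proof. by move=> Uy; apply/matrixP => a b; rewrite mxE !ChrE chr_sym. Qed.

Lemma GamG b y : U y -> Gam b y *m G y = 2^-1 *: \matrix_(c, l)
  (pmx b G y c l + pmx c G y b l - pmx l G y b c).
Proof.
move=> Uy; set S := \matrix_(c, l) _.
have -> : Gam b y = 2^-1 *: (S *m H y).
  apply/matrixP => c k; rewrite GamE chrE mxZE [(S *m _) _ _]mxE; congr (_ * _).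
  apply: eq_bigr => l _; rewrite mulrC mxE; congr (_ * _).
  by have /matrixP/(_ k l) := symH Uy; rewrite mxE => ->.
by rewrite -scalemxAl -mulmxA HG// mulmx1.
Qed.

(** Compatibility of the connection with the metric: in the formula of [GamG], adding the transpose
    cancels the derivatives other than the one in direction [b]. *)
Lemma compat b y : U y -> pmx b G y = Gam b y *m G y + G y *m (Gam b y)^T.
Proof.
move=> Uy; rewrite -{2}(symG Uy) -trmx_mul GamG//; apply/matrixP => c l.
rewrite mxDE [(_^T) _ _]mxE !mxZE [X in _ = _ * X + _]mxE [X in _ = _ + _ * X]mxE.
by have /matrixP/(_ c l) := pmx_symG b Uy; rewrite mxE; lra.
Qed.

Lemma pmx_H b y : U y -> pmx b H y = - (H y *m Gam b y) - (Gam b y)^T *m H y.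
Proof.
move=> Uy; have uG z : U z -> G z \in unitmx by move=> /GH/mulmx1_unit[].
have HE z : U z -> H z = invmx (G z).
  by move=> Uz; rewrite -[LHS]mulmx1 -(mulmxV (uG z Uz)) mulmxA HG// mul1mx.
rewrite (pmx_eq b oU HE Uy) (pmx_inv b oU sG uG Uy) -!HE// (compat b Uy) mulmxDr mulmxDl.
rewrite opprD; congr (- _ - _).
  by rewrite -!mulmxA GH// mulmx1.
by rewrite !mulmxA HG// mul1mx.
Qed.

(** Differentiating tr(H S) = 0: by [pmx_H] the derivative of [H] yields two terms, which have the
    same trace. The lemma trades a derivative of a trace-free symmetric matrix for Christoffel
    symbols. *)
Lemma tr_H_deriv (S : V -> 'M[R]_m) b y : msmooth U S ->
  (forall y, U y -> (S y)^T = S y) -> (forall y, U y -> \tr (H y *m S y) = 0) ->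
  U y -> \tr (H y *m pmx b S y) = 2 * \tr (H y *m Gam b y *m S y).
Proof.
move=> sS symS tr0 Uy.
have E : \tr (pmx b (fun y => H y *m S y) y) = 0.
  rewrite -[RHS](@partial_out0 R m U (fun y => \tr (H y *m S y)) b y)//.
  apply/esym; apply: partial_is_derive; apply: is_derive_bigsum => i.
  rewrite pmxE; apply: smooth_is_derive Uy.
  exact: (msmoothM oU sH sS).
move: E; rewrite (pmxM b sH sS Uy) (pmx_H b Uy) mxtraceD mulmxBl mulNmx.
rewrite mxtraceB mxtraceN.
have -> : \tr ((Gam b y)^T *m H y *m S y) = \tr (H y *m Gam b y *m S y).
  rewrite -mxtrace_tr !trmx_mul trmxK (symS _ Uy) (symH Uy) mulmxA.
  by rewrite -mulmxA mxtrace_mulC.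
lra.
Qed.

Fact Riem_key : {f : 'I_m -> 'I_m -> V -> 'M[R]_m | forall d b y, f d b y =
  pmx d (Gam b) y - pmx b (Gam d) y + Gam b y *m Gam d y - Gam d y *m Gam b y}.
Proof. by eexists. Qed.

(* The curvature endomorphism of the directions d and b, acting on row vectors. *)
Definition Riem := sval Riem_key.

Lemma Riem_def d b y : Riem d b y =
  pmx d (Gam b) y - pmx b (Gam d) y + Gam b y *m Gam d y - Gam d y *m Gam b y.
Proof. exact: (svalP Riem_key). Qed.

Lemma RiemE d b y i j : Riem d b y i j =
  pmx d (Gam b) y i j - pmx b (Gam d) y i j +
  \sum_k Gam b y i k * Gam d y k j - \sum_k Gam d y i k * Gam b y k j.
Proof. by rewrite Riem_def !(mxDE, mxNE); congr (_ + _ - _); rewrite mxE. Qed.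

Lemma tr_Riem d b y : \tr (Riem d b y) = \sum_k (pmx d (Gam b) y k k - pmx b (Gam d) y k k).
Proof.
rewrite !Riem_def linearB/= mxtraceD mxtrace_mulC addrK; apply: eq_bigr => k _.
by rewrite mxDE mxNE.
Qed.

(** Expand both sides of the equality of the mixed second derivatives of [G] with [compat]; the
    difference is the claimed skew-symmetry. *)
Lemma Riem_anti d b y : U y -> (Riem d b y *m G y)^T = - (Riem d b y *m G y).
Proof.
move=> Uy.
have key d' b' : pmx d' (pmx b' G) y =
    pmx d' (Gam b') y *m G y + Gam b' y *m (Gam d' y *m G y + G y *m (Gam d' y)^T)
    + ((Gam d' y *m G y + G y *m (Gam d' y)^T) *m (Gam b' y)^T
    + G y *m (pmx d' (Gam b') y)^T).
  rewrite (pmx_eq d' oU (fun z => @compat b' z) Uy).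
  rewrite (pmxD d' (A := fun y => Gam b' y *m G y)
     (B := fun y => G y *m (Gam b' y)^T) (U := U)) //; last 2 first.
  - by apply: msmoothM => //; exact: Gam_msmooth.
  - by apply: msmoothM => //; apply: msmooth_tr => //; exact: Gam_msmooth.
  rewrite (pmxM d' (Gam_msmooth b') sG Uy).
  rewrite (pmxM d' (B := fun y => (Gam b' y)^T) sG (msmooth_tr oU (Gam_msmooth b')) Uy).
  by rewrite (compat d' Uy) pmx_tr.
have sw : pmx d (pmx b G) y = pmx b (pmx d G) y.
  apply/matrixP => i j; rewrite !pmxE.
  have fE c : (fun z => pmx c G z i j) = partial c (fun z => G z i j).
    by apply/funext => z; rewrite pmxE.
  by rewrite !fE; exact: (partialC d b oU (sG i j) Uy).
move: sw; rewrite !key; rewrite !Riem_def => sw.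
apply/eqP; rewrite -subr_eq0 opprK; apply/eqP.
rewrite trmx_mul (symG Uy) !(trmxD, trmxN) !trmx_mul.
move/eqP : sw; rewrite -subr_eq0 => /eqP sw; rewrite -[RHS]sw.
rewrite !(mulmxDl, mulmxDr, mulNmx, mulmxN) !mulmxA.
apply/matrixP => i j; rewrite !(mxDE, mxNE); ring.
Qed.

Fact ric_key : {f : V -> 'M[R]_m | forall y, f y = \matrix_(a, b) \sum_k
    (partial k (chr k a b) y - partial b (chr k a k) y +
     \sum_l (chr k k l y * chr l a b y - chr k b l y * chr l a k y))}.
Proof. by eexists. Qed.

Definition ric := sval ric_key.

Lemma ricE y a b : ric y a b = \sum_k
    (partial k (chr k a b) y - partial b (chr k a k) y +
     \sum_l (chr k k l y * chr l a b y - chr k b l y * chr l a k y)).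
Proof. by rewrite /ric (svalP ric_key) mxE. Qed.

Lemma pmx_Gam d b c k y : pmx d (Gam b) y c k = partial d (chr k b c) y.
Proof.
by rewrite pmxE; congr (partial _ _ _); apply/funext => z; rewrite GamE.
Qed.

Lemma partial_chr_sym d k a b y : U y -> partial d (chr k a b) y = partial d (chr k b a) y.
Proof. by move=> Uy; apply: (partial_eq_on d oU _ Uy) => z Uz; exact: chr_sym. Qed.

Lemma ric_Riem a b y : U y -> ric y a b = \sum_k Riem k b y a k.
Proof.
move=> Uy; rewrite ricE; apply: eq_bigr => k _.
rewrite RiemE !pmx_Gam sumrB (partial_chr_sym k k a b Uy) (partial_chr_sym b k a k Uy) addrA.
congr (_ + _ - _); apply: eq_bigr => l _; rewrite !GamE.
  by rewrite mulrC (chr_sym l b a Uy).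
by rewrite mulrC (chr_sym l k a Uy).
Qed.

(** The skew part of [ric] is the trace of the curvature endomorphism, which vanishes because
    [Riem a b y *m G y] is skew while [H] is symmetric. *)
Lemma ric_sym y : U y -> (ric y)^T = ric y.
Proof.
move=> Uy.
have trR a b : \tr (Riem a b y) = 0.
  have := tr_sym_anti (symH Uy) (Riem_anti a b Uy).
  by rewrite mxtrace_mulC -mulmxA GH// mulmx1.
have E a b : ric y a b - ric y b a = \tr (Riem a b y).
  have -> : \tr (Riem a b y) = \sum_k (partial a (chr k b k) y - partial b (chr k a k) y).
    by rewrite tr_Riem; apply: eq_bigr => k _; rewrite !pmx_Gam.
  rewrite !ricE !big_split/= !sumrN.
  have -> : \sum_k partial k (chr k b a) y = \sum_k partial k (chr k a b) y.
    by apply: eq_bigr => k _; exact: partial_chr_sym.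
  set A := \sum_k partial k _ y; set B := \sum_k partial b _ y; set C := \sum_k partial a _ y.
  set X := \sum_i \sum_l (_ - _); set Y := \sum_i \sum_l (_ - _).
  suff -> : X = Y by ring.
  rewrite /X /Y.
  under eq_bigr do rewrite sumrB.
  under [RHS]eq_bigr do rewrite sumrB.
  rewrite !sumrB; congr (_ - _).
    by apply: eq_bigr => k _; apply: eq_bigr => l _; rewrite (chr_sym l a b Uy).
  rewrite exchange_big; apply: eq_bigr => k _; apply: eq_bigr => l _.
  by rewrite mulrC (chr_sym l b k Uy) (chr_sym k a l Uy) (chr_sym l k b Uy) (chr_sym k l a Uy).
apply/matrixP => b a; rewrite mxE; apply/eqP.
by rewrite -subr_eq0 E trR.
Qed.

Lemma H_sumC (F : 'I_m -> 'I_m -> R) y : U y ->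
  \sum_k \sum_c H y k c * F k c = \sum_k \sum_c H y k c * F c k.
Proof.
move=> Uy; rewrite exchange_big; apply: eq_bigr => k _; apply: eq_bigr => c _.
by have /matrixP/(_ k c) := symH Uy; rewrite mxE => ->.
Qed.

Lemma tr_H_sum (A : 'M[R]_m) y : U y ->
  \tr (H y *m A) = \sum_k \sum_c H y k c * A k c.
Proof. by move=> Uy; rewrite tr_mulE -H_sumC. Qed.

(** The Ricci operator in harmonic coordinates, that is under the condition [trChr] below. Its form
    is the one in which curvature appears in the traced second derivative of a differential. *)
Definition ricA y : 'M[R]_m :=
  \sum_k \sum_c H y k c *: (Gam k y *m Gam c y - pmx k (Gam c) y).

Lemma ricAE y b l : ricA y b l = \sum_k \sum_c H y k c *
  (\sum_j Gam k y b j * Gam c y j l - pmx k (Gam c) y b l).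
Proof.
rewrite summxE; apply: eq_bigr => k _; rewrite summxE; apply: eq_bigr => c _.
by rewrite mxZE mxDE mxNE; congr (_ * (_ - _)); rewrite mxE.
Qed.

Context (trChr : forall k y, U y -> \tr (H y *m Chr k y) = 0).

(** Of the four terms of [Riem], one contraction vanishes by [trChr], and the derivative in
    direction [b] becomes twice a product of symbols by [tr_H_deriv]. The remaining quadratic
    contraction equals that product by the symmetry of lower indices. *)
Lemma ric_tr_sum y b l : U y ->
  \sum_k \sum_c H y k c * Riem k b y c l = - ricA y b l.
Proof.
move=> Uy; rewrite ricAE.
have E2 : \sum_k \sum_c H y k c * pmx b (Gam k) y c l =
    2 * \sum_k \sum_c H y k c * (\sum_j Gam b y k j * chr l j c y).
  rewrite [X in _ * X](_ : _ = \tr (H y *m Gam b y *m Chr l y)); last first.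
    rewrite -mulmxA tr_H_sum//; apply: eq_bigr => k _; apply: eq_bigr => c _; congr (_ * _).
    by rewrite mxE; apply: eq_bigr => j _; rewrite ChrE.
  rewrite -tr_H_deriv//; [|exact: Chr_msmooth|by move=> z Uz; exact: Chr_sym|by move=> z Uz; exact: trChr].
  rewrite tr_H_sum//; apply: eq_bigr => k _; apply: eq_bigr => c _; congr (_ * _).
  by rewrite pmx_Gam pmxE; congr (partial _ _ _); apply/funext => z; rewrite ChrE.
have E4 : \sum_k \sum_c H y k c * (\sum_j Gam k y c j * Gam b y j l) = 0.
  transitivity (\sum_j Gam b y j l * \tr (H y *m Chr j y)); last first.
    by rewrite big1// => j _; rewrite trChr// mulr0.
  under [RHS]eq_bigr => j _ do rewrite tr_H_sum// mulr_sumr.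
  rewrite [RHS]exchange_big; apply: eq_bigr => k _.
  under [RHS]eq_bigr => j _ do rewrite mulr_sumr.
  rewrite [RHS]exchange_big; apply: eq_bigr => c _; rewrite mulr_sumr; apply: eq_bigr => j _.
  by rewrite GamE ChrE; ring.
have E3 : \sum_k \sum_c H y k c * (\sum_j Gam b y c j * Gam k y j l) =
    \sum_k \sum_c H y k c * (\sum_j Gam b y k j * chr l j c y).
  rewrite H_sumC//; apply: eq_bigr => k _; apply: eq_bigr => c _; congr (_ * _).
  by apply: eq_bigr => j _; rewrite [Gam c y j l]GamE (chr_sym l c j Uy).
have E5 : \sum_k \sum_c H y k c * (\sum_j Gam k y b j * Gam c y j l) =
    \sum_k \sum_c H y k c * (\sum_j Gam b y k j * chr l j c y).
  apply: eq_bigr => k _; apply: eq_bigr => c _; congr (_ * _).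
  apply: eq_bigr => j _; rewrite [Gam c y j l]GamE (chr_sym l c j Uy).
  by rewrite (Gam_sym k b j Uy).
have E1 : \sum_k \sum_c H y k c * pmx k (Gam b) y c l =
    \sum_k \sum_c H y k c * pmx k (Gam c) y b l.
  apply: eq_bigr => k _; apply: eq_bigr => c _; congr (_ * _).
  by rewrite !pmx_Gam; exact: partial_chr_sym.
transitivity (\sum_k \sum_c H y k c * pmx k (Gam b) y c l
  - \sum_k \sum_c H y k c * pmx b (Gam k) y c l
  + \sum_k \sum_c H y k c * (\sum_j Gam b y c j * Gam k y j l)
  - \sum_k \sum_c H y k c * (\sum_j Gam k y c j * Gam b y j l)).
  rewrite -!(sumrN, big_split)/=; apply: eq_bigr => k _.
  rewrite -!(sumrN, big_split)/=; apply: eq_bigr => c _.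
  by rewrite RiemE; ring.
transitivity (- (\sum_k \sum_c H y k c * (\sum_j Gam k y b j * Gam c y j l)
   - \sum_k \sum_c H y k c * pmx k (Gam c) y b l)); last first.
  congr (- _); rewrite -!(sumrN, big_split)/=; apply: eq_bigr => k _.
  rewrite -!(sumrN, big_split)/=; apply: eq_bigr => c _; ring.
rewrite E1 E2 E3 E4 E5; ring.
Qed.

(** Skew-symmetry of the curvature moves the contraction defining [ric] to the pair of indices
    handled by [ric_tr_sum]. *)
Lemma ric_ricA y : U y -> (ric y)^T = ricA y *m G y.
Proof.
move=> Uy; apply/matrixP => b a; rewrite mxE (ric_Riem _ _ Uy).
have RE k : Riem k b y = - (G y *m (Riem k b y)^T *m H y).
  rewrite -{1}(mulmx1 (Riem k b y)) -(GH Uy) mulmxA -mulNmx; congr (_ *m _).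
  apply/eqP; rewrite -eqr_oppLR -(Riem_anti k b Uy) trmx_mul.
  by rewrite (symG Uy).
under eq_bigr => k _ do rewrite RE mxNE mxE.
transitivity (- \sum_l G y a l * \sum_k \sum_c H y k c * Riem k b y c l); last first.
  rewrite [RHS]mxE -sumrN; apply: eq_bigr => l _; rewrite ric_tr_sum//.
  have /matrixP/(_ a l) := symG Uy; rewrite mxE => ->; ring.
rewrite sumrN; congr (- _).
under [RHS]eq_bigr => l _ do rewrite mulr_sumr.
rewrite [RHS]exchange_big; apply: eq_bigr => k _.
under [RHS]eq_bigr => l _ do rewrite mulr_sumr.
rewrite [RHS]exchange_big; apply: eq_bigr => c _.
rewrite mxE mulr_suml; apply: eq_bigr => l _; rewrite mxE.
have /matrixP/(_ k c) := symH Uy; rewrite mxE => ->; ring.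
Qed.

Fact hess_key : {f : (V -> R) -> V -> 'M[R]_m |
  forall u y, f u y = \matrix_(a, b) partial a (partial b u) y}.
Proof. by eexists. Qed.

Definition hess := sval hess_key.

Lemma hessE u y a b : hess u y a b = partial a (partial b u) y.
Proof. by rewrite /hess (svalP hess_key) mxE. Qed.

Fact drow_key : {f : (V -> R) -> V -> 'rV[R]_m | forall u y, f u y = \row_a partial a u y}.
Proof. by eexists. Qed.

Definition drow := sval drow_key.

Lemma drow_def u y : drow u y = \row_a partial a u y.
Proof. by rewrite /drow (svalP drow_key). Qed.

Lemma drowE u y i a : drow u y i a = partial a u y.
Proof. by rewrite drow_def mxE. Qed.

Lemma hess_msmooth u : smooth U u -> msmooth U (hess u).
Proof.
move=> su a b; apply: (@smooth_on_eq _ _ _ (partial a (partial b u))) => [//|y _|].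
  by rewrite hessE.
by do 2 apply: smooth_on_partial.
Qed.

Lemma drow_msmooth u : smooth U u -> msmooth U (drow u).
Proof.
move=> su a b; apply: (@smooth_on_eq _ _ _ (partial b u)) => [//|y _|].
  by rewrite drowE.
exact: smooth_on_partial.
Qed.

Lemma hess_sym u y : smooth U u -> U y -> (hess u y)^T = hess u y.
Proof.
by move=> su Uy; apply/matrixP => a b; rewrite mxE !hessE (partialC b a oU su Uy).
Qed.

Lemma pmx_drow u b y i c : pmx b (drow u) y i c = hess u y b c.
Proof. by rewrite pmxE hessE; congr partial; apply/funext => z; rewrite drowE. Qed.

Lemma pmx_hess u l y b c : pmx l (hess u) y b c = partial l (partial b (partial c u)) y.
Proof.
have fE : (fun z => hess u z b c) = partial b (partial c u).
  by apply/funext => z; rewrite hessE.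
by rewrite pmxE fE.
Qed.

Section Energy.
Context (u : V -> R) (su : smooth U u)
  (trhess : forall y, U y -> \tr (H y *m hess u y) = 0).

(* chess is the covariant Hessian and energy is |du|^2. *)
Definition grad y : 'rV[R]_m := drow u y *m H y.
Definition chess y : 'M[R]_m := hess u y - \sum_k drow u y 0 k *: Chr k y.
Definition energy y : R := (drow u y *m H y *m (drow u y)^T) 0 0.

Lemma chess_sym y : U y -> (chess y)^T = chess y.
Proof.
move=> Uy; apply/matrixP => a b; rewrite mxE !mxDE !mxNE !summxE.
have /matrixP/(_ a b) := hess_sym su Uy; rewrite mxE => ->; congr (_ - _).
by apply: eq_bigr => k _; rewrite !mxZE !ChrE (chr_sym k b a Uy).
Qed.

Lemma row_chess c y : U y ->
  row c (chess y) = pmx c (drow u) y - drow u y *m (Gam c y)^T.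
Proof.
move=> Uy; apply/rowP => b; rewrite mxE !mxDE !mxNE pmx_drow; congr (_ - _).
rewrite summxE mxE; apply: eq_bigr => k _; rewrite mxZE ChrE mxE GamE.
by rewrite (chr_sym k c b Uy).
Qed.

Lemma pmx_grad b y : U y ->
  pmx b grad y = row b (chess y) *m H y - grad y *m Gam b y.
Proof.
move=> Uy; rewrite (pmxM b (drow_msmooth su) sH Uy) (pmx_H b Uy) (row_chess b Uy).
by rewrite /grad mulmxBr mulmxN mulmxBl !mulmxA addrA addrAC.
Qed.

Lemma grad_msmooth : msmooth U grad.
Proof. by apply: msmoothM => //; exact: drow_msmooth. Qed.

Lemma partial_energy b y : U y ->
  partial b energy y = 2 * (grad y *m (row b (chess y))^T) 0 0.
Proof.
move=> Uy.
have -> : partial b energy y = pmx b (fun y => grad y *m (drow u y)^T) y 0 0.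
  by rewrite pmxE.
rewrite (pmxM b grad_msmooth (msmooth_tr oU (drow_msmooth su)) Uy) pmx_tr (pmx_grad b Uy).
rewrite (row_chess b Uy) mxDE.
set d := pmx b (drow u) y.
have -> : ((d - drow u y *m (Gam b y)^T) *m H y - grad y *m Gam b y) *m (drow u y)^T =
  (grad y *m (d - drow u y *m (Gam b y)^T)^T) - grad y *m Gam b y *m (drow u y)^T.
  rewrite mulmxBl; congr (_ - _); rewrite -[LHS]tr11 !trmx_mul !trmxK symH//.
  by rewrite mulmxA.
have -> : grad y *m (d - drow u y *m (Gam b y)^T)^T =
    grad y *m d^T - grad y *m Gam b y *m (drow u y)^T.
  by rewrite linearB/= trmx_mul trmxK mulmxBr mulmxA.
by rewrite !(mxDE, mxNE); ring.
Qed.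

Lemma drow_energy y : U y -> drow energy y = 2 *: (grad y *m chess y).
Proof.
move=> Uy; apply/rowP => b; rewrite drowE (partial_energy b Uy) mxZE; congr (_ * _).
by rewrite row_mul_sym// chess_sym.
Qed.

(** The second covariant derivative of du is left expanded in coordinates: only its trace against
    [H] is needed, and the cancellations take place there. *)
Lemma hess_energy b c y : U y -> hess energy y b c = 2 *
  ((chess y *m H y *m chess y) b c +
   (grad y *m (pmx b (pmx c (drow u)) y - pmx c (drow u) y *m (Gam b y)^T
      - pmx b (drow u) y *m (Gam c y)^T
      + drow u y *m (Gam b y *m Gam c y - pmx b (Gam c) y)^T)^T) 0 0).
Proof.
move=> Uy; rewrite hessE.
have sd a : msmooth U (pmx a (drow u)) by apply: msmooth_pmx => //; exact: drow_msmooth.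
have sdG a : msmooth U (fun y => drow u y *m (Gam a y)^T).
  by apply: msmoothM => //; [exact: drow_msmooth|apply: msmooth_tr => //; exact: Gam_msmooth].
pose L z := pmx c (drow u) z - drow u z *m (Gam c z)^T.
have sL : msmooth U L.
  move=> i j; apply: (@smooth_on_eq _ _ _ (fun y => pmx c (drow u) y i j -
    (drow u y *m (Gam c y)^T) i j)) => [//|z _|]; first by rewrite mxDE mxNE.
  by apply: smooth_onB => //; [exact: sd|exact: sdG].
have -> : partial b (partial c energy) y =
    pmx b (fun y => 2 *: (grad y *m (L y)^T)) y 0 0.
  rewrite pmxE; apply: (partial_eq_on b oU _ Uy) => z Uz.
  by rewrite (partial_energy c Uz) mxZE (row_chess c Uz).
have sLt := msmooth_tr oU sL.
rewrite (pmxZ b 2 oU (msmoothM oU grad_msmooth sLt) Uy) mxZE; congr (_ * _).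
rewrite (pmxM b grad_msmooth sLt Uy) pmx_tr (pmx_grad b Uy).
have -> : pmx b L y = pmx b (pmx c (drow u)) y -
    (pmx b (drow u) y *m (Gam c y)^T + drow u y *m (pmx b (Gam c) y)^T).
  rewrite (pmxB b oU (sd c) (sdG c) Uy).
  rewrite (pmxM b (drow_msmooth su) (msmooth_tr oU (Gam_msmooth c)) Uy).
  by rewrite pmx_tr.
have LE : L y = row c (chess y) by rewrite row_chess.
rewrite mulmxBl -addrA mxDE; congr (_ + _).
  by rewrite LE row_mul_sym ?chess_sym// -!row_mul mxE.
have -> : grad y *m Gam b y *m (L y)^T = grad y *m (L y *m (Gam b y)^T)^T.
  by rewrite trmx_mul trmxK mulmxA.
rewrite addrC -mulmxBr -trmxB; congr ((_ *m _^T) 0 0).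
rewrite /L mulmxBl (trmxB (Gam b y *m _)) trmx_mul mulmxBr mulmxA.
apply/rowP => l; rewrite !(mxDE, mxNE); ring.
Qed.

(** Bochner's formula for a harmonic function in harmonic coordinates, where the trace of the
    coordinate Hessian against [H] is the Laplacian. *)
Lemma laplacian_energy y : U y ->
  \tr (H y *m hess energy y) =
  2 * \tr (H y *m chess y *m H y *m chess y) + 2 * (grad y *m ric y *m (grad y)^T) 0 0.
Proof.
move=> Uy; rewrite tr_H_sum// -mulrDr.
under eq_bigr => b _ do under eq_bigr => c _ do rewrite hess_energy// mulrCA mulrDr.
under eq_bigr => b _ do rewrite -mulr_sumr big_split/=.
rewrite -mulr_sumr big_split/=; congr (_ * (_ + _)).
  by rewrite -!mulmxA tr_H_sum// !mulmxA.
pose F b c := pmx b (pmx c (drow u)) y - pmx c (drow u) y *m (Gam b y)^T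
      - pmx b (drow u) y *m (Gam c y)^T
      + drow u y *m (Gam b y *m Gam c y - pmx b (Gam c) y)^T.
transitivity ((grad y *m (\sum_b \sum_c H y b c *: F b c)^T) 0 0).
  rewrite linear_sum mulmx_sumr summxE; apply: eq_bigr => b _.
  rewrite linear_sum mulmx_sumr summxE; apply: eq_bigr => c _.
  by rewrite linearZ/= -scalemxAr mxZE.
suff -> : \sum_b \sum_c H y b c *: F b c = grad y *m ric y.
  by rewrite trmx_mul ric_sym// mulmxA.
have -> : grad y *m ric y = drow u y *m (ricA y)^T.
  rewrite -[ric y]trmxK ric_ricA// trmx_mul symG// mulmxA /grad -(mulmxA (drow u y)).
  by rewrite HG// mulmx1.
apply/rowP => l; rewrite summxE.
(* The third derivatives are the derivative of the trace-free matrix [hess u], so [tr_H_deriv]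
   expresses them by second derivatives. These cancel the two mixed terms and leave [ricA]. *)
have cancel : \sum_b \sum_c H y b c * (pmx b (pmx c (drow u)) y 0 l) =
    2 * \sum_b \sum_c H y b c * (pmx c (drow u) y *m (Gam b y)^T) 0 l.
  transitivity (\tr (H y *m pmx l (hess u) y)).
    rewrite tr_H_sum//; apply: eq_bigr => b _; apply: eq_bigr => c _; congr (_ * _).
    have E1 : pmx b (pmx c (drow u)) y 0 l = partial b (partial c (partial l u)) y.
      rewrite pmxE; apply: (partial_eq_on b oU _ Uy) => z Uz.
      by rewrite pmx_drow hessE.
    have E2 : pmx l (hess u) y b c = partial l (partial b (partial c u)) y.
      exact: pmx_hess.
    rewrite E1 E2 (partialC l b oU (smooth_on_partial c su) Uy).
    apply: (partial_eq_on b oU _ Uy) => z Uz.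
    exact: (partialC c l oU su Uz).
  rewrite tr_H_deriv//; [|exact: hess_msmooth|by move=> z Uz; exact: hess_sym].
  rewrite -mulmxA tr_H_sum//; congr (_ * _); apply: eq_bigr => b _; apply: eq_bigr => c _.
  congr (_ * _); rewrite !mxE; apply: eq_bigr => k _; rewrite pmx_drow mxE mulrC.
  have /matrixP/(_ c k) := hess_sym su Uy; rewrite mxE => ->.
  by rewrite (Gam_sym b l k Uy).
have cancel' : \sum_b \sum_c H y b c * (pmx b (drow u) y *m (Gam c y)^T) 0 l =
    \sum_b \sum_c H y b c * (pmx c (drow u) y *m (Gam b y)^T) 0 l.
  exact: (H_sumC (fun b c => (pmx b (drow u) y *m (Gam c y)^T) 0 l)).
transitivity (\sum_b \sum_c H y b c * (pmx b (pmx c (drow u)) y 0 l)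
   - \sum_b \sum_c H y b c * (pmx c (drow u) y *m (Gam b y)^T) 0 l
   - \sum_b \sum_c H y b c * (pmx b (drow u) y *m (Gam c y)^T) 0 l
   + \sum_b \sum_c H y b c * (drow u y *m (Gam b y *m Gam c y - pmx b (Gam c) y)^T) 0 l).
  rewrite -!(sumrN, big_split)/=; apply: eq_bigr => b _.
  rewrite summxE -!(sumrN, big_split)/=; apply: eq_bigr => c _.
  by rewrite mxZE /F !(mxDE, mxNE); ring.
rewrite cancel cancel' -[RHS]add0r; congr (_ + _); first by ring.
rewrite /ricA linear_sum mulmx_sumr summxE; apply: eq_bigr => b _.
rewrite linear_sum mulmx_sumr summxE; apply: eq_bigr => c _.
by rewrite linearZ/= -scalemxAr mxZE.
Qed.

End Energy.
End LocalGeometry.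

(** * Consequences of a complex structure compatible with the metric *)

Section ComplexStructure.
Context {R : realType} {m : nat}.
Local Notation V := 'rV[R]_m.
Implicit Types (P Q : 'I_m -> 'M[R]_m) (x y z : V).

Definition tri P x y z : R := \sum_k x 0 k * (y *m P k *m z^T) 0 0.

Lemma triE P x y z : tri P x y z = \sum_k \sum_i \sum_j x 0 k * y 0 i * z 0 j * P k i j.
Proof.
apply: eq_bigr => k _; rewrite bilE mulr_sumr; apply: eq_bigr => i _.
by rewrite mulr_sumr; apply: eq_bigr => j _; ring.
Qed.

Lemma triC P x y z : (forall k, (P k)^T = P k) -> tri P x y z = tri P x z y.
Proof. by move=> sP; apply: eq_bigr => k _; rewrite -{1}[P k]sP bil_tr. Qed.

Lemma triN2 P x y z : tri P x (- y) z = - tri P x y z.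
Proof.
rewrite -sumrN; apply: eq_bigr => k _; rewrite mulNmx mulNmx mxNE; ring.
Qed.

Lemma tri_cycle Q x y z : (forall a b c, Q a b c + Q b c a + Q c a b = 0) ->
  tri Q x y z + tri Q y z x + tri Q z x y = 0.
Proof.
move=> Q0; rewrite !triE.
rewrite [X in _ + X + _]exchange_big/= [X in _ + X + _](_ : _ =
  \sum_k \sum_i \sum_j x 0 k * y 0 i * z 0 j * Q i j k); last first.
  rewrite (eq_bigr (fun j => \sum_k \sum_i x 0 k * y 0 i * z 0 j * Q i j k)).
    rewrite exchange_big; apply: eq_bigr => k _; rewrite exchange_big.
    by apply: eq_bigr.
  move=> j _; rewrite exchange_big; apply: eq_bigr => k _; apply: eq_bigr => i _; ring.
rewrite [X in _ + _ + X](_ : _ =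
  \sum_k \sum_i \sum_j x 0 k * y 0 i * z 0 j * Q j k i); last first.
  rewrite exchange_big; apply: eq_bigr => k _; rewrite exchange_big.
  by apply: eq_bigr => i _; apply: eq_bigr => j _; ring.
rewrite -!big_split/= big1// => k _; rewrite -!big_split/= big1// => i _.
rewrite -!big_split/= big1// => j _; rewrite -!mulrDr.
by rewrite Q0 mulr0.
Qed.

Context (J : 'M[R]_m) (tJ : J^T = - J) (JJ : J *m J = - 1%:M).

Lemma JtJ : J^T *m J = 1%:M. Proof. by rewrite tJ mulNmx JJ opprK. Qed.

Lemma J_twice x : x *m J *m J = - x.
Proof. by rewrite -mulmxA JJ mulmxN mulmx1. Qed.

(** Twice the Christoffel symbol of the first kind, as a trilinear form, when [P k] is the
    derivative of the metric in direction [k]. *)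
Definition first_chr P x y z : R := tri P x y z + tri P y x z - tri P z x y.

(** The real form of the vanishing of the symbols with lower indices of mixed type. It is the sum of
    the closedness relation for (x J, y, z) and the one for (y J, x, z), simplified by J^2 = -1 and
    the invariance of each [P k]. *)
Lemma first_chr_J P x y z : (forall k, (P k)^T = P k) ->
  (forall k, J *m P k *m J^T = P k) ->
  (forall a b c, (J *m P a) b c + (J *m P b) c a + (J *m P c) a b = 0) ->
  first_chr P (x *m J) (y *m J) z = - first_chr P x y z.
Proof.
move=> sP hP cP.
have JT u v w : tri P u (v *m J) (w *m J) = tri P u v w.
  apply: eq_bigr => k _; congr (_ * _); rewrite trmx_mul.
  by rewrite -{2}(hP k) !mulmxA.
have cyc u v w : tri P u (v *m J) w + tri P v (w *m J) u + tri P w (u *m J) v = 0.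
  rewrite -[RHS](tri_cycle u v w cP); congr (_ + _ + _);
  by apply: eq_bigr => k _; rewrite !mulmxA.
have h1 := cyc (x *m J) y z; rewrite J_twice triN2 JT in h1.
have h2 := cyc (y *m J) x z; rewrite J_twice triN2 JT in h2.
rewrite /first_chr JT.
move: h1 h2; rewrite (triC y z x sP) (triC x z y sP) (triC z y x sP).
set a := tri P (x *m J) _ _; set b := tri P (y *m J) _ _; lra.
Qed.

Lemma J_inv_mx (G H : 'M[R]_m) : H *m G = 1%:M -> G *m H = 1%:M ->
  J *m G *m J^T = G -> J *m H *m J^T = H.
Proof.
move=> HG GH hG.
have E : J *m H *m J^T *m G = 1%:M.
  rewrite -hG !mulmxA -(mulmxA (J *m H)) JtJ mulmx1 -(mulmxA J) HG mulmx1.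
  by rewrite tJ mulmxN JJ opprK.
by rewrite -[LHS]mulmx1 -GH mulmxA E mul1mx.
Qed.

(** Conjugation by J preserves the trace but changes the sign of [A]. This one fact makes
    coordinates, pluriharmonic functions and holomorphic transitions harmonic. *)
Lemma tr_J_anti (H A : 'M[R]_m) : J *m H *m J^T = H -> J *m A *m J^T = - A ->
  \tr (H *m A) = 0.
Proof.
move=> hH hA; have : \tr (H *m A) = - \tr (H *m A).
  rewrite -{1}hH -!mulmxA mxtrace_mulC -!mulmxA.
  have -> : J^T *m (A *m J) = - A by rewrite -hA tJ !mulmxN !mulNmx mulmxA.
  by rewrite mulmxN mxtraceN.
lra.
Qed.

End ComplexStructure.

(** * The refined Kato inequality *)

Section Kato.
Context {R : realType} {m : nat}.
Implicit Types (x z v d : 'rV[R]_m).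

Definition dot x z : R := (x *m z^T) 0 0.

Lemma dotE x z : dot x z = \sum_i x 0 i * z 0 i.
Proof. by rewrite /dot mxE; apply: eq_bigr => i _; rewrite mxE. Qed.

Lemma dotC x z : dot x z = dot z x.
Proof. by rewrite !dotE; apply: eq_bigr => i _; rewrite mulrC. Qed.

Lemma dot_ge0 x : 0 <= dot x x.
Proof. by rewrite dotE; apply: sumr_ge0 => i _; rewrite -expr2 sqr_ge0. Qed.

Lemma dot_eq0 x z : dot x x = 0 -> dot x z = 0.
Proof.
rewrite !dotE => /eqP; rewrite psumr_eq0 => [/allP h|i _]; last by rewrite -expr2 sqr_ge0.
apply: big1 => i _; have := h i (mem_index_enum i).
by rewrite -expr2 sqrf_eq0 => /eqP->; rewrite mul0r.
Qed.

(** Bessel's inequality for two orthogonal vectors of common squared length [w], including w = 0,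
    where both products vanish. Otherwise expand the square of w v - a x - b z. *)
Lemma bessel x z v w : dot x x = w -> dot z z = w -> dot x z = 0 ->
  dot x v ^+ 2 + dot z v ^+ 2 <= w * dot v v.
Proof.
move=> xx zz xz; have w0 : 0 <= w by rewrite -xx dot_ge0.
have [w00|wn0] := eqVneq w 0.
  have -> : dot x v = 0 by apply: dot_eq0; rewrite xx.
  have -> : dot z v = 0 by apply: dot_eq0; rewrite zz.
  by rewrite w00 mul0r expr0n addr0.
have wp : 0 < w by rewrite lt_def wn0.
set a := dot x v; set b := dot z v.
have := dot_ge0 (w *: v - a *: x - b *: z).
have -> : dot (w *: v - a *: x - b *: z) (w *: v - a *: x - b *: z) =
  w * (w * dot v v - (a ^+ 2 + b ^+ 2)).
  have E y1 y2 c1 c2 c3 : dot (c1 *: v - c2 *: x - c3 *: z) (y1 - y2) =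
     c1 * (dot v y1 - dot v y2) - c2 * (dot x y1 - dot x y2) - c3 * (dot z y1 - dot z y2).
    rewrite !dotE -!sumrB !mulr_sumr -!sumrB; apply: eq_bigr => i _.
    by rewrite !(mxDE, mxNE, mxZE); ring.
  have F y1 y2 y3 c1 c2 : dot y1 (c1 *: y2 - c2 *: y3) = c1 * dot y1 y2 - c2 * dot y1 y3.
    rewrite !dotE !mulr_sumr -!sumrB; apply: eq_bigr => i _.
    by rewrite !(mxDE, mxNE, mxZE); ring.
  have F1 y1 y2 c1 : dot y1 (c1 *: y2) = c1 * dot y1 y2.
    rewrite !dotE !mulr_sumr; apply: eq_bigr => i _.
    by rewrite !mxZE; ring.
  rewrite E !F !F1 (dotC v x) (dotC v z) (dotC z x) xx zz xz -/a -/b; ring.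
by rewrite pmulr_rge0// subr_ge0.
Qed.

Context (J H A : 'M[R]_m) (tJ : J^T = - J) (JJ : J *m J = - 1%:M)
  (symH : H^T = H) (posH : posdef H) (hH : J *m H *m J^T = H)
  (symA : A^T = A) (hA : J *m A *m J^T = - A).

(* The rows d and d J are orthogonal of the same length, and A has the same
   size on both, hence the factor 2 against the Hilbert-Schmidt norm of A. *)
Lemma kato d : 0 <= \tr (H *m A *m H *m A) /\
  2 * (d *m H *m A *m H *m A *m H *m d^T) 0 0 <=
  (d *m H *m d^T) 0 0 * \tr (H *m A *m H *m A).
Proof.
(* In the frame of the factor [E] the product of rows defined by [H] becomes the standard one, and
   [B] represents [A]. *)
have [E _ HE] := cholesky symH posH.
pose B := E^T *m A *m E.
have sB : B^T = B by rewrite /B !trmx_mul trmxK symA mulmxA.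
have BB : \tr (H *m A *m H *m A) = \sum_r dot (row r B) (row r B).
  transitivity (\tr (B *m B^T)).
    rewrite sB /B HE -!mulmxA [RHS]mxtrace_mulC -!mulmxA.
    by rewrite [RHS]mxtrace_mulC -!mulmxA.
  by apply: eq_bigr => r _; rewrite dotE mxE; apply: eq_bigr => i _; rewrite !mxE.
have dB x : dot (x *m E *m B) (x *m E *m B) = (x *m H *m A *m H *m A *m H *m x^T) 0 0.
  by rewrite /dot trmx_mul sB trmx_mul /B HE !mulmxA.
have dd x : dot (x *m E) (x *m E) = (x *m H *m x^T) 0 0.
  by rewrite /dot trmx_mul HE !mulmxA.
have JH : J *m H = H *m J by rewrite -{2}hH -mulmxA JtJ// mulmx1.
have JA : J *m A = - (A *m J).
  have <- : J *m A *m J^T *m J = J *m A by rewrite -mulmxA JtJ// mulmx1.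
  by rewrite hA mulNmx.
have JHA : J *m (H *m A *m H *m A *m H) = H *m A *m H *m A *m H *m J.
  rewrite !mulmxA JH -(mulmxA H J) JA mulmxN !mulNmx -!mulmxA (mulmxA J H) JH -!mulmxA.
  rewrite (mulmxA J A) JA !mulNmx !mulmxN opprK -!mulmxA JH.
  by rewrite !mulmxA.
have JJt : J *m J^T = 1%:M by rewrite tJ mulmxN JJ opprK.
split; first by rewrite BB; apply: sumr_ge0 => r _; exact: dot_ge0.
have n2 : dot (d *m J *m E) (d *m J *m E) = (d *m H *m d^T) 0 0.
  rewrite dd trmx_mul !mulmxA -(mulmxA d J) JH !mulmxA -(mulmxA _ J) JJt mulmx1 //.
have n2' : dot (d *m J *m E *m B) (d *m J *m E *m B) = dot (d *m E *m B) (d *m E *m B).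
  rewrite !dB trmx_mul.
  have -> : d *m J *m H *m A *m H *m A *m H = d *m (J *m (H *m A *m H *m A *m H)).
    by rewrite !mulmxA.
  by rewrite JHA !mulmxA -(mulmxA _ J) JJt mulmx1.
have orth : dot (d *m E) (d *m J *m E) = 0.
  have -> : dot (d *m E) (d *m J *m E) = (d *m (H *m J^T) *m d^T) 0 0.
    by rewrite /dot !trmx_mul HE !mulmxA.
  have : (d *m (H *m J^T) *m d^T) 0 0 = - (d *m (H *m J^T) *m d^T) 0 0.
    rewrite -{1}bil_tr (_ : (H *m J^T)^T = - (H *m J^T)).
      by rewrite mulmxN mulNmx mxNE.
    by rewrite trmx_mul trmxK symH JH tJ mulmxN opprK.
  lra.
have rB x r : (x *m B) 0 r = dot x (row r B).
  by rewrite -row_mul_sym.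
have sumB x : dot (x *m B) (x *m B) = \sum_r dot x (row r B) ^+ 2.
  by rewrite dotE; apply: eq_bigr => r _; rewrite rB expr2.
have -> : 2 * (d *m H *m A *m H *m A *m H *m d^T) 0 0 =
   \sum_r (dot (d *m E) (row r B) ^+ 2 + dot (d *m J *m E) (row r B) ^+ 2).
  by rewrite big_split/= -!sumB n2' dB; ring.
rewrite BB mulr_sumr; apply: ler_sum => r _.
by apply: bessel => //; rewrite dd.
Qed.

End Kato.

(** * The smallest eigenvalue as a minimum of the Rayleigh quotient *)

Section Rayleigh.
Context {R : realType} {m : nat}.
Implicit Types (x v : 'rV[R]_m).

Lemma qform_continuous (A : 'M[R]_m) : continuous (qform A).
Proof.
move=> v; apply: (@smooth_on_continuous _ _ setT) => //.
apply: (@smooth_on_eq _ _ _ (fun v : 'rV[R]_m => \sum_i \sum_j v 0 i * A i j * v 0 j)).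
- exact: openT.
- by move=> y _; rewrite qformE.
apply: smooth_on_sum => [|i]; first exact: openT.
apply: smooth_on_sum => [|j]; first exact: openT.
apply: smooth_onM => [||]; [exact: openT| |exact: smooth_on_coord openT].
by apply: smooth_onM; [exact: openT|exact: smooth_on_coord openT|exact: smooth_on_cst openT].
Qed.

Lemma qform_line (A : 'M[R]_m) (x v : 'rV[R]_m) (t : R) : A^T = A ->
  qform A (x + t *: v) = qform A x + 2 * t * (v *m A *m x^T) 0 0 + t ^+ 2 * qform A v.
Proof.
move=> sA; rewrite /qform trmxD [(t *: _)^T]linearZ/=.
rewrite !mulmxDl !mulmxDr -!scalemxAl -!scalemxAr.
have -> : x *m A *m v^T = v *m A *m x^T by rewrite -bil_tr sA.
by rewrite !(mxDE, mxZE); ring.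
Qed.

Lemma qformZ (A : 'M[R]_m) (t : R) v : qform A (t *: v) = t ^+ 2 * qform A v.
Proof.
by rewrite /qform [(t *: _)^T]linearZ/= -!scalemxAl -!scalemxAr !mxZE; ring.
Qed.

Lemma psd_kernel (Q : 'M[R]_m) v : Q^T = Q -> (forall x, 0 <= qform Q x) ->
  qform Q v = 0 -> v *m Q = 0.
Proof.
move=> sQ pQ v0; apply/rowP => i; rewrite [RHS]mxE.
pose e := delta_mx 0 i : 'rV[R]_m.
have eE : (v *m Q *m e^T) 0 0 = (v *m Q) 0 i.
  by rewrite /e trmx_delta -colE mxE.
set b := (v *m Q) 0 i in eE *; apply/eqP/negPn/negP => b0.
(* Since the form vanishes at [v], it is affine along this line; the parameter is chosen to give the
   value -1. *)
have := pQ (e + (- (qform Q e + 1) / (2 * b)) *: v); rewrite qform_line// v0 eE mulr0 addr0.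
have -> : 2 * (- (qform Q e + 1) / (2 * b)) * b = - (qform Q e + 1) by field.
by rewrite opprD addNKr oppr_ge0 ler10.
Qed.

(** The quotient attains its minimum on the unit sphere, at some [v]. There S - f(v) G is positive
    semidefinite and vanishes at [v], hence annihilates it, so f(v) is an eigenvalue of S H. Every
    eigenvalue is a value of the quotient, so the infimum is f(v). *)
Lemma rayleigh (G S H : 'M[R]_m) x : G^T = G -> posdef G -> S^T = S ->
  H *m G = 1%:M -> G *m H = 1%:M ->
  inf [set a : R | eigenvalue (S *m H) a] * qform G x <= qform S x.
Proof.
move=> sG pG sS HG GH; have [->|x0] := eqVneq x 0.
  by rewrite /qform !mul0mx mxE mulr0.
pose f v : R := qform S v / qform G v.
pose K := [set v : 'rV[R]_m | `|v| = 1].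
have Kn0 v : K v -> v != 0.
  by move=> Kv; apply/eqP => v0; move: Kv; rewrite /K/= v0 normr0 => /esym/eqP; rewrite oner_eq0.
have cK : compact K.
  apply: bounded_closed_compact.
    by exists 1; split => // r r1 v /= ->; exact: ltW.
  apply: (closed_comp (f := fun v : 'rV[R]_m => `|v|) (D := [set 1])).
    by move=> v _; exact: norm_continuous.
  exact: closed_eq.
have KN v : v != 0 -> K (`|v|^-1 *: v).
  by move=> v0; rewrite /K/= normrZ gtr0_norm ?invr_gt0 ?normr_gt0// mulVf// normr_eq0.
have cf : {within K, continuous f}.
  apply: continuous_in_subspaceT => v; rewrite inE => Kv.
  have Gv : qform G v != 0 by rewrite gt_eqF// pG// Kn0.
  exact: (continuousM (@qform_continuous S v) (continuousV Gv (@qform_continuous G v))).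
have [v Kv vmin] := @EVT_min_rV R m f K (ex_intro _ _ (KN x x0)) cK cf.
have v0 := Kn0 v (set_mem Kv).
have fmin z : f v * qform G z <= qform S z.
  have [->|z0] := eqVneq z 0; first by rewrite /qform !mul0mx mxE mulr0.
  rewrite -ler_pdivlMr ?pG//.
  have := vmin _ (mem_set (KN z z0)).
  rewrite /f !qformZ -mulf_div divff ?mul1r// expf_neq0// invr_eq0 normr_eq0//.
have sQ : (S - f v *: G)^T = S - f v *: G by rewrite trmxB [(f v *: G)^T]linearZ/= sG sS.
have QE z : qform (S - f v *: G) z = qform S z - f v * qform G z.
  by rewrite /qform mulmxBr mulmxBl -scalemxAr -scalemxAl mxDE mxNE mxZE.
have vQ : v *m (S - f v *: G) = 0.
  apply: psd_kernel => // [z|]; first by rewrite QE subr_ge0.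
  by rewrite QE /f divfK ?subrr// gt_eqF// pG.
have vE : v *m (S *m H) = f v *: v.
  move: vQ; rewrite mulmxBr => /eqP; rewrite subr_eq0 => /eqP vS.
  by rewrite mulmxA vS -scalemxAr -scalemxAl -mulmxA GH mulmx1.
have <- : f v = inf [set a : R | eigenvalue (S *m H) a].
  apply/eqP; rewrite eq_le; apply/andP; split.
    apply: lb_le_inf; first by exists (f v); apply/eigenvalueP; exists v.
    move=> a /eigenvalueP[z zE z0].
    have := fmin z; have -> : qform S z = a * qform G z.
      rewrite /qform -{1}(mulmx1 S) -HG !mulmxA -(mulmxA z) zE -!scalemxAl mxZE.
      by [].
    by rewrite ler_pM2r// pG.
  apply: ge_inf; last by apply/eigenvalueP; exists v.
  exists (f v) => a /eigenvalueP[z zE z0].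
  have := fmin z; have -> : qform S z = a * qform G z.
    by rewrite /qform -{1}(mulmx1 S) -HG !mulmxA -(mulmxA z) zE -!scalemxAl mxZE.
  by rewrite ler_pM2r// pG.
exact: fmin.
Qed.

End Rayleigh.

Section LogHessian.
Context {R : realType} {m : nat}.
Local Notation V := 'rV[R]_m.
Context (U : set V) (oU : open U) (f : V -> R) (sf : smooth U f)
  (f0 : forall y, U y -> 0 < f y).

Lemma partial_ln a y : U y -> partial a (fun y => ln (f y)) y = (f y)^-1 * partial a f y.
Proof.
move=> Uy; apply: partial_is_derive.
exact: is_derive_chain1 (is_derive1_ln (f0 Uy)) (smooth_is_derive a sf Uy).
Qed.

Lemma hess_ln y : U y -> hess (fun y => ln (f y)) y =
  (f y)^-1 *: hess f y - (f y)^-2 *: ((drow f y)^T *m drow f y).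
Proof.
move=> Uy; apply/matrixP => a b; rewrite mxDE mxNE !mxZE !hessE mxE big_ord1 mxE !drowE.
rewrite (partial_eq_on a oU (fun z => @partial_ln b z) Uy).
apply: partial_is_derive; have fy0 : f y != 0 by rewrite gt_eqF// f0.
have d1 := is_derive_chain1 (@is_deriveV R id (f y) 1 1 fy0 (is_derive_id _ _)) (smooth_is_derive a sf Uy).
have := is_deriveM d1 (smooth_is_derive a (smooth_on_partial b sf) Uy).
move=> d2; apply: is_derive_eq d2 _.
rewrite /GRing.scale/=; ring.
Qed.

End LogHessian.

(** * The Bochner inequality in a Kähler chart *)

Section KahlerLocal.
Context {R : realType} {m : nat}.
Local Notation V := 'rV[R]_m.
Context (U : set V) (oU : open U) (G H : V -> 'M[R]_m).
Context (sG : msmooth U G) (sH : msmooth U H)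
  (symG : forall y, U y -> (G y)^T = G y) (symH : forall y, U y -> (H y)^T = H y)
  (HG : forall y, U y -> H y *m G y = 1%:M) (GH : forall y, U y -> G y *m H y = 1%:M)
  (posG : forall y, U y -> posdef (G y)) (posH : forall y, U y -> posdef (H y)).
Context (J : 'M[R]_m) (tJ : J^T = - J) (JJ : J *m J = - 1%:M)
  (hG : forall y, U y -> J *m G y *m J^T = G y)
  (closedG : forall a b c y, U y -> (J *m pmx a G y) b c + (J *m pmx b G y) c a +
     (J *m pmx c G y) a b = 0).

Lemma hermH y : U y -> J *m H y *m J^T = H y.
Proof. by move=> Uy; apply: (J_inv_mx tJ JJ (HG Uy) (GH Uy)); exact: hG. Qed.

Lemma bil_ext (A B : 'M[R]_m) :
  (forall x z : 'rV[R]_m, (x *m A *m z^T) 0 0 = (x *m B *m z^T) 0 0) -> A = B.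
Proof.
move=> AB; apply/matrixP => i j; have := AB (delta_mx 0 i) (delta_mx 0 j).
by rewrite !trmx_delta -!rowE -!colE !mxE.
Qed.

Lemma Chr_first k y (x z : V) : U y -> (x *m Chr G H k y *m z^T) 0 0 =
  2^-1 * first_chr (fun k => pmx k G y) x z (row k (H y)).
Proof.
move=> Uy; rewrite bilE /first_chr !triE.
rewrite [X in _ + X - _]exchange_big/= [X in _ - X]exchange_big/=.
rewrite -sumrN -!big_split/= mulr_sumr; apply: eq_bigr => a _.
rewrite [X in _ - X]exchange_big/= -sumrN -!big_split/= mulr_sumr; apply: eq_bigr => b _.
rewrite -sumrN -!big_split/= ChrE chrE !mulr_sumr mulr_suml; apply: eq_bigr => l _.
rewrite mxE; ring.
Qed.

Lemma Chr_J k y : U y -> J *m Chr G H k y *m J^T = - Chr G H k y.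
Proof.
move=> Uy; apply: bil_ext => x z.
have -> : x *m (J *m Chr G H k y *m J^T) *m z^T =
    (x *m J) *m Chr G H k y *m (z *m J)^T by rewrite trmx_mul !mulmxA.
rewrite mulmxN mulNmx mxNE !Chr_first// (first_chr_J JJ) ?mulrN//.
- by move=> j; apply: (pmx_symG oU symG).
- move=> j; rewrite -[RHS](pmx_eq j oU hG Uy).
  rewrite (pmxM j (msmoothM oU (msmooth_cst J oU) sG) (msmooth_cst J^T oU) Uy).
  rewrite (pmxM j (msmooth_cst J oU) sG Uy) !pmx_cst.
  by rewrite mul0mx add0r mulmx0 addr0.
- by move=> a b c; exact: closedG.
Qed.

Context (u : V -> R) (su : smooth U u)
  (Ju : forall y, U y -> J *m hess u y *m J^T = - hess u y).

(** Holomorphic coordinates are harmonic for a Kähler metric; this discharges the condition [trChr]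
    of the Bochner formula. *)
Lemma trace_Chr k y : U y -> \tr (H y *m Chr G H k y) = 0.
Proof. by move=> Uy; apply: (tr_J_anti tJ (hermH Uy)); exact: Chr_J. Qed.

Lemma trace_hess y : U y -> \tr (H y *m hess u y) = 0.
Proof. by move=> Uy; apply: (tr_J_anti tJ (hermH Uy)); exact: Ju. Qed.

Lemma chess_J y : U y -> J *m chess G H u y *m J^T = - chess G H u y.
Proof.
move=> Uy; rewrite /chess mulmxBr mulmxBl Ju// opprB addrC; congr (_ - _).
rewrite mulmx_sumr mulmx_suml -sumrN; apply: eq_bigr => k _.
by rewrite -scalemxAr -scalemxAl Chr_J// scalerN opprK.
Qed.

Lemma energy_smooth : smooth U (energy H u).
Proof.
apply: (@smooth_on_eq _ _ _ (fun y => (drow u y *m H y *m (drow u y)^T) 0 0)) => [//|//|].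
have sd := drow_msmooth oU su.
exact: (msmoothM oU (msmoothM oU sd sH) (msmooth_tr oU sd)).
Qed.

Lemma energy_ge0 y : U y -> 0 <= energy H u y.
Proof. by move=> Uy; apply: posdef_ge0; exact: posH. Qed.

Lemma bochner e Lam y : U y -> 0 < e -> Lam <= 0 ->
  (forall x, Lam * qform (G y) x <= qform (ric G H y) x) ->
  2 * Lam <= \tr (H y *m hess (fun y => ln (energy H u y + e)) y).
Proof.
move=> Uy e0 Lam0 ricL; set w := energy H u; pose f y := w y + e.
have sf : smooth U f.
  by apply: smooth_onD => //; [exact: energy_smooth|exact: smooth_on_cst].
have f0 z : U z -> 0 < f z by move=> Uz; rewrite ltr_wpDl// energy_ge0.
have dfE b z : U z -> partial b f z = partial b w z.
  move=> Uz; apply: partial_is_derive; rewrite -[partial b w z]addr0.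
  exact: is_deriveD (smooth_is_derive b energy_smooth Uz) (is_derive_cst _ _ _).
have dE : drow f y = drow w y.
  by apply/rowP => b; rewrite !drowE dfE.
have hE : hess f y = hess w y.
  apply/matrixP => a b; rewrite !hessE.
  by apply: (partial_eq_on a oU _ Uy) => z Uz; exact: dfE.
rewrite (hess_ln oU sf f0 Uy) dE hE mulmxBr mxtraceB -!scalemxAr !mxtraceZ.
have -> : \tr (H y *m ((drow w y)^T *m drow w y)) = (drow w y *m H y *m (drow w y)^T) 0 0.
  by rewrite mulmxA mxtrace_mulC mulmxA trace_mx11.
rewrite (laplacian_energy oU sG sH symG symH HG GH trace_Chr su trace_hess Uy).
rewrite (drow_energy oU sG sH symG symH HG GH su Uy).
have [T0 K] := kato tJ JJ (symH Uy) (posH Uy) (hermH Uy) (chess_sym oU H symG su Uy)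
  (chess_J Uy) (drow u y).
set T := \tr _ in T0 K *; set C := chess G H u y in T0 K *.
have -> : (2 *: (grad H u y *m C) *m H y *m (2 *: (grad H u y *m C))^T) 0 0 =
    4 * (drow u y *m H y *m C *m H y *m C *m H y *m (drow u y)^T) 0 0.
  rewrite [(2 *: _)^T]linearZ/= -!scalemxAl -scalemxAr !mxZE /grad !trmx_mul.
  rewrite (symH Uy) (chess_sym oU H symG su Uy) !mulmxA; ring.
move: K; set D := (_ *m (drow u y)^T) 0 0 => K.
set r := (_ *m _ *m _) 0 0.
have wE : (drow u y *m H y *m (drow u y)^T) 0 0 = w y by [].
rewrite wE in K.
have rL : Lam * w y <= r.
  have := ricL (grad H u y); congr (_ * _ <= _).
  rewrite /qform /grad trmx_mul (symH Uy) !mulmxA -wE.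
  by rewrite -(mulmxA (drow u y)) HG// mulmx1.
have fy := f0 y Uy; have w0 : 0 <= w y by exact: energy_ge0.
have E : f y = w y + e by [].
rewrite -subr_ge0.
have -> : (f y)^-1 * (2 * T + 2 * r) - f y ^- 2 * (4 * D) - 2 * Lam =
    (f y)^-1 ^+ 2 * (f y * (2 * T + 2 * r) - 4 * D - 2 * Lam * f y ^+ 2).
  by field; rewrite gt_eqF.
apply: mulr_ge0; first by rewrite sqr_ge0.
(* Kato bounds 4 D by 2 w T, so the Hessian terms leave at least 2 e T. From r >= Lam w the Ricci
   term leaves - 2 Lam e f, which is nonnegative because Lam <= 0. *)
have h1 : 0 <= e * T by rewrite mulr_ge0// ltW.
have h2 : 0 <= f y * (r - Lam * w y) by rewrite mulr_ge0 ?subr_ge0// ltW.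
have h3 : 0 <= - Lam * (f y * e) by rewrite mulr_ge0 ?oppr_ge0// mulr_ge0// ltW.
move: h2 h3; rewrite E; nra.
Qed.

End KahlerLocal.

(** * Cauchy-Riemann equations and the Hessian *)

Section StandardComplexStructure.
Context {R : realType} {n : nat}.
Local Notation N := (n + n)%N.
Local Notation V := 'rV[R]_N.

Lemma stdJ_tr : (stdJ : 'M[R]_N)^T = - stdJ.
Proof.
rewrite /stdJ tr_block_mx !trmx0 trmx1 trmxN trmx1 opp_block_mx.
by rewrite !oppr0 opprK.
Qed.

Lemma stdJ_sqr : (stdJ : 'M[R]_N) *m stdJ = - 1%:M.
Proof.
rewrite /stdJ mulmx_block !mulmx0 !mul0mx !mulmx1 !add0r !addr0 mul1mx.
by rewrite (scalar_mx_block _ _ (1 : R)) opp_block_mx !oppr0.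
Qed.

Lemma J_anti_blocks (A : 'M[R]_N) :
  (forall a b, A (lshift n a) (lshift n b) + A (rshift n a) (rshift n b) = 0) ->
  (forall a b, A (lshift n a) (rshift n b) = A (rshift n a) (lshift n b)) ->
  stdJ *m A *m stdJ^T = - A.
Proof.
move=> h1 h2; rewrite -[A]submxK.
have -> : drsubmx A = - ulsubmx A.
  by apply/matrixP => a b; rewrite !mxE; apply/eqP; rewrite -addr_eq0 addrC h1.
have -> : dlsubmx A = ursubmx A.
  by apply/matrixP => a b; rewrite !mxE h2.
rewrite stdJ_tr mulmxN /stdJ !mulmx_block !mulmx0 !mul0mx !mulmx1 !mul1mx !add0r !addr0.
by rewrite !mulNmx !mul1mx !mulmxN !mulmx1 !opprK.
Qed.

(** Differentiating the Cauchy-Riemann equations and commuting the derivatives of [p] and [q] yields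
    the block relations of [J_anti_blocks]. *)
Lemma hess_CR (U : set V) (p q : V -> R) y : open U -> smooth U p -> smooth U q ->
  (forall b z, U z -> partial (lshift n b) p z = partial (rshift n b) q z) ->
  (forall b z, U z -> partial (rshift n b) p z = - partial (lshift n b) q z) ->
  U y -> stdJ *m hess p y *m stdJ^T = - hess p y.
Proof.
move=> oU sp sq cr1 cr2 Uy.
have dN a f z : smooth U f -> U z -> partial a (fun z => - f z) z = - partial a f z.
  by move=> sf Uz; apply: partial_is_derive; exact: is_deriveN (smooth_is_derive a sf Uz).
have e1 a b : partial a (partial (lshift n b) p) y = partial a (partial (rshift n b) q) y.
  by apply: (partial_eq_on a oU _ Uy) => z; exact: cr1.
have e2 a b : partial a (partial (rshift n b) p) y = - partial a (partial (lshift n b) q) y.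
  rewrite -dN//; last exact: smooth_on_partial.
  by apply: (partial_eq_on a oU _ Uy) => z; exact: cr2.
have cp a b : partial a (partial b p) y = partial b (partial a p) y by exact: partialC oU sp Uy.
have cq a b : partial a (partial b q) y = partial b (partial a q) y by exact: partialC oU sq Uy.
apply: J_anti_blocks => a b; rewrite !hessE.
  rewrite (e2 (rshift n a) b) (cq (rshift n a) (lshift n b)) -(e1 (lshift n b) a).
  by rewrite (cp (lshift n b) (lshift n a)) subrr.
rewrite (e2 (lshift n a) b) (cq (lshift n a) (lshift n b)) -(e2 (lshift n b) a).
exact: cp.
Qed.

End StandardComplexStructure.

(** * The Laplacian *)

Section Laplacian.
Context {R : realType} {n : nat} {M : complexManifold R n}.
Context (g : kahlerMetric M).
Local Notation V := 'rV[R]_(n + n).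
Local Notation N := (n + n)%N.
Local Notation tjac := (@tjac R n M).
Implicit Types (f h u : M -> R) (i j : chart_index M).

Lemma ginvK i y : chart_codom i y -> ginv g i y *m gmx g i y = 1%:M.
Proof. by move=> Cy; rewrite mulVmx// gmx_unit. Qed.

Lemma gmxK i y : chart_codom i y -> gmx g i y *m ginv g i y = 1%:M.
Proof. by move=> Cy; rewrite mulmxV// gmx_unit. Qed.

Lemma christoffelE i k a b y : christoffel g i k a b y = chr (gmx g i) (ginv g i) k a b y.
Proof. by rewrite chr_def. Qed.

Lemma ricciE i y : ricci g i y = ric (gmx g i) (ginv g i) y.
Proof.
apply/matrixP => a b; rewrite ricE mxE; apply: eq_bigr => k _.
have cE k' a' b' : christoffel g i k' a' b' = chr (gmx g i) (ginv g i) k' a' b'.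
  by apply/funext => z; exact: christoffelE.
by rewrite !cE; congr (_ + _); apply: eq_bigr => l _; rewrite !cE.
Qed.

Lemma gmx_closed i a b c y : chart_codom i y ->
  (stdJ *m pmx a (gmx g i) y) b c + (stdJ *m pmx b (gmx g i) y) c a +
  (stdJ *m pmx c (gmx g i) y) a b = 0.
Proof.
move=> Cy; have E d k l : partial d (fun z => (stdJ *m gmx g i z) k l) y =
    (stdJ *m pmx d (gmx g i) y) k l.
  rewrite -(pmxE d (fun z => stdJ *m gmx g i z)).
  rewrite (pmxM d (msmooth_cst stdJ (open_chart_codom i)) (gmx_msmooth g i) Cy).
  by rewrite pmx_cst mul0mx add0r.
by rewrite -!E; exact: kahler_closed.
Qed.

(** The Laplace-Beltrami operator in coordinates: the Christoffel term is absent because its trace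
    vanishes in a holomorphic chart of a Kähler metric. *)
Definition lapc f i y : R := \tr (ginv g i y *m hess (lrep f i) y).

Definition lap f x : R := lapc f (chart_at x) (chart (chart_at x) x).

Lemma dmxE f i y : dmx f i y = drow (lrep f i) y.
Proof. by rewrite drow_def. Qed.

Lemma lapc_smooth f i : sfun f -> smooth (chart_codom i) (lapc f i).
Proof.
move=> sf; apply: smooth_on_sum => [|a]; first exact: open_chart_codom.
apply: (msmoothM (open_chart_codom i) (ginv_msmooth g i)).
by apply: (hess_msmooth (open_chart_codom i)); exact: sfun_lrep.
Qed.

Lemma ReD (z w : R[i]) : complex.Re (z + w) = complex.Re z + complex.Re w.
Proof. by case: z w => [a b] [c d]. Qed.

Lemma ImD (z w : R[i]) : complex.Im (z + w) = complex.Im z + complex.Im w.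
Proof. by case: z w => [a b] [c d]. Qed.

Lemma Re_half (z : R[i]) : complex.Re (z / 2) = complex.Re z / 2.
Proof. by rewrite {2}(splitr z) ReD; field. Qed.

Lemma Im_half (z : R[i]) : complex.Im (z / 2) = complex.Im z / 2.
Proof. by rewrite {2}(splitr z) ImD; field. Qed.

Lemma complex_iM (a b : R) : ('i * (a +i* b) = (- b) +i* a)%C.
Proof. by simpc. Qed.

Lemma d_zbarE (F : V -> R[i]) b y : d_zbar b F y =
  (((partial (lshift n b) (fun z => complex.Re (F z)) y -
     partial (rshift n b) (fun z => complex.Im (F z)) y) / 2) +i*
   ((partial (lshift n b) (fun z => complex.Im (F z)) y +
     partial (rshift n b) (fun z => complex.Re (F z)) y) / 2))%C.
Proof.
apply/eqP; rewrite eq_complex /d_zbar /cpartial complex_iM; apply/andP; split; apply/eqP.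
  by rewrite Re_half ReD.
by rewrite Im_half ImD.
Qed.

Lemma d_zE (F : V -> R[i]) b y : d_z b F y =
  (((partial (lshift n b) (fun z => complex.Re (F z)) y +
     partial (rshift n b) (fun z => complex.Im (F z)) y) / 2) +i*
   ((partial (lshift n b) (fun z => complex.Im (F z)) y -
     partial (rshift n b) (fun z => complex.Re (F z)) y) / 2))%C.
Proof.
apply/eqP; rewrite eq_complex /d_z /cpartial complex_iM; apply/andP; split; apply/eqP.
  by rewrite Re_half ReD /= opprK.
by rewrite Im_half ImD.
Qed.

Lemma transition_CR i j (a b : 'I_n) y : overlap i j y ->
  tjac i j y (lshift n b) (lshift n a) = tjac i j y (rshift n b) (rshift n a) /\
  tjac i j y (lshift n b) (rshift n a) = - tjac i j y (rshift n b) (lshift n a).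
Proof.
move=> oy; have := @transition_holomorphic _ _ M i j a b y oy.
rewrite d_zbarE /complex_coord /= => -[h1 h2]; rewrite !mxE; split.
  by move: h1 => /eqP; rewrite mulf_eq0 invr_eq0 pnatr_eq0 orbF subr_eq0 => /eqP.
by move: h2 => /eqP; rewrite mulf_eq0 invr_eq0 pnatr_eq0 orbF addr_eq0 => /eqP.
Qed.

Lemma ginv_herm i y : chart_codom i y -> stdJ *m ginv g i y *m stdJ^T = ginv g i y.
Proof.
move=> Cy; apply: (J_inv_mx stdJ_tr stdJ_sqr (ginvK Cy) (gmxK Cy)).
exact: gmx_hermitian.
Qed.

(* The coordinates of a holomorphic transition are pluriharmonic. *)
Lemma hess_transition i j (c : 'I_N) y : overlap i j y ->
  stdJ *m hess (fun z => transition i j z 0 c) y *m stdJ^T =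
  - hess (fun z => transition i j z 0 c) y.
Proof.
move=> oy; have oO := open_overlap i j.
rewrite -[c]splitK; case: (fintype.split c) => a /=.
  apply: (@hess_CR R n (overlap i j) _ (fun z => transition i j z 0 (rshift n a))) => //.
  - exact: transition_smooth'.
  - exact: transition_smooth'.
  - by move=> b z oz; have [] := transition_CR a b oz; rewrite !mxE.
  - by move=> b z oz; have [_] := transition_CR a b oz; rewrite !mxE => ->; rewrite opprK.
have dN b z : overlap i j z -> partial b (fun z => - transition i j z 0 (lshift n a)) z =
    - partial b (fun z => transition i j z 0 (lshift n a)) z.
  move=> oz; apply: partial_is_derive.
  exact: is_deriveN (smooth_is_derive b (transition_smooth' i j (lshift n a)) oz).
apply: (@hess_CR R n (overlap i j) _ (fun z => - transition i j z 0 (lshift n a))) => //.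
- exact: transition_smooth'.
- by apply: smooth_onN => //; exact: transition_smooth'.
- move=> b z oz; have [_] := transition_CR a b oz; rewrite !mxE => ->.
  by rewrite dN.
- move=> b z oz; have [+ _] := transition_CR a b oz; rewrite !mxE dN// => ->.
  by rewrite opprK.
Qed.

(** The Hessian transforms as a tensor up to a combination of the Hessians of the transition
    coordinates, and the trace of these against the inverse metric vanishes by [tr_J_anti]. *)
Lemma lapc_transition f i j y : sfun f -> overlap i j y ->
  lapc f i y = lapc f j (transition i j y).
Proof.
move=> sf oy; have oO := open_overlap i j.
pose D := tjac i j y; set y' := transition i j y.
have Cy' : chart_codom j y' by apply: overlap_codom (transition_overlap oy).
have hE : hess (lrep f i) y = \sum_c partial c (lrep f j) y' *:
    hess (fun z => transition i j z 0 c) y + D *m hess (lrep f j) y' *m D^T.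
  apply/matrixP => a b; rewrite hessE mxDE summxE.
  rewrite (partial_eq_on a oO (fun z => @partial_transition _ _ _ f i j b z sf) oy).
  apply: partial_is_derive.
  pose d c := hess (fun z => transition i j z 0 c) y a b * partial c (lrep f j) y' +
    D b c * \sum_e D a e * partial e (partial c (lrep f j)) y'.
  have -> : \sum_c (partial c (lrep f j) y' *: hess (fun z => transition i j z 0 c) y) a b +
     (D *m hess (lrep f j) y' *m D^T) a b = \sum_c d c.
    rewrite /d big_split/=; congr (_ + _).
      by apply: eq_bigr => c _; rewrite mxZE mulrC.
    rewrite mxE; apply: eq_bigr => c _; rewrite [_^T _ _]mxE mulrC; congr (_ * _).
    by rewrite mxE; apply: eq_bigr => e _; rewrite hessE.
  apply: is_derive_bigsum => c.
  have sT := transition_smooth' i j.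
  have d1 : is_derive y (delta_mx 0 a) (fun z => tjac i j z b c)
      (hess (fun z => transition i j z 0 c) y a b).
    have tE : (fun z => tjac i j z b c) = partial b (fun z => transition i j z 0 c).
      by apply/funext => z; rewrite mxE.
    rewrite hessE tE.
    by apply: smooth_is_derive oy; apply: smooth_on_partial; exact: sT.
  have sc : smooth (chart_codom j) (partial c (lrep f j)).
    by apply: smooth_on_partial; exact: sfun_lrep.
  have d2 : is_derive y (delta_mx 0 a) (fun z => partial c (lrep f j) (transition i j z))
      (\sum_e D a e * partial e (partial c (lrep f j)) y').
    have := @C1_chain_dir R _ _ (chart_codom j) (partial c (lrep f j)) (transition i j) y
      (delta_mx 0 a) (fun e => D a e) (open_chart_codom j) (smooth_on_C1 sc) Cy'.
    apply=> e; rewrite /D mxE.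
    by apply: smooth_is_derive oy; exact: sT.
  have := is_deriveM d1 d2 => dd; apply: is_derive_eq dd _.
  by rewrite /d /GRing.scale/= addrC; congr (_ + _); rewrite mulrC.
rewrite /lapc hE mulmxDr mxtraceD mulmx_sumr linear_sum/= big1 ?add0r.
  by rewrite (ginv_tjac g oy) -/D -!mulmxA [RHS]mxtrace_mulC -!mulmxA.
move=> c _; rewrite -scalemxAr mxtraceZ (tr_J_anti stdJ_tr (ginv_herm (overlap_codom oy))) ?mulr0//.
exact: hess_transition.
Qed.

Lemma lap_chart f i x : sfun f -> dom i x -> lap f x = lapc f i (chart i x).
Proof.
move=> sf ix; have ax := dom_chart_at x.
by rewrite /lap (lapc_transition sf (overlap_chart ax ix)) transition_chart.
Qed.

Lemma lap_chart_inv f i y : sfun f -> chart_codom i y -> lap f (chart_inv i y) = lapc f i y.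
Proof.
by move=> sf Cy; rewrite (lap_chart sf (dom_chart_inv Cy)) chart_invK.
Qed.

Lemma sfun_lap f : sfun f -> sfun (lap f).
Proof.
move=> sf; apply: (sfun_of_charts (F := lapc f)) => [i|i y Cy].
  exact: lapc_smooth.
exact: lap_chart_inv.
Qed.

(** The real and imaginary parts of the mixed complex second derivatives are the two block relations
    of [J_anti_blocks]. *)
Lemma pluriharmonic_hess u i y : sfun u -> pluriharmonic u -> chart_codom i y ->
  stdJ *m hess (lrep u i) y *m stdJ^T = - hess (lrep u i) y.
Proof.
move=> su [_ pu] Cy; have oC := open_chart_codom i.
have key a b : partial (lshift n a) (partial (lshift n b) (lrep u i)) y +
    partial (rshift n a) (partial (rshift n b) (lrep u i)) y = 0 /\
  partial (lshift n a) (partial (rshift n b) (lrep u i)) y =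
    partial (rshift n a) (partial (lshift n b) (lrep u i)) y.
  have := pu i a b y Cy; rewrite d_zE.
  have dE z : d_zbar b (fun z => ((u (chart_inv i z))%:C)%C) z =
      ((partial (lshift n b) (lrep u i) z / 2) +i* (partial (rshift n b) (lrep u i) z / 2))%C.
    rewrite d_zbarE /=.
    have p0 c : partial c (fun=> (0 : R)) z = 0 by rewrite partialE derive_cst.
    by rewrite !p0 subr0 add0r.
  have -> : (fun z => complex.Re (d_zbar b (fun z => ((u (chart_inv i z))%:C)%C) z)) =
      (fun z => partial (lshift n b) (lrep u i) z / 2).
    by apply/funext => z; rewrite dE.
  have -> : (fun z => complex.Im (d_zbar b (fun z => ((u (chart_inv i z))%:C)%C) z)) =
      (fun z => partial (rshift n b) (lrep u i) z / 2).
    by apply/funext => z; rewrite dE.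
  have half c d : partial c (fun z => partial d (lrep u i) z / 2) y =
      partial c (partial d (lrep u i)) y / 2.
    apply: partial_is_derive.
    have dd := is_deriveM (smooth_is_derive c (smooth_on_partial d (sfun_lrep i su)) Cy)
      (is_derive_cst (2^-1 : R) y (delta_mx 0 c)).
    apply: is_derive_eq dd _; rewrite /GRing.scale/=; ring.
  rewrite (half (lshift n a) (lshift n b)) (half (rshift n a) (rshift n b)).
  rewrite (half (lshift n a) (rshift n b)) (half (rshift n a) (lshift n b)) => -[].
  move: (partial _ (partial _ _) y) (partial _ (partial _ _) y) => p q.
  move: (partial _ (partial _ _) y) (partial _ (partial _ _) y) => r s.
  by move=> h1 h2; split; lra.
by apply: J_anti_blocks => a b; rewrite !hessE; have [] := key a b.
Qed.

(** [bochner] is applied at a single point with the constant [lambda_minus g x]; [rayleigh] turns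
    the infimum of eigenvalues into the required lower bound on the Ricci form. *)
Lemma lap_ln_ip u e x : sfun u -> pluriharmonic u -> 0 < e ->
  2 * lambda_minus g x <= lap (fun x => ln (ip g u u x + e)) x.
Proof.
move=> su pu e0; set i := chart_at x; set y := chart i x.
have Cy : chart_codom i y by exact: chart_at_codom.
have oC := open_chart_codom i.
rewrite /lap -/i -/y /lapc.
have -> : hess (lrep (fun x => ln (ip g u u x + e)) i) y =
    hess (fun y => ln (energy (ginv g i) (lrep u i) y + e)) y.
  have lE z : chart_codom i z -> lrep (fun x => ln (ip g u u x + e)) i z =
      ln (energy (ginv g i) (lrep u i) z + e).
    by move=> Cz; rewrite /lrep ip_chart_inv// /cip !dmxE.
  apply/matrixP => a b; rewrite !hessE; apply: (partial_eq_on a oC _ Cy) => z Cz.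
  exact: (partial_eq_on b oC lE Cz).
apply: (@bochner R N _ oC (gmx g i) (ginv g i) (gmx_msmooth g i) (ginv_msmooth g i)
  (fun z Cz => gmx_sym g Cz) (fun z Cz => ginv_sym g Cz) (fun z Cz => ginvK Cz)
  (fun z Cz => gmxK Cz) (fun z Cz => ginv_posdef g Cz)
  stdJ stdJ_tr stdJ_sqr (fun z Cz => gmx_hermitian g Cz)
  (fun a b c z Cz => gmx_closed a b c Cz) (lrep u i) (sfun_lrep i su)
  (fun z Cz => pluriharmonic_hess su pu Cz)) => //.
  by rewrite ge_min lexx.
move=> v; apply: (@le_trans _ _ (lambda g x * qform (gmx g i y) v)).
  apply: ler_wpM2r; first by apply: posdef_ge0; exact: gmx_posdef.
  by rewrite ge_min lexx orbT.
rewrite -ricciE /lambda; apply: (rayleigh (H := ginv g i y)).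
- exact: gmx_sym.
- exact: gmx_posdef.
- rewrite ricciE; apply: (ric_sym oC (gmx_msmooth g i) (ginv_msmooth g i)) => //.
  + by move=> z Cz; exact: gmx_sym.
  + by move=> z Cz; exact: ginv_sym.
  + by move=> z Cz; exact: ginvK.
  + by move=> z Cz; exact: gmxK.
- exact: ginvK.
- exact: gmxK.
Qed.

End Laplacian.

(** * The Riemannian volume *)

Section LayerCake.
Context {R : realType}.

(** [S] counts the integers 1, ..., k strictly below [s]: it follows [s] from below with error at
    most 1 until it is exhausted at k. *)
Lemma staircase (s : R) (k : nat) :
  let S := \sum_(j < k) (if j.+1%:R < s then 1 else 0 : R) in
  [/\ 0 <= s -> S <= s, S <= k%:R & s <= S + 1 \/ S = k%:R].
Proof.
elim: k => [|k [h1 h2 h3]] /=; first by rewrite big_ord0; split => //; right.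
rewrite big_ord_recr/=; set S := \sum_(j < k) _ in h1 h2 h3 *.
case: ifPn => ks; last first.
  rewrite addr0; split => //; first by rewrite (le_trans h2)// ler_nat.
  by left; case: h3 => [//|->]; rewrite natr1 leNgt.
have Sk : S = k%:R.
  by case: h3 => [|//] h; move: ks; rewrite -natr1; lra.
rewrite Sk natr1; split => //; last by right.
by move=> _; exact: ltW.
Qed.

(* Two monotone functionals agreeing on the indicators of superlevel sets agree:
   approximate F from both sides by staircases of step 1/N. *)
Lemma layer_cake (T : Type) (Phi Psi : (T -> R) -> \bar R) (lev : R -> \bar R)
    (F : T -> R) (B : R) :
  (forall x, 0 <= F x <= B) -> lev 0 \is a fin_num ->
  (forall c, 0 <= c -> (lev c <= lev 0%R)%E) -> (forall c, (0 <= lev c)%E) ->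
  (forall f h : T -> R, (forall x, 0 <= f x) -> (forall x, f x <= h x) -> (Phi f <= Phi h)%E) ->
  (forall f h : T -> R, (forall x, 0 <= f x) -> (forall x, f x <= h x) -> (Psi f <= Psi h)%E) ->
  (forall k (c : R) (d : nat -> R), 0 <= c -> (forall j, 0 <= d j) ->
     Phi (fun x => \sum_(j < k) c * (if d j < F x then 1 else 0)) =
     (\sum_(j < k) c%:E * lev (d j))%E) ->
  (forall k (c : R) (d : nat -> R), 0 <= c -> (forall j, 0 <= d j) ->
     Psi (fun x => \sum_(j < k) c * (if d j < F x then 1 else 0)) =
     (\sum_(j < k) c%:E * lev (d j))%E) ->
  Phi F = Psi F.
Proof.
move=> FB finA mono mu0 mPhi mPsi sPhi sPsi.
set a := lev 0 in finA mono.
have bounds (L : (T -> R) -> \bar R) (N : nat) :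
   (forall f h : T -> R, (forall x, 0 <= f x) -> (forall x, f x <= h x) -> (L f <= L h)%E) ->
   (forall k (c : R) (d : nat -> R), 0 <= c -> (forall j, 0 <= d j) ->
     L (fun x => \sum_(j < k) c * (if d j < F x then 1 else 0)) =
     (\sum_(j < k) c%:E * lev (d j))%E) ->
   let k := (Num.truncn (B * N.+1%:R)).+1 in
   let S := (\sum_(j < k) (N.+1%:R^-1)%:E * lev (j.+1%:R / N.+1%:R)%R)%E in
   (S <= L F)%E /\ (L F <= (N.+1%:R^-1)%:E * a + S)%E.
  move=> mL sL k S; pose c : R := N.+1%:R^-1.
  have c0 : 0 < c by rewrite invr_gt0.
  (* Enough steps to pass the bound [B], so that the staircase is nowhere cut off too low. *)
  have Bk : B * N.+1%:R < k%:R by rewrite /k Num.Theory.truncnS_gt.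
  have cmp x j : (j%:R * c < F x) = (j%:R < F x * N.+1%:R) by rewrite ltr_pdivrMr.
  have sumE x : \sum_(j < k) c * (if j.+1%:R * c < F x then 1 else 0) =
      c * \sum_(j < k) (if j.+1%:R < F x * N.+1%:R then 1 else 0).
    by rewrite mulr_sumr; apply: eq_bigr => j _; rewrite cmp.
  have F0 x : 0 <= F x by have /andP[] := FB x.
  have d0 (j : nat) : 0 <= j%:R * c by rewrite mulr_ge0// ltW.
  have i0 (b : bool) : 0 <= (if b then 1 else 0 : R) by case: b.
  split.
    have <- : L (fun x => \sum_(j < k) c * (if j.+1%:R * c < F x then 1 else 0)) = S.
      exact: (sL k c (fun j => j.+1%:R * c) (ltW c0) (fun j => d0 j.+1)).
    apply: mL => x; first by apply: sumr_ge0 => j _; exact: mulr_ge0 (ltW c0) (i0 _).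
    rewrite sumE mulrC ler_pdivrMr//.
    have [h1 _ _] := staircase (F x * N.+1%:R) k; apply: h1.
    by rewrite mulr_ge0.
  (* One more step, at level 0, lifts the staircase above [F]; it costs the step size times
     [lev 0]. *)
  have -> : ((N.+1%:R^-1)%:E * a + S = \sum_(j < k.+1) c%:E * lev (j%:R * c)%R)%E.
    by rewrite big_ord_recl/= mul0r.
  have <- : L (fun x => \sum_(j < k.+1) c * (if j%:R * c < F x then 1 else 0)) =
      (\sum_(j < k.+1) c%:E * lev (j%:R * c)%R)%E.
    exact: (sL k.+1 c (fun j => j%:R * c) (ltW c0) d0).
  apply: (mL _ _ F0) => x; rewrite big_ord_recl/= mul0r.
  rewrite (eq_bigr (fun j : 'I_k => c * (if j.+1%:R * c < F x then 1 else 0)))//.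
  rewrite sumE -mulrDr mulrC ler_pdivlMr//.
  have [_ h2 h3] := staircase (F x * N.+1%:R) k.
  case: ifPn => Fx; last first.
    have -> : F x = 0 by apply/eqP; rewrite eq_le F0 leNgt Fx.
    by rewrite mul0r add0r; apply: sumr_ge0 => j _; case: ifP.
  rewrite addrC; case: h3 => [//|->].
  apply: (@le_trans _ _ (B * N.+1%:R)); last by lra.
  by rewrite ler_wpM2r//; have /andP[] := FB x.
have a0 : (0 <= a)%E by exact: mu0.
have finS N : (\sum_(j < (Num.truncn (B * N.+1%:R)).+1)
    (N.+1%:R^-1)%:E * lev (j.+1%:R / N.+1%:R)%R)%E \is a fin_num.
  apply: (big_ind (fun x : \bar R => x \is a fin_num)) => [//|x y fx fy|j _].
    by rewrite fin_numD fx.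
  rewrite fin_numM//.
  rewrite ge0_fin_numE ?mu0//; apply: le_lt_trans (mono _ _) _; first by rewrite divr_ge0.
  by rewrite -ge0_fin_numE.
have [h1 h2] := bounds Phi 0%N mPhi sPhi; have [h3 h4] := bounds Psi 0%N mPsi sPsi.
have fU : ((1%:R^-1)%:E * a + \sum_(j < (Num.truncn (B * 1%:R)).+1)
    (1%:R^-1)%:E * lev (j.+1%:R / 1%:R)%R)%E \is a fin_num.
  by rewrite fin_numD (finS 0%N) andbT fin_numM.
have fPhi : Phi F \is a fin_num.
  rewrite fin_real//; apply/andP; split.
    by apply: lt_le_trans h1; rewrite ltNye_eq (finS 0%N).
  by apply: le_lt_trans h2 _; rewrite ltey_eq fU.
have fPsi : Psi F \is a fin_num.
  rewrite fin_real//; apply/andP; split.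
    by apply: lt_le_trans h3; rewrite ltNye_eq (finS 0%N).
  by apply: le_lt_trans h4 _; rewrite ltey_eq fU.
have diff (N : nat) : `|fine (Phi F) - fine (Psi F)| <= N.+1%:R^-1 * fine a.
  have [] := bounds Phi N mPhi sPhi; have [] := bounds Psi N mPsi sPsi.
  move: (finS N); set S := (\sum_(j < _) _)%E => fS.
  rewrite -(fineK fS) -(fineK fPhi) -(fineK fPsi) -(fineK finA) -EFinM -EFinD !lee_fin.
  rewrite /=; move: (fine S) (fine (Phi F)) (fine (Psi F)) (_ * fine a) => s p q r.
  by move=> *; rewrite ler_norml; apply/andP; split; lra.
rewrite -(fineK fPhi) -(fineK fPsi); congr (_%:E); apply/eqP.
rewrite -subr_eq0 -normr_le0 leNgt; apply/negP => dp.
set e := `|_| in dp diff; have fa0 : 0 <= fine a by exact: fine_ge0.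
have := diff (Num.truncn (fine a / e)); rewrite ler_pdivlMl// leNgt => /negP; apply.
by rewrite -ltr_pdivrMr// Num.Theory.truncnS_gt.
Qed.

End LayerCake.

Section Volume.
Context {R : realType} {n : nat} {M : complexManifold R n}.
Context (g : kahlerMetric M).
Local Notation V := 'rV[R]_(n + n).
Local Notation N := (n + n)%N.
Local Notation LI := lebesgue_int.
Implicit Types (f h F : M -> R) (i j : chart_index M).

Definition vol i (y : V) : R := Num.sqrt (\det (gmx g i y)).

Lemma vol_gt0 i y : chart_codom i y -> 0 < vol i y.
Proof.
move=> Cy; rewrite sqrtr_gt0; apply: posdef_det; first exact: gmx_sym.
exact: gmx_posdef.
Qed.

Lemma vol_smooth i : smooth (chart_codom i) (vol i).
Proof.
apply: smooth_on_sqrt; first exact: open_chart_codom.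
  apply: smooth_det; [exact: open_chart_codom|exact: gmx_msmooth].
move=> y Cy; apply: posdef_det; first exact: gmx_sym.
exact: gmx_posdef.
Qed.

Definition dens i F (y : V) : R :=
  if `[< chart_codom i y >] then F (chart_inv i y) * vol i y else 0.

Lemma densE i F y : chart_codom i y -> dens i F y = F (chart_inv i y) * vol i y.
Proof. by move=> Cy; rewrite /dens asboolT. Qed.

Lemma dens_out i F y : ~ chart_codom i y -> dens i F y = 0.
Proof. by move=> Cy; rewrite /dens asboolF. Qed.

Lemma dens_ge0 i F y : (forall x, 0 <= F x) -> 0 <= dens i F y.
Proof.
move=> F0; rewrite /dens; case: asboolP => // Cy.
by rewrite mulr_ge0// ltW// vol_gt0.
Qed.

Lemma dens_mono i F F' y : (forall x, F x <= F' x) -> dens i F y <= dens i F' y.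
Proof.
move=> unit_cutoff; rewrite /dens; case: asboolP => // Cy.
by rewrite ler_wpM2r// ltW// vol_gt0.
Qed.

Definition ind (A : set M) (x : M) : R := if `[< A x >] then 1 else 0.

Lemma ind_ge0 A x : 0 <= ind A x. Proof. by rewrite /ind; case: ifP. Qed.

Lemma bmeas_dens_ind i A : open A -> A `<=` dom i -> bmeas (fun y => (dens i (ind A) y)%:E).
Proof.
move=> oA Ai; apply/measurable_EFinP.
apply: (@measurable_fun_on_open R _ (chart_codom i `&` chart_inv i @^-1` A)).
- apply: open_preimage_on => //; first exact: open_chart_codom.
  by move=> y Cy; exact: chart_inv_continuous.
- have oW : open (chart_codom i `&` chart_inv i @^-1` A).
    apply: open_preimage_on => //; first exact: open_chart_codom.
    by move=> y Cy; exact: chart_inv_continuous.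
  move=> y [Cy Ay]; apply: (@near_eq_continuous _ _ (vol i)).
    have /filterS := open_nbhs_nbhs (conj oW (conj Cy Ay)); apply => z [Cz Az].
    by rewrite densE// /ind asboolT// mul1r.
  exact: smooth_on_continuous (vol_smooth i) Cy.
- move=> y nW; have [Cy|/dens_out//] := EM (chart_codom i y).
  by rewrite densE// /ind asboolF ?mul0r// => Ay; apply: nW.
Qed.

Context (mu : {measure set (borel M) -> \bar R}) (mu_vol : riemannian_volume g mu).

Lemma mu_open i A : open A -> A `<=` dom i -> mu A = LI (fun y => (dens i (ind A) y)%:E).
Proof.
move=> oA Ai; rewrite (mu_vol (open_borel oA) Ai); apply: LI_eq => y; congr (_%:E).
rewrite indicE; have [Cy|nCy] := EM (chart_codom i y); last first.
  rewrite dens_out// memNset ?mul0r// => -[x Ax xy]; apply: nCy.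
  by rewrite -xy; apply: codom_chart; exact: Ai.
rewrite densE// /ind; case: asboolP => Ay.
  by rewrite mem_set//; exists (chart_inv i y) => //; exact: chart_invK.
rewrite memNset// => -[x Ax xy]; apply: Ay; rewrite -xy chartK//; exact: Ai.
Qed.

Lemma open_superlevel F (c : R) : continuous F -> open [set x | c < F x].
Proof.
move=> cF; rewrite (_ : [set x | c < F x] = F @^-1` `]c, +oo[%classic).
  by apply: open_comp => [x _|]; [exact: cF|exact: interval_open].
by apply/seteqP; split => x /=; rewrite in_itv/= andbT.
Qed.

(** Superlevel sets of [F] are open subsets of the chart domain, where [riemannian_volume]
    determines [mu]. Layer cake extends the agreement from these sets to [F]. *)
Lemma integral_dens i F (B : R) : continuous F -> (forall x, 0 <= F x <= B) ->
  (forall x, F x != 0 -> dom i x) -> mu [set x | 0 < F x] \is a fin_num ->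
  (\int[mu]_(x in [set: borel M]) (F x)%:E = LI (fun y => (dens i F y)%:E))%E.
Proof.
move=> cF FB Fi fin0.
have oA (c : R) := open_superlevel c cF.
have Ai (c : R) : 0 <= c -> [set x | c < F x] `<=` dom i.
  by move=> c0 x /= cx; apply: Fi; rewrite gt_eqF// (le_lt_trans c0).
have iE (c : R) x : (if c < F x then 1 else 0) = ind [set x | c < F x] x.
  by rewrite /ind; case: asboolP => /= [->//|/negP/negPf ->].
apply: (@layer_cake R M (fun F => \int[mu]_(x in [set: borel M]) (F x)%:E)%E
  (fun F => LI (fun y => (dens i F y)%:E)) (fun c => mu [set x | c < F x]) F B FB fin0).
- move=> c c0; apply: le_measure; rewrite ?inE; [exact: open_borel|exact: open_borel|].
  by move=> x /=; exact: le_lt_trans.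
- by move=> c; exact: measure_ge0.
- by move=> f h f0 fh; apply: integral_mono => x; rewrite lee_fin.
- move=> f h f0 fh; apply: LI_mono => y; rewrite lee_fin; first exact: dens_ge0.
  exact: dens_mono.
- move=> k c d c0 d0.
  have mI (c' : R) : measurable_fun [set: borel M] (fun x : borel M => (ind [set x | c' < F x] x)%:E).
    rewrite (_ : (fun x => _) = (fun x => (\1_([set x | c' < F x] : set (borel M)) x)%:E)).
      by apply/measurable_EFinP; apply: measurable_indic; exact: open_borel.
    apply/funext => x; rewrite indicE /ind; case: asboolP => Ax; first by rewrite mem_set.
    by rewrite memNset.
  transitivity (\int[mu]_(x in [set: borel M])
      (\sum_(j < k) (c%:E * (ind [set x | d j < F x] x)%:E)))%E.
    apply: eq_integral => x _; rewrite -sumEFin; apply: eq_bigr => j _.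
    by rewrite iE EFinM.
  rewrite ge0_integral_sum//; last 2 first.
  + by move=> j; apply: measurable_funeM; exact: mI.
  + by move=> j x _; rewrite mule_ge0// lee_fin ind_ge0.
  apply: eq_bigr => j _; rewrite ge0_integralZl_EFin//; last first.
    by move=> x _; rewrite lee_fin ind_ge0.
  congr (_ * _)%E; rewrite -[in RHS](setIT [set x | d j < F x]).
  rewrite -(@integral_indic _ _ _ mu setT measurableT); last exact: open_borel.
  apply: eq_integral => x _; rewrite indicE /ind; case: asboolP => Ax; first by rewrite mem_set.
  by rewrite memNset.
- move=> k c d c0 d0.
  have I0 (j : nat) y : (0 <= c%:E * (dens i (ind [set x | d j < F x]) y)%:E)%E.
    by rewrite -EFinM lee_fin mulr_ge0// dens_ge0// => x; exact: ind_ge0.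
  have mI (j : nat) : bmeas (fun y => (dens i (ind [set x | d j < F x]) y)%:E).
    by apply: bmeas_dens_ind; [exact: oA|exact: Ai].
  transitivity (LI (fun y => \sum_(j < k) (c%:E * (dens i (ind [set x | d j < F x]) y)%:E)))%E.
    apply: LI_eq => y; under [RHS]eq_bigr => j _ do rewrite -EFinM.
    rewrite sumEFin; congr (_%:E).
    rewrite /dens; case: asboolP => Cy; last by rewrite big1// => j _; rewrite mulr0.
    by rewrite mulr_suml; apply: eq_bigr => j _; rewrite iE mulrA.
  rewrite LI_sum//; last by move=> j; apply: measurable_funeM; exact: mI.
  apply: eq_bigr => j _; rewrite LI_scale//; last first.
    by move=> y; rewrite lee_fin dens_ge0// => x; exact: ind_ge0.
  by rewrite (mu_open (i := i))//; exact: Ai.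
Qed.

Lemma chart_box i y : chart_codom i y -> exists2 r : R, 0 < r &
  forall z, `|z - y| <= r -> chart_codom i z.
Proof.
move=> Cy; have /nbhs_ballP[e /= e0 eb] := open_nbhs_nbhs (conj (open_chart_codom i) Cy).
exists (e / 2); first by rewrite divr_gt0.
move=> z zy; apply: eb; rewrite -ball_normE /= distrC.
by apply: le_lt_trans zy _; rewrite ltr_pdivrMr// mulr_natr mulr2n ltrDl.
Qed.

Lemma compact_box (y : V) (r : R) : compact [set z : V | `|z - y| <= r].
Proof.
apply: bounded_closed_compact.
  exists (`|y| + r); split; first exact: num_real.
  move=> c rc z /= zy; apply: le_trans (ltW rc).
  by rewrite -(subrK y z) addrC (le_trans (ler_normD _ _))// lerD2l.
apply: (@closed_comp _ _ (fun z : V => `|z - y|) [set t | t <= r]) => //.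
move=> z _; apply: (@continuous_comp _ _ _ (fun z : V => z - y) (fun t => `|t|)).
  by apply: continuousB; [exact: cvg_id|exact: cst_continuous].
exact: norm_continuous.
Qed.

Lemma vol_bounds i y : chart_codom i y -> exists r c C : R,
  [/\ 0 < r, 0 < c, 0 <= C, (forall z, `|z - y| <= r -> chart_codom i z) &
     forall z, `|z - y| <= r -> c <= vol i z <= C].
Proof.
move=> Cy; have [r r0 rC] := chart_box Cy.
have K0 : [set z : V | `|z - y| <= r] !=set0 by exists y; rewrite /= subrr normr0 ltW.
have cK : {within [set z : V | `|z - y| <= r], continuous (vol i)}.
  apply: continuous_in_subspaceT => z; rewrite inE => /rC Cz.
  exact: smooth_on_continuous (vol_smooth i) Cz.
have [a /set_mem aK amin] := EVT_min_rV K0 (compact_box (r := r)) cK.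
have [b /set_mem bK bmax] := EVT_max_rV K0 (compact_box (r := r)) cK.
exists r, (vol i a), (vol i b); split => //.
- by apply: vol_gt0; exact: rC.
- by apply: ltW; apply: vol_gt0; exact: rC.
by move=> z zK; rewrite amin ?bmax// inE.
Qed.

Lemma open_nball (y : V) (r : R) : open [set z : V | `|z - y| < r].
Proof.
rewrite (_ : [set z : V | _] = (fun z : V => `|z - y|) @^-1` `]-oo, r[%classic).
  apply: open_comp => [z _|]; last exact: interval_open.
  apply: (@continuous_comp _ _ _ (fun z : V => z - y) (fun t => `|t|)).
    by apply: continuousB; [exact: cvg_id|exact: cst_continuous].
  exact: norm_continuous.
by apply/seteqP; split => z /=; rewrite in_itv.
Qed.

Lemma open_box (i : chart_index M) (y : V) (r : R) :
  open (dom i `&` [set x | `|chart i x - y| < r]).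
Proof.
have -> : dom i `&` [set x | `|chart i x - y| < r] =
    dom i `&` chart i @^-1` [set z | `|z - y| < r] by [].
apply: open_preimage_on; [exact: open_dom|by move=> x; exact: chart_continuous|].
exact: open_nball.
Qed.

Lemma mu_locally_finite (x : M) : exists A : set M, [/\ open A, A x & mu A \is a fin_num].
Proof.
set i := chart_at x; set y := chart i x.
have Cy : chart_codom i y := chart_at_codom x.
have [r [c [C [r0 c0 C0 rC vC]]]] := vol_bounds Cy.
pose A := dom i `&` [set x | `|chart i x - y| < r].
have oA : open A by exact: open_box.
exists A; split => //.
  by split; [exact: dom_chart_at|rewrite /= subrr normr0].
rewrite ge0_fin_numE// (mu_open (i := i) oA); last by move=> z [].
apply: (@le_lt_trans _ _ (LI (fun z : V => (if `|z - y| < r then C else 0)%:E))); last first.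
  by rewrite LI_box// ltry.
apply: LI_mono => z; rewrite lee_fin; first by apply: dens_ge0 => w; exact: ind_ge0.
have [Cz|nCz] := EM (chart_codom i z); last by rewrite dens_out//; case: ifP.
rewrite densE// /ind; case: asboolP => [[_ /=]|_]; last by rewrite mul0r; case: ifP.
rewrite chart_invK// mul1r => zr; rewrite zr.
by have /andP[] := vC z (ltW zr).
Qed.

(** The open set contains the preimage of a small coordinate cube on which the density is bounded
    below by a positive constant. *)
Lemma mu_open_gt0 (A : set M) (x : M) : open A -> A x -> (0 < mu A)%E.
Proof.
move=> oA Ax; set i := chart_at x; set y := chart i x.
have Cy : chart_codom i y := chart_at_codom x.
have [r [c [C [r0 c0 C0 rC vC]]]] := vol_bounds Cy.
have oW : open (chart_codom i `&` chart_inv i @^-1` A).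
  apply: open_preimage_on => //; first exact: open_chart_codom.
  by move=> z Cz; exact: chart_inv_continuous.
have Wy : (chart_codom i `&` chart_inv i @^-1` A) y.
  by split => //=; rewrite chartK//; exact: dom_chart_at.
have /nbhs_ballP[e /= e0 eA] := open_nbhs_nbhs (conj oW Wy).
pose s := Num.min e r; have s0 : 0 < s by rewrite lt_min e0.
pose B := dom i `&` [set x | `|chart i x - y| < s].
have sr z : `|z - y| < s -> `|z - y| <= r.
  by move=> zs; apply: ltW; apply: lt_le_trans zs _; rewrite ge_min lexx orbT.
have oB : open B by exact: open_box.
have BA : B `<=` A.
  move=> z [iz /= zs]; rewrite -(chartK iz).
  have [] // := eA (chart i z); rewrite -ball_normE /= distrC.
  by apply: lt_le_trans zs _; rewrite ge_min lexx.
apply: (@lt_le_trans _ _ (mu B)); last first.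
  by apply: le_measure; rewrite ?inE; [exact: open_borel|exact: open_borel|].
rewrite (mu_open (i := i) oB); last by move=> z [].
apply: (@lt_le_trans _ _ (LI (fun z : V => (if `|z - y| < s then c else 0)%:E))).
  rewrite LI_box//; last exact: ltW.
  by rewrite lte_fin mulr_gt0// exprn_gt0// mulr_gt0.
apply: LI_mono => z; rewrite lee_fin; first by case: ifP => // _; exact: ltW.
case: ifPn => zs; last by apply: dens_ge0 => w; exact: ind_ge0.
have Cz := rC z (sr z zs).
rewrite densE// /ind asboolT ?mul1r; last first.
  by split; [exact: dom_chart_inv|rewrite /= chart_invK].
by have /andP[] := vC z (sr z zs).
Qed.

Lemma compact_finite_nbhd (K : set M) : compact K ->
  exists A : set M, [/\ open A, K `<=` A & mu A \is a fin_num].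
Proof.
move=> cK; apply: (@compact_ind M K (fun K =>
  exists A : set M, [/\ open A, K `<=` A & mu A \is a fin_num])) => //.
- by exists set0; split => //; [exact: open0|rewrite measure0].
- move=> A B [A' [oA AA fA]] [B' [oB BB fB]]; exists (A' `|` B'); split.
  + exact: openU.
  + by move=> x [/AA|/BB]; [left|right].
  + rewrite ge0_fin_numE//; apply: le_lt_trans (measureU2 _ _ _) _; try exact: open_borel.
    by rewrite -ge0_fin_numE ?adde_ge0// fin_numD fA.
- by move=> A B AB [B' [oB BB fB]]; exists B'; split => // x /AB; exact: BB.
move=> x _; have [A [oA Ax fA]] := mu_locally_finite x.
by exists A; [exact: open_nbhs_nbhs|exists A; split].
Qed.

Lemma csupp_bounded F : continuous F -> csupp F -> exists2 B, 0 <= B & forall x, `|F x| <= B.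
Proof.
move=> cF [K cK FK]; have [K0|nK] := EM (K !=set0); last first.
  by exists 0 => // x; case: (eqVneq (F x) 0) => [->|/FK Kx]; rewrite ?normr0//; case: nK; exists x.
have cN : {within K, continuous (fun x => `|F x|)}.
  apply: continuous_subspaceT => x.
  by apply: (@continuous_comp _ _ _ F (fun t => `|t|)); [exact: cF|exact: norm_continuous].
have [a aK amax] := compact_EVT_max K0 cK cN.
exists `|F a| => // x; case: (eqVneq (F x) 0) => [->|/FK Kx]; first by rewrite normr0.
by apply: amax; rewrite inE.
Qed.

Lemma csupp_integrable F : continuous F -> csupp F ->
  mu.-integrable [set: borel M] (fun x => (F x)%:E).
Proof.
move=> cF sF; have [B B0 FB] := csupp_bounded cF sF.
have [K cK FK] := sF; have [A [oA KA fA]] := compact_finite_nbhd cK.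
apply/integrableP; split; first by apply/measurable_EFinP; exact: continuous_borel.
apply: (@le_lt_trans _ _ (\int[mu]_(x in [set: borel M]) (B%:E * (\1_(A : set (borel M)) x)%:E))%E).
  apply: integral_mono => x /=; first by rewrite lee_fin.
  rewrite -EFinM lee_fin indicE; case: (boolP (x \in (A : set (borel M)))) => xA.
    by rewrite mulr1.
  rewrite mulr0 (_ : F x = 0) ?normr0//; apply/eqP/negPn/negP => /FK/KA Ax.
  by move/negP : xA; apply; rewrite inE.
have mA : measurable (A : set (borel M)) := open_borel oA.
rewrite ge0_integralZl_EFin//; last by apply/measurable_EFinP; exact: measurable_indic.
by rewrite integral_indic// setIT -(fineK fA) -EFinM ltry.
Qed.

(** Transfers integrals of signed functions supported in one chart to R^m, where derivatives
    integrate to zero. *)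
Lemma integral_sint i F (K : set M) : continuous F -> compact K -> K `<=` dom i ->
  (forall x, F x != 0 -> K x) ->
  (\int[mu]_(x in [set: borel M]) (F x)%:E = (sint (dens i F))%:E)%E.
Proof.
move=> cF cK Ki FK; have sF : csupp F by exists K.
have [B B0 FB] := csupp_bounded cF sF.
have [A [oA KA fA]] := compact_finite_nbhd cK.
have fin0 (G : M -> R) : (forall x, G x != 0 -> K x) -> continuous G ->
    mu [set x | 0 < G x] \is a fin_num.
  move=> GK cG; rewrite ge0_fin_numE//; apply: (@le_lt_trans _ _ (mu A)).
    apply: le_measure; rewrite ?inE; [|exact: open_borel|].
      by apply: open_borel; exact: open_superlevel.
    by move=> x /= Gx; apply: KA; apply: GK; rewrite gt_eqF.
  by rewrite -ge0_fin_numE.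
have pK x : pos_part F x != 0 -> K x.
  by move=> h; apply: FK; apply: contraNneq h => h; rewrite /pos_part h maxxx.
have nK x : neg_part F x != 0 -> K x.
  by move=> h; apply: FK; apply: contraNneq h => h; rewrite /neg_part h oppr0 maxxx.
have cp := continuous_pos_part cF; have cn := continuous_neg_part cF.
have Ep : (\int[mu]_(x in [set: borel M]) (pos_part F x)%:E =
    LI (fun y => (pos_part (dens i F) y)%:E))%E.
  rewrite (@integral_dens i _ B cp)//; last 3 first.
  - by move=> x; rewrite pos_part_ge0/= (le_trans (pos_part_le _ _)).
  - by move=> x /pK; exact: Ki.
  - exact: fin0.
  apply: LI_eq => y; congr (_%:E); rewrite /pos_part /dens; case: asboolP => Cy; last by rewrite maxxx.
  by rewrite -{2}(mul0r (vol i y)) maxr_pMl// ltW// vol_gt0.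
have En : (\int[mu]_(x in [set: borel M]) (neg_part F x)%:E =
    LI (fun y => (neg_part (dens i F) y)%:E))%E.
  rewrite (@integral_dens i _ B cn)//; last 3 first.
  - by move=> x; rewrite neg_part_ge0/= (le_trans (neg_part_le _ _)).
  - by move=> x /nK; exact: Ki.
  - exact: fin0.
  apply: LI_eq => y; congr (_%:E); rewrite /neg_part /dens; case: asboolP => Cy; last by rewrite oppr0 maxxx.
  by rewrite -mulNr -{2}(mul0r (vol i y)) maxr_pMl// ltW// vol_gt0.
have fp : (\int[mu]_(x in [set: borel M]) (pos_part F x)%:E \is a fin_num)%E.
  apply: integrable_fin_num => //; apply: csupp_integrable => //.
  by exists K.
have fn : (\int[mu]_(x in [set: borel M]) (neg_part F x)%:E \is a fin_num)%E.
  apply: integrable_fin_num => //; apply: csupp_integrable => //.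
  by exists K.
rewrite integralE.
have -> : (\int[mu]_(x in [set: borel M]) ((fun x => (F x)%:E) ^\+ x) =
    \int[mu]_(x in [set: borel M]) (pos_part F x)%:E)%E.
  by apply: eq_integral => x _; rewrite funeposE /pos_part EFin_max.
have -> : (\int[mu]_(x in [set: borel M]) ((fun x => (F x)%:E) ^\- x) =
    \int[mu]_(x in [set: borel M]) (neg_part F x)%:E)%E.
  by apply: eq_integral => x _; rewrite funenegE /neg_part EFin_max.
by rewrite /sint EFinB -Ep -En !fineK.
Qed.

End Volume.

(** * Green's identity *)

Section ZeroExtension.
Context {R : realType} {m : nat}.
Local Notation V := 'rV[R]_m.
Context (U : set V) (oU : open U) (K : set V) (cK : compact K) (KU : K `<=` U).

Definition zext (f : V -> R) (y : V) : R := if `[< U y >] then f y else 0.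

Lemma zextE f y : U y -> zext f y = f y.
Proof. by move=> Uy; rewrite /zext asboolT. Qed.

Context (f : V -> R) (fK : forall y, U y -> f y != 0 -> K y).

Lemma zext0 y : ~ K y -> zext f y = 0.
Proof.
move=> nK; rewrite /zext; case: asboolP => // Uy.
by apply/eqP/negPn/negP => fy; apply: nK; exact: fK.
Qed.

Lemma closedK : closed K.
Proof. by apply: compact_closed => //; exact: norm_hausdorff. Qed.

Lemma smooth_zext : smooth U f -> smooth setT (zext f).
Proof.
move=> sf; apply: smooth_on_local => y _; have [Uy|nU] := EM (U y).
  exists U => //; apply: (@smooth_on_eq _ _ _ f) => // z Uz; exact/esym/zextE.
exists (~` K); first by move=> /KU.
apply: (@smooth_on_eq _ _ _ (fun=> 0)).
- exact: closed_openC closedK.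
- by move=> z nz; rewrite zext0.
by apply: smooth_on_cst; exact: closed_openC closedK.
Qed.

Lemma partial_zext a y : ~ U y -> partial a (zext f) y = 0.
Proof.
move=> nU; apply: (@partial_out0 _ _ (~` K)) => //.
- exact: closed_openC closedK.
- by move=> z nz; rewrite zext0.
by move=> /KU.
Qed.

End ZeroExtension.

Lemma compact_norm_bound (R : realType) m (K : set 'rV[R]_m) : compact K ->
  exists2 r : R, 0 < r & forall y, r <= `|y| -> ~ K y.
Proof.
move=> cK; have [r [_ rK]] := compact_bounded cK.
exists (`|r| + 2) => [|y ry Ky]; first by rewrite ltr_wpDl.
have := rK (`|r| + 1) _ y Ky.
rewrite (le_lt_trans (ler_norm r)) ?ltrDl// => /(_ isT) /= h.
by move: (le_trans ry h); rewrite lerD2l lern1.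
Qed.

Section Divergence.
Context {R : realType} {n : nat} {M : complexManifold R n}.
Context (g : kahlerMetric M).
Local Notation V := 'rV[R]_(n + n).
Local Notation N := (n + n)%N.
Implicit Types (i : chart_index M).

Context (i : chart_index M).

Let oC : open (chart_codom i). Proof. exact: open_chart_codom. Qed.
Let sG : msmooth (chart_codom i) (gmx g i). Proof. exact: gmx_msmooth. Qed.
Let sH : msmooth (chart_codom i) (ginv g i). Proof. exact: ginv_msmooth. Qed.
Let symG y : chart_codom i y -> (gmx g i y)^T = gmx g i y.
Proof. exact: gmx_sym. Qed.
Let symH y : chart_codom i y -> (ginv g i y)^T = ginv g i y.
Proof. exact: ginv_sym. Qed.
Let HG y : chart_codom i y -> ginv g i y *m gmx g i y = 1%:M.
Proof. exact: ginvK. Qed.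
Let GH y : chart_codom i y -> gmx g i y *m ginv g i y = 1%:M.
Proof. exact: gmxK. Qed.
Arguments sG : clear implicits.
Arguments sH : clear implicits.
Arguments symG : clear implicits.
Arguments symH : clear implicits.
Arguments HG : clear implicits.
Arguments GH : clear implicits.

Lemma trace_christoffel k y : chart_codom i y ->
  \tr (ginv g i y *m Chr (gmx g i) (ginv g i) k y) = 0.
Proof.
move=> Cy; apply: (trace_Chr oC sG symG HG GH
  stdJ_tr stdJ_sqr) => //.
- by move=> z Cz; exact: gmx_hermitian.
- by move=> a b c z Cz; exact: gmx_closed.
Qed.

Lemma partial_det a y : chart_codom i y ->
  partial a (fun y => \det (gmx g i y)) y =
  2 * \det (gmx g i y) * \tr (Gam (gmx g i) (ginv g i) a y).
Proof.
move=> Cy; apply: partial_is_derive.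
have d : is_derive y (delta_mx 0 a) (fun y => \det (gmx g i y))
    (\tr (\adj (gmx g i y) *m pmx a (gmx g i) y)).
  by apply: is_derive_det => k l; rewrite pmxE; apply: smooth_is_derive Cy; exact: sG.
apply: is_derive_eq d _.
have -> : \adj (gmx g i y) = \det (gmx g i y) *: ginv g i y.
  by rewrite -[LHS]mulmx1 -(GH _ Cy) mulmxA mul_adj_mx mul_scalar_mx.
rewrite -scalemxAl mxtraceZ (compat oC symG symH HG a Cy).
rewrite mulmxDr mxtraceD mulmxA mxtrace_mulC mulmxA GH// mul1mx.
by rewrite mulmxA HG// mul1mx mxtrace_tr; ring.
Qed.

(** The square of [vol] is the determinant, so [partial_det] and the product rule determine the
    derivative, [vol] being positive. *)
Lemma partial_vol a y : chart_codom i y ->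
  partial a (vol g i) y = vol g i y * \tr (Gam (gmx g i) (ginv g i) a y).
Proof.
move=> Cy; have v0 := vol_gt0 g Cy.
have E : partial a (fun y => vol g i y * vol g i y) y =
    2 * \det (gmx g i y) * \tr (Gam (gmx g i) (ginv g i) a y).
  rewrite -(partial_det a Cy); apply: (partial_eq_on a oC _ Cy) => z Cz.
  rewrite -expr2 sqr_sqrtr// ltW//; apply: posdef_det; first exact: gmx_sym.
  exact: gmx_posdef.
have dv := smooth_is_derive a (vol_smooth g i) Cy.
have dd := is_deriveM dv dv.
have E2 := partial_is_derive dd; rewrite E2 in E.
have D : \det (gmx g i y) = vol g i y * vol g i y.
  rewrite -expr2 sqr_sqrtr// ltW//; apply: posdef_det; first exact: gmx_sym.
  exact: gmx_posdef.
move: E; rewrite /GRing.scale/= D => E.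
apply: (mulfI (lt0r_neq0 v0)); lra.
Qed.

(** The Laplacian in divergence form: the trace of Christoffel symbols produced by the volume
    density cancels the one in the derivative of the gradient. *)
Lemma local_divergence (z v : V -> R) y :
  smooth (chart_codom i) z -> smooth (chart_codom i) v -> chart_codom i y ->
  \sum_a partial a (fun y => z y * vol g i y * grad (ginv g i) v y 0 a) y =
  (drow v y *m ginv g i y *m (drow z y)^T) 0 0 * vol g i y +
  z y * \tr (ginv g i y *m hess v y) * vol g i y.
Proof.
move=> sz sv Cy; set H := ginv g i; set G := gmx g i; set w := vol g i y.
have sgr := grad_msmooth oC sH sv.
have E a : partial a (fun y => z y * vol g i y * grad H v y 0 a) y =
    partial a z y * w * grad H v y 0 a +
    z y * w * (\tr (Gam G H a y) * grad H v y 0 a + pmx a (grad H v) y 0 a).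
  apply: partial_is_derive.
  have d1 := is_deriveM (smooth_is_derive a sz Cy) (smooth_is_derive a (vol_smooth g i) Cy).
  have d2 := is_deriveM d1 (smooth_is_derive a (sgr 0 a) Cy).
  apply: is_derive_eq d2 _; rewrite pmxE (partial_vol a Cy) /GRing.scale/= -/G -/H -/w.
  rewrite (_ : (z * vol g i) y = z y * w)//.
  ring.
under eq_bigr => a _ do rewrite E.
rewrite big_split/= -mulr_sumr; congr (_ + _).
  rewrite [X in X * _]mxE mulr_suml; apply: eq_bigr => a _.
  by rewrite [_^T _ _]mxE drowE; ring.
rewrite mulrAC; congr (_ * _); rewrite big_split/=.
have -> : \sum_a pmx a (grad H v) y 0 a =
    \tr (H y *m hess v y) - \sum_a \tr (Gam G H a y) * grad H v y 0 a.
  have -> : \tr (H y *m hess v y) = \tr (chess G H v y *m H y).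
    rewrite [RHS]mxtrace_mulC /chess mulmxBr mxtraceB.
    suff -> : \tr (H y *m \sum_k drow v y 0 k *: Chr G H k y) = 0 by rewrite subr0.
    rewrite mulmx_sumr linear_sum/= big1// => k _.
    by rewrite -scalemxAr mxtraceZ trace_christoffel ?mulr0.
  have -> : \sum_a (\tr (Gam G H a y) * grad H v y 0 a) =
      \sum_a (grad H v y *m Gam G H a y) 0 a.
    transitivity (\sum_a \sum_c Gam G H a y c c * grad H v y 0 a).
      by apply: eq_bigr => a _; rewrite mulr_suml.
    rewrite exchange_big; apply: eq_bigr => c _; rewrite [RHS]mxE.
    apply: eq_bigr => a _; rewrite mulrC.
    by rewrite (Gam_sym oC (ginv g i) symG a c c Cy).
  rewrite -sumrB; apply: eq_bigr => a _.
  rewrite (pmx_grad oC sG sH symG symH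
     HG GH sv a Cy) mxDE mxNE.
  by rewrite -row_mul mxE.
ring.
Qed.

End Divergence.

(** * Bump functions in charts *)

Section Bumps.
Context {R : realType} {n : nat} {M : complexManifold R n}.
Local Notation V := 'rV[R]_(n + n).
Local Notation N := (n + n)%N.

(** The Euclidean distance is used because it has a smooth square; the norm on row vectors is the
    sup norm. *)
Definition sqdist (y z : V) : R := \sum_a (z 0 a - y 0 a) ^+ 2.

Lemma sqdist_smooth (U : set V) y : open U -> smooth U (sqdist y).
Proof.
move=> oU; apply: smooth_on_sum => [//|a].
apply: (@smooth_on_eq _ _ _ (fun z : V => (z 0 a - y 0 a) * (z 0 a - y 0 a))) => [//|z _|].
  by rewrite expr2.
by apply: smooth_onM => //; apply: smooth_onB => //; (exact: smooth_on_coord) || exact: smooth_on_cst.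
Qed.

Lemma sqdist_norm y z (r : R) : 0 <= r -> sqdist y z <= r ^+ 2 -> `|z - y| <= r.
Proof.
move=> r0 h; apply: normrV_le => // a; rewrite mxDE mxNE.
rewrite -ler_sqr ?nnegrE// real_normK ?num_real//; apply: le_trans h.
by rewrite /sqdist (bigD1 a)//= lerDl; apply: sumr_ge0 => b _; exact: sqr_ge0.
Qed.

Lemma open_sqdist (i : chart_index M) (y : V) (c : R) :
  open (dom i `&` [set x | sqdist y (chart i x) < c]).
Proof.
have -> : dom i `&` [set x | sqdist y (chart i x) < c] =
    dom i `&` chart i @^-1` [set z | sqdist y z < c] by [].
apply: open_preimage_on; [exact: open_dom|by move=> x; exact: chart_continuous|].
rewrite (_ : [set z | _] = sqdist y @^-1` `]-oo, c[%classic).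
  apply: open_comp => [z _|]; last exact: interval_open.
  by apply: (@smooth_on_continuous _ _ setT) => //; exact: sqdist_smooth openT.
by apply/seteqP; split => z /=; rewrite in_itv.
Qed.

Lemma chart_bump (x : M) : exists (b : M -> R) (W K : set M),
  [/\ sfun b, nbhs x W, forall z, W z -> b z = 1, compact K &
   K `<=` dom (chart_at x) /\ forall z, b z != 0 -> K z].
Proof.
set i := chart_at x; set y := chart i x.
have Cy : chart_codom i y := chart_at_codom x.
have [r r0 rC] := chart_box Cy.
(* [A] is positive exactly inside the sphere of radius r and [B] exactly outside that of radius r /
   2. The quotient A / (A + B) is therefore smooth, equal to 1 near [y] and 0 far from it. *)
pose A (z : V) := ramp 1 (r ^+ 2 - sqdist y z).
pose B (z : V) := ramp 1 (sqdist y z - r ^+ 2 / 4).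
pose F z := A z / (A z + B z).
have r2 : 0 < r ^+ 2 by rewrite exprn_gt0.
have AB z : 0 < A z + B z.
  have [h|h] := ltP (sqdist y z) (r ^+ 2).
    by rewrite ltr_pwDl// ?ramp_ge0// ramp_gt0 subr_gt0.
  rewrite ltr_wpDl ?ramp_ge0// ramp_gt0 subr_gt0; apply: lt_le_trans h.
  by rewrite ltr_pdivrMr// ltr_pMr// ltr1n.
have oC := open_chart_codom i.
have sq := sqdist_smooth y oC.
have sA : smooth (chart_codom i) A.
  by apply: smooth_on_ramp => //; apply: smooth_onB => //; exact: smooth_on_cst.
have sB : smooth (chart_codom i) B.
  by apply: smooth_on_ramp => //; apply: smooth_onB => //; exact: smooth_on_cst.
have sF : smooth (chart_codom i) F.
  apply: smooth_onM => //; apply: smooth_onV => //; first exact: smooth_onD.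
  by move=> z _; rewrite gt_eqF.
have FK z : F z != 0 -> `|z - y| <= r.
  move=> Fz; apply: sqdist_norm; first exact: ltW.
  rewrite leNgt; apply: contraNN Fz => h.
  by rewrite /F /A ramp_le0 ?mul0r// subr_le0 ltW.
have [sb bK] := @extend_chart_smooth R n M i F [set z | `|z - y| <= r]
  (compact_box (r := r)) rC (fun z _ => FK z) sF.
exists (extend_chart i F), (dom i `&` [set x | sqdist y (chart i x) < r ^+ 2 / 4]),
  (chart_inv i @` [set z | `|z - y| <= r]); split => //.
- apply: open_nbhs_nbhs; split; first exact: open_sqdist.
  split; first exact: dom_chart_at.
  rewrite /= /sqdist big1 ?divr_gt0// => a _.
  by rewrite -/y subrr expr0n.
- move=> z [iz /= zr]; rewrite /extend_chart asboolT// /F /B ramp_le0 ?subr_le0 1?ltW//.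
  rewrite addr0 divff// gt_eqF// /A ramp_gt0 subr_gt0; apply: lt_trans zr _.
  by rewrite ltr_pdivrMr// ltr_pMr// ltr1n.
- by apply: compact_chart_inv; [exact: compact_box|exact: rC].
by split => // _ [z zr <-]; apply: dom_chart_inv; exact: rC.
Qed.

End Bumps.

Section Green.
Context {R : realType} {n : nat} {M : complexManifold R n} (g : kahlerMetric M).
Context (mu : {measure set (borel M) -> \bar R}) (mu_vol : riemannian_volume g mu).
Local Notation V := 'rV[R]_(n + n).
Local Notation N := (n + n)%N.

Lemma ip_vanish v z (K : set M) : closed K -> (forall x, z x != 0 -> K x) ->
  forall x, ~ K x -> ip g v z x = 0.
Proof.
move=> cK zK x nK; rewrite ipE.
suff -> : dform z x = 0 by rewrite trmx0 mulmx0 mxE.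
rewrite -[RHS](@dform_cst R n M 0 x); apply: dform_near.
have /filterS := open_nbhs_nbhs (conj (closed_openC cK) nK); apply => w /= nw.
by apply/eqP/negPn/negP => /zK.
Qed.

Definition green z v := (\int[mu]_(x in [set: borel M]) (ip g v z x + z x * lap g v x)%:E = 0)%E.

Lemma green_local i (K : set M) z v : sfun z -> sfun v -> compact K -> K `<=` dom i ->
  (forall x, z x != 0 -> K x) -> green z v.
Proof.
move=> sz sv cK Ki zK; rewrite /green; pose F x := ip g v z x + z x * lap g v x.
have clK : closed K by apply: compact_closed => //; exact: manifold_hausdorff.
have sF : sfun F by apply: sfunD; [exact: sfun_ip|apply: sfunM => //; exact: sfun_lap].
have FK x : F x != 0 -> K x.
  apply: contra_neqP => nK; rewrite /F (ip_vanish v clK zK nK) add0r.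
  have [->|/zK//] := eqVneq (z x) 0; by rewrite mul0r.
rewrite (integral_sint mu_vol (sfun_continuous sF) cK Ki FK); congr (_%:E).
have oC := open_chart_codom i.
(* The coordinates of the vector field z grad v, weighted by the volume density. Their supports are
   compact in the chart, so they extend by zero to R^m and each partial derivative integrates to
   0. *)
pose h a y := lrep z i y * vol g i y * grad (ginv g i) (lrep v i) y 0 a.
have sh a : smooth (chart_codom i) (h a).
  apply: smooth_onM => //; last first.
    by apply: (grad_msmooth oC (ginv_msmooth g i)); exact: sfun_lrep.
  by apply: smooth_onM => //; [exact: sfun_lrep|exact: vol_smooth].
pose K' := chart i @` K.
have cK' : compact K'.
  apply: continuous_compact => //; apply: continuous_in_subspaceT => x; rewrite inE => /Ki.
  exact: chart_continuous.
have K'C : K' `<=` chart_codom i by move=> _ [x Kx <-]; apply: codom_chart; exact: Ki.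
have hK a y : chart_codom i y -> h a y != 0 -> K' y.
  move=> Cy hy; exists (chart_inv i y); last exact: chart_invK.
  by apply: zK; apply: contraNneq hy => zy; rewrite /h /lrep zy !mul0r.
have sx a := smooth_zext oC cK' K'C (hK a) (sh a).
have densE' y : dens g i F y = \sum_a partial a (zext (chart_codom i) (h a)) y.
  have [Cy|nC] := EM (chart_codom i y); last first.
    by rewrite dens_out// big1// => a _; exact: (partial_zext cK' K'C (hK a) a nC).
  rewrite densE// /F (ip_chart_inv g sv sz Cy) (lap_chart_inv g sv Cy) mulrDl.
  rewrite (eq_bigr (fun a => partial a (h a) y)); last first.
    by move=> a _; apply: (partial_eq_on a oC _ Cy) => w Cw; exact: zextE.
  rewrite (local_divergence g (sfun_lrep i sz) (sfun_lrep i sv) Cy).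
  by rewrite /cip !dmxE.
have [r r0 rK] := compact_norm_bound cK'.
have rb a y (ry : r <= `|y|) := zext0 (hK a) (rK y ry).
rewrite (_ : dens g i F = fun y => \sum_a partial a (zext (chart_codom i) (h a)) y).
  have bs a := bsupp_partial a (sx a) (rb a).
  have r1 : 0 < r + 1 by rewrite ltr_wpDl// ltW.
  have [_ ->] := sint_sum (index_enum 'I_N) r1 bs.
  by apply: big1 => a _; exact: sint_partial r0 (sx a) (rb a).
by apply/funext => y; exact: densE'.
Qed.

Lemma green_integrable z v : sfun z -> csupp z -> sfun v ->
  mu.-integrable [set: borel M] (fun x => (ip g v z x + z x * lap g v x)%:E).
Proof.
move=> sz [K cK zK] sv; apply: (csupp_integrable mu_vol).
  by apply: sfun_continuous; apply: sfunD; [exact: sfun_ip|apply: sfunM => //; exact: sfun_lap].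
have clK : closed K by apply: compact_closed => //; exact: manifold_hausdorff.
exists K => // x; apply: contra_neqP => nK; rewrite (ip_vanish v clK zK nK) add0r.
by have [->|/zK//] := eqVneq (z x) 0; rewrite mul0r.
Qed.

Lemma ipDr v z1 z2 x : sfun z1 -> sfun z2 ->
  ip g v (fun x => z1 x + z2 x) x = ip g v z1 x + ip g v z2 x.
Proof. by move=> s1 s2; rewrite !ipE dformD// trmxD mulmxDr mxDE. Qed.

Lemma greenD z1 z2 v : sfun z1 -> sfun z2 -> csupp z1 -> csupp z2 -> sfun v ->
  green z1 v -> green z2 v -> green (fun x => z1 x + z2 x) v.
Proof.
move=> s1 s2 c1 c2 sv g1 g2; rewrite /green.
have i1 := green_integrable s1 c1 sv; have i2 := green_integrable s2 c2 sv.
transitivity (\int[mu]_(x in [set: borel M]) ((ip g v z1 x + z1 x * lap g v x)%:E +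
    (ip g v z2 x + z2 x * lap g v x)%:E))%E.
  by apply: eq_integral => x _; rewrite -EFinD ipDr//; congr (_%:E); ring.
by rewrite integralD// g1 g2 adde0.
Qed.

(* A partition of unity in disguise: multiplying z by 1 - b, for bumps b, makes
   it vanish on larger and larger sets, at the cost of local terms z b. *)
Lemma green_identity z v : sfun z -> csupp z -> sfun v -> green z v.
Proof.
move=> sz cz sv; have [K cK zK] := cz.
(* [P A] says that Green's identity for [z] may be reduced to functions supported inside [z] and
   vanishing on [A]. For A = K only the zero function remains. *)
pose P (A : set M) := forall z, sfun z -> csupp z ->
  (forall z', sfun z' -> csupp z' -> (forall x, z' x != 0 -> z x != 0) ->
     (forall x, A x -> z' x = 0) -> green z' v) -> green z v.
have : P K.
  apply: compact_ind => //.
  - by move=> z1 s1 c1; apply.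
  - move=> A B PA PB z1 s1 c1 H; apply: (PA z1) => // z2 s2 c2 z21 z2A.
    apply: (PB z2) => // z3 s3 c3 z32 z3B; apply: H => // [x /z32/z21//|x [Ax|/z3B//]].
    by apply/eqP/negPn/negP => /z32; rewrite z2A// eqxx.
  - move=> A B AB PB z1 s1 c1 H; apply: (PB z1) => // z2 s2 c2 z21 z2B.
    by apply: H => // x /AB; exact: z2B.
  move=> x _; have [b [W [L [sb Wx bW cL [Li bL]]]]] := chart_bump x.
  exists W => // z1 s1 c1 H.
  have s2 : sfun (fun x => z1 x * b x) by exact: sfunM.
  have s3 : sfun (fun x => z1 x * (1 - b x)).
    by apply: sfunM => //; apply: sfunB => //; exact: sfun_cst.
  have -> : z1 = fun x => z1 x * b x + z1 x * (1 - b x).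
    by apply/funext => w; ring.
  apply: greenD => //; [exact: csuppMl|exact: csuppMl| |].
  - apply: (@green_local (chart_at x) L) => // w; rewrite mulf_eq0 negb_or => /andP[_].
    exact: bL.
  - apply: H => //; first exact: csuppMl.
      by move=> w; rewrite mulf_eq0 negb_or => /andP[].
    by move=> w Ww; rewrite bW// subrr mulr0.
move=> /(_ z sz cz); apply => z' s' c' z'z z'K.
rewrite /green (eq_integral (cst 0%E)) ?integral0// => x _.
have z0 : z' = fun=> 0.
  by apply/funext => w; apply/eqP/negPn/negP => /[dup] /z'z/zK/z'K ->; rewrite eqxx.
by rewrite z0 ipE dform_cst trmx0 mulmx0 mxE mul0r addr0.
Qed.

End Green.

(** * Curves and the Riemannian distance *)

Section Curves.
Context {R : realType} {n : nat} {M : complexManifold R n} (g : kahlerMetric M).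
Local Notation V := 'rV[R]_(n + n).
Local Notation N := (n + n)%N.
Implicit Types (c : R -> M) (t s : R) (i j : chart_index M).

Definition ccoord c i (a : 'I_N) : R -> R := fun s => chart i (c s) 0 a.

Lemma C1_curve_local c : (forall t, exists2 c', C1_curve c' & \forall s \near t, c' s = c s) ->
  C1_curve c.
Proof.
move=> loc; split.
  move=> t; have [c' [cc' _] nc] := loc t.
  exact: near_eq_continuous nc (cc' t).
move=> t i ict a; have [c' [_ dc'] nc] := loc t.
have ct := nbhs_singleton nc.
rewrite -ct in ict; have [d' k'] := dc' t i ict a.
have nca : \forall s \near t, ccoord c' i a s = ccoord c i a s.
  by apply: filterS nc => s cs; rewrite /ccoord cs.
split; first exact: near_eq_derivable nca d'.
apply: near_eq_continuous k'.
have /filterS := near_join nca; apply => s ns.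
by rewrite !derive1E; exact: near_eq_derive.
Qed.

Lemma velocity_near c c' t : (\forall s \near t, c' s = c s) -> velocity c t = velocity c' t.
Proof.
move=> nc; have ct := nbhs_singleton nc; apply/rowP => a; rewrite !mxE -ct !derive1E.
apply: near_eq_derive; apply: filterS nc => s ns; by rewrite ns.
Qed.

Lemma ccoord_is_derive c i a t : C1_curve c -> dom i (c t) ->
  is_derive t 1 (ccoord c i a) (derive1 (ccoord c i a) t).
Proof.
by move=> [_ dc] ict; have [d _] := dc t i ict a; split => //; rewrite derive1E.
Qed.

Lemma is_derive_affine (f : R -> R) (k d t l : R) : is_derive (k * t + d) 1 f l ->
  is_derive t 1 (fun s => f (k * s + d)) (k * l).
Proof.
move=> df; have da : is_derive t 1 (fun s => k * s + d) k.
  have h := is_deriveD (is_deriveZ k (is_derive_id t (1 : R))) (is_derive_cst d t (1 : R)).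
  by apply: is_derive_eq h _; rewrite /GRing.scale/= mulr1 addr0.
have h := is_derive_chain1 (f := fun s => k * s + d) df da.
by apply: is_derive_eq h _; exact: mulrC.
Qed.

Lemma affine_continuous (k d : R) : continuous (fun s : R => k * s + d).
Proof.
move=> t; apply: continuousD; last exact: cst_continuous.
by apply: continuousM; [exact: cst_continuous|exact: cvg_id].
Qed.

Lemma near_dom c i t : C1_curve c -> dom i (c t) -> \forall s \near t, dom i (c s).
Proof.
move=> [cc _] ict; exact: (cc t _ (open_nbhs_nbhs (conj (@open_dom _ _ M i) ict))).
Qed.

Lemma derive1_affine c i a (k d t : R) : C1_curve c -> dom i (c (k * t + d)) ->
  is_derive t 1 (ccoord (fun s => c (k * s + d)) i a) (k * derive1 (ccoord c i a) (k * t + d)).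
Proof.
move=> cc ict; apply: (@is_derive_affine (ccoord c i a)).
exact: ccoord_is_derive.
Qed.

Lemma C1_curve_affine c (k d : R) : C1_curve c -> C1_curve (fun s => c (k * s + d)).
Proof.
move=> cc; have [c0 dc] := cc; split.
  by move=> t; apply: (@continuous_comp _ _ _ (fun s => k * s + d) c);
     [exact: affine_continuous|exact: c0].
move=> t i ict a; have h := derive1_affine a cc ict; split; first by case: h.
have nd : \forall s \near t, dom i (c (k * s + d)).
  exact: (affine_continuous (near_dom cc ict)).
apply: (@near_eq_continuous _ _ (fun s => k * derive1 (ccoord c i a) (k * s + d))).
  apply: filterS nd => s ds; have [_ <-] := derive1_affine a cc ds.
  by rewrite derive1E.
apply: continuousM; first exact: cst_continuous.
apply: (@continuous_comp _ _ _ (fun s => k * s + d) (derive1 (ccoord c i a))).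
  exact: affine_continuous.
by have [_] := dc _ i ict a.
Qed.

Lemma velocity_affine c (k d t : R) : C1_curve c ->
  velocity (fun s => c (k * s + d)) t = k *: velocity c (k * t + d).
Proof.
move=> cc; apply/rowP => a; rewrite mxZE !mxE.
have [_ <-] := derive1_affine a cc (dom_chart_at (c (k * t + d))).
by rewrite derive1E.
Qed.

Lemma C1_curve_cst (x : M) : C1_curve (fun=> x).
Proof.
split; first by move=> t; exact: cst_continuous.
move=> t i _ a; split; first exact: derivable_cst.
rewrite (_ : derive1 _ = cst 0); first exact: cst_continuous.
by apply/funext => s; rewrite derive1_cst.
Qed.

Lemma velocity_cst (x : M) t : velocity (fun=> x) t = 0.
Proof. by apply/rowP => a; rewrite !mxE derive1_cst. Qed.

Lemma tangent_normZ x (k : R) (v : V) : tangent_norm g x (k *: v) = `|k| * tangent_norm g x v.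
Proof.
rewrite /tangent_norm -!/(qform _ _) qformZ sqrtrM ?sqr_ge0// sqrtr_sqr //.
Qed.

Lemma tangent_norm0 x : tangent_norm g x 0 = 0.
Proof. by rewrite /tangent_norm !mul0mx mxE sqrtr0. Qed.

Lemma tangent_norm_ge0 x v : 0 <= tangent_norm g x v.
Proof. exact: sqrtr_ge0. Qed.

Section Chain.
Context (phi : M -> R) (sphi : sfun phi) (c : R -> M) (cc : C1_curve c).

Lemma chain_chart i t : dom i (c t) -> is_derive t 1 (fun s => phi (c s))
  (\sum_a derive1 (ccoord c i a) t * partial a (lrep phi i) (chart i (c t))).
Proof.
move=> ict.
have h := @C1_chain R N (chart_codom i) (lrep phi i) (fun s => chart i (c s)) t
  (fun a => derive1 (ccoord c i a) t) (open_chart_codom i) (smooth_on_C1 (sfun_lrep i sphi))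
  (codom_chart ict) (fun a => ccoord_is_derive a cc ict).
apply: near_eq_is_derive h.
by apply: filterS (near_dom cc ict) => s ds; rewrite /lrep chartK.
Qed.

Lemma chain_velocity t :
  is_derive t 1 (fun s => phi (c s)) ((dform phi (c t) *m (velocity c t)^T) 0 0).
Proof.
have h := chain_chart (dom_chart_at (c t)); apply: is_derive_eq h _.
by rewrite mxE; apply: eq_bigr => a _; rewrite !mxE mulrC.
Qed.

Lemma chain_derive1_continuous : continuous (derive1 (fun s => phi (c s))).
Proof.
move=> t; set i := chart_at (c t); have ict : dom i (c t) by exact: dom_chart_at.
apply: (@near_eq_continuous _ _ (fun s =>
  \sum_a derive1 (ccoord c i a) s * partial a (lrep phi i) (chart i (c s)))).
  apply: filterS (near_dom cc ict) => s ds.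
  by have [_ <-] := chain_chart ds; rewrite derive1E.
have [c0 dc] := cc.
suff H (r : seq 'I_N) : {for t, continuous (fun s =>
    \sum_(a <- r) derive1 (ccoord c i a) s * partial a (lrep phi i) (chart i (c s)))} by exact: H.
elim: r => [|a r IH].
  rewrite (_ : (fun s => _) = cst 0); first exact: cst_continuous.
  by apply/funext => s; rewrite big_nil.
rewrite (_ : (fun s => _) = fun s => derive1 (ccoord c i a) s *
   partial a (lrep phi i) (chart i (c s)) +
   \sum_(a <- r) derive1 (ccoord c i a) s * partial a (lrep phi i) (chart i (c s))); last first.
  by apply/funext => s; rewrite big_cons.
apply: continuousD; last exact: IH.
apply: continuousM; first by have [_] := dc t i ict a.
apply: (@continuous_comp _ _ _ (fun s => chart i (c s)) (partial a (lrep phi i))).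
  by apply: continuous_comp; [exact: c0|exact: chart_continuous].
apply: smooth_on_continuous (codom_chart ict).
by apply: smooth_on_partial; exact: sfun_lrep.
Qed.

Context (phi1 : forall x, grad_norm g phi x <= 1).

Lemma chain_le t : derive1 (fun s => phi (c s)) t <= tangent_norm g (c t) (velocity c t).
Proof.
have [_ h] := chain_velocity t; rewrite derive1E h.
apply: le_trans (ler_norm _) _; apply: le_trans (dform_le g _ _ _) _.
by rewrite ler_piMl// tangent_norm_ge0.
Qed.

Lemma length_ge : ((phi (c 1) - phi (c 0))%:E <= curve_length g c)%E.
Proof.
pose F s := phi (c s); have dF s : derivable F s 1 by have [] := chain_velocity s.
have cF : continuous F.
  by move=> s; apply: differentiable_continuous; exact/derivable1_diffP.
have cF' := chain_derive1_continuous.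
have FTC : (\int[lebesgue_measure]_(t in `[0%R, 1%R]) (derive1 F t)%:E = (F 1)%:E - (F 0)%:E)%E.
  apply: (@continuous_FTC2 R (derive1 F) F 0 1 ltr01) => [||//].
    exact: continuous_subspaceT.
  split; first by move=> s _; exact: dF.
    by apply: cvg_at_right_filter; exact: cF.
  by apply: cvg_at_left_filter; exact: cF.
rewrite EFinB -/(F 1) -/(F 0) -FTC /curve_length.
(* Taking the positive part makes both integrands nonnegative, so the comparison with the speed
   needs no measurability of the speed. *)
apply: (@le_trans _ _ (\int[lebesgue_measure]_(t in `[0%R, 1%R]) (Num.max (derive1 F t) 0)%:E)%E).
  apply: le_integral => //; last by move=> t _; rewrite lee_fin le_max lexx.
    apply: continuous_compact_integrable; first exact: segment_compact.
    exact: continuous_subspaceT.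
  apply: continuous_compact_integrable; first exact: segment_compact.
  apply: continuous_subspaceT => t; apply: continuous_max; first exact: cF'.
  exact: cst_continuous.
rewrite integral_mkcond [leRHS]integral_mkcond.
apply: integral_mono => t; rewrite /patch; case: ifP => // _; rewrite lee_fin ?le_max ?lexx ?orbT//.
by rewrite ge_max chain_le tangent_norm_ge0.
Qed.

End Chain.

(* Constancy near the ends makes concatenations C^1. *)
Definition joined (x y : M) (T : R) := exists c, [/\ C1_curve c,
  exists2 e, 0 < e & (forall t, t <= e -> c t = x) /\ (forall t, T - e <= t -> c t = y),
  0 < T & forall t, tangent_norm g (c t) (velocity c t) <= 1].

Lemma joined_refl x T : 0 < T -> joined x x T.
Proof.
move=> T0; exists (fun=> x); split => //; first exact: C1_curve_cst.
  by exists 1.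
by move=> t; rewrite velocity_cst tangent_norm0.
Qed.

Lemma near_lt (a b : R) : a < b -> \forall s \near a, s < b.
Proof. by move=> ab; exact: lt_nbhsl. Qed.

Lemma near_gt (a b : R) : b < a -> \forall s \near a, b < s.
Proof. by move=> ab; exact: lt_nbhsr. Qed.

Lemma joined_trans x y z T1 T2 : joined x y T1 -> joined y z T2 -> joined x z (T1 + T2).
Proof.
move=> [c1 [C1 [e1 e10 [h1 k1]] T10 s1]] [c2 [C2 [e2 e20 [h2 k2]] T20 s2]].
pose c t := if t < T1 then c1 t else c2 (1 * t + - T1).
(* Both pieces rest at [y] around the time [T1], so near any time the concatenation coincides with
   one of the two curves. *)
have loc t : exists c', [/\ C1_curve c', \forall s \near t, c' s = c s &
    tangent_norm g (c' t) (velocity c' t) <= 1].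
  have [tT|tT] := ltP t (T1 + e2).
    exists c1; split => //; apply: filterS (near_lt tT) => s sT.
    rewrite /c; case: ltP => // Ts; rewrite k1 ?h2//; last by lra.
    by lra.
  exists (fun t => c2 (1 * t + - T1)); split; first exact: C1_curve_affine.
    have tT' : T1 - e1 < t by lra.
    apply: filterS (near_gt tT') => s sT; rewrite /c; case: ltP => // Ts.
    by rewrite h2 ?k1//; lra.
  by rewrite velocity_affine// scale1r.
exists c; split.
- by apply: C1_curve_local => t; have [c' [? ? _]] := loc t; exists c'.
- exists (Num.min e1 e2); first by rewrite lt_min e10.
  split => t; rewrite /c.
    rewrite le_min => /andP[te1 te2]; case: ltP => tT; first exact: h1.
    rewrite h2; last by lra.
    by rewrite -(k1 t) ?h1//; lra.
  have m1 : Num.min e1 e2 <= e1 by rewrite ge_min lexx.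
  have m2 : Num.min e1 e2 <= e2 by rewrite ge_min lexx orbT.
  move=> tT; case: ltP => tT'; last by rewrite k2//; lra.
  have h2' : c2 (1 * t - T1) = y by apply: h2; lra.
  have k2' : c2 (1 * t - T1) = z by apply: k2; lra.
  by rewrite k1 -?h2' ?k2'//; lra.
- by rewrite addr_gt0.
move=> t; have [c' [_ nc s']] := loc t; rewrite (velocity_near nc).
by have := nbhs_singleton nc => <-.
Qed.

Lemma joined_sym x y T : joined x y T -> joined y x T.
Proof.
move=> [c [C [e e0 [h k]] T0 s]]; exists (fun t => c (-1 * t + T)).
split; [exact: C1_curve_affine| |exact: T0|].
  by exists e => //; split => t te; [apply: k|apply: h]; lra.
by move=> t; rewrite (velocity_affine _ _ _ C) tangent_normZ normrN1 mul1r.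
Qed.

Lemma joined_le x y T T' : T <= T' -> joined x y T -> joined x y T'.
Proof.
rewrite le_eqVlt => /orP[/eqP<-//|TT] H.
have := joined_trans H (@joined_refl y (T' - T) _); rewrite subrKC; apply.
by rewrite subr_gt0.
Qed.

(** Rescaling the time interval to [0, 1] multiplies the speed by [T]. *)
Lemma rdist_joined x y T : joined x y T -> (rdist g x y <= T%:E)%E.
Proof.
move=> [c [C [e e0 [h k]] T0 s]].
have C' := C1_curve_affine T 0 C.
apply: (@le_trans _ _ (curve_length g (fun t => c (T * t + 0)))).
  apply: ereal_inf_lbound; exists (fun t => c (T * t + 0)) => //; split => //.
    by rewrite h// mulr0 addr0 ltW.
  by rewrite k// mulr1 addr0 gerBl ltW.
rewrite /curve_length.
apply: (@le_trans _ _ (\int[lebesgue_measure]_(t in `[0%R, 1%R]) (cst T%:E t))%E).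
  rewrite integral_mkcond [leRHS]integral_mkcond.
  apply: integral_mono => t; rewrite /patch; case: ifP => // _.
    by rewrite lee_fin tangent_norm_ge0.
  rewrite /= lee_fin velocity_affine// tangent_normZ gtr0_norm//.
  by rewrite ger_pMr.
have m01 : lebesgue_measure (`[0%R, 1%R]%classic : set R) = 1%E.
  by rewrite lebesgue_measure_itv/= lte_fin ltr01 -EFinB subr0.
rewrite integral_cst//; by rewrite [X in (_ * X)%E]m01 mule1.
Qed.

Lemma rdist_lip phi x y : sfun phi -> (forall x, grad_norm g phi x <= 1) ->
  ((phi y - phi x)%:E <= rdist g x y)%E.
Proof.
move=> sphi phi1; apply: le_ereal_inf_tmp => _ [c [cc <- <-] <-].
exact: length_ge.
Qed.

End Curves.

(** * Cutoff functions on complete manifolds *)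

Section UnitGradient.
Context {R : realType} {n : nat} {M : complexManifold R n} (g : kahlerMetric M).
Local Notation V := 'rV[R]_(n + n).
Local Notation N := (n + n)%N.
Implicit Types (phi psi a b : M -> R) (i j : chart_index M).

Definition unit_cutoff phi := [/\ sfun phi, csupp phi & forall x, ip g phi phi x <= 1].

Lemma unit_cutoff_grad_norm phi : unit_cutoff phi -> forall x, grad_norm g phi x <= 1.
Proof. by move=> [_ _ p1] x; rewrite grad_normE -sqrtr1 ler_wsqrtr. Qed.

Lemma unit_cutoff0 : unit_cutoff (fun=> 0).
Proof.
split; first exact: sfun_cst.
  by exists set0; [exact: compact0|move=> x; rewrite eqxx].
by move=> x; rewrite ipE dform_cst mul0mx mul0mx mxE.
Qed.

(** The unit ball of the cotangent space is convex and contains 0. All gradient bounds for glued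
    functions reduce to this. *)
Lemma ip_convex f a b x (s t : R) : 0 <= s -> 0 <= t -> s + t <= 1 ->
  dform f x = s *: dform a x + t *: dform b x ->
  ip g a a x <= 1 -> ip g b b x <= 1 -> ip g f f x <= 1.
Proof.
move=> s0 t0 st fE a1 b1.
have y := ip_young g a b x 1 1.
have -> : ip g f f x = s ^+ 2 * ip g a a x + 2 * (s * t) * ip g a b x + t ^+ 2 * ip g b b x.
  have c : ip g b a x = ip g a b x by rewrite ipC.
  move: c; rewrite !ipE fE; move: (dform a x) (dform b x) (invmx _) => u v A c.
  rewrite trmxD ![(_ *: _)^T]linearZ/= !mulmxDl !mulmxDr -!scalemxAl -!scalemxAr.
  by rewrite !(mxDE, mxZE) c; ring.
have h : ip g a b x <= 1 by move: y; rewrite !mulr1 expr1n !mul1r; lra.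
apply: (@le_trans _ _ (s ^+ 2 + 2 * (s * t) + t ^+ 2)).
  have s2 := sqr_ge0 s; have t2 := sqr_ge0 t; have st2 : 0 <= 2 * (s * t) by rewrite !mulr_ge0.
  by rewrite !lerD// -[leRHS]mulr1 ler_wpM2l.
have -> : s ^+ 2 + 2 * (s * t) + t ^+ 2 = (s + t) ^+ 2 by ring.
by rewrite expr_le1 // addr_ge0.
Qed.

Definition hyp (tau t : R) := Num.sqrt (t ^+ 2 + tau ^+ 2).

Lemma is_derive_hyp (tau t : R) : 0 < tau -> is_derive t 1 (hyp tau) (t / hyp tau t).
Proof.
move=> tau0; have p : 0 < t ^+ 2 + tau ^+ 2 by rewrite ltr_wpDl ?sqr_ge0// exprn_gt0.
have d1 : is_derive t 1 (fun t : R => t ^+ 2 + tau ^+ 2) (2 * t).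
  have h := is_deriveD (is_deriveX 2 (is_derive_id t (1 : R))) (is_derive_cst (tau ^+ 2) t (1 : R)).
  by apply: is_derive_eq h _; rewrite /GRing.scale/= addr0 mulr1 expr1.
have h := is_derive_chain1 (f := fun t : R => t ^+ 2 + tau ^+ 2) (is_derive1_sqrt p) d1.
apply: is_derive_eq h _; rewrite -/(hyp tau t).
have h0 : hyp tau t != 0 by rewrite gt_eqF// sqrtr_gt0.
by field.
Qed.

(* A smooth substitute for the maximum, at distance at most tau. *)
Definition smax (tau s t : R) := 2^-1 * ((s + t) + (hyp tau (s - t) - tau)).

Lemma hyp_bounds (tau t : R) : 0 < tau -> `|t| <= hyp tau t <= `|t| + tau.
Proof.
move=> tau0; have p : 0 <= t ^+ 2 + tau ^+ 2 by rewrite addr_ge0 ?sqr_ge0.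
have h0 : 0 <= hyp tau t by exact: sqrtr_ge0.
have hE : hyp tau t ^+ 2 = t ^+ 2 + tau ^+ 2 by rewrite sqr_sqrtr.
have n2 : `|t| ^+ 2 = t ^+ 2 by rewrite real_normK ?num_real.
apply/andP; split.
  by rewrite -ler_sqr ?nnegrE// hE n2 lerDl sqr_ge0.
rewrite -ler_sqr ?nnegrE ?addr_ge0 ?(ltW tau0)// hE sqrrD n2.
have : 0 <= `|t| * tau by rewrite mulr_ge0// ltW.
lra.
Qed.

Lemma smax_ge (tau s t : R) : 0 < tau -> s - tau <= smax tau s t /\ t - tau <= smax tau s t.
Proof.
move=> tau0; have /andP[h _] := hyp_bounds (s - t) tau0.
have := ler_norm (s - t); have := ler_norm (- (s - t)); rewrite normrN /smax.
by move: h; move: (hyp _ _) `|_| => h k; lra.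
Qed.

Lemma smax_gt0 (tau s t : R) : 0 < tau -> 0 < smax tau s t -> 0 < s \/ 0 < t.
Proof.
move=> tau0; have /andP[_ h] := hyp_bounds (s - t) tau0; rewrite /smax => m0.
have [s0|s0] := ltP 0 s; [by left|right]; rewrite ltNge; apply/negP => t0.
have : `|s - t| = s - t \/ `|s - t| = - (s - t).
  by case: (ger0P (s - t)); [left|right].
by move: h m0; move: (hyp _ _) => k h m0 [E|E]; rewrite E in h; lra.
Qed.

Lemma unit_cutoff_smax tau a b : 0 < tau -> unit_cutoff a -> unit_cutoff b -> unit_cutoff (fun x => smax tau (a x) (b x)).
Proof.
move=> tau0 [sa [Ka cKa aK] a1] [sb [Kb cKb bK] b1].
have sd : sfun (fun x => a x - b x) by exact: sfunB.
split.
- have sh : sfun (fun x => hyp tau (a x - b x)).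
    have := sfun_sqrt (f := fun x => (a x - b x) * (a x - b x) + tau ^+ 2).
    rewrite /hyp => H; under eq_fun do rewrite expr2.
    apply: H; first by apply: sfunD; [exact: sfunM|exact: sfun_cst].
    by move=> x; rewrite -expr2 ltr_wpDl ?sqr_ge0// exprn_gt0.
  apply: sfunM; first exact: sfun_cst.
  apply: sfunD; first exact: sfunD.
  by apply: sfunB => //; exact: sfun_cst.
- exists (Ka `|` Kb); first exact: compactU.
  move=> x mx; have [a0|/aK] := eqVneq (a x) 0; last by left.
  have [b0|/bK] := eqVneq (b x) 0; last by right.
  (* The constant [tau] subtracted in [smax] makes it vanish at (0, 0), which keeps the support
     compact. *)
  move: mx; rewrite a0 b0 /smax /hyp subrr expr0n /= !add0r sqrtr_sqr gtr0_norm//.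
  by rewrite subrr mulr0 eqxx.
(* The derivative of [hyp] lies in [-1, 1], so the differential of [smax] is a convex combination of
   those of [a] and [b], with weights (1 + k) / 2 and (1 - k) / 2. *)
move=> x; pose k := (a x - b x) / hyp tau (a x - b x).
have hp : 0 < hyp tau (a x - b x).
  by rewrite sqrtr_gt0 ltr_wpDl ?sqr_ge0// exprn_gt0.
have /andP[nh _] := hyp_bounds (a x - b x) tau0.
have k1 : - 1 <= k <= 1.
  rewrite -ler_norml normrM normfV (gtr0_norm hp) ler_pdivrMr// mul1r //.
have /andP[k1l k1r] := k1.
apply: (@ip_convex _ a b x ((1 + k) / 2) ((1 - k) / 2)) => //.
- by apply: divr_ge0 => //; lra.
- by apply: divr_ge0 => //; lra.
- by rewrite -mulrDl; lra.
apply: dform_is_derive => c.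
have da := lrep_is_derive x c sa; have db := lrep_is_derive x c sb.
have dh := is_derive_chain1 (f := fun z => lrep a (chart_at x) z - lrep b (chart_at x) z)
    (is_derive_hyp (lrep a (chart_at x) (chart (chart_at x) x) -
  lrep b (chart_at x) (chart (chart_at x) x)) tau0) (is_deriveB da db).
have h := is_deriveZ (2^-1) (is_deriveD (is_deriveD da db)
  (is_deriveB dh (is_derive_cst tau (chart (chart_at x) x) (delta_mx 0 c)))).
apply: is_derive_eq h _.
have lE f : lrep f (chart_at x) (chart (chart_at x) x) = f x.
  by rewrite /lrep chartK//; exact: dom_chart_at.
rewrite !lE -/k !(mxDE, mxZE) /GRing.scale/=; clearbody k; ring.
Qed.

(** Each smooth maximum loses [tau]. The conclusion therefore keeps a uniform margin c' > c over
    [K], half of which pays for the next union. *)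
Lemma unit_cutoff_cover (K : set M) (P : M -> Prop) (c : R) : compact K ->
  (forall y, K y -> exists b, [/\ unit_cutoff b, c < b y & forall w, 0 < b w -> P w]) ->
  exists m c', [/\ unit_cutoff m, c < c', forall z, K z -> c' <= m z & forall w, 0 < m w -> P w].
Proof.
move=> cK H; apply: (@compact_ind M K (fun K => exists m c',
  [/\ unit_cutoff m, c < c', forall z, K z -> c' <= m z & forall w, 0 < m w -> P w])) => //.
- exists (fun=> 0), (c + 1); split => //; [exact: unit_cutoff0|by rewrite ltrDl|by move=> w; rewrite ltxx].
- move=> A B [m1 [c1 [F1 cc1 A1 P1]]] [m2 [c2 [F2 cc2 B2 P2]]].
  pose d := Num.min c1 c2; have cd : c < d by rewrite lt_min cc1.
  pose tau := (d - c) / 2; have tau0 : 0 < tau by rewrite divr_gt0// subr_gt0.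
  have d1 : d <= c1 by rewrite ge_min lexx.
  have d2 : d <= c2 by rewrite ge_min lexx orbT.
  have tE : d = c + 2 * tau by rewrite /tau mulrCA divff// mulr1 addrC subrK.
  exists (fun x => smax tau (m1 x) (m2 x)), (c + tau); split.
  + exact: unit_cutoff_smax.
  + by rewrite ltrDl.
  + move=> z Kz; have [s1 s2] := smax_ge (m1 z) (m2 z) tau0.
    by case: Kz => [/A1|/B2] h; lra.
  + by move=> w /(smax_gt0 tau0)[/P1|/P2].
- move=> A B AB [m [c' [F cc mB Pm]]]; exists m, c'; split => // z /AB; exact: mB.
move=> y Ky; have [b [Fb cb Pb]] := H y Ky.
have [sb _ _] := Fb.
exists [set z | (c + b y) / 2 < b z].
  apply: open_nbhs_nbhs; split; first by apply: open_superlevel; exact: sfun_continuous.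
  by rewrite /=; lra.
by exists b, ((c + b y) / 2); split => //; [lra|move=> z /= /ltW].
Qed.

(* Add to phi - eta, truncated smoothly, a capped smooth maximum of bumps from a
   finite subcover; the cap is reached wherever phi >= eta, so at each point at
   most one of the two differentials is nonzero. *)
Lemma unit_cutoff_extend phi (P : M -> Prop) (c eta : R) : unit_cutoff phi -> 0 < c -> 0 < eta ->
  (forall y, 0 < phi y -> exists b, [/\ unit_cutoff b, c < b y & forall w, 0 < b w -> P w]) ->
  exists psi, [/\ unit_cutoff psi, forall x, eta <= phi x -> phi x + c - 3 * eta <= psi x &
     forall w, 0 < psi w -> 0 < phi w \/ P w].
Proof.
move=> [sphi [K cK phiK] phi1] c0 eta0 H.
pose L := [set y | eta <= phi y].
have cL : compact L.
  apply: (@subclosed_compact _ _ K) => //.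
    rewrite (_ : L = phi @^-1` [set t | eta <= t]) //.
    by apply: closed_comp => [x _|]; [exact: sfun_continuous|exact: closed_ge].
  by move=> x /= px; apply: phiK; rewrite gt_eqF// (lt_le_trans eta0).
have [m [c' [[sm [Km cKm mK] m1] cc mL mP]]] := @unit_cutoff_cover L P c cL
  (fun y Ly => H y (lt_le_trans eta0 Ly)).
(* The loss 3 eta has three sources: the shift by eta and the two ramps. The second summand vanishes
   where m <= 0 and reaches its cap [ramp eta c] where m >= c, in particular wherever phi >= eta. *)
pose psi x := ramp eta (phi x - eta) + (ramp eta c - ramp eta (c - m x)).
have spm : sfun (fun x => phi x - eta) by apply: sfunB => //; exact: sfun_cst.
have scm : sfun (fun x => c - m x) by apply: sfunB => //; exact: sfun_cst.
exists psi; split.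
- split.
  + apply: sfunD; first exact: sfun_ramp.
    by apply: sfunB; [exact: sfun_cst|exact: sfun_ramp].
  + exists (K `|` Km); first exact: compactU.
    move=> x px; have [p0|/phiK] := eqVneq (phi x) 0; last by left.
    have [m0|/mK] := eqVneq (m x) 0; last by right.
    by move: px; rewrite /psi p0 m0 subr0 subrr addr0 ramp_le0 ?eqxx// sub0r oppr_le0 ltW.
  move=> x; apply: (@ip_convex _ phi m x (dramp eta (phi x - eta)) (dramp eta (c - m x))) => //.
  + exact: dramp_ge0.
  + exact: dramp_ge0.
  + have [px|px] := leP eta (phi x).
      rewrite [X in _ + X]dramp_le0 ?addr0; first exact: dramp_le1.
      by rewrite subr_le0 (le_trans (ltW cc))// mL.
    rewrite [X in X + _]dramp_le0 ?add0r; first exact: dramp_le1.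
    by rewrite subr_le0 ltW.
  apply: dform_is_derive => k.
  have dp := lrep_is_derive x k sphi; have dm := lrep_is_derive x k sm.
  have lE f : lrep f (chart_at x) (chart (chart_at x) x) = f x.
    by rewrite /lrep chartK//; exact: dom_chart_at.
  have d1 := is_derive_chain1 (f := fun z => lrep phi (chart_at x) z - eta) (is_derive_ramp
    (lrep phi (chart_at x) (chart (chart_at x) x) - eta) eta0)
    (is_deriveB dp (is_derive_cst eta (chart (chart_at x) x) (delta_mx 0 k))).
  have d2 := is_derive_chain1 (f := fun z => c - lrep m (chart_at x) z) (is_derive_ramp
    (c - lrep m (chart_at x) (chart (chart_at x) x)) eta0)
    (is_deriveB (is_derive_cst c (chart (chart_at x) x) (delta_mx 0 k)) dm).
  have h := is_deriveD d1 (is_deriveB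
    (is_derive_cst (ramp eta c) (chart (chart_at x) x) (delta_mx 0 k)) d2).
  apply: is_derive_eq h _; rewrite !lE !(mxDE, mxZE); ring.
- move=> x px; have E : ramp eta (c - m x) = 0.
    by apply: ramp_le0; rewrite subr_le0 (le_trans (ltW cc))// mL.
  rewrite /psi E.
  have := ramp_ge (phi x - eta) eta0; have := ramp_ge c eta0; lra.
move=> w; rewrite /psi => pw.
have [p0|p0] := ltP 0 (phi w - eta); first by left; lra.
right; apply: mP; rewrite ltNge; apply/negP => m0.
move: pw; rewrite ramp_le0// add0r subr_gt0 ltNge => /negP; apply.
by apply: ramp_homo => //; lra.
Qed.

End UnitGradient.

(** * Smooth steps and short curves in charts *)

Section Step.
Context {R : realType}.
Implicit Types (b t L : R).

Lemma flat_continuous b k : 0 < b -> continuous (flat b k : R -> R).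
Proof.
move=> b0 t; apply: differentiable_continuous; apply/derivable1_diffP.
by have [] := is_derive_flat k t b0.
Qed.

Lemma ramp_continuous b : 0 < b -> continuous (ramp b : R -> R).
Proof.
move=> b0 t; apply: differentiable_continuous; apply/derivable1_diffP.
by have [] := is_derive_ramp t b0.
Qed.

Lemma dramp_continuous b : 0 < b -> continuous (dramp b : R -> R).
Proof.
move=> b0 t; apply: continuousD; first exact: flat_continuous.
by apply: continuousM; [exact: cst_continuous|exact: flat_continuous].
Qed.

(* A smooth step from 0 to 1 on [L / 8, 15 L / 8]. *)
Definition step L t :=
  (ramp (L / 4) L)^-1 * (ramp (L / 4) L - ramp (L / 4) (L - ramp (L / 4) (1 * t + - (L / 8)))).

Definition dstep L t := (ramp (L / 4) L)^-1 *
  (dramp (L / 4) (L - ramp (L / 4) (1 * t + - (L / 8))) * dramp (L / 4) (1 * t + - (L / 8))).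

Lemma is_derive_step L t : 0 < L -> is_derive t 1 (step L) (dstep L t).
Proof.
move=> L0; have b0 : 0 < L / 4 by rewrite divr_gt0.
have d1 := @is_derive_affine R (ramp (L / 4)) 1 (- (L / 8)) t _ (is_derive_ramp _ b0).
have d2 := is_deriveB (is_derive_cst L t (1 : R)) d1.
have d3 := is_derive_chain1 (f := fun t => L - ramp (L / 4) (1 * t + - (L / 8)))
  (is_derive_ramp _ b0) d2.
have d4 := is_deriveZ (ramp (L / 4) L)^-1 (is_deriveB (is_derive_cst (ramp (L / 4) L) t (1 : R)) d3).
apply: is_derive_eq d4 _; rewrite /dstep /GRing.scale/=; ring.
Qed.

Lemma dstep_continuous L : 0 < L -> continuous (dstep L).
Proof.
move=> L0 t; have b0 : 0 < L / 4 by rewrite divr_gt0.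
have a : {for t, continuous (fun t => 1 * t + - (L / 8))} by exact: affine_continuous.
have cr : {for t, continuous (fun t => ramp (L / 4) (1 * t + - (L / 8)))}.
  by apply: (@continuous_comp _ _ _ (fun t => 1 * t + - (L / 8)) (ramp (L / 4)));
    [exact: a|exact: ramp_continuous].
have c1 : {for t, continuous (fun t => dramp (L / 4) (1 * t + - (L / 8)))}.
  by apply: (@continuous_comp _ _ _ (fun t => 1 * t + - (L / 8)) (dramp (L / 4)));
    [exact: a|exact: dramp_continuous].
have c2 : {for t, continuous (fun t => dramp (L / 4) (L - ramp (L / 4) (1 * t + - (L / 8))))}.
  apply: (@continuous_comp _ _ _ (fun t => L - ramp (L / 4) (1 * t + - (L / 8))) (dramp (L / 4))).
    by apply: continuousB; [exact: cst_continuous|exact: cr].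
  exact: dramp_continuous.
exact: (continuousM (@cst_continuous _ _ _ t) (continuousM c2 c1)).
Qed.

Lemma ramp_L L : 0 < L -> 3 / 4 * L <= ramp (L / 4) L.
Proof.
move=> L0; have b0 : 0 < L / 4 by rewrite divr_gt0.
have := ramp_ge L b0; lra.
Qed.

Lemma ramp_L0 L : 0 < L -> 0 < ramp (L / 4) L.
Proof. by move=> L0; rewrite ramp_gt0. Qed.

Lemma step_itv L t : 0 < L -> 0 <= step L t <= 1.
Proof.
move=> L0; have b0 : 0 < L / 4 by rewrite divr_gt0.
have r0 := ramp_L0 L0; rewrite /step; apply/andP; split.
  apply: mulr_ge0; first by rewrite invr_ge0 ltW.
  rewrite subr_ge0; apply: ramp_homo => //.
  by rewrite gerBl ramp_ge0.
by rewrite ler_pdivrMl// mulr1 gerBl ramp_ge0.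
Qed.

Lemma dstep_bound L t : 0 < L -> `|dstep L t| <= 4 / (3 * L).
Proof.
move=> L0; have b0 : 0 < L / 4 by rewrite divr_gt0.
have r0 := ramp_L0 L0; have rL := ramp_L L0.
have d0 s := dramp_ge0 s b0; have d1 s := dramp_le1 s b0.
rewrite /dstep ger0_norm; last first.
  by apply: mulr_ge0; [rewrite invr_ge0 ltW|exact: mulr_ge0].
apply: (@le_trans _ _ (ramp (L / 4) L)^-1).
  by apply: ler_piMr; [rewrite invr_ge0 ltW|exact: mulr_ile1].
have -> : 4 / (3 * L) = (3 / 4 * L)^-1 by field; rewrite gt_eqF.
by rewrite lef_pV2// posrE mulr_gt0.
Qed.

Lemma step0 L t : 0 < L -> t <= L / 8 -> step L t = 0.
Proof.
move=> L0 tL; rewrite /step (@ramp_le0 _ _ (1 * t + - (L / 8))); last by lra.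
by rewrite subr0 subrr mulr0.
Qed.

Lemma step1 L t : 0 < L -> 2 * L - L / 8 <= t -> step L t = 1.
Proof.
move=> L0 tL; have b0 : 0 < L / 4 by rewrite divr_gt0.
have r := ramp_ge (1 * t + - (L / 8)) b0.
rewrite /step (@ramp_le0 _ _ (L - _)); last by lra.
by rewrite subr0 mulVf// gt_eqF// ramp_L0.
Qed.

End Step.

Section Segment.
Context {R : realType} {n : nat} {M : complexManifold R n} (g : kahlerMetric M).
Local Notation V := 'rV[R]_(n + n).
Local Notation N := (n + n)%N.

(** The segment is run through with [step] as time profile, which rests near both ends as [joined]
    requires. *)
Lemma joined_segment (i : chart_index M) (y v : V) (D T : R) : 0 < T -> 0 <= D -> 3 * D <= T ->
  (forall s, 0 <= s <= 1 -> chart_codom i (y + s *: v)) ->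
  (forall s, 0 <= s <= 1 -> qform (gmx g i (y + s *: v)) v <= D ^+ 2) ->
  joined g (chart_inv i y) (chart_inv i (y + v)) T.
Proof.
move=> T0 D0 DT Cv Gv; pose L := T / 2; have L0 : 0 < L by rewrite divr_gt0.
pose p t := y + step L t *: v.
have Cp t : chart_codom i (p t) by apply: Cv; exact: step_itv.
have dp (t : R) b : is_derive t 1 (fun s => p s 0 b) (dstep L t * v 0 b).
  rewrite (_ : (fun s => _) = fun s => y 0 b + step L s * v 0 b); last first.
    by apply/funext => s; rewrite mxDE mxZE.
  have h := is_deriveD (is_derive_cst (y 0 b) t (1 : R))
    (is_deriveM (is_derive_step t L0) (is_derive_cst (v 0 b) t (1 : R))).
  by apply: is_derive_eq h _; rewrite /GRing.scale/=; ring.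
have cp : continuous p.
  move=> t; apply: rV_continuous => b; apply: differentiable_continuous.
  by apply/derivable1_diffP; have [] := dp t b.
pose c t := chart_inv i (p t).
have dc t j a : dom j (c t) -> is_derive t 1 (ccoord c j a)
    (\sum_b (dstep L t * v 0 b) * partial b (fun z => transition i j z 0 a) (p t)).
  move=> jct; have oy : overlap i j (p t) by rewrite overlapE.
  exact: (@C1_chain R N (overlap i j) (fun z => transition i j z 0 a) p t _ (open_overlap i j)
    (smooth_on_C1 (transition_smooth' i j a)) oy (dp t)).
have cc : continuous c.
  move=> t; apply: (@continuous_comp _ _ _ p (chart_inv i)); first exact: cp.
  exact: chart_inv_continuous (Cp t).
have C1c : C1_curve c.
  split=> // t j jct a; split; first by have [] := dc t j a jct.
  have nd : \forall s \near t, dom j (c s).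
    exact: (cc t _ (open_nbhs_nbhs (conj (@open_dom _ _ M j) jct))).
  apply: (@near_eq_continuous _ _ (fun s =>
    \sum_b (dstep L s * v 0 b) * partial b (fun z => transition i j z 0 a) (p s))).
    by apply: filterS nd => s ds; have [_ <-] := dc s j a ds; rewrite derive1E.
  have oy : overlap i j (p t) by rewrite overlapE.
  suff H (r : seq 'I_N) : {for t, continuous (fun s =>
    \sum_(b <- r) (dstep L s * v 0 b) * partial b (fun z => transition i j z 0 a) (p s))}.
    exact: H.
  elim: r => [|b r IH].
    rewrite (_ : (fun s => _) = cst 0); first exact: cst_continuous.
    by apply/funext => s; rewrite big_nil.
  rewrite (_ : (fun s => _) = fun s => (dstep L s * v 0 b) *
      partial b (fun z => transition i j z 0 a) (p s) +
     \sum_(b <- r) (dstep L s * v 0 b) * partial b (fun z => transition i j z 0 a) (p s)); last first.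
    by apply/funext => s; rewrite big_cons.
  apply: continuousD; last exact: IH.
  apply: continuousM.
    by apply: continuousM; [exact: dstep_continuous|exact: cst_continuous].
  apply: (@continuous_comp _ _ _ p (partial b (fun z => transition i j z 0 a))); first exact: cp.
  by apply: smooth_on_continuous oy; apply: smooth_on_partial; exact: transition_smooth'.
exists c; split => //.
  exists (L / 8); first by rewrite divr_gt0.
  split => t tL; rewrite /c /p.
    by rewrite step0// scale0r addr0.
  rewrite step1// ?scale1r//; move: tL; rewrite /L; lra.
move=> t; set j := chart_at (c t).
have oy : overlap i j (p t) by rewrite overlapE; split; [exact: Cp|exact: dom_chart_at].
have -> : velocity c t = dstep L t *: (v *m tjac i j (p t)).
  apply/rowP => a; rewrite mxE derive1E mxZE.
  have [_ ->] := dc t j a (dom_chart_at (c t)).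
  rewrite mxE mulr_sumr; apply: eq_bigr => b _.
  by rewrite [tjac i j (p t) b a]mxE; ring.
rewrite tangent_normZ.
have -> : tangent_norm g (c t) (v *m tjac i j (p t)) = Num.sqrt (qform (gmx g i (p t)) v).
  rewrite /tangent_norm /metric_at -/j (_ : chart j (c t) = transition i j (p t))//.
  rewrite /qform (gmx_tjac g oy) trmx_mul.
  by rewrite !mulmxA.
have st := step_itv t L0.
apply: (@le_trans _ _ (4 / (3 * L) * D)).
  apply: ler_pM; [exact: normr_ge0|exact: sqrtr_ge0|exact: dstep_bound|].
  by rewrite -(ger0_norm D0) -sqrtr_sqr ler_wsqrtr// Gv.
(* Since 3 D <= T, the speed is at most 8 / 9. *)
have -> : 4 / (3 * L) * D = (8 * D) / (3 * T) by rewrite /L; field; rewrite gt_eqF.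
by rewrite ler_pdivrMr ?mulr_gt0// mul1r; lra.
Qed.

(** Cauchy-Schwarz for [A] between [v] and the row e_a A^-1, whose product with [v] is the
    coordinate. The constant is the trace of the inverse. *)
Lemma qform_coord (A : 'M[R]_N) : A^T = A -> posdef A ->
  exists2 h : R, 0 <= h & forall (v : V) a, v 0 a ^+ 2 <= h * qform A v.
Proof.
move=> sym pos; have uA := posdef_unit pos.
have [sH pH] := posdef_inv sym pos; set H := invmx A in sH pH.
have HA : H *m A = 1%:M := mulVmx uA.
pose h := \sum_a qform H (delta_mx 0 a : V).
have h_ge a : qform H (delta_mx 0 a : V) <= h.
  by rewrite /h (bigD1 a)//= lerDl sumr_ge0// => b _; exact: posdef_ge0.
exists h => [|v a]; first by apply: sumr_ge0 => b _; exact: posdef_ge0.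
have := qform_CS ((delta_mx 0 a : V) *m H) v sym pos.
have -> : (delta_mx 0 a : V) *m H *m A *m v^T = (delta_mx 0 a : V) *m v^T.
  by rewrite -(mulmxA _ H A) HA mulmx1.
have -> : ((delta_mx 0 a : V) *m v^T) 0 0 = v 0 a by rewrite -rowE !mxE.
have -> : qform A ((delta_mx 0 a : V) *m H) = qform H (delta_mx 0 a : V).
  by rewrite /qform trmx_mul sH !mulmxA -(mulmxA _ H A) HA mulmx1.
by move=> /le_trans; apply; rewrite ler_wpM2r// posdef_ge0.
Qed.

Lemma metric_compare (U : set V) (A : V -> 'M[R]_N) (y0 : V) : open U -> msmooth U A -> U y0 ->
  (A y0)^T = A y0 -> posdef (A y0) ->
  exists2 d : R, 0 < d & forall y v, `|y - y0| < d -> qform (A y) v <= 2 * qform (A y0) v.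
Proof.
move=> oU sA Uy0 sym pos; set A0 := A y0.
have [h h0 coord] := qform_coord sym pos.
pose e (y : V) := \sum_a \sum_b `|A y a b - A0 a b|.
have ce : {for y0, continuous e}.
  have ct a b : {for y0, continuous (fun y => `|A y a b - A0 a b|)}.
    apply: (@continuous_comp _ _ _ (fun y => A y a b - A0 a b) (fun t => `|t|)).
      apply: continuousB; last exact: cst_continuous.
      exact: smooth_on_continuous (sA a b) Uy0.
    exact: norm_continuous.
  suff H (r : seq 'I_N) : {for y0, continuous (fun y => \sum_(a <- r) \sum_b `|A y a b - A0 a b|)}.
    exact: H.
  have H2 a (l : seq 'I_N) : {for y0, continuous (fun y => \sum_(b <- l) `|A y a b - A0 a b|)}.
    elim: l => [|b l IH].
      rewrite (_ : (fun y => _) = cst 0); first exact: cst_continuous.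
      by apply/funext => s; rewrite big_nil.
    rewrite (_ : (fun y => _) = fun y => `|A y a b - A0 a b| +
      \sum_(b <- l) `|A y a b - A0 a b|); last by apply/funext => s; rewrite big_cons.
    by apply: continuousD; [exact: ct|exact: IH].
  elim: r => [|a r IH].
    rewrite (_ : (fun y => _) = cst 0); first exact: cst_continuous.
    by apply/funext => s; rewrite big_nil.
  rewrite (_ : (fun y => _) = fun y => \sum_b `|A y a b - A0 a b| +
    \sum_(a <- r) \sum_b `|A y a b - A0 a b|); last by apply/funext => s; rewrite big_cons.
  by apply: continuousD; [exact: H2|exact: IH].
have e0 : e y0 = 0.
  by rewrite /e big1// => a _; rewrite big1// => b _; rewrite subrr normr0.
(* At this threshold the change of the form, at most [e y] times h times the form at [y0], does not
   exceed the form itself. *)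
have : \forall y \near y0, e y < (h + 1)^-1.
  have nb : nbhs (e y0) [set t | t < (h + 1)^-1].
    by rewrite e0; apply: lt_nbhsl; rewrite invr_gt0; exact: ltr_wpDl.
  exact: ce _ nb.
move=> /nbhs_ballP[d /= d0 db]; exists d => // y v yd.
have ey : e y < (h + 1)^-1 by apply: db; rewrite -ball_normE /= distrC.
have q0 : 0 <= qform A0 v by exact: posdef_ge0.
have diff : `|qform (A y) v - qform A0 v| <= e y * (h * qform A0 v).
  have -> : qform (A y) v - qform A0 v =
      \sum_a \sum_b (A y a b - A0 a b) * (v 0 a * v 0 b).
    rewrite !qformE -sumrB; apply: eq_bigr => a _; rewrite -sumrB.
    by apply: eq_bigr => b _; ring.
  apply: le_trans (ler_norm_sum _ _ _) _.
  rewrite mulr_suml; apply: ler_sum => a _; apply: le_trans (ler_norm_sum _ _ _) _.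
  rewrite mulr_suml; apply: ler_sum => b _.
  rewrite normrM; apply: ler_wpM2l; first exact: normr_ge0.
  have ca := coord v a; have cb := coord v b.
  have s1 := sqr_ge0 (v 0 a - v 0 b); have s2 := sqr_ge0 (v 0 a + v 0 b).
  rewrite ler_norml; apply/andP; split; nra.
have : e y * (h * qform A0 v) <= qform A0 v.
  rewrite mulrA ler_piMl//; apply: (@le_trans _ _ ((h + 1)^-1 * h)).
    by rewrite ler_wpM2r// ltW.
  rewrite ler_pdivrMl ?mulr1; first by rewrite lerDl.
  exact: ltr_wpDl.
move: diff; rewrite ler_norml => /andP[_]; lra.
Qed.

Lemma is_derive_qform (A : 'M[R]_N) (c y : V) a : A^T = A ->
  is_derive y (delta_mx 0 a) (fun y => qform A (y - c)) (2 * ((y - c) *m A) 0 a).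
Proof.
move=> sA; apply: is_derive_of_line.
pose d : V := delta_mx 0 a.
rewrite (_ : (fun s => _) = fun s => (qform A (y - c) + 2 * ((y - c) *m A) 0 a * s) +
    qform A d * (s * s)); last first.
  apply/funext => s; rewrite addrAC qform_line// -/d.
  have -> : (d *m A *m (y - c)^T) 0 0 = ((y - c) *m A) 0 a.
    by rewrite -bil_tr sA /d trmx_delta -colE mxE.
  by rewrite expr2; ring.
have id1 := is_derive_id (0 : R) (1 : R).
have h := is_deriveD (is_deriveD (is_derive_cst (qform A (y - c)) (0 : R) (1 : R))
  (is_deriveZ (2 * ((y - c) *m A) 0 a) id1)) (is_deriveZ (qform A d) (is_deriveM id1 id1)).
apply: is_derive_eq h _; rewrite /GRing.scale/=; ring.
Qed.

Lemma smooth_qform (U : set V) (A : 'M[R]_N) (c : V) : open U ->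
  smooth U (fun y => qform A (y - c)).
Proof.
move=> oU; apply: (@smooth_on_eq _ _ _ (fun y : V => \sum_a \sum_b
    (y 0 a - c 0 a) * A a b * (y 0 b - c 0 b))) => [//|y _|].
  rewrite qformE; apply: eq_bigr => a _; apply: eq_bigr => b _.
  by rewrite !(mxDE, mxNE).
have sc a : smooth U (fun y : V => y 0 a - c 0 a).
  by apply: smooth_onB => //; [exact: smooth_on_coord|exact: smooth_on_cst].
apply: smooth_on_sum => [//|a]; apply: smooth_on_sum => [//|b].
by do 2 apply: smooth_onM => //; exact: smooth_on_cst.
Qed.

(** The bumps are functions of the squared distance in the metric frozen at [z0], which controls the
    true one up to a factor 2. The bound [s0] serves all points near [z0], as compactness arguments
    require. *)
Lemma small_bumps_local (z0 : M) : exists2 W, nbhs z0 W & exists2 s0 : R, 0 < s0 &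
  forall s, 0 < s <= s0 -> forall z, W z -> exists b, [/\ unit_cutoff g b, s <= b z &
    forall w, 0 < b w -> joined g z w (64 * s)].
Proof.
set i := chart_at z0; set y0 := chart i z0.
have Cy0 : chart_codom i y0 := chart_at_codom z0.
have oC := open_chart_codom i.
have [r r0 rC] := chart_box Cy0.
have sG0 := gmx_sym g Cy0; have pG0 := gmx_posdef g Cy0.
have [d1 d10 cG] := metric_compare oC (gmx_msmooth g i) Cy0 sG0 pG0.
have [d2 d20 cH] := metric_compare oC (ginv_msmooth g i) Cy0 (ginv_sym g Cy0) (ginv_posdef g Cy0).
have [h h0 coord] := qform_coord sG0 pG0.
set G0 := gmx g i y0 in sG0 pG0 cG coord; set H0 := ginv g i y0 in cH.
pose d := Num.min r (Num.min d1 d2).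
have dP : 0 < d by rewrite !lt_min r0 d10.
have dr : d <= r by rewrite ge_min lexx.
have dd1 : d <= d1 by rewrite /d minCA ge_min lexx.
have dd2 : d <= d2 by rewrite !ge_min lexx !orbT.
exists (dom i `&` [set z | `|chart i z - y0| < d / 2]).
  apply: open_nbhs_nbhs; split; first exact: open_box.
  by split; [exact: dom_chart_at|rewrite /= subrr normr0 divr_gt0].
exists (d / (32 * (h + 1))); first by rewrite divr_gt0// mulr_gt0// ltr_wpDl.
move=> s /andP[sP ss0] z [iz /= zd]; set yz := chart i z in zd.
pose rho : R := 8 * s; have rP : 0 < rho by rewrite mulr_gt0.
have rhoE : rho = 8 * s by [].
clearbody rho.
have hr : h * rho ^+ 2 <= (d / 4) ^+ 2.
  have h1 : 0 < h + 1 by rewrite ltr_wpDl.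
  have rb : rho * (h + 1) <= d / 4.
    move: ss0; rewrite ler_pdivlMr; last by rewrite mulr_gt0.
    by rewrite rhoE; lra.
  apply: (@le_trans _ _ ((rho * (h + 1)) ^+ 2)); last first.
    by rewrite ler_sqr ?nnegrE// ltW// ?mulr_gt0// divr_gt0.
  have h2 : h <= (h + 1) ^+ 2 by nra.
  rewrite exprMn [_ * rho ^+ 2]mulrC; apply: ler_wpM2l => //; exact: sqr_ge0.
have near_z (v : V) : qform G0 v <= rho ^+ 2 -> `|v| <= d / 4.
  move=> qv; have d4 : 0 <= d / 4 by rewrite divr_ge0// ltW.
  apply: normrV_le => // a; rewrite -ler_sqr ?nnegrE// real_normK ?num_real//.
  by apply: le_trans (coord v a) _; apply: le_trans hr; rewrite ler_wpM2l.
have box (y : V) : `|y - yz| <= d / 4 -> `|y - y0| < d.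
  move=> yy; have -> : y - y0 = (y - yz) + (yz - y0) by rewrite addrA subrK.
  by apply: le_lt_trans (ler_normD _ _) _; lra.
have boxC (y : V) : `|y - yz| <= d / 4 -> chart_codom i y.
  by move=> /box yd; apply: rC; apply: ltW; exact: lt_le_trans dr.
(* The value of [F] at its centre is at least (rho^2 - bb) / (4 rho) = rho / 8 = s, and its squared
   gradient is at most 1 / 2. Points where it is positive are joined to the centre in time 6 rho =
   48 s <= 64 s. *)
pose bb := rho ^+ 2 / 2; have bP : 0 < bb by rewrite divr_gt0// exprn_gt0.
pose F y := (4 * rho)^-1 * ramp bb (rho ^+ 2 - qform G0 (y - yz)).
have sF : smooth (chart_codom i) F.
  apply: smooth_onM => //; first exact: smooth_on_cst.
  apply: smooth_on_ramp => //; apply: smooth_onB => //; first exact: smooth_on_cst.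
  exact: smooth_qform.
have FK y : F y != 0 -> `|y - yz| <= d / 4.
  move=> Fy; apply: near_z; rewrite leNgt; apply: contraNN Fy => q.
  by rewrite /F ramp_le0 ?mulr0// subr_le0 ltW.
have [sb bK] := @extend_chart_smooth R n M i F [set y | `|y - yz| <= d / 4]
  (compact_box (r := d / 4)) boxC (fun y _ => FK y) sF.
set b := extend_chart i F in sb bK.
have cK : compact (chart_inv i @` [set y | `|y - yz| <= d / 4]).
  by apply: compact_chart_inv; [exact: compact_box|exact: boxC].
have bE y : chart_codom i y -> b (chart_inv i y) = F y by exact: extend_chartE.
exists b; split.
- split => //; first by exists (chart_inv i @` [set y | `|y - yz| <= d / 4]).
  move=> x; have [[y yb <-]|nx] := EM ((chart_inv i @` [set y | `|y - yz| <= d / 4]) x); last first.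
    have clK : closed (chart_inv i @` [set y | `|y - yz| <= d / 4]).
      by apply: compact_closed => //; exact: manifold_hausdorff.
    by rewrite (ip_vanish g b clK bK nx).
  have Cy := boxC y yb.
  rewrite (ip_chart_inv g sb sb Cy) /cip dmxE.
  pose k := dramp bb (rho ^+ 2 - qform G0 (y - yz)) / (2 * rho).
  have -> : drow (lrep b i) y = (- k) *: ((y - yz) *m G0).
    apply/rowP => a; rewrite drowE mxZE.
    rewrite (partial_eq_on a oC (g := F)) //.
    apply: partial_is_derive.
    have dF := is_derive_chain1 (f := fun y => rho ^+ 2 - qform G0 (y - yz))
      (is_derive_ramp (rho ^+ 2 - qform G0 (y - yz)) bP)
      (is_deriveB (is_derive_cst (rho ^+ 2) y (delta_mx 0 a)) (is_derive_qform yz y a sG0)).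
    have dd := is_deriveZ (4 * rho)^-1 dF.
    apply: is_derive_eq dd _; rewrite /k /GRing.scale/=; field.
    by rewrite gt_eqF.
  have -> : (((- k) *: ((y - yz) *m G0)) *m ginv g i y *m ((- k) *: ((y - yz) *m G0))^T) 0 0 =
      k ^+ 2 * qform (ginv g i y) ((y - yz) *m G0).
    by rewrite -[LHS]/(qform _ _) qformZ sqrrN.
  have qle : qform (ginv g i y) ((y - yz) *m G0) <= 2 * qform G0 (y - yz).
    apply: le_trans (cH y _ _) _; first by apply: lt_le_trans dd2; exact: box.
    rewrite /qform trmx_mul sG0 !mulmxA -(mulmxA _ G0 H0) (gmxK g Cy0) mulmx1 //.
  have [q|q] := leP (rho ^+ 2) (qform G0 (y - yz)).
    by rewrite /k dramp_le0 ?subr_le0// mul0r expr0n mul0r.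
  have k2 : k ^+ 2 <= (2 * rho)^-1 ^+ 2.
    rewrite /k exprMn ler_piMl ?sqr_ge0// expr_le1//; first exact: dramp_le1.
    exact: dramp_ge0.
  apply: (@le_trans _ _ ((2 * rho)^-1 ^+ 2 * (2 * rho ^+ 2))).
    apply: ler_pM => //; first exact: sqr_ge0.
      by apply: posdef_ge0; exact: ginv_posdef.
    by apply: le_trans qle _; rewrite ler_wpM2l// ltW.
  have -> : (2 * rho)^-1 ^+ 2 * (2 * rho ^+ 2) = 2^-1 by field; rewrite gt_eqF.
  lra.
- have zE : z = chart_inv i yz by rewrite /yz chartK.
  rewrite zE bE; last exact: codom_chart.
  rewrite /F subrr [qform _ 0]/qform !mul0mx mxE subr0.
  have := ramp_ge (rho ^+ 2) bP; rewrite /bb.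
  rewrite ler_pdivlMl ?mulr_gt0// => h1; apply: le_trans h1.
  by rewrite rhoE; nra.
move=> w bw; have [y yb yw] := bK w (lt0r_neq0 bw).
have Cy := boxC y yb.
have h4 : 0 < (4 * rho)^-1 by rewrite invr_gt0 mulr_gt0.
move: bw; rewrite -yw bE// /F (pmulr_rgt0 _ h4) ramp_gt0 subr_gt0 => q.
have zE : z = chart_inv i yz by rewrite /yz chartK.
have yE : y = yz + (y - yz) by rewrite addrC subrK.
rewrite zE yE; apply: (@joined_segment i yz (y - yz) (2 * rho)).
- by rewrite mulr_gt0.
- by rewrite mulr_ge0// ltW.
- by rewrite rhoE; lra.
- move=> t /andP[t0 t1]; apply: boxC; rewrite addrAC subrr add0r normrZ ger0_norm//.
  by apply: le_trans yb; rewrite ler_piMl.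
move=> t /andP[t0 t1]; apply: le_trans (cG _ _ _) _.
  apply: lt_le_trans dd1; apply: box; rewrite addrAC subrr add0r normrZ ger0_norm//.
  by apply: le_trans yb; rewrite ler_piMl.
by rewrite exprMn; have := sqr_ge0 rho; lra.
Qed.

End Segment.

(** * Large cutoffs from completeness *)

Section Completeness.
Context {R : realType} {n : nat} {M : complexManifold R n} (g : kahlerMetric M).
Local Notation joined := (joined g).
Local Notation unit_cutoff := (unit_cutoff g).

Lemma small_bumps (K : set M) : compact K -> exists2 s0 : R, 0 < s0 &
  forall s, 0 < s <= s0 -> forall z, K z -> exists b, [/\ unit_cutoff b, s <= b z &
    forall w, 0 < b w -> joined z w (64 * s)].
Proof.
move=> cK; apply: (@compact_ind M K (fun K => exists2 s0 : R, 0 < s0 &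
  forall s, 0 < s <= s0 -> forall z, K z -> exists b, [/\ unit_cutoff b, s <= b z &
    forall w, 0 < b w -> joined z w (64 * s)])) => //.
- by exists 1.
- move=> A B [s1 s10 h1] [s2 s20 h2]; exists (Num.min s1 s2); first by rewrite lt_min s10.
  move=> s /andP[s0]; rewrite le_min => /andP[ss1 ss2] z [Az|Bz].
    by apply: h1 => //; rewrite s0.
  by apply: h2 => //; rewrite s0.
- by move=> A B AB [s1 s10 h1]; exists s1 => // s ss z /AB; exact: h1.
by move=> z _; have [W Wz H] := small_bumps_local g z; exists W.
Qed.

Lemma unit_cutoff_lip phi x y T : unit_cutoff phi -> joined x y T -> phi x - phi y <= T.
Proof.
move=> Fp xy; have [sp _ _] := Fp.
have h := rdist_lip y x sp (unit_cutoff_grad_norm Fp).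
have h2 := rdist_joined (joined_sym xy).
by rewrite -lee_fin; exact: le_trans h h2.
Qed.

(** Each round extends the function by bumps centred where it is positive: the radius of the support
    grows by 64 s and the height at [x] by s / 4, a fixed ratio. The compact set [K] provides one
    [s] for all rounds. *)
Lemma unit_cutoff_growth (K : set M) x r : compact K -> 0 < r -> (forall y, joined x y r -> K y) ->
  exists phi, [/\ unit_cutoff phi, r / 8 / 8 / 8 <= phi x & forall w, 0 < phi w -> joined x w r].
Proof.
move=> cK r0 xK; have [s0 s00 H] := small_bumps cK.
pose s := Num.min s0 (r / 128).
have sP : 0 < s by rewrite lt_min s00 divr_gt0.
have ss0 : s <= s0 by rewrite ge_min lexx.
have sr : s <= r / 128 by rewrite ge_min lexx orbT.
have {}H z : K z -> exists b, [/\ unit_cutoff b, s <= b z & forall w, 0 < b w -> joined z w (64 * s)].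
  by apply: H; rewrite sP.
clearbody s.
have step j : 64 * s * j.+1%:R <= r -> exists phi,
    [/\ unit_cutoff phi, s * j.+4%:R / 4 <= phi x & forall w, 0 < phi w -> joined x w (64 * s * j.+1%:R)].
  elim: j => [|j IH] jr.
    have [|b [Fb sb bC]] := H x; first by apply: xK; exact: joined_refl.
    by exists b; split => //; [rewrite -mulrA divff// mulr1|rewrite mulr1].
  have jle : 64 * s * j.+1%:R <= 64 * s * j.+2%:R.
    by rewrite ler_wpM2l ?ler_nat// ltW// mulr_gt0.
  have [phi [Fp px pC]] := IH (le_trans jle jr).
  (* An extension with c = s / 2 and eta = s / 12 gains c - 3 eta = s / 4, and c is strictly below
     the height [s] of the bumps. *)
  have s2 : 0 < s / 2 by rewrite divr_gt0.
  have s12 : 0 < s / 12 by rewrite divr_gt0.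
  have [|psi [Fq qx qC]] := @unit_cutoff_extend _ _ _ g phi (fun w => joined x w (64 * s * j.+2%:R))
      (s / 2) (s / 12) Fp s2 s12.
    move=> y py; have xy := pC y py.
    have [|b [Fb sb bC]] := H y.
      by apply: xK; apply: joined_le xy; exact: le_trans jr.
    exists b; split => //; first by apply: lt_le_trans sb; lra.
    move=> w /bC yw; have := joined_trans xy yw; congr (joined x w _).
    by rewrite -[j.+2%:R]natr1; ring.
  exists psi; split => //.
    have j4 : s <= s * j.+4%:R / 4.
      have j4' : (4 : R) <= j.+4%:R by rewrite ler_nat.
      by rewrite ler_pdivlMr//; move: (j.+4%:R : R) j4' => k; nra.
    have h := qx x; apply: le_trans (h _); last by apply: le_trans px; lra.
    have -> : s * j.+1.+4%:R / 4 = s * j.+4%:R / 4 + s / 4.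
      by rewrite -[j.+1.+4%:R]natr1; move: (j.+4%:R : R) => k; field.
    lra.
  by move=> w /qC[/pC|//]; exact: joined_le.
have s64 : 0 < 64 * s by rewrite mulr_gt0.
(* The last round is given by the integer part j + 1 of [t]. From r < 64 s (j + 2), the required
   height r / 512 is below s (j + 2) / 8. *)
pose t := r / (64 * s); have t2 : 2 <= t by rewrite ler_pdivlMr//; lra.
have t0 : 0 <= t by apply: le_trans t2.
have /andP[kt tk] := Num.Theory.truncn_itv t0.
case: (Num.truncn t) kt tk => [|j] kt tk.
  by exfalso; clear -t2 tk; move: t2 tk; lra.
have jr : 64 * s * j.+1%:R <= r by rewrite mulrC -ler_pdivlMr.
have [phi [Fp px pC]] := step j jr.
exists phi; split => //; last by move=> w /pC; exact: joined_le.
apply: le_trans px; move: tk; rewrite /t ltr_pdivrMr// -[j.+4%:R]natr1 -[j.+3%:R]natr1.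
move: (j.+2%:R : R) => k; nra.
Qed.

(* Otherwise every y near x carries a function exceeding (1 - kappa) r at y, and
   extending a small bump at x by these functions exceeds r at x. *)
Lemma unit_cutoff_descent kappa x r : kappa = 8^-1 ^+ 4 -> 0 < r -> (forall phi, unit_cutoff phi -> phi x <= r) ->
  exists y, joined x y r /\ forall phi, unit_cutoff phi -> phi y <= (1 - kappa) * r.
Proof.
move=> kE r0 xr.
have k0 : 0 < kappa by rewrite kE exprn_gt0.
have k1 : kappa < 1 by rewrite kE exprn_ilt1// ?invr_ge0// invf_lt1// ltr1n.
(* The value of [kappa] is calibrated so that growth up to radius r / 2 gives height at least 4
   kappa r. *)
have krE : r / 2 / 8 / 8 / 8 = 4 * (kappa * r) by rewrite kE; field.
clear kE; apply: contrapT => nH.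
have H y : joined x y r -> exists2 phi, unit_cutoff phi & (1 - kappa) * r < phi y.
  move=> xy; apply: contrapT => nphi; apply: nH; exists y; split => // phi Fp.
  by rewrite leNgt; apply/negP => h; apply: nphi; exists phi.
have [phi0 F0 p0] := H x (joined_refl g x r0).
have [_ [K cK phiK] _] := F0.
have r2 : 0 < r / 2 by rewrite divr_gt0.
(* Points joined to [x] within r / 2 lie in the compact support of [phi0], which is 1-Lipschitz and
   exceeds (1 - kappa) r at [x]. *)
have [|phi [Fp px pC]] := @unit_cutoff_growth K x (r / 2) cK r2.
  move=> y xy; apply: phiK; have := unit_cutoff_lip F0 xy => h.
  have k2 : kappa * r < r / 2 by lra.
  by apply: lt0r_neq0; lra.
have c0 : 0 < (1 - kappa) * r by rewrite mulr_gt0// subr_gt0.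
have e0 : 0 < kappa * r / 2 by rewrite divr_gt0// mulr_gt0.
(* At [x] the extension is at least 4 kappa r + (1 - kappa) r - 3 kappa r / 2, which exceeds r. *)
have [|psi [Fq qx _]] := @unit_cutoff_extend _ _ _ g phi (fun=> True) ((1 - kappa) * r) (kappa * r / 2) Fp c0 e0.
  move=> y py; have [|b Fb bb] := H y; last by exists b.
  by apply: joined_le (pC y py); lra.
have h1 := qx x; have h2 := xr psi Fq.
rewrite krE in px; have : kappa * r / 2 <= phi x by apply: le_trans px; lra.
move=> /h1 h3; lra.
Qed.

Lemma unit_cutoff_unbounded : complete_metric g -> forall (x0 : M) (r : R), exists2 phi, unit_cutoff phi & r < phi x0.
Proof.
move=> cg x0 r; apply: contrapT => nphi.
have [kappa [k0 k1 descent]] : exists kappa : R, [/\ 0 < kappa, kappa < 1 & forall x r, 0 < r ->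
    (forall phi, unit_cutoff phi -> phi x <= r) ->
    exists y, joined x y r /\ forall phi, unit_cutoff phi -> phi y <= (1 - kappa) * r].
  exists (8^-1 ^+ 4); split; [by rewrite exprn_gt0|by rewrite exprn_ilt1// ?invr_ge0// invf_lt1// ltr1n|].
  by move=> x r1; exact: unit_cutoff_descent.
pose r0 := Num.max r 1; have r00 : 0 < r0 by rewrite lt_max ltr01 orbT.
have x0r phi : unit_cutoff phi -> phi x0 <= r0.
  move=> Fp; rewrite le_max; apply/orP; left; rewrite leNgt.
  by apply/negP => h; apply: nphi; exists phi.
have ex (p : M * R) : exists y, 0 < p.2 -> (forall phi, unit_cutoff phi -> phi p.1 <= p.2) ->
    joined p.1 y p.2 /\ forall phi, unit_cutoff phi -> phi y <= (1 - kappa) * p.2.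
  case: p => x s /=; have [s0|s0] := ltP 0 s; last by exists x.
  have [H|nH] := EM (forall phi, unit_cutoff phi -> phi x <= s); last by exists x.
  by have [y ?] := descent _ _ s0 H; exists y.
have [f fP] := choice ex.
pose q j := (1 - kappa) ^+ j * r0.
pose X := fix X j := if j is j'.+1 then f (X j', q j') else x0.
have q0 j : 0 < q j by rewrite mulr_gt0// exprn_gt0// subr_gt0.
have qS j : q j.+1 = (1 - kappa) * q j by rewrite /q exprS mulrA.
have XP j : forall phi, unit_cutoff phi -> phi (X j) <= q j.
  elim: j => [|j IH].
    move=> phi Fp; have -> : q 0%N = r0 by rewrite /q expr0 mul1r.
    exact: (x0r phi Fp).
  move=> phi Fp; rewrite qS; have [_ h] := fP (X j, q j) (q0 j) IH; exact: h.
have XC j : joined (X j) (X j.+1) (q j) by have [] := fP (X j, q j) (q0 j) (XP j).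
(* A step has duration q j = (q j - q (j + 1)) / kappa, so the total durations telescope. *)
have XCk j k : joined (X j) (X (j + k.+1)%N) ((q j - q (j + k.+1)%N) / kappa).
  elim: k => [|k IH].
    rewrite addn1; have -> : (q j - q j.+1) / kappa = q j; last exact: XC.
    by rewrite qS; field; rewrite gt_eqF.
  have := joined_trans IH (XC (j + k.+1)%N); rewrite -addnS; congr (joined _ _ _).
  by rewrite [in RHS]addnS qS; field; rewrite gt_eqF.
have XCl j l : (j < l)%N -> joined (X j) (X l) (q j / kappa).
  move=> jl; have := XCk j (l - j.+1)%N; rewrite -subSn// subSS subnKC 1?ltnW//.
  apply: joined_le; rewrite ler_pM2r ?invr_gt0// gerBl ltW //.
have qlim (e : R) : 0 < e -> exists N, forall j, (N <= j)%N -> q j < e.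
  move=> e0; have : (1 - kappa) ^+ j @[j --> \oo] --> (0 : R).
    by apply: cvg_expr; rewrite ger0_norm; lra.
  move=> /cvgrPdist_lt/(_ (e / r0)) []; first by rewrite divr_gt0.
  move=> N _ NP; exists N => j Nj; have := NP j Nj.
  rewrite sub0r normrN ger0_norm; last by rewrite exprn_ge0// subr_ge0 ltW.
  by rewrite ltr_pdivlMr.
have [e e0|x xlim] := cg X.
  have [N NP] := qlim (e * kappa) (mulr_gt0 e0 k0).
  have small j : (N <= j)%N -> q j / kappa < e by move=> /NP; rewrite ltr_pdivrMr.
  exists N => k l Nk Nl; have [kl|lk|kl] := ltngtP k l.
  - by apply: le_lt_trans (rdist_joined (XCl _ _ kl)) _; rewrite lte_fin small.
  - by apply: le_lt_trans (rdist_joined (joined_sym (XCl _ _ lk))) _; rewrite lte_fin small.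
  - rewrite kl; apply: le_lt_trans (rdist_joined (joined_refl g (X l) (q0 l))) _.
    rewrite lte_fin; apply: le_lt_trans (small l Nl).
    by rewrite ler_pdivlMr// ler_piMr// ltW.
(* A small bump has height at least [s] at the limit. Far along the sequence it is at most [q k] < s
   / 2, at distance less than s / 2 from the limit, against the Lipschitz bound. *)
have [W Wx [s s0 H]] := small_bumps_local g x.
have [|b [Fb sb _]] := H s _ x (nbhs_singleton Wx); first by rewrite s0 lexx.
have [sfb _ _] := Fb.
have [N1 N1P] := qlim (s / 2) (divr_gt0 s0 (ltr0Sn _ 1)).
have nb : nbhs (0%E : \bar R) [set t : \bar R | (t < (s / 2)%:E)%E].
  by apply: open_nbhs_nbhs; split; [exact: open_ereal_lt_ereal|rewrite /= lte_fin divr_gt0].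
have [N2 _ N2P] := xlim _ nb.
pose k := maxn N1 N2.
have h1 := N1P k (leq_maxl _ _).
have h2 : (rdist g (X k) x < (s / 2)%:E)%E := N2P k (leq_maxr _ _).
have h3 := XP k b Fb.
have h4 := rdist_lip (X k) x sfb (unit_cutoff_grad_norm Fb).
have := le_lt_trans h4 h2; rewrite lte_fin; lra.
Qed.

End Completeness.

(** * The integral estimate *)

Lemma continuous_mul (R : realType) (T : topologicalType) (F G : T -> R) :
  continuous F -> continuous G -> continuous (fun x => F x * G x).
Proof. by move=> cF cG x; apply: continuousM; [exact: cF|exact: cG]. Qed.

Lemma poweR_mono (R : realType) (r : R) (x y : \bar R) : 0 <= r -> (0 <= x)%E -> (x <= y)%E ->
  (x `^ r <= y `^ r)%E.
Proof.
move=> r0 x0 xy; apply: gt0_ler_poweR => //; rewrite in_itv/= leey andbT//.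
exact: le_trans xy.
Qed.

Section Estimates.
Context {R : realType} {n : nat} {M : complexManifold R n} (g : kahlerMetric M).
Context (mu : {measure set (borel M) -> \bar R}) (mu_vol : riemannian_volume g mu).
Local Notation V := 'rV[R]_(n + n).
Local Notation N := (n + n)%N.
Local Notation "'I' F" := (\int[mu]_(x in [set: borel M]) F x) (at level 10, F at level 8).

Lemma integrable_cs (F : M -> R) : continuous F -> csupp F ->
  mu.-integrable [set: borel M] (EFin \o (F : borel M -> R)).
Proof. exact: (csupp_integrable mu_vol). Qed.

Lemma intZ (F : borel M -> R) c : mu.-integrable [set: borel M] (EFin \o F) ->
  mu.-integrable [set: borel M] (EFin \o (fun x => c * F x)).
Proof.
move=> iF; have := integrableZl (@measurableT _ (borel M)) c iF.
by congr (mu.-integrable _ _); apply/funext => x /=; rewrite EFinM.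
Qed.

Lemma intD (F G : borel M -> R) : mu.-integrable [set: borel M] (EFin \o F) ->
  mu.-integrable [set: borel M] (EFin \o G) ->
  mu.-integrable [set: borel M] (EFin \o (fun x => F x + G x)).
Proof.
move=> iF iG; have := integrableD (@measurableT _ (borel M)) iF iG.
by congr (mu.-integrable _ _); apply/funext => x /=; rewrite EFinD.
Qed.

Lemma csupp_ip v z : csupp z -> csupp (ip g v z).
Proof.
move=> [K cK zK]; exists K => // x; apply: contra_neqP => nK.
by apply: (ip_vanish g v _ zK nK); apply: compact_closed => //; exact: manifold_hausdorff.
Qed.

(** With l = ln (w + e) the factor [f] is (w + e)^(p/4), and d eta = (p/4) eta dl + f d phi. Solving
    for eta dl and pairing with 2 d eta gives the formula. *)
Lemma ip_cutoff_square (l phi : M -> R) (p : R) x : sfun l -> sfun phi -> p != 0 ->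
  let f x := expR (p / 4 * l x) in let eta x := phi x * f x in
  ip g l (fun x => eta x * eta x) x = 8 / p * (ip g eta eta x - f x * ip g phi eta x).
Proof.
move=> sl sphi p0 f eta.
have sf : sfun f by apply: sfun_exp; apply: sfunM => //; exact: sfun_cst.
have se : sfun eta by exact: sfunM.
have df : dform f x = (f x * (p / 4)) *: dform l x.
  have d1 := is_deriveZ (p / 4) (is_derive_id (l x) (1 : R)).
  have d2 := is_derive_chain1 (f := fun t => p / 4 * t) (is_derive_expR (p / 4 * l x)) d1.
  have d3 : is_derive (l x) 1 (fun t => expR (p / 4 * t)) (f x * (p / 4)).
    by apply: is_derive_eq d2 _; rewrite /f /GRing.scale/= mulr1.
  exact: (dform_comp sl d3).
have de : dform eta x = phi x *: ((f x * (p / 4)) *: dform l x) + f x *: dform phi x.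
  by rewrite /eta dformM// df.
have dee : dform (fun x => eta x * eta x) x = eta x *: dform eta x + eta x *: dform eta x.
  by rewrite dformM.
rewrite !ipE; set H := invmx _.
rewrite dee; set E := dform eta x in de *.
have -> : (E *m H *m E^T) 0 0 = (phi x * (f x * (p / 4))) * (dform l x *m H *m E^T) 0 0 +
    f x * (dform phi x *m H *m E^T) 0 0.
  by rewrite {1}de scalerA !mulmxDl -!scalemxAl mxDE !mxZE.
rewrite -scalerDl linearZ/= -scalemxAr mxZE /eta; field.
exact: p0.
Qed.

(** Green's identity for [l] against eta^2. The parameter [d] is the share of the gradient of eta
    given up to absorb the cross term with d phi. *)
Lemma caccioppoli (l phi L : M -> R) (p d : R) : sfun l -> sfun phi -> csupp phi ->
  continuous L -> (forall x, - lap g l x <= 2 * L x) -> 0 < p -> 0 < d ->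
  forall f eta : M -> R, f = (fun x => expR (p / 4 * l x)) -> eta = (fun x => phi x * f x) ->
  4 / p * (1 - d) * I (ip g eta eta) <=
  (p * d)^-1 * I (fun x => f x ^+ 2 * ip g phi phi x) + I (fun x => L x * eta x ^+ 2).
Proof.
move=> sl sphi cphi cL lapL p0 d0 f eta fE etaE.
have sf : sfun f by rewrite fE; apply: sfun_exp; apply: sfunM => //; exact: sfun_cst.
have se : sfun eta by rewrite etaE; exact: sfunM.
have ce : csupp eta by rewrite etaE; exact: csuppMl.
pose z x := eta x * eta x.
have sz : sfun z by exact: sfunM.
have cz : csupp z by exact: csuppMl.
pose Z x := ip g l z x + z x * lap g l x.
have iX := integrable_cs (sfun_continuous (sfun_ip g se se)) (csupp_ip eta ce).
pose Y x := f x ^+ 2 * ip g phi phi x.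
have iY : mu.-integrable [set: borel M] (EFin \o (Y : borel M -> R)).
  apply: integrable_cs; last by apply: csuppMr; exact: csupp_ip.
  apply: sfun_continuous; apply: sfunM; last exact: sfun_ip.
  by rewrite (_ : (fun x => _) = fun x => f x * f x)//; exact: sfunM.
pose W x := L x * eta x ^+ 2.
have iW : mu.-integrable [set: borel M] (EFin \o (W : borel M -> R)).
  apply: integrable_cs; last exact: csuppMr.
  exact: (continuous_mul cL (sfun_continuous sz)).
have iZ : mu.-integrable [set: borel M] (EFin \o (Z : borel M -> R)) := green_integrable mu_vol sz cz sl.
have Z0 : I Z = 0 by rewrite /Rintegral (green_identity mu_vol sz cz sl).
have mT : measurable [set: borel M] by [].
rewrite -(RintegralZl _ mT iX) -(RintegralZl _ mT iY).
(* Adding half of the vanishing Green integral reduces the claim to a pointwise inequality. *)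
have -> : I W = I (fun x => W x + 2^-1 * Z x).
  rewrite (RintegralD mT iW); last exact: (intZ 2^-1 iZ).
  by rewrite (RintegralZl _ mT iZ) Z0 mulr0 addr0.
have iWZ := intD iW (intZ 2^-1 iZ).
have iY2 := intZ (p * d)^-1 iY.
rewrite -(RintegralD mT iY2 iWZ).
apply: (le_Rintegral mT).
- exact: (intZ _ iX).
- exact: (intD iY2 iWZ).
move=> x _; have zE : ip g l z x = 8 / p * (ip g eta eta x - f x * ip g phi eta x).
  rewrite /z etaE fE; exact: (ip_cutoff_square x sl sphi (lt0r_neq0 p0)).
rewrite /W /Z zE /z.
have y := ip_young g phi eta x (f x) (2 * d).
set X := ip g eta eta x in y *; set P := ip g phi eta x in y *.
rewrite /Y; set Q := ip g phi phi x in y *.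
have Lx : 0 <= (2 * L x + lap g l x) * eta x ^+ 2.
  by apply: mulr_ge0; [have := lapL x; lra|exact: sqr_ge0].
have -> : 4 / p * (1 - d) * X = (p * d)^-1 * (4 * d * X - 4 * d ^+ 2 * X).
  by field; rewrite !gt_eqF.
have -> : 2^-1 * (8 / p * (X - f x * P) + eta x * eta x * lap g l x) =
   (p * d)^-1 * (4 * d * X - 4 * d * f x * P) + 2^-1 * (eta x ^+ 2 * lap g l x).
  by field; rewrite !gt_eqF.
have pd : 0 < (p * d)^-1 by rewrite invr_gt0 mulr_gt0.
have : (p * d)^-1 * (4 * d * X - 4 * d ^+ 2 * X) <=
    (p * d)^-1 * (f x ^+ 2 * Q + (4 * d * X - 4 * d * f x * P)).
  by rewrite ler_pM2l//; nra.
rewrite [X in _ <= X]mulrDr => h; apply: le_trans h _; rewrite lerD2l addrCA lerDl.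
clear -Lx; move: Lx; lra.
Qed.

Lemma fin_I (F : M -> R) : continuous F -> csupp F ->
  (\int[mu]_(x in [set: borel M]) (F x)%:E = (I F)%:E)%E.
Proof.
by move=> cF sF; rewrite fineK//; apply: integrable_fin_num => //; exact: integrable_cs.
Qed.

Lemma sobolev_ip (nu CS : R) (eta : M -> R) : sobolev_inequality g mu nu CS -> sfun eta -> csupp eta ->
  ((\int[mu]_(x in [set: borel M]) (`|eta x| `^ (2 * nu / (nu - 2)))%:E) `^ ((nu - 2) / nu)
     <= (CS * I (ip g eta eta))%:E)%E.
Proof.
move=> sob se ce; have := sob eta; rewrite -sfun_smooth_fun -csuppP => /(_ se ce).
under [X in (_ <= _ * X)%E]eq_integral do rewrite grad_norm_sqr.
by rewrite (fin_I (sfun_continuous (sfun_ip g se se)) (csupp_ip eta ce)) EFinM.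
Qed.

(** Hölder with the conjugate exponents nu / 2 and nu / (nu - 2), then Sobolev for eta. The bound of
    [L] by |lambda^-| enters only through monotonicity of the integral. *)
Lemma sobolev_potential (nu CS a : R) (L eta : M -> R) : 2 < nu -> 0 <= a ->
  sobolev_inequality g mu nu CS -> lambda_minus_norm g mu nu = a%:E ->
  continuous L -> (forall x, 0 <= L x <= `|lambda_minus g x|) -> sfun eta -> csupp eta ->
  I (fun x => L x * eta x ^+ 2) <= a * (CS * I (ip g eta eta)).
Proof.
move=> nu2 a0 sob na cL L0 se ce.
have nu0 : 0 < nu by lra.
have nu20 : 0 < nu - 2 by lra.
have sz : sfun (fun x => eta x * eta x) by exact: sfunM.
pose W x := L x * eta x ^+ 2.
have cW : continuous W by exact: (continuous_mul cL (sfun_continuous sz)).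
have sW : csupp W by apply: csuppMr; exact: csuppMl.
have W0 x : 0 <= W x by apply: mulr_ge0; [by have /andP[] := L0 x|exact: sqr_ge0].
rewrite -lee_fin -/W -(fin_I cW sW).
have mL : measurable_fun [set: borel M] (L : borel M -> R) by exact: continuous_borel.
have mz : measurable_fun [set: borel M] ((fun x => eta x * eta x) : borel M -> R).
  by apply: continuous_borel; exact: sfun_continuous.
have := @hoelder _ _ _ mu _ _ (nu / 2) (nu / (nu - 2)) mL mz.
move=> /(_ (divr_gt0 nu0 (ltr0Sn _ 1)) (divr_gt0 nu0 nu20)).
have e1 : (nu / 2)^-1 + (nu / (nu - 2))^-1 = 1 by field; rewrite !gt_eqF.
move=> /(_ e1); rewrite Lnorm1.
move=> h; apply: (le_trans _ (le_trans h _)).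
  apply: integral_mono => x; first by rewrite lee_fin.
  by rewrite lee_fin /W expr2 ler_norm.
rewrite (EFinM a); apply: (lee_pmul (Lnorm_ge0 _ _ _) (Lnorm_ge0 _ _ _)).
  rewrite -na /lambda_minus_norm unlock invf_div.
  apply: poweR_mono; first by rewrite divr_ge0// ltW.
    by apply: integral_ge0 => x _; rewrite lee_fin powR_ge0.
  apply: integral_mono => x; first by rewrite lee_fin powR_ge0.
  have /andP[Lx0 Lx] := L0 x.
  rewrite lee_fin; apply: ge0_ler_powR; rewrite ?nnegrE//; first by rewrite divr_ge0// ltW.
  by rewrite ger0_norm.
apply: le_trans (sobolev_ip sob se ce); rewrite unlock invf_div.
apply: poweR_mono; first by rewrite divr_ge0// ltW.
  by apply: integral_ge0 => x _; rewrite lee_fin powR_ge0.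
apply: integral_mono => x; first by rewrite lee_fin powR_ge0.
rewrite lee_fin le_eqVlt -expr2 normrX -powR_mulrn// -powRrM mulrA eqxx //.
Qed.

(** The constant is uniform in [phi] and [e], which are both chosen afterwards. *)
Lemma weighted_sobolev (nu CS a p : R) (u : M -> R) : 2 < nu -> 0 < CS -> 0 <= a -> 0 < p ->
  a < 4 / (p * CS) -> sobolev_inequality g mu nu CS -> lambda_minus_norm g mu nu = a%:E ->
  sfun u -> pluriharmonic u ->
  exists2 C : R, 0 < C & forall phi e f, unit_cutoff g phi -> 0 < e ->
    f = (fun x => expR (p / 4 * ln (ip g u u x + e))) ->
    ((\int[mu]_(x in [set: borel M]) (`|phi x * f x| `^ (2 * nu / (nu - 2)))%:E) `^ ((nu - 2) / nu)
     <= (C * I (fun x => f x ^+ 2 * ip g phi phi x))%:E)%E.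
Proof.
move=> nu2 CS0 a0 p0 aCS sob na su pu.
pose B := 4 / p - a * CS.
have B0 : 0 < B.
  by rewrite subr_gt0 ltr_pdivlMr//; move: aCS; rewrite ltr_pdivlMr ?mulr_gt0//; lra.
(* With this [d] half of the gap [B] between 4 / p and a CS survives. *)
pose d := p * B / 8; have d0 : 0 < d by rewrite divr_gt0// mulr_gt0.
have dE : 4 / p * (1 - d) - a * CS = B / 2 by rewrite /d /B; field; rewrite gt_eqF.
have pd : 0 < (p * d)^-1 by rewrite invr_gt0 mulr_gt0.
exists (CS * (2 / B * (p * d)^-1)); first by rewrite !mulr_gt0// invr_gt0.
move=> phi e f [sphi cphi _] e0 fE.
pose l x := ln (ip g u u x + e).
have we0 x : 0 < ip g u u x + e by have := ip_ge0 g u x; lra.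
have sl : sfun l by apply: sfun_ln => //; apply: sfunD; [exact: sfun_ip|exact: sfun_cst].
pose eta x := phi x * f x.
have sf : sfun f by rewrite fE; apply: sfun_exp; apply: sfunM => //; exact: sfun_cst.
have se : sfun eta by exact: sfunM.
have ce : csupp eta by exact: csuppMl.
(* The negative part of [h] is the continuous substitute for |lambda^-|; [lap_ln_ip] bounds it. *)
pose h x := 2^-1 * lap g l x.
have ch : continuous h by apply: sfun_continuous; apply: sfunM; [exact: sfun_cst|exact: sfun_lap].
pose L := neg_part h; have cL : continuous L by exact: continuous_neg_part.
have lapL x : - lap g l x <= 2 * L x.
  have : - h x <= L x by rewrite /L /neg_part le_max lexx.
  by rewrite /h; lra.
have L0 x : 0 <= L x <= `|lambda_minus g x|.
  have l0 : lambda_minus g x <= 0 by rewrite /lambda_minus ge_min lexx.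
  have := lap_ln_ip g x su pu e0; rewrite -/l /L /neg_part ler0_norm// le_max lexx orbT/=.
  by rewrite ge_max /h => lp; apply/andP; split; lra.
have cac := caccioppoli sl sphi cphi cL lapL p0 d0 fE (erefl eta).
have pot := sobolev_potential nu2 a0 sob na cL L0 se ce.
apply: le_trans (sobolev_ip sob se ce) _; rewrite lee_fin -!mulrA ler_pM2l//.
move: cac pot; set X := I (ip g eta eta); set Y := I (fun x => f x ^+ 2 * ip g phi phi x).
set W := I (fun x => L x * eta x ^+ 2) => cac pot.
have h1 : B / 2 * X <= (p * d)^-1 * Y.
  rewrite -dE mulrBl; have -> : a * CS * X = a * (CS * X) by rewrite mulrA.
  by lra.
have -> : X = 2 * (B^-1 * (B / 2 * X)) by field; rewrite gt_eqF.
by rewrite ler_pM2l// ler_pM2l ?invr_gt0.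
Qed.

(** The bound |d phi| <= 1 is spent on w^(p/2), whose integral is finite. The part with e^(p/2)
    keeps |d phi|^2 with its compact support, as a constant need not be integrable. *)
Lemma gradient_weight_bound (p e : R) (u phi f : M -> R) : 0 < p -> 0 < e -> sfun u -> unit_cutoff g phi ->
  f = (fun x => expR (p / 4 * ln (ip g u u x + e))) ->
  (\int[mu]_(x in [set: borel M]) (grad_norm g u x `^ p)%:E < +oo)%E ->
  I (fun x => f x ^+ 2 * ip g phi phi x) <=
  2 `^ (p / 2) * (I (fun x => grad_norm g u x `^ p) + e `^ (p / 2) * I (ip g phi phi)).
Proof.
move=> p0 e0 su [sphi cphi phi1] fE fin.
have p2 : 0 <= p / 2 by rewrite divr_ge0// ltW.
have we0 x : 0 < ip g u u x + e by have := ip_ge0 g u x; lra.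
have sf : sfun f.
  rewrite fE; apply: sfun_exp; apply: sfunM; first exact: sfun_cst.
  by apply: sfun_ln => //; apply: sfunD; [exact: sfun_ip|exact: sfun_cst].
have iP := integrable_cs (sfun_continuous (sfun_ip g sphi sphi)) (csupp_ip phi cphi).
have iG : mu.-integrable [set: borel M] (EFin \o (fun x : borel M => grad_norm g u x `^ p)).
  apply/integrableP; split.
    apply/measurable_EFinP; apply: (measurableT_comp (measurable_powR p)).
    by apply: continuous_borel; exact: grad_norm_continuous.
  apply: le_lt_trans fin; apply: integral_mono => x; first by rewrite lee_fin.
  by rewrite /= lee_fin ger0_norm// powR_ge0.
have iS := intD iG (intZ (e `^ (p / 2)) iP).
rewrite -(RintegralZl _ (@measurableT _ (borel M)) iP).
rewrite -(RintegralD (@measurableT _ (borel M)) iG (intZ (e `^ (p / 2)) iP)).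
rewrite -(RintegralZl _ (@measurableT _ (borel M)) iS).
apply: (le_Rintegral (@measurableT _ (borel M))).
- apply: integrable_cs; last by apply: csuppMr; exact: csupp_ip.
  apply: sfun_continuous; apply: sfunM; last exact: sfun_ip.
  by rewrite (_ : (fun x => _) = fun x => f x * f x)//; exact: sfunM.
- exact: intZ.
move=> x _; have w0 := ip_ge0 g u x; set w := ip g u u x in w0.
have -> : f x ^+ 2 = (w + e) `^ (p / 2).
  by rewrite fE -expRM_natl /powR (gt_eqF (we0 x)); congr expR; rewrite -/w; field.
have -> : grad_norm g u x `^ p = w `^ (p / 2).
  by rewrite grad_normE -/w -powR12_sqrt// -powRrM; congr (_ `^ _); rewrite mulrC.
have q0 := ip_ge0 g phi x; have q1 := phi1 x; set q := ip g phi phi x in q0 q1 *.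
have wp : 0 <= w `^ (p / 2) := powR_ge0 _ _.
have ep : 0 <= e `^ (p / 2) := powR_ge0 _ _.
have c0 : 0 <= 2 `^ (p / 2) :> R := powR_ge0 _ _.
have key : (w + e) `^ (p / 2) <= 2 `^ (p / 2) * Num.max (w `^ (p / 2)) (e `^ (p / 2)).
  have [we|ew] := leP w e.
    apply: (@le_trans _ _ (2 `^ (p / 2) * e `^ (p / 2))); last first.
      by apply: ler_wpM2l => //; rewrite le_max lexx orbT.
    rewrite -powRM//; last exact: ltW.
    by apply: ge0_ler_powR => //; rewrite ?nnegrE; lra.
  apply: (@le_trans _ _ (2 `^ (p / 2) * w `^ (p / 2))); last first.
    by apply: ler_wpM2l => //; rewrite le_max lexx.
  by rewrite -powRM//; apply: ge0_ler_powR => //; rewrite ?nnegrE; lra.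
apply: le_trans (ler_wpM2r q0 key) _; rewrite -mulrA; apply: ler_wpM2l => //.
have [we|ew] := leP (w `^ (p / 2)) (e `^ (p / 2)).
  by rewrite lerDr.
apply: (@le_trans _ _ (w `^ (p / 2))); first by rewrite ler_piMr.
by rewrite lerDl mulr_ge0.
Qed.

Lemma powR_integral_ge (eta : M -> R) (O : set M) (c q t : R) : open O -> mu O \is a fin_num ->
  0 <= c -> 0 <= q -> 0 <= t -> sfun eta -> (forall x, O x -> c <= `|eta x|) ->
  ((c `^ (q * t) * fine (mu O) `^ t)%:E <=
   (\int[mu]_(x in [set: borel M]) (`|eta x| `^ q)%:E) `^ t)%E.
Proof.
move=> oO fO c0 q0 t0 se etaO.
have mO : measurable (O : set (borel M)) := open_borel oO.
rewrite powRrM -powRM ?powR_ge0// ?fine_ge0// -poweR_EFin.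
apply: poweR_mono => //; first by rewrite lee_fin mulr_ge0// ?powR_ge0// fine_ge0.
rewrite EFinM fineK// -(integral_cst mu mO) integral_mkcond.
apply: integral_mono => x; rewrite patchE; case: ifPn => xO.
- by rewrite lee_fin powR_ge0.
- by [].
- rewrite lee_fin; apply: ge0_ler_powR => //.
  by apply: etaO; move: xO; rewrite inE.
- by rewrite lee_fin powR_ge0.
Qed.

Lemma gradient_vanishes (nu CS a p : R) (u : M -> R) : complete_metric g ->
  2 < nu -> 0 < CS -> 0 <= a -> 0 < p ->
  a < 4 / (p * CS) -> sobolev_inequality g mu nu CS -> lambda_minus_norm g mu nu = a%:E ->
  sfun u -> pluriharmonic u ->
  (\int[mu]_(x in [set: borel M]) (grad_norm g u x `^ p)%:E < +oo)%E ->
  forall x, ip g u u x = 0.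
Proof.
move=> cg nu2 CS0 a0 p0 aCS sob na su pu fin x0; apply: contrapT => /eqP w0.
have {}w0 : 0 < ip g u u x0 by rewrite lt0r w0 ip_ge0.
have [C C0 HC] := weighted_sobolev nu2 CS0 a0 p0 aCS sob na su pu.
set w1 := ip g u u x0 in w0.
have [W Wx [s s0 Hs]] := small_bumps_local g x0.
have [|b [Fb sb bC]] := Hs s _ x0 (nbhs_singleton Wx); first by rewrite s0 lexx.
have [sfb _ _] := Fb.
have [A [oA Ax fA]] := mu_locally_finite mu_vol x0.
(* A neighbourhood of finite volume on which w stays above w1 / 2 and whose points are joined to
   [x0] in time 64 s. A cutoff above r + 64 s at [x0] is thus above r on all of [O]. *)
pose O := A `&` ([set x | 0 < b x] `&` [set x | w1 / 2 < ip g u u x]).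
have oO : open O.
  apply: openI => //; apply: openI; apply: open_superlevel; apply: sfun_continuous => //.
  exact: sfun_ip.
have Ox : O x0.
  by split => //; split => /=; [exact: lt_le_trans sb|rewrite -/w1; lra].
have mO : measurable (O : set (borel M)) := open_borel oO.
have fO : mu O \is a fin_num.
  rewrite ge0_fin_numE//; apply: (@le_lt_trans _ _ (mu A)); last by rewrite -ge0_fin_numE.
  by apply: le_measure; rewrite ?inE//; [exact: open_borel|move=> y []].
pose m := fine (mu O).
have m0 : 0 < m by apply: fine_gt0; rewrite (mu_open_gt0 mu_vol oO Ox)/= -ge0_fin_numE.
have nu0 : 0 < nu by lra.
have nu20 : 0 < nu - 2 by lra.
pose t := (nu - 2) / nu; have t0 : 0 < t by rewrite divr_gt0.
pose q := 2 * nu / (nu - 2); have q0 : 0 < q by rewrite divr_gt0// mulr_gt0.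
have qt : q * t = 2 by rewrite /q /t; field; rewrite !gt_eqF.
pose kap := (w1 / 2) `^ (p / 4); have kap0 : 0 < kap by rewrite powR_gt0// divr_gt0.
pose K := kap ^+ 2 * m `^ t; have K0 : 0 < K by rewrite mulr_gt0 ?exprn_gt0// powR_gt0.
pose H := I (fun x => grad_norm g u x `^ p).
have H0 : 0 <= H by apply: Rintegral_ge0 => x _; exact: powR_ge0.
pose C2 := C * (2 `^ (p / 2) * (H + 1)).
have C20 : 0 < C2 by rewrite !mulr_gt0// ?powR_gt0//; lra.
suff bound (r : R) : 0 < r -> r ^+ 2 * K <= C2.
  pose r := C2 / K + 1; have r1 : 1 <= r by rewrite lerDr divr_ge0// ltW.
  have r0 : 0 < r by exact: lt_le_trans r1.
  have := bound r r0; have : r * K <= r ^+ 2 * K by apply: ler_wpM2r; [exact: ltW|rewrite expr2 ler_peMl// ltW].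
  have -> : r * K = C2 + K by rewrite /r mulrDl divfK ?gt_eqF// mul1r.
  lra.
move=> r0; have [phi Fp px] := unit_cutoff_unbounded cg x0 (r + 64 * s).
have [sphi cphi _] := Fp.
pose J := I (ip g phi phi); have J0 : 0 <= J by apply: Rintegral_ge0 => x _; exact: ip_ge0.
have J1 : 0 < 1 + J by lra.
(* Chosen after [phi] so that e^(p/2) = 1 / (1 + J), which absorbs the Dirichlet integral [J] of
   [phi]. *)
pose e := (1 + J)^-1 `^ (2 / p); have e0 : 0 < e by rewrite powR_gt0// invr_gt0.
have ep : e `^ (p / 2) * J <= 1.
  rewrite /e -powRrM (_ : 2 / p * (p / 2) = 1); last by field; rewrite gt_eqF.
  have J1' : 0 <= (1 + J)^-1 by rewrite invr_ge0 ltW.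
  by rewrite (powRr1 J1') ler_pdivrMl// mulr1 lerDr.
pose f x := expR (p / 4 * ln (ip g u u x + e)).
have we0 x : 0 < ip g u u x + e by have := ip_ge0 g u x; lra.
have sf : sfun f.
  apply: sfun_exp; apply: sfunM; first exact: sfun_cst.
  by apply: sfun_ln => //; apply: sfunD; [exact: sfun_ip|exact: sfun_cst].
have := HC phi e f Fp e0 erefl; rewrite -/q -/t.
have rk : 0 <= r * kap by rewrite mulr_ge0 ?ltW.
have etaO x : O x -> r * kap <= `|phi x * f x|.
  move=> [_ [/= bx wx]]; have := unit_cutoff_lip Fp (bC x bx) => lip.
  have rphi : r <= phi x by lra.
  apply: le_trans (ler_norm _); apply: ler_pM => //; [exact: ltW|exact: ltW|].
  rewrite /f (_ : expR _ = (ip g u u x + e) `^ (p / 4)); last by rewrite /powR gt_eqF.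
  apply: ge0_ler_powR; rewrite ?nnegrE; [by rewrite divr_ge0// ltW|by rewrite divr_ge0// ltW|exact: ltW|].
  by apply: ltW; apply: lt_trans wx _; rewrite ltrDl.
move=> /(le_trans (powR_integral_ge oO fO rk (ltW q0) (ltW t0) (sfunM sphi sf) etaO)).
rewrite lee_fin qt -/m powR_mulrn// exprMn -mulrA -/K => /le_trans; apply.
rewrite ler_pM2l//; apply: le_trans (gradient_weight_bound p0 e0 su Fp erefl fin) _.
by rewrite ler_wpM2l ?powR_ge0// lerD2l.
Qed.

(** Vanishing partial derivatives make [u] locally constant, so its level set through [point] is
    open and closed. *)
Lemma gradient_zero_constant (u : M -> R) : sfun u -> (forall x, ip g u u x = 0) ->
  exists c, forall x, u x = c.
Proof.
move=> su u0; exists (u point) => x.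
have near_const (y : M) : \forall z \near y, u z = u y.
  set i := chart_at y; set v := chart i y.
  have Cv : chart_codom i v := chart_at_codom y.
  have [r r0 rC] := chart_box Cv.
  have oW := open_box i v r.
  have Wy : (dom i `&` [set x | `|chart i x - v| < r]) y.
    by split; [exact: dom_chart_at|rewrite /= subrr normr0].
  have p0 a z : chart_codom i z -> partial a (lrep u i) z = 0.
    move=> Cz; have := u0 (chart_inv i z); rewrite (ip_chart_inv g su su Cz) /cip => q0.
    have : dmx u i z == 0.
      apply: contraTT isT => nz; have := ginv_posdef g Cz nz.
      by rewrite /qform q0 ltxx.
    by move=> /eqP/rowP/(_ a); rewrite !mxE.
  apply: filterS (open_nbhs_nbhs (conj oW Wy)) => z [iz /= zr].
  have bz : ball v r (chart i z) by rewrite -ball_normE/= distrC.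
  have bC : ball v r `<=` chart_codom i.
    by move=> z'; rewrite -ball_normE/= distrC => /ltW/rC.
  have := partial0_ball (open_chart_codom i) (smooth_on_C1 (sfun_lrep i su)) bC
    (fun z' a bz' => p0 a z' (bC z' bz')) bz.
  by rewrite /lrep /v !chartK//; exact: dom_chart_at.
have := @manifold_connected _ _ M [set x | u x = u point].
move=> H; suff : [set x | u x = u point] = [set: M] by move=> E; have : [set: M] x by []; rewrite -E.
apply: H; first by exists point.
- exists [set x | u x = u point]; last by rewrite setTI.
  rewrite openE => y /= uy; rewrite /interior; apply: filterS (near_const y) => z /= ->.
  exact: uy.
exists [set x | u x = u point]; last by rewrite setTI.
have cu := sfun_continuous su.
by apply: (@closed_comp _ _ u [set t | t = u point]) => [y _|]; [exact: cu|exact: closed_eq].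
Qed.

End Estimates.

(** The quotient of the two sides is p^2 / (4 - p)^2, and p < 4 - p. *)
Lemma exponent_bound (R : realType) (p CS : R) : 1 < p -> p < 2 -> 0 < CS ->
  4 * p / ((4 - p) ^+ 2 * CS) <= 4 / (p * CS).
Proof.
move=> p1 p2 CS0; have p0 : 0 < p by lra.
have q0 : 0 < (4 - p) ^+ 2 by rewrite exprn_gt0//; lra.
have pp : p * p <= (4 - p) ^+ 2 by rewrite expr2; nra.
have -> : 4 * p / ((4 - p) ^+ 2 * CS) = 4 / (p * CS) * (p * p / (4 - p) ^+ 2).
  by field; rewrite !gt_eqF//; lra.
by rewrite ler_piMr ?ler_pdivrMr ?mul1r// divr_ge0// ltW// mulr_gt0.
Qed.

Theorem theorem1p7 (R : realType) (n : nat)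
    (M : complexManifold R n) (g : kahlerMetric M)
    (mu : {measure set (borel M) -> \bar R}) (nu CS p : R) :
  riemannian_volume g mu ->
  complete_metric g ->
  2 < nu ->
  0 < CS ->
  sobolev_inequality g mu nu CS ->
  1 < p ->
  (2 <= p -> (lambda_minus_norm g mu nu < (4 / (p * CS))%:E)%E) ->
  (p < 2 ->
    (lambda_minus_norm g mu nu < (4 * p / ((4 - p) ^+ 2 * CS))%:E)%E) ->
  forall u : M -> R,
    pluriharmonic u ->
    (\int[mu]_(x in [set: borel M]) (grad_norm g u x `^ p)%:E < +oo)%E ->
    exists c : R, forall x : M, u x = c.
Proof.
move=> mu_vol cg nu2 CS0 sob p1 big small u pu fin.
have su : sfun u by apply/sfun_smooth_fun; case: pu.
have p0 : 0 < p by lra.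
have lam : (lambda_minus_norm g mu nu < (4 / (p * CS))%:E)%E.
  have [/big//|p2] := leP 2 p.
  by apply: lt_le_trans (small p2) _; rewrite lee_fin exponent_bound.
have lam0 : (0 <= lambda_minus_norm g mu nu)%E by exact: poweR_ge0.
have lamE : lambda_minus_norm g mu nu = (fine (lambda_minus_norm g mu nu))%:E.
  by rewrite fineK// ge0_fin_numE//; apply: lt_trans lam _; rewrite ltry.
apply: (@gradient_zero_constant R n M g u su).
apply: (gradient_vanishes mu_vol cg nu2 CS0 _ p0 _ sob lamE su pu fin).
- exact: fine_ge0.
- by rewrite -lte_fin -lamE.
Qed.
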